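(* Let $n\in\mathbb N$ and $s>n/2$. There is a constant $C$, depending only on $n$ and $s$, such that the following holds. Let $m$ be a function on $\mathbb R^{2n}$ satisfying $$C_s(m):=\sup_{\lambda>0}\lambda\,\bigl|\{x\in\mathbb R^{2n}: |(I-\Delta)^{\frac s2}m(x)|>\lambda\}\bigr|^{\frac14}<\infty .$$ Then the associated bilinear multiplier operator $T_m$ admits a bounded extension from $L^2(\mathbb R^n)\times L^2(\mathbb R^n)$ to $L^1(\mathbb R^n)$, and $$\|T_m(f,g)\|_{L^1(\mathbb R^n)}\le C\,C_s(m)\,\|f\|_{L^2(\mathbb R^n)}\|g\|_{L^2(\mathbb R^n)}$$ for all $f,g\in L^2(\mathbb R^n)$.
   Context: $|E|$ denotes Lebesgue measure of a set $E$. The Fourier transform on $\mathbb R^d$ is $\widehat f(\xi)=\int_{\mathbb R^d} f(x)e^{-2\pi i x\cdot\xi}\,dx$, extended to tempered distributions. For $s>0$, the operator $(I-\Delta)^{s/2}$ on $\mathbb R^{2n}$ is defined via the Fourier transform by $[(I-\Delta)^{s/2}f]^{\wedge}(\xi)=(1+4\pi^2|\xi|^2)^{s/2}\widehat f(\xi)$, $\xi\in\mathbb R^{2n}$. For a bounded function $m$ on $\mathbb R^{2n}=\mathbb R^n\times\mathbb R^n$, the bilinear multiplier operator $T_m$ is defined for Schwartz functions $f,g$ on $\mathbb R^n$ by $$T_m(f,g)(x)=\int_{\mathbb R^n}\int_{\mathbb R^n}m(\xi,\eta)\widehat f(\xi)\widehat g(\eta)e^{2\pi i x\cdot(\xi+\eta)}\,d\xi\,d\eta,\quad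 x\in\mathbb R^n.$$ Under the hypothesis of the claim $m$ is essentially bounded, so $T_m$ is well defined. *)

(* Defs.v *)
From HB Require Import structures.
From mathcomp Require Import all_boot all_order all_algebra.
From mathcomp Require Import complex.
From mathcomp Require Import all_classical all_reals all_analysis.

Set Implicit Arguments.
Unset Strict Implicit.
Unset Printing Implicit Defensive.

Import Order.TTheory GRing.Theory Num.Theory.
Import numFieldNormedType.Exports.

Local Open Scope classical_set_scope.
Local Open Scope ring_scope.

Definition measure_rV_display : measure_display.
Proof. exact: default_measure_display. Qed.

(* 'rV[R]_n carries the sigma-algebra generated by the coordinates, i.e. the
   Borel sets of R^n. *)
Section measurable_rV.
Variables (R : realType) (n : nat).

Let coord (i : 'I_n) (x : 'rV[R]_n) : measurableTypeR R := x 0 i.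

Let rV_set0 : g_sigma_preimage coord set0.
Proof. exact: sigma_algebra0. Qed.

Let rV_setC A : g_sigma_preimage coord A -> g_sigma_preimage coord (~` A).
Proof. exact: sigma_algebraC. Qed.

Let rV_bigcup (F : (set 'rV[R]_n)^nat) :
  (forall i, g_sigma_preimage coord (F i)) ->
  g_sigma_preimage coord (\bigcup_i (F i)).
Proof. exact: sigma_algebra_bigcup. Qed.

HB.instance Definition _ :=
  @isMeasurable.Build measure_rV_display
  'rV[R]_n (g_sigma_preimage coord) rV_set0 rV_setC rV_bigcup.

Lemma measurable_rV_coord (i : 'I_n) :
  measurable_fun [set: 'rV[R]_n] (fun x => x 0 i : measurableTypeR R).
Proof.
move=> _ Y mY; rewrite setTI; apply: sub_sigma_algebra => /=.
rewrite -bigcup_seq/=; exists i => /=; first by rewrite mem_index_enum.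
by exists Y => //; rewrite setTI.
Qed.

Lemma measurable_fun_rVP d (T : measurableType d) (f : T -> 'rV[R]_n) :
  (forall i, measurable_fun [set: T] (fun t => f t 0 i : measurableTypeR R)) ->
  measurable_fun [set: T] f.
Proof.
move=> mf; apply: (@measurability _ _ _ _ _ f
  (\big[setU/set0]_(i < n) preimage_set_system setT (coord i) measurable)) => //.
move=> _ [B + <-]; rewrite -bigcup_seq => -[i _ [A mA <-]].
by rewrite !setTI -[X in measurable X]setTI; exact: mf.
Qed.

End measurable_rV.

Section lebesgue_rV.
Variable R : realType.

Section rV_cons_measure.
Variable n : nat.

Definition rV_cons (p : measurableTypeR R * 'rV[R]_n) : 'rV[R]_n.+1 :=
  row_mx (p.1%:M : 'rV_1) p.2.

Let rV_uncons (x : 'rV[R]_n.+1) : measurableTypeR R * 'rV[R]_n :=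
  (x 0 ord0, \row_j x 0 (lift ord0 j)).

Let rV_consK : cancel rV_cons rV_uncons.
Proof.
move=> [x v]; congr (_, _).
  rewrite (_ : ord0 = @lshift 1 n ord0); last exact/val_inj.
  by rewrite [LHS](@row_mxEl _ 1 1 n) !mxE.
apply/rowP => j; rewrite mxE (_ : lift ord0 j = @rshift 1 n j).
  by rewrite [LHS](@row_mxEr _ 1 1 n).
exact/val_inj.
Qed.

Lemma measurable_rV_cons : measurable_fun setT rV_cons.
Proof.
apply: measurable_fun_rVP => i.
case: (@split_ordP 1 n i) => j ->{i}.
  rewrite [X in measurable_fun _ X](_ : _ = fst)//; apply/funext => -[x v].
  by rewrite [LHS](@row_mxEl _ 1 1 n) ord1 !mxE.
rewrite [X in measurable_fun _ X](_ : _ =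
    (fun v : 'rV[R]_n => v 0 j : measurableTypeR R) \o snd).
  by apply: measurableT_comp => //; exact: measurable_rV_coord.
by apply/funext => -[x v]; rewrite [LHS](@row_mxEr _ 1 1 n).
Qed.

Let measurable_rV_uncons : measurable_fun setT rV_uncons.
Proof.
apply/measurable_fun_pairP; split => /=; first exact: measurable_rV_coord.
apply: measurable_fun_rVP => j.
rewrite [X in measurable_fun _ X](_ : _ =
    (fun x : 'rV[R]_n.+1 => x 0 (lift ord0 j) : measurableTypeR R)).
  exact: measurable_rV_coord.
by apply/funext => x /=; rewrite mxE.
Qed.

Variable mu : {sigma_finite_measure set 'rV[R]_n -> \bar R}.

Definition rV_cons_measure : set 'rV[R]_n.+1 -> \bar R :=
  pushforward (lebesgue_measure \x mu)%E rV_cons.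

HB.instance Definition _ := Measure.copy rV_cons_measure
  (measure_function_pushforward__canonical__measure_function_Measure
     (lebesgue_measure \x mu)%E measurable_rV_cons).

Let rV_cons_measure_sigma_finite : sigma_finite setT rV_cons_measure.
Proof.
have /sigma_finiteP[F [TF ndF Foo]] := sigma_finiteT (@lebesgue_measure R).
have /sigma_finiteP[G [TG ndG Goo]] := sigma_finiteT mu.
exists (fun i => rV_uncons @^-1` (F i `*` G i)).
  apply/esym; rewrite -subTset => x _.
  have [i _ Fi] : (\bigcup_i F i) (rV_uncons x).1 by rewrite -TF.
  have [j _ Gj] : (\bigcup_i G i) (rV_uncons x).2 by rewrite -TG.
  exists (maxn i j) => //; split => /=.
  - by move: Fi; exact/subsetPset/ndF/leq_maxl.
  - by move: Gj; exact/subsetPset/ndG/leq_maxr.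
move=> i; have [mF ltF] := Foo i; have [mG ltG] := Goo i; split.
  rewrite -[X in measurable X]setTI; apply: measurable_rV_uncons => //.
  exact: measurableX.
rewrite /rV_cons_measure /pushforward -comp_preimage.
rewrite (_ : _ \o _ = id) ?preimage_id; last first.
  by apply/funext => p /=; exact: rV_consK.
by rewrite product_measure1E// lte_mul_pinfty// ge0_fin_numE.
Qed.

HB.instance Definition _ := Measure_isSigmaFinite.Build _ _ _ rV_cons_measure
  rV_cons_measure_sigma_finite.

End rV_cons_measure.

(* Lebesgue measure on R^n, as the n-fold product of lebesgue_measure. *)
Fixpoint lebesgue_rV n : {sigma_finite_measure set 'rV[R]_n -> \bar R} :=
  match n with
  | 0%N => @dirac _ 'rV[R]_0 0 R
  | n'.+1 => rV_cons_measure (lebesgue_rV n')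
  end.

End lebesgue_rV.

Section definitions.
Variable R : realType.
Local Notation C := R[i].
Local Notation Re := complex.Re.
Local Notation Im := complex.Im.
Local Notation normc := (@ComplexField.Normc.normc R).

Section euclidean.
Variable d : nat.
Implicit Types (x y xi : 'rV[R]_d) (f g : 'rV[R]_d -> C).
Local Notation mu := (@lebesgue_rV R d).

Definition dotv x y : R := \sum_(i < d) x 0 i * y 0 i.

(* Euclidean norm; `|x| is the sup norm. *)
Definition enorm x : R := Num.sqrt (dotv x x).

Definition cmeasurable f :=
  measurable_fun setT (fun x => Re (f x) : measurableTypeR R) /\
  measurable_fun setT (fun x => Im (f x) : measurableTypeR R).

Definition cintegrable (D : set 'rV[R]_d) f :=
  mu.-integrable D (fun x => (Re (f x))%:E) /\
  mu.-integrable D (fun x => (Im (f x))%:E).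

Definition cintegral f : C :=
  ((\int[mu]_x Re (f x))%R +i* (\int[mu]_x Im (f x))%R)%C.

Definition clocally_integrable f :=
  cmeasurable f /\ forall K, compact K -> cintegrable K f.

Definition ess_bounded f := exists M : R, {ae mu, forall x, normc (f x) <= M}.

Definition cLnorm (p : R) f : \bar R := Lnorm mu p%:E (fun x => (normc (f x))%:E).

Definition in_Lp (p : R) f := cmeasurable f /\ (cLnorm p f < +oo)%E.

(* The quasinorm of the weak space L^{p,oo}. *)
Definition weak_Lnorm (p : R) f : \bar R :=
  ereal_sup [set (l%:E * mu [set x | (l < normc (f x))%R] `^ p^-1)%E
            | l in [set l : R | 0 < l]].

(* e^{it} *)
Definition cexpi (t : R) : C := (cos t +i* sin t)%C.

Definition fourier f : 'rV[R]_d -> C :=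
  fun xi => cintegral (fun x => f x * cexpi (- (2 * pi * dotv x xi))).

(* Iterated partial derivatives along the list of coordinates a. *)
Definition partials (a : seq 'I_d) (u : 'rV[R]_d -> R) : 'rV[R]_d -> R :=
  foldr (fun i v => fun x => 'D_(delta_mx 0 i) v x) u a.

Definition smooth (u : 'rV[R]_d -> R) :=
  forall (a : seq 'I_d) x, differentiable (partials a u) x.

Definition csmooth f :=
  smooth (fun x => Re (f x)) /\ smooth (fun x => Im (f x)).

Definition cpartials (a : seq 'I_d) f : 'rV[R]_d -> C :=
  fun x => (partials a (fun y => Re (f y)) x +i*
            partials a (fun y => Im (f y)) x)%C.

Definition schwartz_seminorm (p : nat * seq 'I_d) f : \bar R :=
  ereal_sup (range (fun x => (enorm x ^+ p.1 * normc (cpartials p.2 f x))%:E)).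

Definition schwartz f :=
  csmooth f /\ forall p, (schwartz_seminorm p f < +oo)%E.

Definition test_function f :=
  csmooth f /\ exists M : R, forall x, M < enorm x -> f x = 0.

(* Tempered distributions are continuous linear functionals on the Schwartz
   space; a functional u is only ever constrained, and should only be used, on
   Schwartz functions.  Continuity of the linear functional u is domination by
   finitely many of the seminorms defining the topology. *)
Definition tempered_distribution (u : ('rV[R]_d -> C) -> C) :=
  (forall (a : C) f g, schwartz f -> schwartz g ->
     u (fun x => a * f x + g x) = a * u f + u g) /\
  (exists (c : R) (ps : seq (nat * seq 'I_d)), forall f, schwartz f ->
     ((normc (u f))%:E <= c%:E * \sum_(p <- ps) schwartz_seminorm p f)%E).

Definition fourier_dist (u : ('rV[R]_d -> C) -> C) : ('rV[R]_d -> C) -> C :=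
  fun phi => u (fourier phi).

Definition mul_dist (w : 'rV[R]_d -> R) (u : ('rV[R]_d -> C) -> C) :
    ('rV[R]_d -> C) -> C :=
  fun phi => u (fun x => (w x)%:C%C * phi x).

(* The tempered distribution u is the function f. *)
Definition dist_is_fun (u : ('rV[R]_d -> C) -> C) f :=
  [/\ tempered_distribution u, clocally_integrable f &
      forall phi, test_function phi -> u phi = cintegral (fun x => f x * phi x)].

Definition bessel_weight (s : R) xi : R :=
  (1 + 4 * pi ^+ 2 * enorm xi ^+ 2) `^ (s / 2).

(* v = (I - Delta)^{s/2} u as tempered distributions. *)
Definition is_bessel_dist (s : R) (u v : ('rV[R]_d -> C) -> C) :=
  forall phi, schwartz phi ->
    fourier_dist v phi = mul_dist (bessel_weight s) (fourier_dist u) phi.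

(* h = (I - Delta)^{s/2} m, both sides being functions. *)
Definition is_bessel (s : R) (m h : 'rV[R]_d -> C) :=
  exists u v, [/\ dist_is_fun u m, dist_is_fun v h & is_bessel_dist s u v].

End euclidean.

Section bilinear.
Variable n : nat.
Implicit Types f g : 'rV[R]_n -> C.

(* R^{2n} is 'rV_(n + n), and (xi, eta) is row_mx xi eta. *)
Definition bilinear_multiplier (m : 'rV[R]_(n + n) -> C) f g : 'rV[R]_n -> C :=
  fun x => cintegral (fun eta => cintegral (fun xi =>
    m (row_mx xi eta) * fourier f xi * fourier g eta *
    cexpi (2 * pi * dotv x (xi + eta)))).

(* T induces a bilinear map L^2 x L^2 -> L^1 on classes modulo a.e. equality;
   that T respects a.e. equality follows from boundedness. *)
Definition bilinear_L2_L1
    (T : ('rV[R]_n -> C) -> ('rV[R]_n -> C) -> 'rV[R]_n -> C) :=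
  [/\ forall f g, in_Lp 2 f -> in_Lp 2 g -> in_Lp 1 (T f g),
      forall (a : C) f1 f2 g, in_Lp 2 f1 -> in_Lp 2 f2 -> in_Lp 2 g ->
        {ae @lebesgue_rV R n, forall x,
          T (fun y => a * f1 y + f2 y) g x = a * T f1 g x + T f2 g x} &
      forall (a : C) f g1 g2, in_Lp 2 f -> in_Lp 2 g1 -> in_Lp 2 g2 ->
        {ae @lebesgue_rV R n, forall x,
          T f (fun y => a * g1 y + g2 y) x = a * T f g1 x + T f g2 x}].

End bilinear.
End definitions.

(* Main.v *)
(* By subordination, m = (I - Laplacian)^{-s/2} h with h = Dm is an average of heat evolutions
   of h over times t with the gamma density of shape s/2.  Hence T_m(f,g)(x) is the integral over t
   and over frequencies (a,b) of the gamma density times h(a,b) F_t(a,x) G_t(b,x), where F_t(a,.)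
   is f restricted to a Gaussian window around x and modulated by a, and likewise for g and b.

   Write the window as a superposition, over centres z, of products of two Gaussians centred at z,
   and pair with a function phi of modulus at most 1.  For fixed t and centres z, z', one is left
   with the trilinear form of h(a,b) A(a+b) B(a) C(b), where B and C are Fourier transforms of
   pieces of f and g, and A is that of phi times a product of Gaussians.  When h is in weak L^4 this
   form is bounded by the product of the L^2 norms of A, B, C, which Bessel's inequality controls.
   Integrating over z and z' against the Gaussian decay of A in z - z' gives the squared L^2 norms
   of f and g, and the remaining integral of t^{-n/4} against the gamma density is finite because
   s > n/2.

   On L^2 x L^2 the operator is the L^1 limit of truncated integrals; on Schwartz functions the
   truncations converge pointwise to T_m(f,g). *)

Require Import Defs.
From HB Require Import structures.
From mathcomp Require Import all_boot all_order all_algebra.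
From mathcomp Require Import complex.
From mathcomp Require Import all_classical all_reals all_analysis.
From mathcomp Require Import measurable_realfun.
From mathcomp Require Import ring lra.

Set Implicit Arguments.
Unset Strict Implicit.
Unset Printing Implicit Defensive.

Import Order.TTheory GRing.Theory Num.Theory.
Import numFieldNormedType.Exports.

Local Open Scope classical_set_scope.
Local Open Scope ring_scope.

(** The obstacle is that the localised pieces F_t(a,x), G_t(b,x) depend on x, which prevents
    integrating in x for a general h. Once both windows are expanded over centres, x enters only
    through Gaussians and the exponential of (a+b).x, so the integral in x becomes a function of
    a+b. The trilinear bound rests on the fact that any two of a+b, a, b are volume-preserving
    coordinates of R^{2n}, so that a pair of level sets has product measure; weak L^4 is the
    exponent dictated by scaling, since 2n/4 + 3n/2 = 2n. In time, the expansion contributes t^{n/4}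
    and the energies t^{-n/2}. The net power t^{-n/4} is also the one met when the heat kernel is
    integrated against a weak L^4 function, so one condition s > n/2 serves both to bound m and to
    bound the operator. Products of two norms are carried as r X + Y/r with r free: this form is
    additive and survives integration over centres and times. The parameter is optimised at the very
    end, and in the Cauchy estimate it is taken large to offset a small tail against a bounded
    energy. *)

Local Notation normc := (@ComplexField.Normc.normc _).
Local Notation Re := complex.Re.
Local Notation Im := complex.Im.

(** * Lebesgue measure on R^n *)
Section lebesgue_affine.
Context {R : realType}.
Local Open Scope ereal_scope.

(** The pushforward rescaled by [c] is a measure that agrees with Lebesgue measure on half-open
    intervals, so uniqueness of Lebesgue measure applies. *)
Lemma lebesgue_measure_affine (c a : R) (A : set R) : (0 < c)%R -> measurable A ->
  lebesgue_measure ((fun x : R => c * x + a)%R @^-1` A) =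
  c^-1%:E * lebesgue_measure A.
Proof.
move=> c0 mA.
have mphi : measurable_fun setT
    (fun x : measurableTypeR R => (c * x + a)%R : measurableTypeR R).
  exact: measurable_funD.
pose nu : {measure set (measurableTypeR R) -> \bar R} :=
  mscale (NngNum (ltW c0)) (measure_function_pushforward__canonical__measure_function_Measure
    (@lebesgue_measure R) mphi).
have nuE B : nu B = c%:E * lebesgue_measure ((fun x : R => c * x + a)%R @^-1` B).
  by [].
have /(_ _ mA) -> : forall B, measurable B -> lebesgue_measure B = nu B.
  apply: lebesgue_measure_unique => _ [[u v] _ <-] /=.
  rewrite nuE (_ : _ @^-1` _ = `](c^-1 * (u - a))%R, (c^-1 * (v - a))%R]%classic); last first.
    apply/seteqP; split => x /=; rewrite !in_itv/= => /andP[ux xv].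
      rewrite ltr_pdivrMl// ler_pdivlMl//; apply/andP; split; lra.
    move: ux xv; rewrite ltr_pdivrMl// ler_pdivlMl// => ux xv.
    apply/andP; split; lra.
  rewrite !lebesgue_measure_itv/= !lte_fin ltr_pM2l ?invr_gt0// ltrD2r.
  case: ifPn => _; last by rewrite mule0.
  rewrite -!EFinB -EFinM; congr EFin.
  have cn0 : c != 0%R by rewrite gt_eqF.
  by field.
by rewrite nuE muleA -EFinM mulVf ?gt_eqF// mul1e.
Qed.

Lemma integral_affine (c a : R) (f : R -> \bar R) : (0 < c)%R ->
  measurable_fun setT f -> (forall x, 0 <= f x) ->
  \int[lebesgue_measure]_x f (c * x + a)%R =
  c^-1%:E * \int[lebesgue_measure]_x f x.
Proof.
move=> c0 mf f0.
have mphi : measurable_fun setT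
    (fun x : measurableTypeR R => (c * x + a)%R : measurableTypeR R).
  exact: measurable_funD.
rewrite -[in LHS](preimage_setT (fun x : measurableTypeR R => (c * x + a)%R : measurableTypeR R)).
rewrite -(@ge0_integral_pushforward _ _ _ _ _ _ mphi lebesgue_measure setT f)//.
have ci0 : (0 <= c^-1)%R by rewrite invr_ge0 ltW.
transitivity (\int[mscale (NngNum ci0) lebesgue_measure]_x f x).
  apply: eq_measure_integral => A mA _.
  exact: lebesgue_measure_affine.
by rewrite ge0_integral_mscale.
Qed.

End lebesgue_affine.

Section rV_measurability.
Context {R : realType} d (T : measurableType d).
Implicit Types n m : nat.

Lemma measurable_rV_comp n (f : T -> 'rV[R]_n) i : measurable_fun setT f ->
  measurable_fun setT (fun x => f x 0 i).
Proof. by move=> mf; exact: (measurableT_comp (measurable_rV_coord i) mf). Qed.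

Lemma measurable_rVD n (f g : T -> 'rV[R]_n) : measurable_fun setT f ->
  measurable_fun setT g -> measurable_fun setT (fun x => f x + g x).
Proof.
move=> mf mg; apply: measurable_fun_rVP => i.
rewrite (_ : (fun _ => _) = (fun x => f x 0 i + g x 0 i)).
  by apply: measurable_funD; exact: measurable_rV_comp.
by apply/funext => x; rewrite mxE.
Qed.

Lemma measurable_rVN n (f : T -> 'rV[R]_n) : measurable_fun setT f ->
  measurable_fun setT (fun x => - f x).
Proof.
move=> mf; apply: measurable_fun_rVP => i.
rewrite (_ : (fun _ => _) = (fun x => - f x 0 i)).
  by apply: measurable_funN; exact: measurable_rV_comp.
by apply/funext => x; rewrite mxE.
Qed.

Lemma measurable_rVB n (f g : T -> 'rV[R]_n) : measurable_fun setT f ->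
  measurable_fun setT g -> measurable_fun setT (fun x => f x - g x).
Proof. by move=> mf mg; apply: measurable_rVD => //; exact: measurable_rVN. Qed.

Lemma measurable_rVZ n (c : T -> R) (f : T -> 'rV[R]_n) : measurable_fun setT c ->
  measurable_fun setT f -> measurable_fun setT (fun x => c x *: f x).
Proof.
move=> mc mf; apply: measurable_fun_rVP => i.
rewrite (_ : (fun _ => _) = (fun x => c x * f x 0 i)).
  by apply: measurable_funM => //; exact: measurable_rV_comp.
by apply/funext => x; rewrite mxE.
Qed.

Lemma measurable_row_mx n m (f : T -> 'rV[R]_n) (g : T -> 'rV[R]_m) :
  measurable_fun setT f -> measurable_fun setT g ->
  measurable_fun setT (fun x => row_mx (f x) (g x)).
Proof.
move=> mf mg; apply: measurable_fun_rVP => i.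
case: (split_ordP i) => j ->.
  rewrite (_ : (fun _ => _) = (fun x => f x 0 j)); first exact: measurable_rV_comp.
  by apply/funext => x; rewrite row_mxEl.
rewrite (_ : (fun _ => _) = (fun x => g x 0 j)); first exact: measurable_rV_comp.
by apply/funext => x; rewrite row_mxEr.
Qed.

Lemma measurable_lsubmx n m (f : T -> 'rV[R]_(n + m)) :
  measurable_fun setT f -> measurable_fun setT (fun x => lsubmx (f x)).
Proof.
move=> mf; apply: measurable_fun_rVP => i.
rewrite (_ : (fun _ => _) = (fun x => f x 0 (lshift m i))).
  exact: measurable_rV_comp.
by apply/funext => x; rewrite mxE.
Qed.

Lemma measurable_rsubmx n m (f : T -> 'rV[R]_(n + m)) :
  measurable_fun setT f -> measurable_fun setT (fun x => rsubmx (f x)).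
Proof.
move=> mf; apply: measurable_fun_rVP => i.
rewrite (_ : (fun _ => _) = (fun x => f x 0 (rshift n i))).
  exact: measurable_rV_comp.
by apply/funext => x; rewrite mxE.
Qed.

Lemma measurable_dotv n (f g : T -> 'rV[R]_n) : measurable_fun setT f ->
  measurable_fun setT g -> measurable_fun setT (fun x => dotv (f x) (g x)).
Proof.
move=> mf mg; apply: measurable_sum => i.
by apply: measurable_funM; exact: measurable_rV_comp.
Qed.

End rV_measurability.

(** * Iterated integrals and affine changes of variables on R^n *)

Section lebesgue_rV_integral.
Context {R : realType}.
Local Open Scope ereal_scope.
Local Notation mu n := (@lebesgue_rV R n).
Local Notation lam := (@lebesgue_measure R).

Lemma integral_rV_cons n (f : 'rV[R]_n.+1 -> \bar R) :
  measurable_fun setT f -> (forall x, 0 <= f x) ->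
  \int[mu n.+1]_x f x = \int[lam]_x \int[mu n]_v f (rV_cons (x, v)).
Proof.
move=> mf f0.
have -> : \int[mu n.+1]_x f x = \int[(lam \x mu n)]_p f (rV_cons p).
  have := @ge0_integral_pushforward _ _ _ _ R (@rV_cons R n)
    (@measurable_rV_cons R n) (lam \x mu n) setT f measurableT mf
    (fun y _ => f0 y).
  by rewrite preimage_setT => <-.
rewrite fubini_tonelli1//.
exact: measurableT_comp mf (@measurable_rV_cons R n).
Qed.

Lemma measurable_int_rV_cons n (f : 'rV[R]_n.+1 -> \bar R) :
  measurable_fun setT f -> (forall x, 0 <= f x) ->
  measurable_fun setT (fun x : R => \int[mu n]_v f (rV_cons (x, v))).
Proof.
move=> mf f0.
apply: (measurable_fun_fubini_tonelli_F (m2 := mu n) (fun p => f (rV_cons p))) => //.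
exact: measurableT_comp mf (@measurable_rV_cons R n).
Qed.

Lemma integral_rV0 (f : 'rV[R]_0 -> \bar R) : measurable_fun setT f ->
  \int[mu 0]_x f x = f 0%R.
Proof. by move=> mf; rewrite [LHS]integral_dirac// diracT mul1e. Qed.

Lemma rV_cons_surj n (a : 'rV[R]_n.+1) : exists b : R * 'rV[R]_n, a = rV_cons b.
Proof.
exists (a 0%R ord0, \row_j a 0%R (lift ord0 j)); apply/rowP => i.
rewrite /rV_cons; case: (@split_ordP 1 n i) => j ->{i}.
  rewrite [RHS](@row_mxEl _ 1 1 n) ord1 !mxE/=; congr (a _ _); exact/val_inj.
rewrite [RHS](@row_mxEr _ 1 1 n) mxE; congr (a _ _); exact/val_inj.
Qed.

Lemma rV_cons_affine n (c : R) (p q : R * 'rV[R]_n) :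
  (c *: rV_cons p + rV_cons q)%R = rV_cons (c * p.1 + q.1, c *: p.2 + q.2)%R.
Proof.
rewrite /rV_cons -[_ *: _]/(_ *: (row_mx _ _ : 'rV_(1 + n)))%R.
by rewrite scale_row_mx [LHS](@add_row_mx _ 1 1 n)/= scale_scalar_mx -raddfD.
Qed.

Lemma measurable_affine_comp n (c : R) (a : 'rV[R]_n) (f : 'rV[R]_n -> \bar R) :
  measurable_fun setT f -> measurable_fun setT (fun x : 'rV[R]_n => f (c *: x + a)%R).
Proof.
move=> mf; apply: (measurableT_comp mf).
by apply: measurable_rVD => //; exact: measurable_rVZ.
Qed.

(** Induction on the dimension: the first coordinate is split off by Tonelli, and each coordinate
    contributes one factor [c^-1]. *)
Lemma integral_rV_affine n (c : R) (a : 'rV[R]_n) (f : 'rV[R]_n -> \bar R) :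
  (0 < c)%R -> measurable_fun setT f -> (forall x, 0 <= f x) ->
  \int[mu n]_x f (c *: x + a)%R = (c ^- n)%:E * \int[mu n]_x f x.
Proof.
move=> c0; elim: n a f => [|n ih] a f mf f0.
  rewrite !integral_rV0 ?expr0 ?invr1 ?mul1e//; last exact: measurable_affine_comp.
  by congr f; rewrite !thinmx0.
have mfa := measurable_affine_comp c a mf.
rewrite !integral_rV_cons//.
have [[a0 a'] ->] := rV_cons_surj a.
under eq_integral => x _.
  under eq_integral => v _ do rewrite rV_cons_affine/=.
  rewrite (ih _ (fun w => f (rV_cons (c * x + a0, w)%R)))//; last first.
    apply: (measurableT_comp mf); apply: (measurableT_comp (@measurable_rV_cons R n)).
    exact: measurable_pair1.
  over.
rewrite (integral_affine a0 (f := fun x => (c ^- n)%:E *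
  \int[mu n]_v f (rV_cons (x, v))) c0); last 2 first.
- by apply: emeasurable_funM => //; exact: measurable_int_rV_cons.
- move=> x; rewrite mule_ge0// ?integral_ge0//.
  by rewrite lee_fin invr_ge0 exprn_ge0// ltW.
rewrite ge0_integralZl//; last 3 first.
- exact: measurable_int_rV_cons.
- by move=> *; exact: integral_ge0.
- by rewrite lee_fin invr_ge0 exprn_ge0// ltW.
by rewrite muleA -EFinM -invfM -exprS.
Qed.

Lemma integral_rV_shift n (a : 'rV[R]_n) (f : 'rV[R]_n -> \bar R) :
  measurable_fun setT f -> (forall x, 0 <= f x) ->
  \int[mu n]_x f (x + a)%R = \int[mu n]_x f x.
Proof.
move=> mf f0; have := integral_rV_affine a (ltr01 : 0 < 1 :> R)%R mf f0.
rewrite expr1n invr1 mul1e => <-.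
by apply: eq_integral => x _; rewrite scale1r.
Qed.

Lemma integralN_lebesgue (f : R -> \bar R) : measurable_fun setT f ->
  (forall x, 0 <= f x) -> \int[lam]_x f (- x)%R = \int[lam]_x f x.
Proof.
move=> mf f0.
have mphi : measurable_fun setT (-%R : measurableTypeR R -> measurableTypeR R).
  exact: oppr_measurable.
rewrite -[in LHS](preimage_setT (-%R : _ -> measurableTypeR R)).
rewrite -(@ge0_integral_pushforward _ _ _ _ _ _ mphi lam setT f)//.
by apply: eq_measure_integral => A mA _; exact: lebesgue_measureN.
Qed.

Lemma integral_rV_opp n (f : 'rV[R]_n -> \bar R) :
  measurable_fun setT f -> (forall x, 0 <= f x) ->
  \int[mu n]_x f (- x)%R = \int[mu n]_x f x.
Proof.
elim: n f => [|n ih] f mf f0.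
  have mfN : measurable_fun setT (fun x : 'rV[R]_0 => f (- x)%R).
    by apply: (measurableT_comp mf); exact: measurable_rVN.
  by rewrite !integral_rV0// oppr0.
have mfN : measurable_fun setT (fun x : 'rV[R]_n.+1 => f (- x)%R).
  by apply: (measurableT_comp mf); exact: measurable_rVN.
rewrite (integral_rV_cons mfN (fun x => f0 _)) (integral_rV_cons mf f0).
under eq_integral => x _.
  under eq_integral => v _.
    rewrite (_ : - rV_cons (x, v) = rV_cons (- x, - v))%R; last first.
      rewrite /rV_cons [LHS](@opp_row_mx _ 1 1 n)/= raddfN//.
    over.
  rewrite (ih (fun w => f (rV_cons (- x, w)%R)))//; last first.
    apply: (measurableT_comp mf); apply: (measurableT_comp (@measurable_rV_cons R n)).
    exact: measurable_pair1.
  over.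
rewrite (integralN_lebesgue (f := fun x => \int[mu n]_w f (rV_cons (x, w))))//.
  exact: measurable_int_rV_cons.
by move=> x; exact: integral_ge0.
Qed.

Lemma rV_cons0 n (p : R * 'rV[R]_n) : rV_cons p 0%R ord0 = p.1.
Proof.
rewrite /rV_cons (_ : ord0 = @lshift 1 n ord0); last exact/val_inj.
by rewrite [LHS](@row_mxEl _ 1 1 n) !mxE.
Qed.

Lemma rV_cons_lift n (p : R * 'rV[R]_n) i :
  rV_cons p 0%R (lift ord0 i) = p.2 0%R i.
Proof.
rewrite /rV_cons (_ : lift ord0 i = @rshift 1 n i); last exact/val_inj.
by rewrite [LHS](@row_mxEr _ 1 1 n).
Qed.

Lemma rV_cons_row_mx n m (x : R) (v : 'rV[R]_n) (w : 'rV[R]_m) :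
  rV_cons (x, row_mx v w) = row_mx (rV_cons (x, v)) w.
Proof.
apply/rowP => i; case: (unliftP (ord0 : 'I_(n + m).+1) i) => [j|] ->{i}.
  rewrite rV_cons_lift/=; case: (split_ordP j) => k ->{j}.
    rewrite row_mxEl (_ : lift _ _ = lshift m (lift ord0 k)); last exact/val_inj.
    by rewrite [RHS](@row_mxEl _ 1 n.+1 m) rV_cons_lift.
  rewrite row_mxEr (_ : lift _ _ = rshift n.+1 k); last exact/val_inj.
  by rewrite [RHS](@row_mxEr _ 1 n.+1 m).
rewrite rV_cons0/= (_ : ord0 = lshift m (ord0 : 'I_n.+1)); last exact/val_inj.
by rewrite [RHS](@row_mxEl _ 1 n.+1 m) rV_cons0.
Qed.

(** The measure on R^{n+m} is built by adding one coordinate at a time on the left, so the splitting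
    follows by induction on [n] from [rV_cons_row_mx]. *)
Lemma integral_row_mx n m (f : 'rV[R]_(n + m) -> \bar R) :
  measurable_fun setT f -> (forall x, 0 <= f x) ->
  \int[mu (n + m)]_x f x = \int[mu n]_x \int[mu m]_y f (row_mx x y).
Proof.
elim: n f => [|n ih] f mf f0.
  rewrite integral_rV0; last first.
    apply: (measurable_fun_fubini_tonelli_F (m2 := mu m) (fun p => f (row_mx p.1 p.2))) => //.
    by apply: (measurableT_comp mf); exact: measurable_row_mx.
  by apply: eq_integral => x _; rewrite row_thin_mx.
rewrite [LHS](@integral_rV_cons (n + m))// [RHS]integral_rV_cons; last 2 first.
- apply: (measurable_fun_fubini_tonelli_F (m2 := mu m) (fun p => f (row_mx p.1 p.2))) => //.
  by apply: (measurableT_comp mf); exact: measurable_row_mx.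
- by move=> x; exact: integral_ge0.
apply: eq_integral => x _.
rewrite ih; last 2 first.
- apply: (measurableT_comp mf); apply: (measurableT_comp (@measurable_rV_cons R (n + m))).
  exact: measurable_pair1.
- by move=> y; exact: f0.
apply: eq_integral => v _; apply: eq_integral => w _; congr f.
exact: rV_cons_row_mx.
Qed.

End lebesgue_rV_integral.

(** * Complex-valued integrals *)
Section complex_modulus.
Context {R : realType}.
Implicit Types z w : R[i].

Lemma ReM z w : Re (z * w) = Re z * Re w - Im z * Im w.
Proof. by case: z w => [a b] [c d]. Qed.

Lemma ImM z w : Im (z * w) = Re z * Im w + Im z * Re w.
Proof. by case: z w => [a b] [c d]. Qed.

Lemma ReD z w : Re (z + w) = Re z + Re w.
Proof. by case: z w => [a b] [c d]. Qed.

Lemma ImD z w : Im (z + w) = Im z + Im w.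
Proof. by case: z w => [a b] [c d]. Qed.

Lemma complex_eq z w : Re z = Re w -> Im z = Im w -> z = w.
Proof. by case: z w => [a b] [c d] /= -> ->. Qed.

Lemma normc_ge0 z : 0 <= normc z.
Proof. by case: z => a b; exact: sqrtr_ge0. Qed.

Lemma sqr_normc z : normc z ^+ 2 = Re z ^+ 2 + Im z ^+ 2.
Proof. by case: z => a b; rewrite sqr_sqrtr// addr_ge0// sqr_ge0. Qed.

Lemma normc_real (r : R) : normc r%:C%C = `|r|.
Proof. by rewrite /= expr0n addr0 sqrtr_sqr. Qed.

Lemma normc_cexpi (t : R) : normc (cexpi t) = 1.
Proof. by rewrite /= cos2Dsin2 sqrtr1. Qed.

Lemma Re_le_normc z : `|Re z| <= normc z.
Proof.
rewrite -ler_sqr ?nnegrE ?normc_ge0// sqr_normc real_normK ?num_real//.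
by rewrite lerDl sqr_ge0.
Qed.

Lemma Im_le_normc z : `|Im z| <= normc z.
Proof.
rewrite -ler_sqr ?nnegrE ?normc_ge0// sqr_normc real_normK ?num_real//.
by rewrite lerDr sqr_ge0.
Qed.

Lemma normc_le_ReIm z : normc z <= `|Re z| + `|Im z|.
Proof.
rewrite -ler_sqr ?nnegrE ?normc_ge0 ?addr_ge0// sqr_normc.
rewrite sqrrD !real_normK ?num_real// -addrA [_ *+ 2 + _]addrC addrA lerDl.
by rewrite mulrn_wge0// mulr_ge0.
Qed.

Lemma normcN z : normc (- z) = normc z.
Proof. by case: z => a b /=; rewrite !sqrrN. Qed.

Lemma normcB z w : normc (z - w) = normc (w - z).
Proof. by rewrite -opprB normcN. Qed.

Lemma normc_conj z : normc (z^*)%C = normc z.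
Proof. by case: z => a b /=; rewrite sqrrN. Qed.

Lemma mul_conjc z : z * (z^*)%C = (normc z ^+ 2)%:C%C.
Proof.
by rewrite sqr_normc; apply: complex_eq; case: z => a b /=; ring.
Qed.

Lemma cexpiD (s t : R) : cexpi (s + t) = cexpi s * cexpi t.
Proof. by apply: complex_eq; rewrite ?ReM ?ImM /= ?cosD ?sinD; ring. Qed.

Lemma conj_cexpi (t : R) : ((cexpi t)^*)%C = cexpi (- t).
Proof. by apply: complex_eq; rewrite /= ?cosN ?sinN. Qed.

End complex_modulus.

Section complex_measurability.
Context {R : realType} d (T : measurableType d).
Implicit Types (f g : T -> R[i]) (r : T -> R).

(** [cmeasurable] over an arbitrary measurable space, since products with the time axis occur below;
    on R^n the two are convertible. *)
Definition cmeas f := measurable_fun setT (fun x => Re (f x)) /\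
  measurable_fun setT (fun x => Im (f x)).

Lemma cmeas_cst z : cmeas (fun=> z). Proof. by split. Qed.

Lemma cmeas_real r : measurable_fun setT r -> cmeas (fun x => (r x)%:C%C).
Proof. by []. Qed.

Lemma cmeasD f g : cmeas f -> cmeas g -> cmeas (fun x => f x + g x).
Proof.
move=> [mf mf'] [mg mg']; split.
  by under eq_fun do rewrite ReD; exact: measurable_funD.
by under eq_fun do rewrite ImD; exact: measurable_funD.
Qed.

Lemma cmeasM f g : cmeas f -> cmeas g -> cmeas (fun x => f x * g x).
Proof.
move=> [mf mf'] [mg mg']; split.
  by under eq_fun do rewrite ReM; apply: measurable_funB; exact: measurable_funM.
by under eq_fun do rewrite ImM; apply: measurable_funD; exact: measurable_funM.
Qed.

Lemma cmeasN f : cmeas f -> cmeas (fun x => - f x).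
Proof.
move=> mf; under eq_fun do rewrite -mulN1r.
by apply: cmeasM => //; exact: cmeas_cst.
Qed.

Lemma cmeas_conj f : cmeas f -> cmeas (fun x => ((f x)^*)%C).
Proof.
move=> [mf mf']; split.
  by rewrite (_ : (fun _ => _) = (fun x => Re (f x)))//; apply/funext => x; case: (f x).
rewrite (_ : (fun _ => _) = (fun x => - Im (f x))); first exact: measurable_funN.
by apply/funext => x; case: (f x).
Qed.

Lemma cmeas_cexpi r : measurable_fun setT r -> cmeas (fun x => cexpi (r x)).
Proof.
move=> mr; split; apply: measurableT_comp mr; apply: continuous_measurable_fun.
  exact: continuous_cos.
exact: continuous_sin.
Qed.

Lemma measurable_normc f : cmeas f -> measurable_fun setT (fun x => normc (f x)).
Proof.
move=> [mf mf'].
rewrite (_ : (fun _ => _) = (fun x => Num.sqrt (Re (f x) ^+ 2 + Im (f x) ^+ 2))).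
  apply: (measurableT_comp (f := Num.sqrt : R -> R)).
    by apply: continuous_measurable_fun; exact: sqrt_continuous.
  by apply: measurable_funD; exact: measurable_funX.
by apply/funext => x; case: (f x).
Qed.

End complex_measurability.

Lemma cmeas_comp {R : realType} d d' (T : measurableType d) (T' : measurableType d')
    (f : T -> R[i]) (g : T' -> T) :
  cmeas f -> measurable_fun setT g -> cmeas (fun x => f (g x)).
Proof.
by move=> [mf mf'] mg; split; [exact: measurableT_comp mf mg|exact: measurableT_comp mf' mg].
Qed.

Section complex_integral.
Context {R : realType} d (T : measurableType d) (mu : {measure set T -> \bar R}).
Implicit Types f g : T -> R[i].

(** [cintegral] over an arbitrary measure; for Lebesgue measure the two are convertible, which lets
    [fourier] and [bilinear_multiplier] be read as [cint]. *)
Definition cint f : R[i] :=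
  ((\int[mu]_x Re (f x))%R +i* (\int[mu]_x Im (f x))%R)%C.

Definition cL1 f := cmeas f /\ (\int[mu]_x (normc (f x))%:E < +oo)%E.

Lemma cL1_Re f : cL1 f -> mu.-integrable setT (EFin \o (fun x => Re (f x))).
Proof.
move=> [[mf mf'] foo]; apply/integrableP; split; first exact/measurable_EFinP.
apply: le_lt_trans foo; apply: ge0_le_integral => //.
- by apply/measurableT_comp => //; exact/measurable_EFinP.
- exact/measurable_EFinP/measurable_normc.
- by move=> x _; rewrite lee_fin Re_le_normc.
Qed.

Lemma cL1_Im f : cL1 f -> mu.-integrable setT (EFin \o (fun x => Im (f x))).
Proof.
move=> [[mf mf'] foo]; apply/integrableP; split; first exact/measurable_EFinP.
apply: le_lt_trans foo; apply: ge0_le_integral => //.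
- by apply/measurableT_comp => //; exact/measurable_EFinP.
- exact/measurable_EFinP/measurable_normc.
- by move=> x _; rewrite lee_fin Im_le_normc.
Qed.

Lemma cL1P f : mu.-integrable setT (EFin \o (fun x => Re (f x))) ->
  mu.-integrable setT (EFin \o (fun x => Im (f x))) -> cL1 f.
Proof.
move=> fr fi.
have mf : cmeas f.
  by split; apply/measurable_EFinP; [exact: measurable_int fr|exact: measurable_int fi].
split=> //.
apply: (@le_lt_trans _ _ (\int[mu]_x (`|(Re (f x))%:E| + `|(Im (f x))%:E|))%E).
  apply: ge0_le_integral => //.
  - by move=> x _; rewrite lee_fin normc_ge0.
  - exact/measurable_EFinP/measurable_normc.
  - by apply: emeasurable_funD; apply: measurableT_comp => //;
      [exact: measurable_int fr|exact: measurable_int fi].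
  - by move=> x _; rewrite lee_fin normc_le_ReIm.
rewrite ge0_integralD//; last 2 first.
  by apply: measurableT_comp => //; exact: measurable_int fr.
  by apply: measurableT_comp => //; exact: measurable_int fi.
by rewrite lte_add_pinfty//; [case/integrableP: fr|case/integrableP: fi].
Qed.

Lemma le_cL1 f (g : T -> R) : cmeas f -> measurable_fun setT g ->
  (forall x, normc (f x) <= g x) -> (\int[mu]_x (g x)%:E < +oo)%E -> cL1 f.
Proof.
move=> mf mg fg goo; split=> //; apply: le_lt_trans goo.
apply: ge0_le_integral => //.
- by move=> x _; rewrite lee_fin normc_ge0.
- exact/measurable_EFinP/measurable_normc.
- exact/measurable_EFinP.
- by move=> x _; rewrite lee_fin.
Qed.

Lemma cL1Z (c : R[i]) f : cL1 f -> cL1 (fun x => c * f x).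
Proof.
move=> [mf foo]; split.
  by apply: cmeasM => //; exact: cmeas_cst.
under eq_integral do rewrite Normc.normcM EFinM.
rewrite ge0_integralZl_EFin//.
- by rewrite lte_mul_pinfty// lee_fin normc_ge0.
- by move=> x _; rewrite lee_fin normc_ge0.
- exact/measurable_EFinP/measurable_normc.
- exact: normc_ge0.
Qed.

Lemma cL1D f g : cL1 f -> cL1 g -> cL1 (fun x => f x + g x).
Proof.
move=> [mf foo] [mg goo].
apply: (@le_cL1 _ (fun x => normc (f x) + normc (g x))).
- exact: cmeasD.
- by apply: measurable_funD; exact: measurable_normc.
- by move=> x; exact: le_normcD.
under eq_integral do rewrite EFinD.
rewrite ge0_integralD//; last 4 first.
- by move=> x _; rewrite lee_fin normc_ge0.
- exact/measurable_EFinP/measurable_normc.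
- by move=> x _; rewrite lee_fin normc_ge0.
- exact/measurable_EFinP/measurable_normc.
exact: lte_add_pinfty.
Qed.

Lemma eq_cint f g : f =1 g -> cint f = cint g.
Proof. by move=> /funext ->. Qed.

Lemma cintD f g : cL1 f -> cL1 g -> cint (fun x => f x + g x) = cint f + cint g.
Proof.
move=> If Ig; apply: complex_eq; rewrite /= ?ReD ?ImD /=.
  rewrite -RintegralD//; [|exact: cL1_Re..].
  by apply: eq_Rintegral => x _; rewrite ReD.
rewrite -RintegralD//; [|exact: cL1_Im..].
by apply: eq_Rintegral => x _; rewrite ImD.
Qed.

Lemma cintZ (c : R[i]) f : cL1 f -> cint (fun x => c * f x) = c * cint f.
Proof.
move=> If; have fr := cL1_Re If; have fi := cL1_Im If.
have Z (r : R) (h : T -> R) : mu.-integrable setT (EFin \o h) ->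
    mu.-integrable setT (EFin \o (fun x => r * h x)).
  by move=> /(integrableZl measurableT r).
apply: complex_eq; rewrite /= ?ReM ?ImM /=.
  rewrite -!RintegralZl// -RintegralB//; [|exact: Z..].
  by apply: eq_Rintegral => x _; rewrite ReM.
rewrite -!RintegralZl// -RintegralD//; [|exact: Z..].
by apply: eq_Rintegral => x _; rewrite ImM.
Qed.

Lemma le_normc_cint f : cL1 f ->
  ((normc (cint f))%:E <= \int[mu]_x (normc (f x))%:E)%E.
Proof.
move=> If; have [mf foo] := If.
have [->|I0] := eqVneq (cint f) 0.
  by rewrite Normc.normc0 integral_ge0// => x _; rewrite lee_fin normc_ge0.
have N0 : normc (cint f) != 0 by apply: contra I0 => /eqP/Normc.eq0_normc ->.
(* The unimodular factor that rotates the integral onto the positive real axis, so that only a real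
   part has to be estimated. *)
pose c := ((cint f)^*)%C * (normc (cint f))^-1%:C%C.
have c1 : normc c = 1.
  by rewrite Normc.normcM normc_conj normc_real ger0_norm ?invr_ge0 ?normc_ge0// divff.
have cI : (normc (cint f))%:C%C = c * cint f.
  rewrite /c mulrAC [_ * cint f]mulrC mul_conjc -rmorphM/=.
  by rewrite expr2 -mulrA divff// mulr1.
have Icf := cL1Z c If.
have -> : normc (cint f) = \int[mu]_x Re (c * f x).
  by rewrite -[LHS]/(Re (normc (cint f))%:C%C) cI -cintZ.
rewrite /Rintegral fineK; last first.
  by apply: integrable_fin_num => //; exact: (cL1_Re Icf).
apply: (le_trans (lee_abs _)); apply: le_trans (le_abse_integral _ _ _) _ => //.
  exact: measurable_int (cL1_Re Icf).
apply: ge0_le_integral => //.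
- apply: measurableT_comp => //; have /integrableP[] := cL1_Re Icf; done.
- exact/measurable_EFinP/measurable_normc.
- move=> x _; rewrite /= lee_fin (le_trans (Re_le_normc _))//.
  by rewrite Normc.normcM c1 mul1r.
Qed.

End complex_integral.

Section complex_dominated_convergence.
Context {R : realType} d (T : measurableType d) (mu : {measure set T -> \bar R}).

Lemma cint_dct (F : nat -> T -> R[i]) (f : T -> R[i]) (g : T -> R) :
  (forall N, cmeas (F N)) -> cmeas f -> measurable_fun setT g ->
  (forall x, (fun N => Re (F N x)) @ \oo --> Re (f x)) ->
  (forall x, (fun N => Im (F N x)) @ \oo --> Im (f x)) ->
  (forall N x, normc (F N x) <= g x) -> (\int[mu]_x (g x)%:E < +oo)%E ->
  (fun N => Re (cint mu (F N))) @ \oo --> Re (cint mu f) /\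
  (fun N => Im (cint mu (F N))) @ \oo --> Im (cint mu f).
Proof.
move=> mF mf mg cRe cIm Fg goo.
have g0 x : 0 <= g x by exact: le_trans (normc_ge0 (F 0%N x)) (Fg 0%N x).
have Ig : mu.-integrable setT (EFin \o g).
  apply/integrableP; split; first exact/measurable_EFinP.
  by under eq_integral do rewrite /= ger0_norm//.
have main (H : nat -> T -> R) (h : T -> R) :
    (forall N, measurable_fun setT (H N)) -> measurable_fun setT h ->
    (forall x, (fun N => H N x) @ \oo --> h x) ->
    (forall N x, `|H N x| <= g x) ->
    (fun N => \int[mu]_x H N x)%R @ \oo --> (\int[mu]_x h x)%R.
  move=> mH mh cH Hg.
  have [|||||ih _ c] := @dominated_convergence _ T R mu setT measurableT
    (fun N x => (H N x)%:E) (EFin \o h) (EFin \o g).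
  - by move=> N; exact/measurable_EFinP.
  - exact/measurable_EFinP.
  - by apply: aeW => x _; apply: cvg_EFin; [exact: nearW|exact: cH].
  - exact: Ig.
  - by apply: aeW => x N _; rewrite lee_fin.
  apply: fine_cvg; rewrite fineK//.
  exact: integrable_fin_num.
split; apply: main => //.
- by move=> N; case: (mF N).
- by case: mf.
- by move=> N x; exact: le_trans (Re_le_normc _) (Fg N x).
- by move=> N; case: (mF N).
- by case: mf.
- by move=> N x; exact: le_trans (Im_le_normc _) (Fg N x).
Qed.

End complex_dominated_convergence.

Section complex_fubini.
Context {R : realType} d1 d2 (T1 : measurableType d1) (T2 : measurableType d2).
Variables (m1 : {sigma_finite_measure set T1 -> \bar R}).
Variables (m2 : {sigma_finite_measure set T2 -> \bar R}).

(** No integrability is assumed: the real integral is [fine] of the difference of two nonnegative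
    partial integrals, each measurable by Tonelli's theorem. *)
Lemma measurable_Rintegral (f : T1 * T2 -> R) : measurable_fun setT f ->
  measurable_fun setT (fun x => (\int[m2]_y f (x, y))%R).
Proof.
move=> mf; apply: measurableT_comp => //.
under eq_fun do rewrite integralE.
have mef : measurable_fun setT (EFin \o f) by exact/measurable_EFinP.
apply: emeasurable_funB.
  under eq_fun do rewrite -[X in X^\+%E]/(EFin \o f \o pair _) funepos_comp.
  exact: (measurable_fun_fubini_tonelli_F (m2 := m2) _ (measurable_funepos mef)
    (fun x => funepos_ge0 _ x)).
under eq_fun do rewrite -[X in X^\-%E]/(EFin \o f \o pair _) funeneg_comp.
exact: (measurable_fun_fubini_tonelli_F (m2 := m2) _ (measurable_funeneg mef)
  (fun x => funeneg_ge0 _ x)).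
Qed.

Lemma cmeas_cint (f : T1 * T2 -> R[i]) : cmeas f ->
  cmeas (fun x => cint m2 (fun y => f (x, y))).
Proof.
by move=> [mf mf']; split => /=;
  [exact: (measurable_Rintegral mf)|exact: (measurable_Rintegral mf')].
Qed.

(** The sections of an integrable function are integrable only almost everywhere, so [fine] is
    removed from the inner integral almost everywhere. *)
Lemma Rintegral_fubini (f : T1 * T2 -> R) :
  (m1 \x m2)%E.-integrable setT (EFin \o f) ->
  (\int[m1]_x (\int[m2]_y f (x, y))%R)%R = (\int[(m1 \x m2)%E]_p f p)%R.
Proof.
move=> If; rewrite /Rintegral -integral12_prod_meas1//; congr fine.
apply: ae_eq_integral => //.
- apply/measurable_EFinP; apply: measurable_Rintegral.
  by apply/measurable_EFinP; exact: measurable_int If.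
- exact: measurable_fubini_F If.
have := ae_integrable1 If; apply: filterS => x Ix _.
by rewrite fineK//; exact: integrable_fin_num.
Qed.

Lemma Rintegral_fubini_sym (f : T1 * T2 -> R) :
  (m1 \x m2)%E.-integrable setT (EFin \o f) ->
  (\int[m2]_y (\int[m1]_x f (x, y))%R)%R = (\int[(m1 \x m2)%E]_p f p)%R.
Proof.
move=> If; rewrite /Rintegral -integral21_prod_meas1//; congr fine.
apply: ae_eq_integral => //.
- apply/measurable_EFinP; apply: measurableT_comp => //.
  exact: measurable_fubini_G If.
- exact: measurable_fubini_G If.
have := ae_integrable2 If; apply: filterS => x Ix _.
by rewrite fineK//; exact: integrable_fin_num.
Qed.

Lemma cint_fubini (f : T1 * T2 -> R[i]) : cL1 (m1 \x m2)%E f ->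
  cint m1 (fun x => cint m2 (fun y => f (x, y))) = cint (m1 \x m2)%E f.
Proof.
move=> If; apply: complex_eq => /=.
  exact: (Rintegral_fubini (cL1_Re If)).
exact: (Rintegral_fubini (cL1_Im If)).
Qed.

Lemma cint_fubini_sym (f : T1 * T2 -> R[i]) : cL1 (m1 \x m2)%E f ->
  cint m2 (fun y => cint m1 (fun x => f (x, y))) = cint (m1 \x m2)%E f.
Proof.
move=> If; apply: complex_eq => /=.
  exact: (Rintegral_fubini_sym (cL1_Re If)).
exact: (Rintegral_fubini_sym (cL1_Im If)).
Qed.

Lemma cint_swap (f : T1 * T2 -> R[i]) : cmeas f ->
  (\int[m1]_x \int[m2]_y (normc (f (x, y)))%:E < +oo)%E ->
  cint m1 (fun x => cint m2 (fun y => f (x, y))) =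
  cint m2 (fun y => cint m1 (fun x => f (x, y))).
Proof.
move=> mf foo.
have If : cL1 (m1 \x m2)%E f.
  split=> //; rewrite fubini_tonelli1//.
    exact/measurable_EFinP/measurable_normc.
  by move=> x; rewrite lee_fin normc_ge0.
by rewrite cint_fubini// cint_fubini_sym.
Qed.

End complex_fubini.

Section complex_integral_rV.
Context {R : realType}.
Local Notation mu n := (@lebesgue_rV R n).

(** Positive and negative parts are translated separately, so the identity holds without
    integrability. *)
Lemma integral_rV_shift_signed n (a : 'rV[R]_n) (f : 'rV[R]_n -> \bar R) :
  measurable_fun setT f -> (\int[mu n]_x f (x + a)%R = \int[mu n]_x f x)%E.
Proof.
move=> mf; rewrite integralE [RHS]integralE; congr (_ - _)%E.
  rewrite -[X in X^\+%E]/(f \o (fun x => x + a)) funepos_comp.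
  by rewrite -[RHS](integral_rV_shift a (measurable_funepos mf)).
rewrite -[X in X^\-%E]/(f \o (fun x => x + a)) funeneg_comp.
by rewrite -[RHS](integral_rV_shift a (measurable_funeneg mf)).
Qed.

Lemma integral_row_mx_prod n m (f : 'rV[R]_(n + m) -> \bar R) :
  measurable_fun setT f ->
  (\int[mu (n + m)]_x f x = \int[mu n \x mu m]_p f (row_mx p.1 p.2))%E.
Proof.
move=> mf; rewrite integralE [RHS]integralE.
have pos (g : 'rV[R]_(n + m) -> \bar R) : measurable_fun setT g ->
    (forall x, 0 <= g x)%E ->
    (\int[mu (n + m)]_x g x = \int[mu n \x mu m]_p g (row_mx p.1 p.2))%E.
  move=> mg g0; rewrite integral_row_mx// fubini_tonelli1//.
  by apply: (measurableT_comp mg); exact: measurable_row_mx.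
congr (_ - _)%E.
  rewrite (pos _ (measurable_funepos mf))//.
  by apply: eq_integral => p _; rewrite !funeposE.
rewrite (pos _ (measurable_funeneg mf))//.
by apply: eq_integral => p _; rewrite !funenegE.
Qed.

Lemma cint_rV_shift n (a : 'rV[R]_n) (f : 'rV[R]_n -> R[i]) : cmeas f ->
  cint (mu n) (fun x => f (x + a)) = cint (mu n) f.
Proof.
move=> [mf mf']; apply: complex_eq; rewrite /= /Rintegral; congr fine.
  by rewrite (integral_rV_shift_signed a (f := fun x => (Re (f x))%:E))//; exact/measurable_EFinP.
by rewrite (integral_rV_shift_signed a (f := fun x => (Im (f x))%:E))//; exact/measurable_EFinP.
Qed.

Lemma cint_row_mx n m (f : 'rV[R]_(n + m) -> R[i]) : cmeas f ->
  cint (mu (n + m)) f = cint (mu n \x mu m)%E (fun p => f (row_mx p.1 p.2)).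
Proof.
move=> [mf mf']; apply: complex_eq; rewrite /= /Rintegral; congr fine.
  by rewrite (integral_row_mx_prod (f := fun x => (Re (f x))%:E))//; exact/measurable_EFinP.
by rewrite (integral_row_mx_prod (f := fun x => (Im (f x))%:E))//; exact/measurable_EFinP.
Qed.

End complex_integral_rV.

(** * Trilinear estimates for weak L^4 *)
Section nonneg_integral.
Context {R : realType} d (T : measurableType d) (mu : {measure set T -> \bar R}).
Local Open Scope ereal_scope.

(* Unlike [ge0_le_integral], no measurability is required. *)
Lemma ge0_le_integral_nomeas (D : set T) (f g : T -> \bar R) :
  (forall x, D x -> 0 <= f x) -> (forall x, D x -> f x <= g x) ->
  \int[mu]_(x in D) f x <= \int[mu]_(x in D) g x.
Proof.
move=> f0 fg; rewrite !ge0_integralE//; last first.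
  by move=> x Dx; exact: le_trans (f0 _ Dx) (fg _ Dx).
apply: le_ereal_sup => _ [h /= hf <-]; exists h => // x.
apply: le_trans (hf x) _; rewrite /patch; case: ifPn => // /set_mem; exact: fg.
Qed.

Lemma ge0_integral_le_setT (D : set T) (f : T -> \bar R) :
  (forall x, 0 <= f x) -> \int[mu]_(x in D) f x <= \int[mu]_x f x.
Proof.
move=> f0; rewrite integral_mkcond; apply: ge0_le_integral_nomeas => x _.
  by rewrite patchE; case: ifP.
by rewrite patchE; case: ifP.
Qed.

End nonneg_integral.

Section powR_integrals.
Context {R : realType}.
Local Notation lam := (@lebesgue_measure R).
Implicit Types c r x : R.

Lemma measurable_powR_fun r : measurable_fun setT (fun x : R => x `^ r).
Proof. exact: measurable_powR. Qed.

Lemma powRD_gt0 x r q : 0 < x -> x `^ r * x `^ q = x `^ (r + q).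
Proof. by move=> x0; rewrite powRD// (gt_eqF x0) implybT. Qed.

(* AM-GM, weighted so that the level-set bounds [t^2 mu{A > t}] and [u^2 mu{B > u}] can be
   integrated against the right-hand side. *)
Lemma young34 (t u a b : R) : 0 < t -> 0 < u -> 0 <= a -> 0 <= b ->
  a `^ (3 / 4) * b `^ (1 / 4) <=
  (t ^+ 2 * a + u ^+ 2 * b) * (t `^ (- (3 / 2)) * u `^ (- (1 / 2))).
Proof.
move=> t0 u0 a0 b0.
set x := t ^+ 2 * a; set y := u ^+ 2 * b.
have x0 : 0 <= x by rewrite mulr_ge0// exprn_ge0// ltW.
have y0 : 0 <= y by rewrite mulr_ge0// exprn_ge0// ltW.
have sq (z : R) : 0 < z -> z ^+ 2 = z `^ 2 by move=> z0; rewrite powR_mulrn// ltW.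
have -> : a `^ (3 / 4) * b `^ (1 / 4) =
    x `^ (3 / 4) * y `^ (1 / 4) * (t `^ (- (3 / 2)) * u `^ (- (1 / 2))).
  rewrite /x /y !sq// !powRM ?powR_ge0// -!powRrM.
  transitivity ((t `^ (2 * (3 / 4)) * t `^ (- (3 / 2))) *
    (u `^ (2 * (1 / 4)) * u `^ (- (1 / 2))) * (a `^ (3 / 4) * b `^ (1 / 4))); last by ring.
  rewrite !powRD_gt0// (_ : 2 * (3 / 4) + - (3 / 2) = 0); last by field.
  by rewrite (_ : 2 * (1 / 4) + - (1 / 2) = 0) ?powRr0 ?mul1r//; field.
rewrite ler_wpM2r ?mulr_ge0 ?powR_ge0//.
(* What remains is [x^(3/4) y^(1/4) <= x + y]: the smaller of the two is replaced by the larger. *)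
wlog xy : x y x0 y0 / x <= y.
  move=> h; case: (leP x y) => [|/ltW yx]; first exact: h.
  apply: (@le_trans _ _ (x `^ (3 / 4) * x `^ (1 / 4))).
    by rewrite ler_wpM2l ?powR_ge0// ge0_ler_powR ?nnegrE//; lra.
  have [->|xn0] := eqVneq x 0; first by rewrite powR0 ?mul0r ?add0r//; lra.
  rewrite powRD_gt0; last by rewrite lt_neqAle eq_sym xn0.
  by rewrite (_ : 3 / 4 + 1 / 4 = 1) ?powRr1 ?lerDl//; field.
apply: (@le_trans _ _ (y `^ (3 / 4) * y `^ (1 / 4))).
  by rewrite ler_wpM2r ?powR_ge0// ge0_ler_powR ?nnegrE//; lra.
have [->|yn0] := eqVneq y 0; first by rewrite powR0 ?mul0r ?addr0//; lra.
rewrite powRD_gt0; last by rewrite lt_neqAle eq_sym yn0.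
by rewrite (_ : 3 / 4 + 1 / 4 = 1) ?powRr1 ?lerDr//; field.
Qed.

Lemma cvg_powRN_pinfty r : 0 < r -> (x `^ (- r)) @[x --> +oo] --> (0 : R).
Proof.
move=> r0; apply/cvgrPdist_le => e e0; near=> x.
rewrite sub0r normrN ger0_norm ?powR_ge0//.
have x0 : 0 < x by near: x; exact: nbhs_pinfty_gt.
rewrite powRN -[leRHS]invrK lef_pV2 ?posrE ?powR_gt0 ?invr_gt0//.
have -> : e^-1 = (e^-1 `^ r^-1) `^ r.
  by rewrite -powRrM mulVf ?gt_eqF// powRr1// invr_ge0 ltW.
apply: ge0_ler_powR; rewrite ?nnegrE ?powR_ge0 ?(ltW x0) ?(ltW r0)//.
Unshelve. all: by end_near. Qed.

Lemma continuous_powR_pos r x : 0 < x -> {for x, continuous (fun y : R => y `^ r)}.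
Proof.
move=> x0; apply: differentiable_continuous; apply/derivable1_diffP.
by apply: derivable_powR; rewrite in_itv/= x0.
Qed.

Lemma integral_powR_infty c r : 0 < c -> 0 < r ->
  (\int[lam]_(x in `[c, +oo[) (x `^ (- (1 + r)))%:E = (c `^ (- r) / r)%:E)%E.
Proof.
move=> c0 r0.
rewrite (@ge0_continuous_FTC2y _ _ (fun x => - (x `^ (- r)) / r) _ 0).
- by rewrite -EFinB sub0r mulNr opprK.
- by move=> x _; exact: powR_ge0.
- apply: continuous_in_subspaceT => x; rewrite inE/= in_itv/= andbT => cx.
  by apply: continuous_powR_pos; exact: lt_le_trans cx.
- rewrite -(mul0r r^-1) -oppr0; apply: cvgMl; apply: cvgN.
  exact: cvg_powRN_pinfty.
- move=> x cx; have x0 := lt_trans c0 cx.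
  apply: derivableM => //; apply: derivableN.
  by apply: derivable_powR; rewrite in_itv/= x0.
- apply: cvg_at_right_filter; apply: cvgMl; apply: cvgN.
  exact: continuous_powR_pos.
- move=> x; rewrite in_itv/= andbT => cx; have x0 := lt_trans c0 cx.
  rewrite derive1E deriveM//; last first.
    by apply: derivableN; apply: derivable_powR; rewrite in_itv/= x0.
  rewrite derive_cst scaler0 add0r deriveN; last first.
    by apply: derivable_powR; rewrite in_itv/= x0.
  rewrite -derive1E powR_derive1 ?in_itv/= ?x0//.
  rewrite -opprD mulNr opprK -[LHS]/(r^-1 * (r * _)) mulrA mulVf ?gt_eqF//.
  by rewrite mul1r addrC.
Qed.

Lemma integral_powR_itv a c r : 0 < a -> a < c -> 0 < r ->
  (\int[lam]_(x in `[a, c]) (x `^ (r - 1))%:E <= (c `^ r / r)%:E)%E.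
Proof.
move=> a0 ac r0.
rewrite (@continuous_FTC2 _ _ (fun x => (x `^ r) / r))//.
- by rewrite -EFinB lee_fin gerBl divr_ge0 ?powR_ge0// ltW.
- apply: continuous_in_subspaceT => x; rewrite inE/= in_itv/= => /andP[ax _].
  by apply: continuous_powR_pos; exact: lt_le_trans ax.
- split.
  + move=> x; rewrite in_itv/= => /andP[ax _]; have x0 := lt_trans a0 ax.
    by apply: derivableM => //; apply: derivable_powR; rewrite in_itv/= x0.
  + apply: cvg_at_right_filter; apply: cvgMl; exact: continuous_powR_pos.
  + apply: cvg_at_left_filter; apply: cvgMl; apply: continuous_powR_pos.
    exact: lt_trans ac.
- move=> x; rewrite in_itv/= => /andP[ax _]; have x0 := lt_trans a0 ax.
  rewrite derive1E deriveM//; last by apply: derivable_powR; rewrite in_itv/= x0.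
  rewrite derive_cst scaler0 add0r -derive1E powR_derive1 ?in_itv/= ?x0//.
  by rewrite -[LHS]/(r^-1 * (r * _)) mulrA mulVf ?gt_eqF// mul1r.
Qed.

(** Exhaustion of []0, c]] by [[c/(n+2), c]]. The shift by two keeps the left end strictly below
    [c], as [integral_powR_itv] requires, and the bound there does not see the left end. *)
Lemma integral_powR_0 c r : 0 < c -> 0 < r ->
  (\int[lam]_(x in `]0%R, c]) (x `^ (r - 1))%:E <= (c `^ r / r)%:E)%E.
Proof.
move=> c0 r0; pose F (n : nat) : set R := `[c / n.+2%:R, c]%classic.
have FE : `]0%R, c]%classic = \bigcup_n F n.
  apply/seteqP; split => [x|x [n _]]; rewrite /F /= !in_itv/= => /andP[h1 h2].
    exists (Num.trunc (c / x)) => //=; rewrite in_itv/= h2 andbT.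
    rewrite ler_pdivrMr// mulrC -ler_pdivrMr// (@le_trans _ _ (Num.trunc (c / x)).+1%:R)//.
      by apply: ltW; rewrite -truncn_lt_nat// divr_ge0// ltW.
    by rewrite ler_nat.
  by rewrite h2 andbT (lt_le_trans _ h1)// divr_gt0.
have ndF : nondecreasing_seq F.
  move=> m n mn; apply/subsetPset => x; rewrite /F /= !in_itv/= => /andP[h1 ->].
  by rewrite andbT (le_trans _ h1)// ler_pM2l// lef_pV2 ?posrE// ler_nat !ltnS.
rewrite FE; apply: (@cvge_le _ \oo); last first.
  apply: ge0_nondecreasing_set_cvg_integral => //.
  - by move=> n; exact: measurable_itv.
  - by move=> n; apply/measurable_EFinP; apply: measurable_funTS; exact: measurable_powR.
  - by move=> n x _; rewrite lee_fin powR_ge0.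
apply: nearW => n; apply: integral_powR_itv => //.
  by rewrite divr_gt0.
by rewrite ltr_pdivrMr// ltr_pMr// ltr1n.
Qed.

End powR_integrals.

Section layer_cake.
Context {R : realType} d (T : measurableType d).
Variable mu : {sigma_finite_measure set T -> \bar R}.
Local Notation lam := (@lebesgue_measure R).
Local Open Scope ereal_scope.

(** [G x] is the length of []0, G x[], and Tonelli exchanges the integrals. The weight [F] allows
    one factor of a product to be sliced while the others stay in place. *)
Lemma layer_cake (F : T -> \bar R) (G : T -> R) :
  measurable_fun setT F -> (forall x, 0 <= F x) ->
  measurable_fun setT G -> (forall x, 0 <= G x)%R ->
  \int[mu]_x (F x * (G x)%:E) =
  \int[lam]_(t in `]0%R, +oo[) \int[mu]_(x in [set x | (t < G x)%R]) F x.
Proof.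
move=> mF F0 mG G0.
pose lev (t a : R) : R := (((0 < t) && (t < a))%:R)%R.
have levE a : (0 <= a)%R -> \int[lam]_t (lev t a)%:E = a%:E.
  move=> a0; transitivity (\int[lam]_t (\1_(`]0%R, a[%classic) t)%:E).
    by apply: eq_integral => t _; rewrite indicE /lev mem_setE in_itv/=.
  rewrite integral_indic// setIT [LHS]lebesgue_measure_itv/= lte_fin.
  case: ifPn => [_|]; first by rewrite oppr0 adde0.
  by rewrite -leNgt => a0'; congr EFin; apply/eqP; rewrite eq_le a0 a0'.
have mlev : measurable_fun setT (fun p : T * R => lev p.2 (G p.1)).
  apply: (measurableT_comp (f := fun b : bool => (b%:R)%R : R)) => //.
  apply: measurable_and.
    exact: measurable_fun_ltr.
  apply: measurable_fun_ltr => //; exact: measurableT_comp.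
transitivity (\int[mu]_x \int[lam]_t (F x * (lev t (G x))%:E)).
  apply: eq_integral => x _; rewrite ge0_integralZl//.
  - by rewrite levE.
  - by apply/measurable_EFinP; exact: (measurableT_comp mlev (measurable_pair1 _)).
  - by move=> t _; rewrite lee_fin ler0n.
transitivity (\int[lam]_t \int[mu]_x (F x * (lev t (G x))%:E)).
  apply: (fubini_tonelli (m1 := mu) (m2 := lam) (fun p => F p.1 * (lev p.2 (G p.1))%:E)).
  - apply: emeasurable_funM; first exact: measurableT_comp.
    exact/measurable_EFinP.
  - by move=> x; rewrite mule_ge0// lee_fin ler0n.
rewrite [RHS]integral_mkcond; apply: eq_integral => t _.
rewrite patchE mem_setE in_itv/= andbT; case: ifPn => t0; last first.
  by apply: integral0_eq => x _; rewrite /lev (negbTE t0) mule0.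
rewrite [RHS]integral_mkcond; apply: eq_integral => x _.
rewrite patchE (_ : (x \in _) = (t < G x)%R); last by apply/idP/idP; rewrite inE.
by rewrite /lev t0 andTb; case: (t < G x)%R; rewrite ?mule1 ?mule0.
Qed.

End layer_cake.

Section level_sets.
Context {R : realType} d (T : measurableType d).
Variable mu : {sigma_finite_measure set T -> \bar R}.
Local Notation lam := (@lebesgue_measure R).
Local Open Scope ereal_scope.

Lemma measurable_level (G : T -> R) (t : R) : measurable_fun setT G ->
  measurable [set x | (t < G x)%R].
Proof.
move=> mG; rewrite -[X in measurable X]setTI.
have -> : [set x | (t < G x)%R] = (fun x => (t < G x)%R) @^-1` [set true] by [].
by apply: measurable_fun_ltr.
Qed.

Lemma measurable_fun_level (G : T -> R) : measurable_fun setT G ->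
  measurable_fun setT (fun t : R => mu [set x | (t < G x)%R]).
Proof.
move=> mG; rewrite (_ : (fun _ => _) =
    (fun t : R => \int[mu]_x (\1_[set x | (t < G x)%R] x)%:E)); last first.
  by apply/funext => t; rewrite integral_indic ?setIT//; exact: measurable_level.
apply: (measurable_fun_fubini_tonelli_G (m1 := mu)
  (fun p : T * R => (\1_[set x | (p.2 < G x)%R] p.1)%:E)) => //=.
apply/measurable_EFinP.
rewrite (_ : (fun _ => _) = (fun p : T * R => (((p.2 < G p.1)%R : bool)%:R)%R)).
  apply: (measurableT_comp (f := fun b : bool => (b%:R)%R : R)) => //.
  by apply: measurable_fun_ltr => //; exact: measurableT_comp.
by apply/funext => p; rewrite indicE mem_setE.
Qed.

Lemma level_set_chebyshev (G : T -> R) (t : R) : measurable_fun setT G ->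
  (forall x, 0 <= G x)%R -> (\int[mu]_x (G x ^+ 2)%:E <= 1) -> (0 < t)%R ->
  mu [set x | (t < G x)%R] <= (t ^- 2)%:E.
Proof.
move=> mG G0 G1 t0; have t2 : (0 < t ^+ 2)%R by rewrite exprn_gt0.
rewrite -[leRHS]mul1e -lee_pdivrMr// ?invr_gt0// invrK muleC.
apply: le_trans G1.
have mL := measurable_level t mG.
rewrite -integral_cst//.
apply: (@le_trans _ _ (\int[mu]_(x in [set x | (t < G x)%R]) (G x ^+ 2)%:E)).
  apply: ge0_le_integral_nomeas => x /= tG; first by rewrite lee_fin ltW.
  by rewrite lee_fin ler_sqr ?nnegrE ?ltW// (lt_trans t0).
by apply: ge0_integral_le_setT => x; rewrite lee_fin sqr_ge0.
Qed.

(** Layer cake for [G] with weight [G] itself: on the set where [G > t] the weight is at least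
    [t]. *)
Lemma integral_level_le (G : T -> R) : measurable_fun setT G ->
  (forall x, 0 <= G x)%R ->
  \int[lam]_(t in `]0%R, +oo[) (t%:E * mu [set x | (t < G x)%R]) <=
  \int[mu]_x (G x ^+ 2)%:E.
Proof.
move=> mG G0; under [leRHS]eq_integral do rewrite expr2 EFinM.
rewrite (layer_cake mu (F := EFin \o G))//; last exact/measurable_EFinP.
apply: ge0_le_integral_nomeas => t /=; rewrite in_itv/= andbT => t0.
  by rewrite mule_ge0// lee_fin ltW.
rewrite -integral_cst//; last exact: measurable_level.
apply: ge0_le_integral_nomeas => x /= tG; first by rewrite lee_fin ltW.
by rewrite lee_fin ltW.
Qed.

Lemma integral_cst_0c (r c : R) : (0 < c)%R ->
  \int[lam]_(x in `]0%R, c]) (cst r%:E) x = (r * c)%:E.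
Proof.
move=> c0; rewrite integral_cst// EFinM; congr (_ * _).
by rewrite [LHS]lebesgue_measure_itv/= lte_fin c0 oppr0 adde0.
Qed.

(** Measurability is asked only of the two majorants. The intervals share the point [c], which can
    only enlarge the bound. *)
Lemma le_integral_split (c : R) (f g1 g2 : R -> \bar R) : (0 < c)%R ->
  (forall x, (0 < x)%R -> 0 <= f x) ->
  measurable_fun setT g1 -> measurable_fun setT g2 ->
  (forall x, 0 <= g1 x) -> (forall x, 0 <= g2 x) ->
  (forall x, (0 < x <= c)%R -> f x <= g1 x) ->
  (forall x, (c <= x)%R -> f x <= g2 x) ->
  \int[lam]_(x in `]0%R, +oo[) f x <=
  \int[lam]_(x in `]0%R, c]) g1 x + \int[lam]_(x in `[c, +oo[) g2 x.
Proof.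
move=> c0 f0 m1 m2 g10 g20 fg1 fg2.
rewrite [leLHS]integral_mkcond [X in X + _]integral_mkcond [X in _ + X]integral_mkcond.
rewrite -ge0_integralD//; last 4 first.
- by move=> x _; rewrite patchE; case: ifP.
- by apply/(measurable_restrictT _ _).1 => //; exact: measurable_funTS.
- by move=> x _; rewrite patchE; case: ifP.
- by apply/(measurable_restrictT _ _).1 => //; exact: measurable_funTS.
apply: ge0_le_integral_nomeas => x _.
  rewrite patchE; case: ifPn => //; rewrite mem_setE in_itv/= andbT; exact: f0.
rewrite !patchE !mem_setE !in_itv/= !andbT; case: ifPn => x0; last first.
  by rewrite adde_ge0//; case: ifP.
case: (leP x c) => [xc|cx] /=.
  by apply: le_trans (fg1 _ _) _; rewrite ?x0// leeDl//; case: ifP.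
by rewrite (ltW cx) add0e fg2// ltW.
Qed.

End level_sets.

Section trilinear.
Context {R : realType} dP dV (P : measurableType dP) (V : measurableType dV).
Variables (pi : {sigma_finite_measure set P -> \bar R}).
Variables (mu : {sigma_finite_measure set V -> \bar R}).
Local Notation lam := (@lebesgue_measure R).
Local Open Scope ereal_scope.

Definition weakL4 (H : P -> R) (k : R) :=
  forall l : R, (0 < l)%R -> pi [set p | (l < H p)%R] <= (k ^+ 4 / l ^+ 4)%:E.

(** At height [t] the part of [S] where [H > t] has measure at most the smaller of [s] and
    [k^4 / t^4]; the two ranges of heights contribute in the proportion 1 to 1/3, whence [4 / 3]. *)
Lemma integral_set_weakL4 (H : P -> R) (k : R) (S : set P) (s : R) :
  measurable_fun setT H -> (forall p, 0 <= H p)%R -> (0 < k)%R -> weakL4 H k ->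
  measurable S -> (0 <= s)%R -> pi S <= s%:E ->
  \int[pi]_(p in S) (H p)%:E <= (4 / 3 * k * s `^ (3 / 4))%:E.
Proof.
move=> mH H0 k0 wH mS; rewrite le_eqVlt => /predU1P[<-|s0] piS.
  rewrite null_set_integral//.
  - by rewrite lee_fin powR0 ?mulr0// gt_eqF//; lra.
  - by apply/measurable_funTS/measurable_EFinP.
  - by apply/eqP; rewrite -measure_le0.
rewrite integral_mkcond (eq_integral (fun p => (\1_S p)%:E * (H p)%:E)); last first.
  by move=> p _; rewrite patchE indicE; case: ifPn; rewrite ?mul1e ?mul0e.
rewrite (layer_cake pi (F := EFin \o \1_S))//; last 2 first.
- by apply/measurable_EFinP; exact: measurable_indic.
- by move=> x; rewrite lee_fin.
have piE t : \int[pi]_(x in [set x | (t < H x)%R]) (\1_S x)%:E =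
    pi (S `&` [set x | (t < H x)%R]).
  by rewrite integral_indic//; exact: measurable_level.
under eq_integral do rewrite piE.
(* The height at which the bounds [s] and [k^4 / t^4] coincide. *)
pose c := (k * s `^ (- (1 / 4)))%R.
have c0 : (0 < c)%R by rewrite mulr_gt0// powR_gt0.
apply: (le_trans (@le_integral_split _ c _ (cst s%:E)
    (fun t => (k ^+ 4)%:E * (t `^ (- (1 + 3)))%:E) c0 _ _ _ _ _ _ _)) => //.
- apply: emeasurable_funM => //; apply/measurable_EFinP; exact: measurable_powR.
- by move=> t; rewrite lee_fin ltW.
- by move=> t; rewrite mule_ge0// lee_fin ?powR_ge0// exprn_ge0// ltW.
- move=> t _; apply: le_trans piS; apply: le_measure; rewrite ?inE//.
  by apply: measurableI => //; exact: measurable_level.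
- move=> t ct; have t0 : (0 < t)%R := lt_le_trans c0 ct.
  apply: (@le_trans _ _ (pi [set x | (t < H x)%R])).
    apply: le_measure; rewrite ?inE//; last exact: measurable_level.
    by apply: measurableI => //; exact: measurable_level.
  apply: le_trans (wH _ t0) _; rewrite -EFinM lee_fin.
  rewrite (_ : - (1 + 3) = - 4%:R)%R; last by ring.
  by rewrite powR_invn// ltW.
rewrite integral_cst_0c//.
rewrite ge0_integralZl//; last 3 first.
- by apply/measurable_EFinP; apply: measurable_funTS; exact: measurable_powR.
- by move=> t _; rewrite lee_fin powR_ge0.
- by rewrite lee_fin exprn_ge0// ltW.
rewrite integral_powR_infty// -!EFinM -EFinD lee_fin le_eqVlt; apply/orP; left.
have k3 : (k `^ (- 3) = k ^- 3)%R by rewrite powR_invn// ltW.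
rewrite /c powRM ?powR_ge0 ?(ltW k0)// k3 -powRrM.
rewrite (_ : - (1 / 4) * - 3 = 3 / 4)%R; last by field.
have -> : (s * (k * s `^ (- (1 / 4))) = k * s `^ (3 / 4))%R.
  rewrite mulrCA; congr (_ * _)%R.
  rewrite -[X in (X * _)%R]powRr1 ?(ltW s0)// powRD_gt0//.
  by congr (_ `^ _)%R; field.
by apply/eqP; field; rewrite gt_eqF.
Qed.

(** For low heights [v] of [C] the domain is bounded by the product of [A'] and [B'], for high ones
    by the product of [A'] and the level set of [C]. The two ranges contribute in the proportion 1
    to 2, so that the constant is [4 / 3] times 3. *)
Lemma bilinear_set_weakL4 (X Y Z : P -> V) (H : P -> R) (C : V -> R) (k : R)
    (A' B' : set V) (a b : R) :
  (forall A B, measurable A -> measurable B ->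
    pi (X @^-1` A `&` Y @^-1` B) <= mu A * mu B) ->
  (forall A B, measurable A -> measurable B ->
    pi (X @^-1` A `&` Z @^-1` B) <= mu A * mu B) ->
  measurable_fun setT X -> measurable_fun setT Y -> measurable_fun setT Z ->
  measurable_fun setT H -> (forall p, 0 <= H p)%R -> (0 < k)%R -> weakL4 H k ->
  measurable_fun setT C -> (forall v, 0 <= C v)%R ->
  (forall v, (0 < v)%R -> mu [set x | (v < C x)%R] <= (v ^- 2)%:E) ->
  measurable A' -> measurable B' -> (0 <= a)%R -> (0 <= b)%R ->
  mu A' = a%:E -> mu B' = b%:E ->
  \int[pi]_(p in X @^-1` A' `&` Y @^-1` B') (H p * C (Z p))%:E <=
  (4 * k * (a `^ (3 / 4) * b `^ (1 / 4)))%:E.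
Proof.
move=> XY XZ mX mY mZ mH H0 k0 wH mC C0 wC mA mB a0 b0 Aa Bb.
have mXA : measurable (X @^-1` A') by rewrite -[X in measurable X]setTI; exact: mX.
have mYB : measurable (Y @^-1` B') by rewrite -[X in measurable X]setTI; exact: mY.
set S := _ `&` _; have mS : measurable S by exact: measurableI.
have piS : pi S <= (a * b)%:E by rewrite EFinM -Aa -Bb; exact: XY.
move: b0; rewrite le_eqVlt => /predU1P[b0|b0].
  rewrite null_set_integral//.
  - by rewrite -b0 [(0 `^ _)%R]powR0 ?mulr0//; lra.
  - apply/measurable_funTS/measurable_EFinP/measurable_funM => //.
    exact: measurableT_comp mC mZ.
  - by apply/eqP; rewrite -measure_le0; move: piS; rewrite -b0 mulr0.
rewrite integral_mkcond (eq_integral (fun p => (H p * \1_S p)%:E * (C (Z p))%:E)); last first.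
  by move=> p _; rewrite patchE indicE; case: ifPn; rewrite ?mulr1 ?mulr0 ?mul0e.
rewrite (layer_cake pi (F := fun p => (H p * \1_S p)%:E) (G := C \o Z))//; last 4 first.
- by apply/measurable_EFinP/measurable_funM => //; exact: measurable_indic.
- by move=> x; rewrite lee_fin mulr_ge0.
- exact: measurableT_comp mC mZ.
- by move=> x; exact: C0.
pose Sv v := S `&` [set p | (v < C (Z p))%R].
have mSv v : measurable (Sv v).
  apply: measurableI => //; apply: measurable_level; exact: measurableT_comp mC mZ.
have intE v : \int[pi]_(p in [set p | (v < (C \o Z) p)%R]) (H p * \1_S p)%:E =
    \int[pi]_(p in Sv v) (H p)%:E.
  rewrite [LHS]integral_mkcond [RHS]integral_mkcond; apply: eq_integral => p _.
  rewrite !patchE indicE [p \in Sv v]in_setI; case: (p \in S); rewrite /= ?mulr1 ?mulr0//.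
  by case: ifP.
under eq_integral do rewrite intE.
have c34 : (0 <= 3 / 4 :> R)%R by lra.
have ab0 : (0 <= a * b)%R by rewrite mulr_ge0// ltW.
(* The height at which the weak L^2 bound [v^-2] on the level set of [C] equals the measure [b] of
   [B']. *)
pose v0 := (b `^ (- (1 / 2)))%R.
have v00 : (0 < v0)%R by exact: powR_gt0.
apply: (le_trans (@le_integral_split _ v0 _
    (cst (4 / 3 * k * (a * b) `^ (3 / 4))%:E)
    (fun v => (4 / 3 * k * a `^ (3 / 4))%:E * (v `^ (- (1 + 1 / 2)))%:E) v00 _ _ _ _ _ _ _)) => //.
- by move=> v _; apply: integral_ge0 => p _; rewrite lee_fin.
- apply: emeasurable_funM => //; apply/measurable_EFinP; exact: measurable_powR.
- by move=> v; rewrite lee_fin !mulr_ge0 ?powR_ge0// ltW.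
- by move=> v; rewrite mule_ge0 ?lee_fin ?mulr_ge0 ?powR_ge0// ltW.
- move=> v _; apply: integral_set_weakL4 => //; apply: le_trans piS.
  by apply: le_measure; rewrite ?inE//; apply: subIsetl.
- move=> v vv; have v1 : (0 < v)%R := lt_le_trans v00 vv.
  apply: (@le_trans _ _ (4 / 3 * k * (a * v ^- 2) `^ (3 / 4))%:E).
    apply: integral_set_weakL4 => //.
      by rewrite mulr_ge0// invr_ge0 exprn_ge0// ltW.
    apply: (@le_trans _ _ (mu A' * mu [set x | (v < C x)%R])).
      apply: le_trans (XZ _ _ mA _); last exact: measurable_level.
      apply: le_measure; rewrite ?inE//; last by move=> p [[? ?] ?]; split.
      apply: measurableI => //; rewrite -[X in measurable X]setTI; apply: mZ => //.
      exact: measurable_level.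
    by rewrite Aa EFinM lee_wpmul2l ?lee_fin//; exact: wC.
  rewrite -EFinM lee_fin powRM ?invr_ge0 ?exprn_ge0 ?(ltW v1)//.
  rewrite mulrA le_eqVlt; apply/orP; left; apply/eqP; congr (_ * _)%R.
  have -> : (v ^- 2 = v `^ (- 2))%R by rewrite powR_invn// ltW.
  by rewrite -powRrM; congr (_ `^ _)%R; field.
rewrite integral_cst_0c//.
rewrite ge0_integralZl//; last 3 first.
- by apply/measurable_EFinP; apply: measurable_funTS; exact: measurable_powR.
- by move=> t _; rewrite lee_fin powR_ge0.
- by rewrite lee_fin !mulr_ge0 ?powR_ge0// ltW.
rewrite integral_powR_infty//.
rewrite -!EFinM -EFinD lee_fin le_eqVlt; apply/orP; left; apply/eqP.
rewrite powRM ?(ltW b0)// /v0 -powRrM.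
rewrite (_ : - (1 / 2) * - (1 / 2) = 1 / 4)%R; last by field.
have bb : (b `^ (3 / 4) * b `^ (- (1 / 2)) = b `^ (1 / 4))%R.
  rewrite powRD_gt0//.
  by congr (_ `^ _)%R; field.
rewrite -[(4 / 3 * k * _ * _)%R]mulrA -[(a `^ _ * _ * _)%R]mulrA bb.
by field.
Qed.

(* Layer cake in [A] and [B]; [C] enters only through its weak L^2 bound.  Of the two level sets,
   the one at the larger height gets the exponent 3/4. *)
Theorem trilinear_weakL4_normalized (X Y Z : P -> V) (H : P -> R) (A B C : V -> R) (k : R) :
  (forall A B, measurable A -> measurable B ->
    pi (X @^-1` A `&` Y @^-1` B) <= mu A * mu B) ->
  (forall A B, measurable A -> measurable B ->
    pi (X @^-1` A `&` Z @^-1` B) <= mu A * mu B) ->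
  (forall A B, measurable A -> measurable B ->
    pi (Y @^-1` A `&` Z @^-1` B) <= mu A * mu B) ->
  measurable_fun setT X -> measurable_fun setT Y -> measurable_fun setT Z ->
  measurable_fun setT H -> (forall p, 0 <= H p)%R -> (0 < k)%R -> weakL4 H k ->
  measurable_fun setT A -> measurable_fun setT B -> measurable_fun setT C ->
  (forall v, 0 <= A v)%R -> (forall v, 0 <= B v)%R -> (forall v, 0 <= C v)%R ->
  \int[mu]_v (A v ^+ 2)%:E <= 1 -> \int[mu]_v (B v ^+ 2)%:E <= 1 ->
  \int[mu]_v (C v ^+ 2)%:E <= 1 ->
  \int[pi]_p (H p * A (X p) * B (Y p) * C (Z p))%:E <= (32 * k)%:E.
Proof.
move=> XY XZ YZ mX mY mZ mH H0 k0 wH mA mB mC A0 B0 C0 A1 B1 C1.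
pose lA t := mu [set v | (t < A v)%R]; pose lB t := mu [set v | (t < B v)%R].
pose a t : R := fine (lA t); pose b t : R := fine (lB t).
have levE (G : V -> R) t : measurable_fun setT G -> (forall v, 0 <= G v)%R ->
    \int[mu]_v (G v ^+ 2)%:E <= 1 -> (0 < t)%R ->
    mu [set v | (t < G v)%R] = (fine (mu [set v | (t < G v)%R]))%:E.
  move=> mG G0 G1 t0; rewrite fineK// ge0_fin_numE//.
  by apply: le_lt_trans (level_set_chebyshev mG G0 G1 t0) _; rewrite ltry.
have aE t : (0 < t)%R -> lA t = (a t)%:E by exact: levE.
have bE t : (0 < t)%R -> lB t = (b t)%:E by exact: levE.
have a0 t : (0 <= a t)%R by exact: fine_ge0.
have b0 t : (0 <= b t)%R by exact: fine_ge0.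
have ma : measurable_fun setT a.
  by apply: measurableT_comp => //; exact: measurable_fun_level.
have mb : measurable_fun setT b.
  by apply: measurableT_comp => //; exact: measurable_fun_level.
(* The weight of [young34], made symmetric in the two heights. Giving the exponent [-3/2] to the
   larger height is what makes it integrable in one variable both near 0 and at infinity. *)
pose W (t u : R) : R := if (u <= t)%R then (t `^ (- (3 / 2)) * u `^ (- (1 / 2)))%R
  else (u `^ (- (3 / 2)) * t `^ (- (1 / 2)))%R.
have W0 t u : (0 <= W t u)%R by rewrite /W; case: ifP => _; rewrite mulr_ge0 ?powR_ge0.
have Wsym t u : W t u = W u t.
  rewrite /W; case: (ltgtP u t) => // ->; by [].
have mW : measurable_fun setT (fun q : R * R => W q.1 q.2).
  have m1 : measurable_fun setT (fun q : R * R => q.1) by exact: measurable_fst.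
  have m2 : measurable_fun setT (fun q : R * R => q.2) by exact: measurable_snd.
  have mp r (h : R * R -> R) : measurable_fun setT h ->
      measurable_fun setT (fun q => h q `^ r)%R.
    by move=> mh; apply: (measurableT_comp (measurable_powR r) mh).
  apply: measurable_fun_ifT.
  - exact: measurable_fun_ler.
  - by apply: measurable_funM; exact: mp.
  - by apply: measurable_funM; exact: mp.
(* Restricts to positive heights while the integrals run over the whole line, where Tonelli can be
   applied. *)
pose pos2 (t u : R) : R := (((0 < t) && (0 < u))%:R)%R.
have pos20 t u : (0 <= pos2 t u)%R by rewrite ler0n.
have mpos2 : measurable_fun setT (fun q : R * R => pos2 q.1 q.2).
  apply: (measurableT_comp (f := fun b : bool => (b%:R)%R : R)) => //.
  by apply: measurable_and; apply: measurable_fun_ltr.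
pose f (c : R -> R) (t u : R) : R := (4 * k * (t ^+ 2 * c t * W t u) * pos2 t u)%R.
have k4 : (0 <= 4 * k)%R by rewrite mulr_ge0// ltW.
have fk (c : R -> R) t : (forall t, 0 <= c t)%R -> (0 <= 4 * k * (t ^+ 2 * c t))%R.
  by move=> c0; apply: mulr_ge0 => //; apply: mulr_ge0 => //; exact: sqr_ge0.
have f0 (c : R -> R) t u : (forall t, 0 <= c t)%R -> (0 <= f c t u)%R.
  by move=> c0; apply: mulr_ge0 => //; rewrite mulrA mulr_ge0// fk.
have mf c : measurable_fun setT c -> measurable_fun setT (fun q : R * R => f c q.1 q.2).
  move=> mc; apply: measurable_funM => //; apply: measurable_funM => //.
  apply: measurable_funM => //; apply: measurable_funM; first exact: measurable_funX.
  exact: measurableT_comp.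
have HAB : \int[pi]_p (H p * A (X p) * B (Y p) * C (Z p))%:E <=
    \int[lam]_t \int[lam]_u ((f a t u)%:E + (f b u t)%:E).
  rewrite (eq_integral (fun p => (H p * B (Y p) * C (Z p))%:E * (A (X p))%:E)); last first.
    by move=> p _; rewrite -EFinM; congr EFin; ring.
  have mAX : measurable_fun setT (A \o X) by exact: measurableT_comp.
  have mBY : measurable_fun setT (B \o Y) by exact: measurableT_comp.
  have mCZ : measurable_fun setT (C \o Z) by exact: measurableT_comp.
  rewrite (layer_cake pi (F := fun p => (H p * B (Y p) * C (Z p))%:E) (G := A \o X))//; last 3 first.
  - by apply/measurable_EFinP; do 2 apply: measurable_funM => //.
  - by move=> p; rewrite lee_fin !mulr_ge0.
  - by move=> p; exact: A0.
  rewrite integral_mkcond; apply: ge0_le_integral_nomeas => t _.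
    rewrite patchE; case: ifP => // _; apply: integral_ge0 => p _.
    by rewrite lee_fin !mulr_ge0.
  rewrite patchE mem_setE in_itv/= andbT; case: ifPn => t0; last first.
    by apply: integral_ge0 => u _; rewrite adde_ge0// lee_fin f0.
  rewrite integral_mkcond (eq_integral
    (fun p => (H p * C (Z p) * \1_[set p | (t < A (X p))%R] p)%:E * (B (Y p))%:E)); last first.
    move=> p _; rewrite patchE indicE; case: ifP => _ /=; rewrite ?mulr1 ?mulr0 ?mul0e//.
    by rewrite -EFinM; congr EFin; ring.
  have mlA : measurable [set p | (t < A (X p))%R] by exact: measurable_level.
  rewrite (layer_cake pi (F := fun p => (H p * C (Z p) * \1_[set p | (t < A (X p))%R] p)%:E)
    (G := B \o Y))//; last 3 first.
  - apply/measurable_EFinP; apply: measurable_funM; last exact: measurable_indic.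
    exact: measurable_funM.
  - by move=> p; rewrite lee_fin !mulr_ge0.
  - by move=> p; exact: B0.
  rewrite integral_mkcond; apply: ge0_le_integral_nomeas => u _.
    rewrite patchE; case: ifP => // _; apply: integral_ge0 => p _.
    by rewrite lee_fin !mulr_ge0.
  rewrite patchE mem_setE in_itv/= andbT; case: ifPn => u0; last first.
    by rewrite adde_ge0// lee_fin f0.
  have -> : \int[pi]_(p in [set p | (u < (B \o Y) p)%R])
      (H p * C (Z p) * \1_[set p | (t < A (X p))%R] p)%:E =
      \int[pi]_(p in X @^-1` [set v | (t < A v)%R] `&` Y @^-1` [set v | (u < B v)%R])
      (H p * C (Z p))%:E.
    rewrite [LHS]integral_mkcond [RHS]integral_mkcond; apply: eq_integral => p _.
    rewrite !patchE indicE [X in _ = if X then _ else _]in_setI andbC.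
    rewrite -[p \in [set p | (u < (B \o Y) p)%R]]/(p \in Y @^-1` [set v | (u < B v)%R]).
    rewrite -[p \in [set p | (t < A (X p))%R]]/(p \in X @^-1` [set v | (t < A v)%R]).
    case: (p \in Y @^-1` _) => //=.
    by case: (p \in X @^-1` _); rewrite ?mulr1 ?mulr0.
  have C2 v : (0 < v)%R -> mu [set x | (v < C x)%R] <= (v ^- 2)%:E.
    exact: level_set_chebyshev.
  have mA' := measurable_level t mA; have mB' := measurable_level u mB.
  rewrite -EFinD /f /pos2 t0 u0 !mulr1 -mulrDr.
  rewrite [W u t]Wsym -mulrDl.
  have [ut|tu] := leP u t.
    apply: le_trans (bilinear_set_weakL4 XY XZ mX mY mZ mH H0 k0 wH mC C0 C2
      mA' mB' (a0 t) (b0 u) (aE t t0) (bE u u0)) _.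
    rewrite lee_fin ler_wpM2l ?mulr_ge0 ?(ltW k0)// /W ut; exact: young34.
  rewrite setIC.
  have YX A2 B2 : measurable A2 -> measurable B2 ->
      pi (Y @^-1` A2 `&` X @^-1` B2) <= mu A2 * mu B2.
    by move=> m1 m2; rewrite setIC muleC; exact: XY.
  apply: le_trans (bilinear_set_weakL4 YX YZ mY mX mZ mH H0 k0 wH mC C0 C2
      mB' mA' (b0 u) (a0 t) (bE u u0) (aE t t0)) _.
  rewrite lee_fin ler_wpM2l ?mulr_ge0 ?(ltW k0)// /W [(u <= t)%R]leNgt tu/= addrC.
  exact: young34.
(* The ranges [u <= t] and [u >= t] contribute [2 / t] each. *)
have Wint t : (0 < t)%R -> \int[lam]_(u in `]0%R, +oo[) (W t u)%:E <= (4 * t^-1)%:E.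
  move=> t0.
  apply: (le_trans (@le_integral_split _ t _
      (fun u => (t `^ (- (3 / 2)))%:E * (u `^ (1 / 2 - 1))%:E)
      (fun u => (t `^ (- (1 / 2)))%:E * (u `^ (- (1 + 1 / 2)))%:E)
      t0 _ _ _ _ _ _ _)).
  - by move=> u u0; rewrite lee_fin.
  - by apply: emeasurable_funM => //; apply/measurable_EFinP; exact: measurable_powR.
  - by apply: emeasurable_funM => //; apply/measurable_EFinP; exact: measurable_powR.
  - by move=> u; rewrite mule_ge0// lee_fin powR_ge0.
  - by move=> u; rewrite mule_ge0// lee_fin powR_ge0.
  - move=> u /andP[u0 ut]; rewrite -EFinM lee_fin /W ut.
    by rewrite (_ : 1 / 2 - 1 = - (1 / 2))%R//; field.
  - move=> u tu; rewrite -EFinM lee_fin Wsym /W tu mulrC.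
    by rewrite (_ : 1 + 1 / 2 = 3 / 2)%R//; field.
  rewrite !ge0_integralZl//; last 6 first.
  - by apply/measurable_EFinP; apply: measurable_funTS; exact: measurable_powR.
  - by move=> u _; rewrite lee_fin powR_ge0.
  - by rewrite lee_fin powR_ge0.
  - by apply/measurable_EFinP; apply: measurable_funTS; exact: measurable_powR.
  - by move=> u _; rewrite lee_fin powR_ge0.
  - by rewrite lee_fin powR_ge0.
  rewrite integral_powR_infty//.
  apply: (@le_trans _ _ ((t `^ (- (3 / 2)))%:E * (t `^ (1 / 2) / (1 / 2))%:E +
    (t `^ (- (1 / 2)))%:E * (t `^ (- (1 / 2)) / (1 / 2))%:E)).
    rewrite leeD2r// lee_wpmul2l// ?lee_fin ?powR_ge0//.
    by apply: integral_powR_0 => //; lra.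
  rewrite -!EFinM -EFinD lee_fin !mulrA !powRD_gt0// -(powR_inv1 (ltW t0)).
  rewrite (_ : - (3 / 2) + 1 / 2 = - 1)%R; last by field.
  rewrite (_ : - (1 / 2) + - (1 / 2) = - 1)%R; last by field.
  by rewrite le_eqVlt; apply/orP; left; apply/eqP; field.
(* Integrating in [u] turns [4 k t^2 c(t)] into [16 k t c(t)], which the L^2 normalisation controls.
   The families [a] and [b] contribute 16 k each, whence the final 32 k. *)
have fint (c : R -> R) : (forall t, 0 <= c t)%R -> measurable_fun setT c ->
    \int[lam]_(t in `]0%R, +oo[) (t * c t)%:E <= 1 ->
    \int[lam]_t \int[lam]_u (f c t u)%:E <= (16 * k)%:E.
  move=> c0 mc c1.
  apply: (@le_trans _ _ (\int[lam]_(t in `]0%R, +oo[) ((16 * k)%:E * (t * c t)%:E))).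
    rewrite [leRHS]integral_mkcond; apply: ge0_le_integral_nomeas => t _.
      by apply: integral_ge0 => u _; rewrite lee_fin f0.
    rewrite patchE mem_setE in_itv/= andbT; case: ifPn => t0; last first.
      by rewrite integral0_eq// => u _; rewrite /f /pos2 (negbTE t0) mulr0.
    have -> : \int[lam]_u (f c t u)%:E = \int[lam]_u ((4 * k * (t ^+ 2 * c t))%:E *
       ((EFin \o W t) \_ `]0%R, +oo[) u).
      apply: eq_integral => u _; rewrite patchE mem_setE in_itv/= andbT /f /pos2 t0/=.
      case: ifP => _; last by rewrite mulr0 mule0.
      by rewrite mulr1 -EFinM; congr EFin; ring.
    have mWt : measurable_fun setT (W t) by exact: (measurableT_comp mW (measurable_pair1 _)).
    rewrite ge0_integralZl//; last 3 first.
    - apply/(measurable_restrictT _ _).1 => //; apply/measurable_EFinP.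
      exact: measurable_funTS.
    - by move=> u _; rewrite patchE; case: ifP => // _; rewrite lee_fin.
    - by rewrite lee_fin fk.
    rewrite -integral_mkcond.
    apply: (@le_trans _ _ ((4 * k * (t ^+ 2 * c t))%:E * (4 * t^-1)%:E)).
      by rewrite lee_wpmul2l ?lee_fin ?fk//; exact: Wint.
    rewrite -!EFinM lee_fin le_eqVlt; apply/orP; left; apply/eqP; field.
    by rewrite gt_eqF.
  rewrite ge0_integralZl//; last 3 first.
  - by apply/measurable_EFinP; apply: measurable_funTS; exact: measurable_funM.
  - by move=> t /=; rewrite in_itv/= andbT => t0; rewrite lee_fin mulr_ge0// ltW.
  - by rewrite lee_fin mulr_ge0// ltW.
  by rewrite -[leRHS]mule1 lee_wpmul2l// lee_fin mulr_ge0// ltW.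
have ta1 : \int[lam]_(t in `]0%R, +oo[) (t * a t)%:E <= 1.
  apply: le_trans A1; apply: le_trans (integral_level_le mu mA A0).
  apply: ge0_le_integral_nomeas => t /=; rewrite in_itv/= andbT => t0.
    by rewrite lee_fin mulr_ge0// ltW.
  by rewrite EFinM -aE.
have tb1 : \int[lam]_(t in `]0%R, +oo[) (t * b t)%:E <= 1.
  apply: le_trans B1; apply: le_trans (integral_level_le mu mB B0).
  apply: ge0_le_integral_nomeas => t /=; rewrite in_itv/= andbT => t0.
    by rewrite lee_fin mulr_ge0// ltW.
  by rewrite EFinM -bE.
apply: (le_trans HAB).
have mfs c : measurable_fun setT c -> measurable_fun setT (fun q : R * R => f c q.2 q.1).
  move=> mc.
  by apply: (measurableT_comp (f := fun q : R * R => f c q.1 q.2)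
    (g := fun q : R * R => (q.2, q.1))); [exact: mf|exact: measurable_swap].
under eq_integral => t _.
  rewrite ge0_integralD//; last 4 first.
  - by move=> u _; rewrite lee_fin f0.
  - by apply/measurable_EFinP; exact: (measurableT_comp (mf a ma) (measurable_pair1 _)).
  - by move=> u _; rewrite lee_fin f0.
  - by apply/measurable_EFinP; exact: (measurableT_comp (mfs b mb) (measurable_pair1 _)).
  over.
rewrite ge0_integralD//; last 4 first.
- by move=> t _; apply: integral_ge0 => u _; rewrite lee_fin f0.
- apply: (measurable_fun_fubini_tonelli_F (m2 := lam) (fun q => (f a q.1 q.2)%:E)) => //.
    by apply/measurable_EFinP; exact: mf.
  by move=> q; rewrite lee_fin f0.
- by move=> t _; apply: integral_ge0 => u _; rewrite lee_fin f0.
- apply: (measurable_fun_fubini_tonelli_F (m2 := lam) (fun q => (f b q.2 q.1)%:E)) => //.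
    by apply/measurable_EFinP; exact: mfs.
  by move=> q; rewrite lee_fin f0.
rewrite (fubini_tonelli (m1 := lam) (m2 := lam) (fun q => (f b q.2 q.1)%:E)) /=; last 2 first.
- by apply/measurable_EFinP; exact: mfs.
- by move=> q; rewrite lee_fin f0.
rewrite (_ : 32 * k = 16 * k + 16 * k)%R; last by ring.
by rewrite EFinD leeD// fint.
Qed.

Theorem trilinear_weakL4 (X Y Z : P -> V) (H : P -> R) (A B C : V -> R) (k a b c : R) :
  (forall A B, measurable A -> measurable B ->
    pi (X @^-1` A `&` Y @^-1` B) <= mu A * mu B) ->
  (forall A B, measurable A -> measurable B ->
    pi (X @^-1` A `&` Z @^-1` B) <= mu A * mu B) ->
  (forall A B, measurable A -> measurable B ->
    pi (Y @^-1` A `&` Z @^-1` B) <= mu A * mu B) ->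
  measurable_fun setT X -> measurable_fun setT Y -> measurable_fun setT Z ->
  measurable_fun setT H -> (forall p, 0 <= H p)%R -> (0 < k)%R -> weakL4 H k ->
  measurable_fun setT A -> measurable_fun setT B -> measurable_fun setT C ->
  (forall v, 0 <= A v)%R -> (forall v, 0 <= B v)%R -> (forall v, 0 <= C v)%R ->
  (0 < a)%R -> (0 < b)%R -> (0 < c)%R ->
  \int[mu]_v (A v ^+ 2)%:E <= (a ^+ 2)%:E -> \int[mu]_v (B v ^+ 2)%:E <= (b ^+ 2)%:E ->
  \int[mu]_v (C v ^+ 2)%:E <= (c ^+ 2)%:E ->
  \int[pi]_p (H p * A (X p) * B (Y p) * C (Z p))%:E <= (32 * k * a * b * c)%:E.
Proof.
move=> XY XZ YZ mX mY mZ mH H0 k0 wH mA mB mC A0 B0 C0 a0 b0 c0 A1 B1 C1.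
have main (g : R) (G : V -> R) : (0 < g)%R -> measurable_fun setT G ->
    \int[mu]_v (G v ^+ 2)%:E <= (g ^+ 2)%:E ->
    \int[mu]_v ((g^-1 * G v) ^+ 2)%:E <= 1.
  move=> g0 mG hG; under eq_integral do rewrite exprMn EFinM.
  rewrite ge0_integralZl//; last 3 first.
  - by apply/measurable_EFinP; exact: measurable_funX.
  - by move=> v _; rewrite lee_fin sqr_ge0.
  - by rewrite lee_fin sqr_ge0.
  rewrite exprVn muleC lee_pdivrMr ?mul1e// exprn_gt0//.
have D0 g (G : V -> R) : (0 < g)%R -> (forall v, 0 <= G v)%R ->
    (forall v, 0 <= g^-1 * G v)%R.
  by move=> g0 G0 v; rewrite mulr_ge0// invr_ge0 ltW.
have Dm g (G : V -> R) : measurable_fun setT G ->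
    measurable_fun setT (fun v => g^-1 * G v)%R.
  by move=> mG; exact: measurable_funM.
have := trilinear_weakL4_normalized XY XZ YZ mX mY mZ mH H0 k0 wH
  (Dm a _ mA) (Dm b _ mB) (Dm c _ mC) (D0 _ _ a0 A0) (D0 _ _ b0 B0) (D0 _ _ c0 C0)
  (main _ _ a0 mA A1) (main _ _ b0 mB B1) (main _ _ c0 mC C1).
have an0 : a != 0%R by rewrite gt_eqF.
have bn0 : b != 0%R by rewrite gt_eqF.
have cn0 : c != 0%R by rewrite gt_eqF.
under eq_integral => p _.
  rewrite (_ : (H p * (a^-1 * A (X p)) * (b^-1 * B (Y p)) * (c^-1 * C (Z p)))%R =
    (a * b * c)^-1 * (H p * A (X p) * B (Y p) * C (Z p)))%R; last first.
    by field; rewrite an0 bn0 cn0.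
  rewrite EFinM; over.
have abc0 : (0 < a * b * c)%R by rewrite !mulr_gt0.
rewrite ge0_integralZl//; last 3 first.
- apply/measurable_EFinP; apply: measurable_funM; last exact: measurableT_comp.
  apply: measurable_funM; last exact: measurableT_comp.
  apply: measurable_funM => //; exact: measurableT_comp.
- by move=> p _; rewrite lee_fin !mulr_ge0.
- by rewrite lee_fin invr_ge0 ltW.
rewrite muleC lee_pdivrMr//; move/le_trans; apply.
by rewrite -EFinM lee_fin !mulrA.
Qed.

End trilinear.

(** * Schwartz functions and multipliers *)
Section euclidean_norm.
Context {R : realType} {d : nat}.
Implicit Types x y : 'rV[R]_d.

Lemma dotvC x y : dotv x y = dotv y x.
Proof. by apply: eq_bigr => i _; rewrite mulrC. Qed.

Lemma dotvDl x y z : dotv (x + y) z = dotv x z + dotv y z.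
Proof. by rewrite -big_split; apply: eq_bigr => i _; rewrite mxE mulrDl. Qed.

Lemma dotvDr x y z : dotv z (x + y) = dotv z x + dotv z y.
Proof. by rewrite dotvC dotvDl !(dotvC z). Qed.

Lemma dotvNl x y : dotv (- x) y = - dotv x y.
Proof. by rewrite -sumrN; apply: eq_bigr => i _; rewrite mxE mulNr. Qed.

Lemma dotvNr x y : dotv y (- x) = - dotv y x.
Proof. by rewrite dotvC dotvNl dotvC. Qed.

Lemma dotvZl (c : R) x y : dotv (c *: x) y = c * dotv x y.
Proof. by rewrite mulr_sumr; apply: eq_bigr => i _; rewrite mxE mulrA. Qed.

Lemma dotvZr (c : R) x y : dotv y (c *: x) = c * dotv y x.
Proof. by rewrite dotvC dotvZl dotvC. Qed.

Lemma dotv0l x : dotv 0 x = 0.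
Proof. by apply: big1 => i _; rewrite mxE mul0r. Qed.

Lemma dotv_delta (i : 'I_d) x : dotv (delta_mx 0 i) x = x 0 i.
Proof.
rewrite /dotv (bigD1 i)//= big1 ?addr0 ?mxE ?eqxx ?mul1r// => j ji.
by rewrite mxE (negbTE ji) andbF mul0r.
Qed.

Lemma dotvv_ge0 x : 0 <= dotv x x.
Proof. by apply: sumr_ge0 => i _; rewrite -expr2 sqr_ge0. Qed.

Lemma enorm_ge0 x : 0 <= enorm x. Proof. exact: sqrtr_ge0. Qed.

Lemma sqr_enorm x : enorm x ^+ 2 = dotv x x.
Proof. by rewrite sqr_sqrtr// dotvv_ge0. Qed.

Lemma coord_le_enorm x (i : 'I_d) : `|x 0 i| <= enorm x.
Proof.
rewrite -ler_sqr ?nnegrE ?enorm_ge0// sqr_enorm real_normK ?num_real//.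
rewrite /dotv (bigD1 i)//= -expr2 lerDl; apply: sumr_ge0 => j _.
by rewrite -expr2 sqr_ge0.
Qed.

Lemma enorm_le_sum x : enorm x <= \sum_(i < d) `|x 0 i|.
Proof.
rewrite -ler_sqr ?nnegrE ?enorm_ge0 ?sumr_ge0// sqr_enorm /dotv.
rewrite expr2 mulr_suml; apply: ler_sum => i _.
rewrite -expr2 -[leLHS]real_normK ?num_real// expr2 ler_wpM2l//.
by rewrite (bigD1 i)//= lerDl sumr_ge0.
Qed.

Lemma dotv_le x y : `|dotv x y| <= enorm x * \sum_(i < d) `|y 0 i|.
Proof.
apply: le_trans (ler_norm_sum _ _ _) _; rewrite mulr_sumr; apply: ler_sum => i _.
by rewrite normrM ler_wpM2r// coord_le_enorm.
Qed.

End euclidean_norm.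

Section smooth_functions.
Context {R : realType} {d : nat}.
Implicit Types (x : 'rV[R]_d) (u v b : 'rV[R]_d -> R) (a : seq 'I_d).

Definition DD (i : 'I_d) u : 'rV[R]_d -> R := fun x => 'D_(delta_mx 0 i) u x.

Lemma DD_cst i (c : R) : DD i (fun=> c) = fun=> 0.
Proof. by apply/funext => x; exact: derive_cst. Qed.

Lemma DD_add i u v x : differentiable u x -> differentiable v x ->
  DD i (fun y => u y + v y) x = DD i u x + DD i v x.
Proof. by move=> du dv; apply: deriveD; exact: diff_derivable. Qed.

Lemma DD_mul i u v x : differentiable u x -> differentiable v x ->
  DD i (fun y => u y * v y) x = DD i u x * v x + u x * DD i v x.
Proof.
move=> du dv; rewrite /DD [LHS](deriveM (f := u) (g := v)); try exact: diff_derivable.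
by rewrite addrC mulrC.
Qed.

Lemma differentiable_comp1 (k : R -> R) u x (k' : R) : differentiable u x ->
  is_derive (u x) 1 k k' -> differentiable (fun y => k (u y)) x.
Proof.
move=> du dk; apply: (differentiable_comp (f := u) (g := k)) => //.
exact/derivable1_diffP.
Qed.

Lemma DD_comp1 i (k : R -> R) u x (k' : R) : differentiable u x ->
  is_derive (u x) 1 k k' -> DD i (fun y => k (u y)) x = k' * DD i u x.
Proof.
move=> du dk; have dk1 : differentiable k (u x) by exact/derivable1_diffP.
rewrite /DD deriveE; last exact: differentiable_comp1 du dk.
rewrite [LHS](congr1 (fun f : 'rV[R]_d -> R => f _) (diff_comp du dk1)) /=.
rewrite diff1E// -deriveE// derive1E (@derive_val _ _ _ _ _ _ _ dk).
by rewrite -[LHS]/(_ * _) mulrC.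
Qed.

Lemma differentiable_dotv (w : 'rV[R]_d) x : differentiable (fun y => dotv y w) x.
Proof.
have -> : (fun y => dotv y w) = \sum_(j < d) (fun y : 'rV[R]_d => y 0 j * w 0 j).
  by apply/funext => y; rewrite fct_sumE.
apply: differentiable_sum => j.
by apply: differentiableM => //; exact: differentiable_coord.
Qed.

Lemma DD_linear i (f : 'rV[R]_d -> R) x :
  (forall (c : R) y z, f (c *: y + z) = c * f y + f z) -> DD i f x = f (delta_mx 0 i).
Proof.
move=> lf; rewrite /DD /derive.
apply: cvg_lim => //; apply/cvgrPdist_le => e e0.
near=> h; rewrite /= lf addrK -[_ *: _]/(_ * _) mulrA mulVf; last first.
  by near: h; exact: nbhs_dnbhs_neq.
by rewrite mul1r subrr normr0 ltW.
Unshelve. all: by end_near. Qed.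

Lemma DD_dotv i (w : 'rV[R]_d) x : DD i (fun y => dotv y w) x = w 0 i.
Proof.
rewrite DD_linear ?dotv_delta// => a y z.
by rewrite dotvDl dotvZl.
Qed.

Lemma DD_coord i j x : DD i (fun y : 'rV[R]_d => y 0 j) x = (i == j)%:R.
Proof.
rewrite DD_linear; first by rewrite mxE eqxx eq_sym.
by move=> a y z; rewrite !mxE.
Qed.

Lemma differentiable_sqnorm x : differentiable (fun y : 'rV[R]_d => dotv y y) x.
Proof.
have -> : (fun y => dotv y y) = \sum_(j < d) (fun y : 'rV[R]_d => y 0 j * y 0 j).
  by apply/funext => y; rewrite fct_sumE.
apply: differentiable_sum => j.
by apply: differentiableM; exact: differentiable_coord.
Qed.

Lemma DD_sqnorm i x : DD i (fun y : 'rV[R]_d => dotv y y) x = 2 * x 0 i.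
Proof.
pose f j (y : 'rV[R]_d) := y 0 j * y 0 j.
have -> : (fun y : 'rV[R]_d => dotv y y) = \sum_(j < d) f j.
  by apply/funext => y; rewrite fct_sumE.
rewrite /DD derive_sum; last first.
  by move=> j; apply: diff_derivable; apply: differentiableM; exact: differentiable_coord.
transitivity (\sum_(j < d) (i == j)%:R * (2 * x 0 j)).
  apply: eq_bigr => j _; rewrite -[LHS]/(DD i (fun y : 'rV[R]_d => y 0 j * y 0 j) x).
  by rewrite DD_mul ?DD_coord; [ring|exact: differentiable_coord..].
rewrite (bigD1 i)//= eqxx mul1r big1 ?addr0// => j ji.
by rewrite eq_sym (negbTE ji) mul0r.
Qed.

(** The last index of the list is differentiated first; for this reason the inductions on lists of
    indices run by [last_ind], moving one derivative at a time onto [u]. *)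
Lemma partials_rcons a i u : partials (rcons a i) u = partials a (DD i u).
Proof. by rewrite /partials foldr_rcons. Qed.

Lemma smooth_differentiable u x : smooth u -> differentiable u x.
Proof. by move=> su; exact: (su [::]). Qed.

Lemma smooth_DD i u : smooth u -> smooth (DD i u).
Proof. by move=> su a x; rewrite -partials_rcons; exact: su. Qed.

(** The induction principle for smoothness: it suffices to exhibit a class containing [u] that is
    stable under [DD], so no formula for higher derivatives is required. *)
Lemma closed_smooth (K : ('rV[R]_d -> R) -> Prop) :
  (forall u, K u -> forall x, differentiable u x) ->
  (forall u i, K u -> K (DD i u)) -> forall u, K u -> smooth u.
Proof.
move=> Kd KD u Ku a; elim/last_ind: a u Ku => [|a i ih] u Ku; first exact: Kd.
by rewrite partials_rcons; apply/ih/KD.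
Qed.

Lemma partialsD a u v : smooth u -> smooth v ->
  partials a (fun x => u x + v x) = fun x => partials a u x + partials a v x.
Proof.
elim/last_ind: a u v => [|a i ih] u v su sv //.
rewrite !partials_rcons -ih; [|exact: smooth_DD..].
by congr partials; apply/funext => x; rewrite DD_add//; exact: smooth_differentiable.
Qed.

Lemma smoothD u v : smooth u -> smooth v -> smooth (fun x => u x + v x).
Proof. by move=> su sv a x; rewrite partialsD//; apply: differentiableD. Qed.

(** The sums of products of smooth functions: by the Leibniz rule this class is stable under [DD],
    which single products are not. *)
Inductive product_sum : ('rV[R]_d -> R) -> Prop :=
| product_sum_mul u v : smooth u -> smooth v -> product_sum (fun x => u x * v x)
| product_sum_add u v : product_sum u -> product_sum v ->
    product_sum (fun x => u x + v x).

Lemma smoothM u v : smooth u -> smooth v -> smooth (fun x => u x * v x).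
Proof.
move=> su sv; apply: (@closed_smooth product_sum); last exact: product_sum_mul.
  move=> w; elim=> {w} [f g sf sg x|f g _ df _ dg x].
    by apply: differentiableM; exact: smooth_differentiable.
  exact: differentiableD.
have dps w : product_sum w -> forall x, differentiable w x.
  elim=> {w} [f g sf sg x|f g _ df _ dg x].
    by apply: differentiableM; exact: smooth_differentiable.
  exact: differentiableD.
move=> w i; elim=> {w} [f g sf sg|f g pf df pg dg].
  rewrite (_ : DD i _ = fun x => DD i f x * g x + f x * DD i g x).
    by apply: product_sum_add; apply: product_sum_mul => //; exact: smooth_DD.
  by apply/funext => x; rewrite DD_mul//; exact: smooth_differentiable.
rewrite (_ : DD i _ = fun x => DD i f x + DD i g x); first exact: product_sum_add.
by apply/funext => x; rewrite DD_add//; exact: dps.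
Qed.

Lemma DD_mul_smooth i u v : smooth u -> smooth v ->
  DD i (fun y => u y * v y) = fun x => DD i u x * v x + u x * DD i v x.
Proof. by move=> su sv; apply/funext => x; rewrite DD_mul//; exact: smooth_differentiable. Qed.

End smooth_functions.

Section schwartz_class.
Context {R : realType} {d : nat}.
Implicit Types (x : 'rV[R]_d) (u v b : 'rV[R]_d -> R) (a : seq 'I_d).

Definition polybnd u := exists N (C : R), forall x, `|u x| <= C * (1 + enorm x) ^+ N.

Definition rapid u := forall k, exists C : R, forall x, enorm x ^+ k * `|u x| <= C.

(** The slowly increasing functions, known as the multiplier space O_M of the Schwartz space. *)
Definition tame u := smooth u /\ forall a, polybnd (partials a u).

Definition schw u := smooth u /\ forall a, rapid (partials a u).

Lemma closed_tame (K : ('rV[R]_d -> R) -> Prop) :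
  (forall u, K u -> forall x, differentiable u x) ->
  (forall u i, K u -> K (DD i u)) -> (forall u, K u -> polybnd u) ->
  forall u, K u -> tame u.
Proof.
move=> Kd KD Kp u Ku; split; first exact: closed_smooth Kd KD _ Ku.
move=> a; elim/last_ind: a u Ku => [|a i ih] u Ku; first exact: Kp.
by rewrite partials_rcons; apply/ih/KD.
Qed.

Lemma closed_schw (K : ('rV[R]_d -> R) -> Prop) :
  (forall u, K u -> forall x, differentiable u x) ->
  (forall u i, K u -> K (DD i u)) -> (forall u, K u -> rapid u) ->
  forall u, K u -> schw u.
Proof.
move=> Kd KD Kp u Ku; split; first exact: closed_smooth Kd KD _ Ku.
move=> a; elim/last_ind: a u Ku => [|a i ih] u Ku; first exact: Kp.
by rewrite partials_rcons; apply/ih/KD.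
Qed.

Lemma enorm1_ge1 x : 1 <= 1 + enorm x. Proof. by rewrite lerDl enorm_ge0. Qed.

Lemma polybnd_ge0 u : polybnd u ->
  exists N (C : R), 0 <= C /\ forall x, `|u x| <= C * (1 + enorm x) ^+ N.
Proof.
move=> [N [C h]]; exists N, `|C|; split => // x; apply: le_trans (h x) _.
by rewrite ler_wpM2r ?ler_norm// exprn_ge0// (le_trans ler01)// enorm1_ge1.
Qed.

Lemma polybndD u v : polybnd u -> polybnd v -> polybnd (fun x => u x + v x).
Proof.
move=> /polybnd_ge0[N [C [C0 h]]] /polybnd_ge0[M [E [E0 g]]].
exists (maxn N M), (C + E) => x; apply: le_trans (ler_normD _ _) _; rewrite mulrDl.
apply: lerD; [apply: le_trans (h x) _|apply: le_trans (g x) _];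
  by rewrite ler_wpM2l// ler_weXn2l ?enorm1_ge1 ?leq_maxl ?leq_maxr.
Qed.

Lemma polybndM u v : polybnd u -> polybnd v -> polybnd (fun x => u x * v x).
Proof.
move=> /polybnd_ge0[N [C [C0 h]]] /polybnd_ge0[M [E [E0 g]]].
exists (N + M)%N, (C * E) => x; rewrite normrM exprD mulrACA.
by apply: ler_pM.
Qed.

Lemma rapidD u v : rapid u -> rapid v -> rapid (fun x => u x + v x).
Proof.
move=> hu hv k; have [C h] := hu k; have [E g] := hv k.
exists (C + E) => x; apply: le_trans (lerD (h x) (g x)).
by rewrite -mulrDr ler_wpM2l ?exprn_ge0 ?enorm_ge0// ler_normD.
Qed.

(** The weight [|x|^k] is upgraded to [(1 + |x|)^k] by applying the induction hypothesis both to [u]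
    and to [|x| u]. *)
Lemma rapid_ge0 u k : rapid u ->
  exists C, 0 <= C /\ forall x, (1 + enorm x) ^+ k * `|u x| <= C.
Proof.
move=> ru; elim: k u ru => [|k ih] u ru.
  by have [C h] := ru 0%N; exists C; split => [|x];
    [apply: le_trans (h 0)|have := h x]; rewrite expr0 ?mul1r.
have [C [C0 h]] := ih _ ru.
have [|E [E0 g]] := ih (fun x => enorm x * u x).
  move=> j; have [E g] := ru j.+1; exists E => x.
  by rewrite normrM ger0_norm ?enorm_ge0// mulrA -exprSr.
exists (C + E); split; first exact: addr_ge0.
move=> x; have := lerD (h x) (g x); apply: le_trans.
by rewrite exprS -!mulrA mulrDl mul1r lerD2l normrM (ger0_norm (enorm_ge0 x)) mulrCA.
Qed.

Lemma rapid_mul u v : polybnd u -> rapid v -> rapid (fun x => u x * v x).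
Proof.
move=> /polybnd_ge0[N [C [C0 h]]] rv k.
have [E [E0 g]] := rapid_ge0 (k + N) rv.
exists (C * E) => x; rewrite normrM.
apply: (@le_trans _ _ (C * ((1 + enorm x) ^+ (k + N) * `|v x|))); last first.
  by rewrite ler_wpM2l.
have e0 : 0 <= 1 + enorm x by rewrite (le_trans ler01)// enorm1_ge1.
rewrite (_ : C * _ = (1 + enorm x) ^+ k * (C * (1 + enorm x) ^+ N * `|v x|)); last first.
  by rewrite exprD; ring.
apply: ler_pM; rewrite ?exprn_ge0 ?enorm_ge0 ?mulr_ge0//.
  by rewrite lerXn2r ?nnegrE ?enorm_ge0// lerDr.
by rewrite ler_wpM2r.
Qed.

Lemma tame_DD i u : tame u -> tame (DD i u).
Proof. by move=> [su h]; split => [|a]; [exact: smooth_DD|rewrite -partials_rcons]. Qed.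

Lemma schw_DD i u : schw u -> schw (DD i u).
Proof. by move=> [su h]; split => [|a]; [exact: smooth_DD|rewrite -partials_rcons]. Qed.

Lemma schw_mul b u : tame b -> schw u -> schw (fun x => b x * u x).
Proof.
move=> tb hu; split; first by apply: smoothM; [exact: tb.1|exact: hu.1].
move=> a; elim/last_ind: a b u tb hu => [|a i ih] b u tb hu.
  by apply: rapid_mul; [exact: (tb.2 [::])|exact: (hu.2 [::])].
rewrite partials_rcons DD_mul_smooth; [|exact: tb.1|exact: hu.1].
rewrite partialsD; last 2 first.
- by apply: smoothM; [apply/smooth_DD/tb.1|exact: hu.1].
- by apply: smoothM; [exact: tb.1|apply/smooth_DD/hu.1].
by apply: rapidD; apply: ih => //; [exact: tame_DD|exact: schw_DD].
Qed.

Lemma schwD u v : schw u -> schw v -> schw (fun x => u x + v x).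
Proof.
move=> [su hu] [sv hv]; split => [|a]; first exact: smoothD.
by rewrite partialsD//; exact: rapidD.
Qed.

Lemma tame_cst (c : R) : tame (fun=> c).
Proof.
apply: (@closed_tame (fun u => exists c, u = fun=> c)); last by exists c.
- by move=> u [e ->] x; exact: differentiable_cst.
- by move=> u i [e ->]; exists 0; exact: DD_cst.
- by move=> u [e ->]; exists 0%N, `|e| => x; rewrite expr0 mulr1.
Qed.

Lemma schwZ (c : R) u : schw u -> schw (fun x => c * u x).
Proof. by apply: schw_mul; exact: tame_cst. Qed.

End schwartz_class.

(** * A concrete class of slowly increasing multipliers *)

Section multipliers.
Context {R : realType} {d : nat}.
Implicit Types (x w : 'rV[R]_d) (u v b : 'rV[R]_d -> R).

(** A function listed with all its derivatives, each of them bounded. One notion covers the cosine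
    in the Fourier kernel and the bump [exp(-1/x)]. *)
Definition bounded_family (B : nat -> R -> R) :=
  (forall k (y : R), is_derive y 1 (B k) (B k.+1 y)) /\
  (forall k, exists C, forall y, `|B k y| <= C).

Definition bweight x : R := 1 + 4 * pi ^+ 2 * dotv x x.

(** A syntactic subclass of the slowly increasing functions, rich enough for the phases, Bessel
    weights, Gaussians and bumps used below. Being inductive, it reduces stability under [DD] and
    polynomial growth to structural inductions. *)
Inductive OM : ('rV[R]_d -> R) -> Prop :=
| OM_cst (c : R) : OM (fun=> c)
| OM_coord i : OM (fun x => x 0 i)
| OM_add u v : OM u -> OM v -> OM (fun x => u x + v x)
| OM_mul u v : OM u -> OM v -> OM (fun x => u x * v x)
| OM_family B k w (e : R) : bounded_family B -> OM (fun x => B k (dotv x w + e))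
| OM_bweight (r : R) : OM (fun x => bweight x `^ r)
| OM_gauss (l : R) : 0 <= l -> OM (fun x => expR (- l * dotv x x)).

Lemma bweight_ge1 x : 1 <= bweight x.
Proof.
rewrite lerDl; apply: mulr_ge0; last exact: dotvv_ge0.
by apply: mulr_ge0 => //; exact: sqr_ge0.
Qed.

Lemma bweight_gt0 x : 0 < bweight x.
Proof. exact: lt_le_trans ltr01 (bweight_ge1 x). Qed.

Lemma DD_gauss i (l : R) x : DD i (fun x => expR (- l * dotv x x)) x =
  expR (- l * dotv x x) * (- l * (2 * x 0 i)).
Proof.
have dl : differentiable (fun x => - l * dotv x x) x.
  by apply: differentiableM => //; exact: differentiable_sqnorm.
rewrite (DD_comp1 i dl (is_derive_expR _)).
rewrite DD_mul ?DD_cst ?DD_sqnorm ?mul0r ?add0r//; exact: differentiable_sqnorm.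
Qed.

Lemma OM_diff u : OM u -> forall x, differentiable u x.
Proof.
elim=> {u} [c x|i x|u v _ du _ dv x|u v _ du _ dv x|B k w e [dB _] x|r x|l l0 x].
- exact: differentiable_cst.
- exact: differentiable_coord.
- exact: differentiableD.
- exact: differentiableM.
- apply: (differentiable_comp1 (k := B k) (u := fun x => dotv x w + e)).
  by apply: differentiableD => //; exact: differentiable_dotv.
- apply: (differentiable_comp1 (k := fun y => y `^ r) (u := bweight)).
    apply: differentiableD => //; apply: differentiableM => //.
    exact: differentiable_sqnorm.
  apply: is_derive1_powR; exact: bweight_gt0.
- apply: (differentiable_comp1 (k := expR) (u := fun x => - l * dotv x x)).
  by apply: differentiableM => //; exact: differentiable_sqnorm.
Qed.

Lemma OM_DD u i : OM u -> OM (DD i u).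
Proof.
elim=> {u} [c|j|u v ou du ov dv|u v ou du ov dv|B k w e hB|r|l l0].
- by rewrite DD_cst; exact: OM_cst.
- by rewrite (_ : DD i _ = fun=> (i == j)%:R); [exact: OM_cst|apply/funext => x; exact: DD_coord].
- rewrite (_ : DD i _ = fun x => DD i u x + DD i v x); first exact: OM_add.
  by apply/funext => x; rewrite DD_add//; exact: OM_diff.
- rewrite (_ : DD i _ = fun x => DD i u x * v x + u x * DD i v x).
    by apply: OM_add; apply: OM_mul.
  by apply/funext => x; rewrite DD_mul//; exact: OM_diff.
- rewrite (_ : DD i _ = fun x => B k.+1 (dotv x w + e) * w 0 i).
    by apply: OM_mul; [exact: OM_family|exact: OM_cst].
  have dl x : differentiable (fun x => dotv x w + e) x.
    by apply: differentiableD => //; exact: differentiable_dotv.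
  apply/funext => x; rewrite (DD_comp1 i (dl x) (hB.1 k _)).
  rewrite DD_add ?DD_dotv ?DD_cst ?addr0//; exact: differentiable_dotv.
- rewrite (_ : DD i _ = fun x => r * bweight x `^ (r - 1) * (8 * pi ^+ 2 * x 0 i)).
    apply: OM_mul; apply: OM_mul; [exact: OM_cst|exact: OM_bweight|exact: OM_cst|exact: OM_coord].
  have dq x : differentiable (fun x : 'rV[R]_d => 4 * pi ^+ 2 * dotv x x) x.
    by apply: differentiableM => //; exact: differentiable_sqnorm.
  have db x : differentiable bweight x by apply: differentiableD.
  apply/funext => x; rewrite (DD_comp1 i (db x) (is_derive1_powR r (bweight_gt0 x))).
  rewrite /bweight DD_add ?DD_cst// DD_mul ?DD_cst//; last exact: differentiable_sqnorm.
  by rewrite DD_sqnorm; congr (_ * _); ring.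
- rewrite (_ : DD i _ = fun x => expR (- l * dotv x x) * (- l * (2 * x 0 i))).
    apply: OM_mul; first exact: OM_gauss.
    by apply: OM_mul; [exact: OM_cst|apply: OM_mul; [exact: OM_cst|exact: OM_coord]].
  by apply/funext => x; exact: DD_gauss.
Qed.

Lemma polybnd_cst (c : R) : polybnd ((fun=> c) : 'rV[R]_d -> R).
Proof. by exists 0%N, `|c| => x; rewrite expr0 mulr1. Qed.

Lemma le_polybnd u v : (forall x, `|u x| <= `|v x|) -> polybnd v -> polybnd u.
Proof. by move=> uv [N [C h]]; exists N, C => x; exact: le_trans (uv x) (h x). Qed.

Lemma polybnd_enorm : polybnd (fun x : 'rV[R]_d => enorm x).
Proof.
exists 1%N, 1 => x; rewrite mul1r expr1 ger0_norm ?enorm_ge0//.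
by rewrite lerDr.
Qed.

Lemma polybndX u n : polybnd u -> polybnd (fun x => u x ^+ n).
Proof.
move=> pu; elim: n => [|n ih]; first by under eq_fun do rewrite expr0; exact: polybnd_cst.
by under eq_fun do rewrite exprS; exact: polybndM.
Qed.

Lemma polybnd_bweight : polybnd bweight.
Proof.
apply: polybndD; first exact: polybnd_cst.
apply: polybndM; first exact: polybnd_cst.
by under eq_fun do rewrite -sqr_enorm; exact: polybndX polybnd_enorm.
Qed.

Lemma OM_polybnd u : OM u -> polybnd u.
Proof.
elim=> {u} [c|j|u v ou du ov dv|u v ou du ov dv|B k w e [_ hB]|r|l l0].
- exact: polybnd_cst.
- apply: le_polybnd polybnd_enorm => x.
  by rewrite (ger0_norm (enorm_ge0 x)) coord_le_enorm.
- exact: polybndD.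
- exact: polybndM.
- by have [C h] := hB k; exists 0%N, C => x; rewrite expr0 mulr1.
- pose N := (Num.trunc `|r|).+1.
  apply: (@le_polybnd _ (fun x => bweight x ^+ N)); last exact/polybndX/polybnd_bweight.
  move=> x; rewrite !ger0_norm ?powR_ge0 ?exprn_ge0 ?(ltW (bweight_gt0 x))//.
  rewrite -powR_mulrn ?(ltW (bweight_gt0 x))// ler_powR ?bweight_ge1//.
  by apply: le_trans (ler_norm r) _; apply: ltW; rewrite -truncn_lt_nat.
- apply: (@le_polybnd _ (fun=> 1)); last exact: polybnd_cst.
  move=> x; rewrite normr1 ger0_norm ?expR_ge0// -expR0 ler_expR.
  by rewrite mulNr oppr_le0 mulr_ge0// dotvv_ge0.
Qed.

Lemma OM_tame u : OM u -> tame u.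
Proof.
apply: closed_tame => [{}u ou x|{}u i|{}u].
- exact: OM_diff.
- exact: OM_DD.
- exact: OM_polybnd.
Qed.

Lemma OM_schw_mul b u : OM b -> schw u -> schw (fun x => b x * u x).
Proof. by move=> /OM_tame; exact: schw_mul. Qed.

(** Derivatives vanish where [|x|^2 > M] because this set is open, and on the complement polynomial
    growth is mere boundedness. *)
Lemma OM_compact_schw u (M : R) : 0 <= M -> OM u ->
  (forall x, M < dotv x x -> u x = 0) -> schw u.
Proof.
move=> M0 ou u0; pose K v := OM v /\ (forall x, M < dotv x x -> v x = 0).
apply: (@closed_schw _ _ K) => //.
- by move=> v [ov _] x; exact: OM_diff.
- move=> v i [ov v0]; split; first exact: OM_DD.
  move=> x Mx; rewrite /DD (@near_eq_derive _ _ _ _ (fun=> 0)); first exact: derive_cst.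
  have cx : {for x, continuous (fun y : 'rV[R]_d => dotv y y)}.
    by apply: differentiable_continuous; exact: differentiable_sqnorm.
  near=> y; apply: v0; near: y; exact: (cvgr_gt _ cx _ Mx).
- move=> v [ov v0] k; have [N [C [C0 h]]] := polybnd_ge0 (OM_polybnd ov).
  exists ((1 + M) ^+ k * (C * (1 + (1 + M)) ^+ N)) => x.
  have [xM|Mx] := leP (dotv x x) M; last first.
    rewrite v0// normr0 mulr0 !mulr_ge0 ?exprn_ge0 ?addr_ge0//.
  have x1 : enorm x <= 1 + M.
    rewrite -ler_sqr ?nnegrE ?enorm_ge0 ?addr_ge0// sqr_enorm; nra.
  apply: ler_pM => //; first by rewrite exprn_ge0// enorm_ge0.
    by rewrite lerXn2r ?nnegrE ?enorm_ge0 ?addr_ge0.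
  apply: le_trans (h x) _; rewrite ler_wpM2l// lerXn2r ?nnegrE ?addr_ge0 ?enorm_ge0//.
  by rewrite lerD2l.
Unshelve. all: by end_near. Qed.

Lemma rapid_gauss (l : R) : 0 < l -> rapid (fun x => expR (- l * dotv x x)).
Proof.
(* The factorial comes from the term of order [k+1] of the exponential series, which dominates
   [|x|^k] for [|x| >= 1]; the summand 1 covers [|x| <= 1]. *)
move=> l0 k; exists (k.+1`!%:R / l ^+ k.+1 + 1) => x.
rewrite ger0_norm ?expR_ge0// mulNr expRN.
rewrite ler_pdivrMr ?expR_gt0//.
have ln0 : l ^+ k.+1 != 0 by rewrite expf_neq0// gt_eqF.
have y0 : 0 <= l * dotv x x by rewrite mulr_ge0 ?dotvv_ge0// ltW.
have := expR_ge1Dxn k y0; set E := expR _ => hE.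
have f0 : 0 < k.+1`!%:R :> R by rewrite ltr0n fact_gt0.
have h1 : dotv x x ^+ k.+1 <= k.+1`!%:R / l ^+ k.+1 * E.
  apply: (@le_trans _ _ (k.+1`!%:R / l ^+ k.+1 * ((l * dotv x x) ^+ k.+1 / k.+1`!%:R))).
    by rewrite exprMn le_eqVlt; apply/orP; left; apply/eqP; field; rewrite ln0 gt_eqF.
  rewrite ler_wpM2l ?divr_ge0 ?exprn_ge0 ?(ltW l0)//.
  by apply: le_trans hE; rewrite lerDr.
have E1 : 1 <= E by apply: le_trans hE; rewrite lerDl divr_ge0 ?exprn_ge0.
rewrite mulrDl mul1r.
have [x1|x1] := leP (enorm x) 1.
  apply: (@le_trans _ _ 1); first by rewrite exprn_ile1 ?enorm_ge0.
  by apply: le_trans E1 _; rewrite lerDr mulr_ge0 ?divr_ge0 ?exprn_ge0 ?expR_ge0 ?(ltW l0).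
apply: (@le_trans _ _ (dotv x x ^+ k.+1)); last first.
  by apply: le_trans h1 _; rewrite lerDl (le_trans ler01).
by rewrite -sqr_enorm -exprM ler_weXn2l ?(ltW x1)// mul2n -addnn addSn leqW// leq_addr.
Qed.

Lemma gauss_schw (l : R) : 0 < l -> schw (fun x => expR (- l * dotv x x)).
Proof.
move=> l0; pose g x := expR (- l * dotv x x).
have og : OM g by apply: OM_gauss; exact: ltW.
(* Multiples of the Gaussian by [OM] functions: a derivative only changes the multiplier. *)
pose K v := exists2 b, OM b & v = fun x => b x * g x.
apply: (@closed_schw _ _ K); last first.
- by exists (fun=> 1); [exact: OM_cst|apply/funext => x; rewrite mul1r].
- move=> v [b ob ->]; apply: rapid_mul; first exact: OM_polybnd.
  exact: rapid_gauss.
- move=> v i [b ob ->]; exists (fun x => DD i b x + b x * (- l * (2 * x 0 i))).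
    apply: OM_add; [exact: OM_DD|apply: OM_mul => //].
    by apply: OM_mul; [exact: OM_cst|apply: OM_mul; [exact: OM_cst|exact: OM_coord]].
  apply/funext => x; rewrite DD_mul//; [|exact: OM_diff..].
  by rewrite /g DD_gauss; ring.
- by move=> v [b ob ->] x; apply: differentiableM; exact: OM_diff.
Qed.

End multipliers.

(** * Open sets and continuous functions are measurable on R^n *)

Section borel_rV.
Context {R : realType} {d : nat}.
Implicit Types x y : 'rV[R]_d.

Lemma rat_approx (a e : R) : 0 < e -> exists q : rat, `|a - ratr q| < e.
Proof.
move=> e0; have [|q] := @rat_in_itvoo R (a - e) (a + e); first by lra.
rewrite in_itv/= => /andP[h1 h2]; exists q; rewrite ltr_norml; apply/andP; split; lra.
Qed.

Lemma measurable_rV_ball x (e : R) : measurable (ball x e).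
Proof.
have [e0|e0] := ltP 0 e; last first.
  rewrite (_ : ball x e = set0)//; apply/seteqP; split => y // [+ _].
  by rewrite ltNge e0.
rewrite (_ : ball x e = \bigcap_(i in [set: 'I_d]) [set y : 'rV[R]_d | `|x 0 i - y 0 i| < e]).
  apply: fin_bigcap_measurable => // i _; rewrite -[X in measurable X]setTI.
  have -> : [set y : 'rV[R]_d | `|x 0 i - y 0 i| < e] =
    (fun y : 'rV[R]_d => `|x 0 i - y 0 i| < e) @^-1` [set true] by [].
  apply: measurable_fun_ltr => //; apply: measurableT_comp => //.
  by apply: measurable_funB => //; exact: measurable_rV_coord.
apply/seteqP; split => y /= h; first by move=> i _; case: h => _ /(_ 0 i).
by split => // i j; rewrite ord1; exact: h.
Qed.

(** The sigma-algebra is generated by the coordinates, whereas continuity speaks of the topology.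
    The link is that an open set is a countable union of sup-norm balls with rational centres. *)
Lemma open_measurable_rV (U : set 'rV[R]_d) : open U -> measurable U.
Proof.
move=> oU.
pose q2 (q : 'rV[rat]_d) : 'rV[R]_d := \row_i ratr (q 0 i).
pose B (p : 'rV[rat]_d * nat) : set 'rV[R]_d :=
  [set y | ball (q2 p.1) p.2.+1%:R^-1 y /\ ball (q2 p.1) p.2.+1%:R^-1 `<=` U].
have -> : U = \bigcup_p B p.
  apply/seteqP; split => [x Ux|x [p _] [px pU]]; last exact: pU.
  have /nbhs_ballP[e /= e0 xeU] : nbhs x U by exact: open_nbhs_nbhs.
  (* A centre within [1/(k+1)] of [x] and a radius [1/(k+1) < e/2] keep the rational ball inside
     [ball x e]. *)
  have [k hk] : exists k, k.+1%:R^-1 < e / 2.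
    exists (Num.trunc (e / 2)^-1); rewrite invf_plt ?posrE ?divr_gt0//.
    by rewrite -truncn_lt_nat// invr_ge0 ltW// divr_gt0.
  have /choice[q hq] : forall i, exists q : rat, `|x 0 i - ratr q| < k.+1%:R^-1.
    by move=> i; exact: rat_approx.
  exists (\row_i q i, k) => //; split => /=.
    by split => // i j; rewrite ord1 !mxE /ball/= distrC; exact: hq.
  move=> y [_ hy]; apply: xeU; split => // i j; rewrite ord1 /ball/=.
  have := hy 0 j; rewrite !mxE /ball/= => hyj; have := hq j => hxj.
  have -> : x 0 j - y 0 j = (x 0 j - ratr (q j)) + (ratr (q j) - y 0 j) by ring.
  apply: le_lt_trans (ler_normD _ _) _; apply: lt_trans (ltrD hxj hyj) _.
  by rewrite [ltRHS]splitr ltrD.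
apply: countable_bigcupT_measurable; first exact: countableP.
move=> p; rewrite /B; have [h|h] := pselect (ball (q2 p.1) p.2.+1%:R^-1 `<=` U).
  rewrite (_ : [set _ | _] = ball (q2 p.1) p.2.+1%:R^-1); first exact: measurable_rV_ball.
  by apply/seteqP; split => y; [case|split].
rewrite (_ : [set _ | _] = set0)//.
by apply/seteqP; split => y // [].
Qed.

Lemma continuous_measurable_rV (f : 'rV[R]_d -> R) : continuous f ->
  measurable_fun setT f.
Proof.
move=> /continuousP cf; apply: (measurability _ (RGenOpens.measurableE R)).
move=> _ [_ [a [b ->] <-]]; rewrite setTI.
by apply: open_measurable_rV; apply: cf; exact: interval_open.
Qed.

Lemma smooth_measurable (u : 'rV[R]_d -> R) : smooth u -> measurable_fun setT u.
Proof.
move=> su; apply: continuous_measurable_rV => x.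
by apply: differentiable_continuous; exact: smooth_differentiable.
Qed.

End borel_rV.

(** * An integrable majorant for Schwartz functions *)

Section japanese_bracket.
Context {R : realType}.
Local Notation lam := (@lebesgue_measure R).
Local Notation mu d := (@lebesgue_rV R d).

(** A product over the coordinates in place of a power of [1 + |x|^2]: the integral of its inverse
    then factors into one-dimensional integrals. *)
Definition japanese d (x : 'rV[R]_d) : R := \prod_(i < d) (1 + x 0 i ^+ 2).

Lemma measurable_inv_gt0 d' (T : measurableType d') (f : T -> R) :
  measurable_fun setT f -> (forall x, 0 < f x) -> measurable_fun setT (fun x => (f x)^-1).
Proof.
move=> mf f0; rewrite (_ : (fun _ => _) = fun x => f x `^ (- 1)).
  exact: (measurableT_comp (measurable_powR _) mf).
by apply/funext => x; rewrite powR_inv1// ltW.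
Qed.

Lemma measurable_sqr1V : measurable_fun setT (fun x : R => (1 + x ^+ 2)^-1).
Proof.
apply: measurable_inv_gt0 => [|x]; last by rewrite ltr_pwDl ?sqr_ge0.
by apply: measurable_funD.
Qed.

Lemma sqr1_gt0 (y : R) : 0 < 1 + y ^+ 2.
Proof. by rewrite ltr_pwDl ?sqr_ge0. Qed.

Lemma japanese_gt0 d (x : 'rV[R]_d) : 0 < japanese x.
Proof. by apply: prodr_gt0 => i _; exact: sqr1_gt0. Qed.

Lemma OM_japanese d : OM (@japanese d).
Proof.
rewrite /japanese; elim: (index_enum _) => [|i s ih].
  by rewrite (_ : (fun _ => _) = fun=> 1); [exact: OM_cst|apply/funext => x; rewrite big_nil].
rewrite (_ : (fun _ => _) = fun x : 'rV[R]_d => (1 + x 0 i * x 0 i) *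
    \prod_(i <- s) (1 + x 0 i ^+ 2)); last by apply/funext => x; rewrite big_cons.
apply: OM_mul => //; apply: OM_add; [exact: OM_cst|apply: OM_mul; exact: OM_coord].
Qed.

Lemma measurable_japanese d : measurable_fun setT (@japanese d).
Proof. exact: smooth_measurable (OM_tame (OM_japanese d)).1. Qed.

Lemma measurable_japaneseV d : measurable_fun setT (fun x : 'rV[R]_d => (japanese x)^-1).
Proof.
by apply: measurable_inv_gt0 => [|x]; [exact: measurable_japanese|exact: japanese_gt0].
Qed.

Lemma integral_sqr1_lty : (\int[lam]_x ((1 + x ^+ 2)^-1)%:E < +oo)%E.
Proof.
rewrite ge0_symfun_integralT//.
- rewrite (_ : [set x | _] = `[0, +oo[%classic); last first.
    by apply/seteqP; split => x/=; rewrite in_itv/= andbT.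
  have m1 : measurable_fun setT (fun x : R => ((1 + x ^+ 2)^-1)%:E).
    by apply/measurable_EFinP; exact: measurable_sqr1V.
  rewrite -integral_itv_obnd_cbnd; last exact: measurable_funTS.
  rewrite lte_mul_pinfty//.
  apply: (le_lt_trans (@le_integral_split _ 1 _ (cst 1%:E)
    (fun x => (x `^ (- (1 + 1)))%:E) ltr01 _ _ _ _ _ _ _)) => //.
  + by move=> x _; rewrite lee_fin invr_ge0 ltW// sqr1_gt0.
  + by apply/measurable_EFinP; exact: measurable_powR.
  + by move=> x; rewrite lee_fin powR_ge0.
  + by move=> x _; rewrite lee_fin invf_le1 ?sqr1_gt0// lerDl sqr_ge0.
  + move=> x x1; have x0 : 0 < x by exact: lt_le_trans x1.
    rewrite lee_fin (_ : - (1 + 1) = - 2%:R)// powR_invn ?(ltW x0)//.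
    by rewrite lef_pV2 ?posrE ?sqr1_gt0 ?exprn_gt0// lerDr.
  by rewrite integral_cst_0c// integral_powR_infty// -EFinD ltry.
- by move=> x; rewrite invr_ge0 ltW// sqr1_gt0.
- move=> x; apply: (@continuousV _ _ (fun x : R => 1 + x ^+ 2)).
    by rewrite gt_eqF// sqr1_gt0.
  apply: continuousD; first exact: cst_continuous.
  exact: exprn_continuous.
- by move=> x /=; rewrite sqrrN.
Qed.

Lemma integral_japaneseV_lty d : (\int[mu d]_x ((japanese x)^-1)%:E < +oo)%E.
Proof.
elim: d => [|d ih].
  rewrite integral_rV0 ?ltry//; apply/measurable_EFinP; exact: measurable_japaneseV.
rewrite integral_rV_cons; last 2 first.
- by apply/measurable_EFinP; exact: measurable_japaneseV.
- by move=> x; rewrite lee_fin invr_ge0 ltW// japanese_gt0.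
have jE y (v : 'rV[R]_d) : japanese (rV_cons (y, v)) = (1 + y ^+ 2) * japanese v.
  rewrite /japanese big_ord_recl rV_cons0; congr (_ * _).
  by apply: eq_bigr => i _; rewrite rV_cons_lift.
under eq_integral => y _.
  under eq_integral => v _ do rewrite jE invfM EFinM.
  rewrite ge0_integralZl//; last 3 first.
  - by apply/measurable_EFinP; exact: measurable_japaneseV.
  - by move=> v _; rewrite lee_fin invr_ge0 ltW// japanese_gt0.
  - by rewrite lee_fin invr_ge0 ltW// sqr1_gt0.
  over.
have i0 : (0 <= \int[mu d]_x ((japanese x)^-1)%:E)%E.
  by apply: integral_ge0 => x _; rewrite lee_fin invr_ge0 ltW// japanese_gt0.
rewrite ge0_integralZr//; last 2 first.
- by apply/measurable_EFinP; exact: measurable_sqr1V.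
- by move=> y _; rewrite lee_fin invr_ge0 ltW// sqr1_gt0.
rewrite lte_mul_pinfty//.
- by apply: integral_ge0 => x _; rewrite lee_fin invr_ge0 ltW// sqr1_gt0.
- rewrite ge0_fin_numE ?integral_sqr1_lty//.
  by apply: integral_ge0 => x _; rewrite lee_fin invr_ge0 ltW// sqr1_gt0.
Qed.

(** Makes the inverse bracket a majorant that is stable under translations of length at most 1, for
    the Taylor remainder in [integral_DD_eq0]. *)
Lemma japanese_shift d (x : 'rV[R]_d) i (s : R) : 0 <= s <= 1 ->
  japanese x <= 3 * japanese (x + s *: delta_mx 0 i).
Proof.
move=> /andP[s0 s1]; rewrite /japanese (bigD1 i)//= [in leRHS](bigD1 i)//=.
rewrite (eq_bigr (fun j => 1 + (x + s *: delta_mx 0 i) 0 j ^+ 2)); last first.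
  by move=> j ji; rewrite !mxE (negbTE ji) andbF mulr0 addr0.
rewrite mulrA ler_wpM2r//.
  by apply: prodr_ge0 => j _; rewrite ltW// sqr1_gt0.
rewrite !mxE !eqxx mulr1.
(* The certificate is [3(1 + (x+s)^2) - (1 + x^2) = 2(x + 3s/2)^2 + 2 - 3s^2/2]. *)
have h1 : 0 <= (x 0 i + 3 / 2 * s) ^+ 2 by exact: sqr_ge0.
have h2 : s * s <= 1 by nra.
by rewrite !expr2 in h1 *; nra.
Qed.

Lemma schw_japanese d (u : 'rV[R]_d -> R) : schw u ->
  exists2 C : R, 0 <= C & forall x, `|u x| <= C * (japanese x)^-1.
Proof.
move=> hu; have h := OM_schw_mul (OM_japanese d) hu.
have [C hC] := h.2 [::] 0%N; exists C.
  by apply: le_trans (hC 0); rewrite mulr_ge0// ?exprn_ge0 ?enorm_ge0.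
move=> x; rewrite ler_pdivlMr ?japanese_gt0// mulrC.
by have := hC x; rewrite expr0 mul1r /= normrM (ger0_norm (ltW (japanese_gt0 x))).
Qed.

Lemma le_japanese_lty d (u : 'rV[R]_d -> R) (C : R) : 
  (forall x, 0 <= u x <= C * (japanese x)^-1) -> (\int[mu d]_x (u x)%:E < +oo)%E.
Proof.
move=> h.
apply: (@le_lt_trans _ _ (\int[mu d]_x ((C%:E * ((japanese x)^-1)%:E)))%E).
  apply: ge0_le_integral_nomeas => x _; have /andP[h1 h2] := h x.
    by rewrite lee_fin.
  by rewrite -EFinM lee_fin.
have C0 : 0 <= C.
  have /andP[h1 h2] := h 0; have := le_trans h1 h2.
  by rewrite pmulr_lge0// invr_gt0 japanese_gt0.
rewrite ge0_integralZl//; last 2 first.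
- by apply/measurable_EFinP; exact: measurable_japaneseV.
- by move=> v _; rewrite lee_fin invr_ge0 ltW// japanese_gt0.
by rewrite lte_mul_pinfty// ?lee_fin// integral_japaneseV_lty.
Qed.

Lemma schw_L1 d (u : 'rV[R]_d -> R) : schw u -> (\int[mu d]_x `|u x|%:E < +oo)%E.
Proof.
move=> hu; have [C C0 hC] := schw_japanese hu.
by apply: (@le_japanese_lty _ _ C) => x; rewrite normr_ge0 hC.
Qed.

Lemma schw_measurable d (u : 'rV[R]_d -> R) : schw u -> measurable_fun setT u.
Proof. by move=> [su _]; exact: smooth_measurable. Qed.

Lemma schw_integrable d (u : 'rV[R]_d -> R) : schw u ->
  (mu d).-integrable setT (EFin \o u).
Proof.
move=> hu; apply/integrableP; split; last exact: schw_L1.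
by apply/measurable_EFinP; exact: schw_measurable.
Qed.

End japanese_bracket.

Section taylor.
Context {R : realType}.

(** Two applications of the mean value theorem, at the price of the factor 1/2 of Taylor's
    formula. *)
Lemma taylor2_pos (f f1 f2 : R -> R) (M h : R) : 0 <= h ->
  (forall x : R, is_derive x 1 f (f1 x)) -> (forall x : R, is_derive x 1 f1 (f2 x)) ->
  (forall x, 0 <= x <= h -> `|f2 x| <= M) ->
  `|f h - f 0 - h * f1 0| <= M * h ^+ 2.
Proof.
move=> h0 df df1 hM.
have ct (g g1 : R -> R) b : (forall x : R, is_derive x 1 g (g1 x)) -> {within `[0, b], continuous g}.
  move=> dg; apply: continuous_subspaceT => x.
  by apply: differentiable_continuous; apply/derivable1_diffP; apply: ex_derive.
have [c] := MVT_segment h0 (fun x _ => df x) (ct _ _ _ df).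
rewrite in_itv/= subr0 => /andP[c0 ch] ->.
have [e] := MVT_segment c0 (fun x _ => df1 x) (ct _ _ _ df1).
rewrite in_itv/= subr0 => /andP[e0 ec] fe.
rewrite [h * _]mulrC -mulrBl fe normrM (ger0_norm h0) expr2 mulrA ler_wpM2r//.
rewrite normrM (ger0_norm c0); apply: ler_pM => //.
by apply: hM; rewrite e0 (le_trans ec).
Qed.

Lemma taylor2 (f f1 f2 : R -> R) (M h : R) :
  (forall x : R, is_derive x 1 f (f1 x)) -> (forall x : R, is_derive x 1 f1 (f2 x)) ->
  (forall x, `|f2 x| <= M) ->
  `|f h - f 0 - h * f1 0| <= M * h ^+ 2.
Proof.
move=> df df1 hM; have [h0|h0] := leP 0 h.
  by apply: (taylor2_pos h0 df df1) => x _; exact: hM.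
have dN (g g1 : R -> R) : (forall x : R, is_derive x 1 g (g1 x)) ->
    forall x : R, is_derive x 1 (fun y => g (- y)) (- g1 (- x)).
  move=> dg x; have := @is_derive1_comp _ g -%R x (g1 (- x)) (- 1) (dg (- x)).
  rewrite mulrN1; apply; exact: is_deriveNid.
have hN : 0 <= - h by rewrite oppr_ge0 ltW.
have d1 := dN _ _ df.
have d2 : forall x : R, is_derive x 1 (fun y => - f1 (- y)) (f2 (- x)).
  move=> x; have := is_deriveN (dN _ _ df1 x).
  by rewrite opprK.
have := taylor2_pos hN d1 d2 (fun x _ => hM (- x)).
by rewrite opprK oppr0 mulrNN sqrrN.
Qed.

Lemma cos_taylor2 (a h : R) : `|cos (a + h) - cos a - h * cos (a + pi / 2)| <= h ^+ 2.
Proof.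
have d1 (x : R) : is_derive x 1 (fun y => cos (a + y)) (cos (a + x + pi / 2)).
  have := @is_derive1_comp _ cos (fun y => a + y) x (- sin (a + x)) 1 (is_derive_cos _).
  rewrite mulr1 cosDpihalf; apply.
  have := is_deriveD (is_derive_cst a x 1) (is_derive_id x (1 : R)).
  by rewrite add0r.
have d2 (x : R) : is_derive x 1 (fun y => cos (a + y + pi / 2)) (cos (a + x + pi / 2 + pi / 2)).
  have := @is_derive1_comp _ cos (fun y => a + y + pi / 2) x (- sin (a + x + pi / 2)) 1 (is_derive_cos _).
  rewrite mulr1 [cos (_ + _ + _)]cosDpihalf; apply.
  have := is_deriveD (is_deriveD (is_derive_cst a x 1) (is_derive_id x (1 : R))) (is_derive_cst (pi / 2) x 1).
  by rewrite add0r addr0.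
have := @taylor2 _ _ _ 1 h d1 d2 (fun x => _).
by rewrite addr0 mul1r; apply => x; rewrite ler_norml cos_geN1 cos_le1.
Qed.

End taylor.

(** * Integrals of derivatives vanish *)

Section integration_by_parts.
Context {R : realType} {d : nat}.
Local Notation mu := (@lebesgue_rV R d).
Implicit Types (x xi : 'rV[R]_d) (u v : 'rV[R]_d -> R).

Lemma is_derive_line i u x (s : R) : smooth u ->
  is_derive s 1 (fun s : R => u (x + s *: delta_mx 0 i)) (DD i u (x + s *: delta_mx 0 i)).
Proof.
move=> su.
have E : (fun h : R => h^-1 *: (((fun s : R => u (x + s *: delta_mx 0 i)) \o shift s) (h *: 1)
      - u (x + s *: delta_mx 0 i))) =
    (fun h => h^-1 *: ((u \o shift (x + s *: delta_mx 0 i)) (h *: delta_mx 0 i)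
      - u (x + s *: delta_mx 0 i))).
  apply/funext => h; congr (_ *: (u _ - _)) => /=.
  by rewrite scalerDl addrCA -[h *: 1]/(h * 1) mulr1.
have du : derivable u (x + s *: delta_mx 0 i) (delta_mx 0 i).
  exact: diff_derivable (smooth_differentiable _ su).
apply: DeriveDef.
  by move: du; rewrite /derivable E.
by rewrite /DD /derive E.
Qed.

(** By translation invariance the integral of [u(x + e e_i) - u(x)] is 0. The second-order remainder
    has an integrable majorant of size [e^2], so the integral of the derivative is at most [e K] for
    every small [e]. *)
Lemma integral_DD_eq0 i u : schw u -> (\int[mu]_x DD i u x)%R = 0.
Proof.
move=> hu; have su := hu.1.
have h1 := schw_DD i hu; have h2 := schw_DD i h1.
have [C C0 hC] := schw_japanese h2.
have [K [K0 hK]] : exists K : R, 0 <= K /\ \int[mu]_x (3 * C * (japanese x)^-1) = K.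
  eexists; split; last by []; apply: Rintegral_ge0 => x _.
  by rewrite !mulr_ge0// invr_ge0 ltW// japanese_gt0.
have mJ : measurable_fun setT (fun x : 'rV[R]_d => 3 * C * (japanese x)^-1).
  by apply: measurable_funM => //; exact: measurable_japaneseV.
have IJ : mu.-integrable setT (EFin \o (fun x => 3 * C * (japanese x)^-1)).
  apply/integrableP; split; first exact/measurable_EFinP.
  apply: (@le_japanese_lty _ _ _ (3 * C)) => x /=.
  by rewrite ger0_norm ?lexx ?normr_ge0// !mulr_ge0// invr_ge0 ltW// japanese_gt0.
have Is e : mu.-integrable setT (EFin \o (fun x => u (x + e *: delta_mx 0 i))).
  apply/integrableP; split.
    apply/measurable_EFinP; apply: (measurableT_comp (schw_measurable hu)).
    exact: measurable_rVD.
  have := schw_L1 hu; rewrite -(integral_rV_shift (e *: delta_mx 0 i))//.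
  by apply/measurable_EFinP; apply: measurableT_comp => //; exact: schw_measurable.
have Iu := schw_integrable hu; have I1 := schw_integrable h1.
have IB (f g : 'rV[R]_d -> R) : mu.-integrable setT (EFin \o f) ->
    mu.-integrable setT (EFin \o g) -> mu.-integrable setT (EFin \o (fun x => f x - g x)).
  by move=> If Ig; exact: (integrableB measurableT If Ig).
have IZ (f : 'rV[R]_d -> R) c : mu.-integrable setT (EFin \o f) ->
    mu.-integrable setT (EFin \o (fun x => c * f x)).
  by move=> If; exact: (integrableZl measurableT c If).
have main e : 0 < e <= 1 -> `|\int[mu]_x DD i u x| <= e * K.
  move=> /andP[e0 e1].
  have E0 : (\int[mu]_x (u (x + e *: delta_mx 0 i) - u x))%R = 0.
    rewrite RintegralB//; apply/eqP; rewrite subr_eq0; apply/eqP.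
    rewrite /Rintegral (integral_rV_shift_signed (e *: delta_mx 0 i) (f := EFin \o u))//.
    by apply/measurable_EFinP; exact: schw_measurable.
  have -> : (\int[mu]_x DD i u x)%R = - e^-1 *
      (\int[mu]_x (u (x + e *: delta_mx 0 i) - u x - e * DD i u x))%R.
    rewrite (RintegralB _ (IB _ _ (Is e) Iu) (IZ _ e I1))// E0 sub0r RintegralZl//.
    by rewrite mulrNN mulrA mulVf ?mul1r// gt_eqF.
  set X := (X in `|_ * X|).
  have -> : `|- e^-1 * X| = e^-1 * `|X|.
    by rewrite normrM normrN (ger0_norm (_ : 0 <= e^-1))// invr_ge0 ltW.
  rewrite ler_pdivrMl// mulrA -expr2 /X.
  apply: le_trans (le_normr_Rintegral _ _) _ => //.
    exact: IB (IB _ _ (Is e) Iu) (IZ _ e I1).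
  rewrite -hK -RintegralZl//; apply: le_Rintegral => //.
  - have := integrable_norm (IB _ _ (IB _ _ (Is e) Iu) (IZ _ e I1)); exact.
  - exact: IZ.
  move=> x _.
  have := @taylor2_pos _ (fun s => u (x + s *: delta_mx 0 i))
    (fun s => DD i u (x + s *: delta_mx 0 i))
    (fun s => DD i (DD i u) (x + s *: delta_mx 0 i)) (3 * C * (japanese x)^-1) e
    (ltW e0) (fun s => is_derive_line i x s su) (fun s => is_derive_line i x s (smooth_DD i su)).
  rewrite scale0r addr0 [_ * e ^+ 2]mulrC; apply => s /andP[s0 se].
  apply: le_trans (hC _) _; rewrite [3 * C]mulrC -mulrA ler_wpM2l//.
  rewrite -[leLHS]mul1r ler_pdivrMr ?japanese_gt0// mulrAC ler_pdivlMr ?japanese_gt0//.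
  by rewrite mul1r; apply: japanese_shift; rewrite s0 (le_trans se).
apply/eqP; rewrite -normr_le0; apply/ler_addgt0Pr => e e0; rewrite add0r.
have K1 : 0 < K + 1 by rewrite ltr_wpDl.
pose e' := Num.min 1 (e / (K + 1)).
have e'0 : 0 < e' by rewrite lt_min ltr01 divr_gt0.
apply: le_trans (main e' _) _; first by rewrite e'0 ge_min lexx.
apply: (@le_trans _ _ (e / (K + 1) * (K + 1))).
  by apply: ler_pM => //; rewrite ?(ltW e'0)// ?ge_min ?lexx ?orbT// lerDl.
by rewrite divfK// gt_eqF.
Qed.

End integration_by_parts.

(** * The Fourier transform of Schwartz functions *)
Lemma littleo_differentiable (R : realType) (V W : normedModType R) (r : V -> W) x :
  (forall e, 0 < e -> \forall v \near 0, `|r (v + x) - r x| <= e * `|v|) ->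
  differentiable r x /\ 'd r x = (fun=> 0) :> (V -> W).
Proof.
move=> h.
have eqr : r \o shift x = cst (r x) + (\0 : {linear V -> W}) +o_ 0 id.
  apply/eqaddoP => e e0; have := h e e0; apply: filterS => v hv.
  by rewrite -[X in `|X|]/(r (v + x) - (r x + 0)) addr0.
have d0 : 'd r x = \0 :> (V -> W) by apply: diff_unique => //; exact: cst_continuous.
by split=> //; apply/diff_locallyP; split; rewrite d0//; exact: cst_continuous.
Qed.

Section frechet.
Context {R : realType} {d : nat}.
Implicit Types (x v w : 'rV[R]_d).

Lemma coord_le_norm (v : 'rV[R]_d) i : `|v 0 i| <= `|v|.
Proof.
rewrite [leRHS]/Num.norm/= mx_normrE.
by apply: (le_bigmax_cond _ (fun ij : 'I_1 * 'I_d => `|v ij.1 ij.2|) (j := (0, i))).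
Qed.

Lemma sum_coord_le_norm (v : 'rV[R]_d) : \sum_(i < d) `|v 0 i| <= d%:R * `|v|.
Proof.
apply: le_trans (ler_sum _ (fun i _ => coord_le_norm v i)) _.
by rewrite (sumr_const (predT : pred 'I_d)) cardT size_enum_ord -[X in X <= _]mulr_natl.
Qed.

(** Frechet differentiability from a single quadratic estimate: after subtracting the linear part,
    the function has increments of order [|v|^2] and hence derivative 0. *)
Lemma quadratic_differentiable (f : 'rV[R]_d -> R) x w (C : R) :
  (forall v, `|f (x + v) - f x - dotv v w| <= C * `|v| ^+ 2) ->
  differentiable f x /\ forall i, DD i f x = w 0 i.
Proof.
move=> h; pose r : 'rV[R]_d -> R^o := fun y => f y - dotv y w.
have dg : differentiable (fun y => dotv y w) x by exact: differentiable_dotv.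
have hr v : `|r (v + x) - r x| <= C * `|v| ^+ 2.
  rewrite /r [v + x]addrC dotvDl.
  by rewrite (_ : _ - (f x - _) = f (x + v) - f x - dotv v w) ?h//; ring.
have [|dr d0] := @littleo_differentiable _ _ _ r x.
  move=> e e0; have [C0|C0] := leP C 0.
    near=> v; apply: le_trans (hr v) _.
    by apply: (@le_trans _ _ 0); [rewrite mulr_le0_ge0|rewrite mulr_ge0// ltW].
  near=> v; apply: le_trans (hr v) _.
  rewrite expr2 mulrA ler_wpM2r// mulrC -ler_pdivlMr//.
  near: v; apply/nbhs_ballP; exists (e / C) => /=; first exact: divr_gt0.
  by move=> v; rewrite mx_norm_ball /ball_/= sub0r normrN => /ltW.
have fE : f = fun y => r y + dotv y w by apply/funext => y; rewrite /r subrK.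
split => [|i]; first by rewrite fE; exact: differentiableD.
rewrite fE DD_add// DD_dotv /DD deriveE//.
by rewrite d0 add0r.
Unshelve. all: by end_near. Qed.

End frechet.

Section real_integral_sum.
Context {R : realType} d' (T : measurableType d') (mu : {measure set T -> \bar R}).

Lemma Rintegral_sum (I : Type) (s : seq I) (h : I -> T -> R) :
  (forall i, mu.-integrable setT (EFin \o h i)) ->
  mu.-integrable setT (EFin \o (fun x => \sum_(i <- s) h i x)) /\
  (\int[mu]_x (\sum_(i <- s) h i x) = \sum_(i <- s) \int[mu]_x h i x)%R.
Proof.
move=> Ih; elim: s => [|i s [ih1 ih2]].
  split; first by under eq_fun do rewrite big_nil; exact: integrable0.
  rewrite big_nil; under eq_Rintegral do rewrite big_nil.
  by rewrite /Rintegral integral0.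
split.
  under eq_fun do rewrite big_cons.
  exact: (integrableD measurableT (Ih i) ih1).
under eq_Rintegral do rewrite big_cons.
by rewrite RintegralD// big_cons ih2.
Qed.

End real_integral_sum.

Section real_fourier.
Context {R : realType} {d : nat}.
Local Notation mu := (@lebesgue_rV R d).
Implicit Types (x xi : 'rV[R]_d) (u v : 'rV[R]_d -> R) (tau : R).

Definition phase tau xi x : R := cos (2 * pi * dotv x xi + tau).

(* The offset [tau] makes the cosine and the sine transform instances of one definition. *)
Definition Ft tau u xi : R := (\int[mu]_x (u x * phase tau xi x))%R.

Lemma bounded_cos : bounded_family (fun k (y : R) => cos (y + k%:R * (pi / 2))).
Proof.
split=> [k y|k]; last by exists 1 => y; rewrite ler_norml cos_geN1 cos_le1.
have -> : y + k.+1%:R * (pi / 2) = y + k%:R * (pi / 2) + pi / 2 by rewrite -natr1; ring.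
have := @is_derive1_comp _ cos (fun y => y + k%:R * (pi / 2)) y (- sin (y + k%:R * (pi / 2))) 1 (is_derive_cos _).
rewrite mulr1 cosDpihalf; apply.
have := is_deriveD (is_derive_id y (1 : R)) (is_derive_cst (k%:R * (pi / 2)) y 1).
by rewrite addr0.
Qed.

Lemma OM_phase tau xi : OM (phase tau xi).
Proof.
rewrite (_ : phase tau xi = fun x => (fun k (y : R) => cos (y + k%:R * (pi / 2))) 0%N
    (dotv x ((2 * pi) *: xi) + tau)); first exact: (OM_family 0 _ _ bounded_cos).
by apply/funext => x; rewrite /phase mul0r addr0 dotvZr.
Qed.

Lemma phase_le1 tau xi x : `|phase tau xi x| <= 1.
Proof. by rewrite ler_norml cos_geN1 cos_le1. Qed.

Lemma DD_phase i tau xi x : DD i (phase tau xi) x =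
  2 * pi * xi 0 i * phase (tau + pi / 2) xi x.
Proof.
have dl : differentiable (fun x => 2 * pi * dotv x xi + tau) x.
  by apply: differentiableD => //; apply: differentiableM => //; exact: differentiable_dotv.
rewrite (DD_comp1 i dl (is_derive_cos _)) /phase addrA cosDpihalf.
rewrite DD_add ?DD_cst ?addr0//; last by apply: differentiableM => //; exact: differentiable_dotv.
by rewrite DD_mul ?DD_cst ?DD_dotv ?mul0r ?add0r 1?mulrC//; exact: differentiable_dotv.
Qed.

Lemma schw_phase tau xi u : schw u -> schw (fun x => u x * phase tau xi x).
Proof.
move=> hu; under eq_fun do rewrite mulrC.
by apply: OM_schw_mul => //; exact: OM_phase.
Qed.

Lemma schw_coord i u : schw u -> schw (fun x => x 0 i * u x).
Proof. by apply: OM_schw_mul; exact: OM_coord. Qed.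

Lemma Ft_bound u : schw u -> exists C : R, forall tau xi, `|Ft tau u xi| <= C.
Proof.
move=> hu; exists (\int[mu]_x `|u x|)%R => tau xi.
have I1 := schw_integrable (schw_phase tau xi hu).
apply: le_trans (le_normr_Rintegral _ I1) _ => //.
apply: le_Rintegral => //.
- exact: (integrable_norm I1).
- exact: (integrable_norm (schw_integrable hu)).
by move=> x _; rewrite normrM ler_piMr ?phase_le1.
Qed.

(** The second-order estimate for the cosine is integrated against [u]; differentiating the cosine
    advances the offset by [pi / 2]. *)
Lemma Ft_differentiable tau u xi : schw u -> differentiable (Ft tau u) xi /\
  forall i, DD i (Ft tau u) xi = 2 * pi * Ft (tau + pi / 2) (fun x => x 0 i * u x) xi.
Proof.
move=> hu.
pose w : 'rV[R]_d := \row_i (2 * pi * Ft (tau + pi / 2) (fun x => x 0 i * u x) xi).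
have hE : schw (fun x => dotv x x * u x).
  have -> : (fun x => dotv x x * u x) = fun x => \sum_(i < d) x 0 i * (x 0 i * u x).
    by apply/funext => x; rewrite mulr_suml; apply: eq_bigr => i _; rewrite mulrA.
  elim: (index_enum _) => [|i s ih].
    under eq_fun do rewrite big_nil.
    have := schwZ 0 hu; congr schw; apply/funext => x; exact: mul0r.
  under eq_fun do rewrite big_cons.
  by apply: schwD => //; do 2 apply: schw_coord.
(* The factor [d^2] arises in passing from the sum of the [|v_i|] to the sup norm of [v], and
   [4 pi^2] from the square of the phase increment [2 pi x.v]. *)
pose K := (4 * pi ^+ 2 * d%:R ^+ 2 * \int[mu]_x `|dotv x x * u x|)%R.
have [|dF DF] := @quadratic_differentiable _ _ (Ft tau u) xi w K; last first.
- by split=> // i; rewrite DF mxE.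
move=> v; rewrite /Ft.
have Iphi i : mu.-integrable setT (EFin \o (fun x => v 0 i *
    (2 * pi * (x 0 i * u x * phase (tau + pi / 2) xi x)))).
  apply: schw_integrable; apply: schwZ; apply: schwZ; apply: schw_phase.
  exact: schw_coord.
have -> : dotv v w = (\int[mu]_x (2 * pi * dotv x v * u x * phase (tau + pi / 2) xi x))%R.
  rewrite /dotv; under [RHS]eq_Rintegral => x _.
    rewrite (_ : _ * _ = \sum_(i < d) v 0 i * (2 * pi * (x 0 i * u x * phase (tau + pi / 2) xi x))).
      over.
    rewrite mulr_sumr !mulr_suml; apply: eq_bigr => i _; ring.
  rewrite (Rintegral_sum _ Iphi).2; apply: eq_bigr => i _.
  rewrite mxE RintegralZl//; last first.
    by apply: schw_integrable; apply: schwZ; apply: schw_phase; exact: schw_coord.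
  rewrite RintegralZl//; apply: schw_integrable; apply: schw_phase; exact: schw_coord.
have I0 := schw_integrable (schw_phase tau xi hu).
have I1 := schw_integrable (schw_phase tau (xi + v) hu).
have I2 : mu.-integrable setT (EFin \o (fun x => 2 * pi * dotv x v * u x * phase (tau + pi / 2) xi x)).
  have := (Rintegral_sum (index_enum _) Iphi).1; apply: eq_integrable => // x _ /=.
  by congr EFin; rewrite mulr_sumr !mulr_suml; apply: eq_bigr => i _; ring.
have I01 : mu.-integrable setT (EFin \o (fun x => u x * phase tau (xi + v) x - u x * phase tau xi x)).
  exact: (integrableB measurableT I1 I0).
have I012 := integrableB measurableT I01 I2.
rewrite -RintegralB// -RintegralB//.
apply: le_trans (le_normr_Rintegral _ I012) _ => //.
have IE := integrable_norm (schw_integrable hE).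
rewrite /K mulrAC -RintegralZl//; apply: le_Rintegral => //.
- exact: (integrable_norm I012).
- exact: (integrableZl measurableT _ IE).
move=> x _.
have -> : u x * phase tau (xi + v) x - u x * phase tau xi x -
    2 * pi * dotv x v * u x * phase (tau + pi / 2) xi x =
    u x * (phase tau (xi + v) x - phase tau xi x - 2 * pi * dotv x v * phase (tau + pi / 2) xi x).
  by ring.
rewrite normrM /phase dotvDr mulrDr.
have := cos_taylor2 (2 * pi * dotv x xi + tau) (2 * pi * dotv x v).
rewrite -[_ + tau + pi / 2]addrA [_ + 2 * pi * _]addrAC => h.
apply: le_trans (ler_wpM2l (normr_ge0 _) h) _.
rewrite exprMn normrM [`|dotv x x|]ger0_norm ?dotvv_ge0//.
have : dotv x v ^+ 2 <= dotv x x * (d%:R * `|v|) ^+ 2.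
  rewrite -sqr_enorm -exprMn -[leLHS]real_normK ?num_real//.
  rewrite lerXn2r ?nnegrE ?mulr_ge0 ?enorm_ge0//.
  apply: le_trans (dotv_le _ _) _; rewrite ler_wpM2l ?enorm_ge0//.
  exact: sum_coord_le_norm.
move=> /(ler_wpM2l (_ : 0 <= `|u x| * (2 * pi) ^+ 2)) h2.
rewrite mulrA; apply: le_trans (h2 _) _; first by rewrite mulr_ge0// sqr_ge0.
by rewrite le_eqVlt; apply/orP; left; apply/eqP; ring.
Qed.

(** With the offset lowered by [pi / 2], the derivative of the phase is the phase of offset [tau];
    the integral of the derivative of the product vanishes. *)
Lemma Ft_parts i tau u xi : schw u ->
  2 * pi * xi 0 i * Ft tau u xi = - Ft (tau - pi / 2) (DD i u) xi.
Proof.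
move=> hu; have hw := schw_phase (tau - pi / 2) xi hu.
have := integral_DD_eq0 i hw.
rewrite DD_mul_smooth; [|exact: hu.1|exact: (OM_tame (OM_phase _ _)).1].
have h1 := schw_phase (tau - pi / 2) xi (schw_DD i hu).
have h2 := schwZ (2 * pi * xi 0 i) (schw_phase tau xi hu).
have E x : u x * DD i (phase (tau - pi / 2) xi) x = 2 * pi * xi 0 i * (u x * phase tau xi x).
  by rewrite DD_phase subrK; ring.
under eq_Rintegral do rewrite E.
rewrite RintegralD//; [|exact: schw_integrable..].
rewrite RintegralZl//; last exact: schw_integrable (schw_phase _ _ hu).
by move/eqP; rewrite addr_eq0 -/(Ft _ _ _) => /eqP ->; rewrite opprK.
Qed.

(** Each power of [|xi|] is traded for a derivative of [u], after bounding [|xi|] by the sum of the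
    moduli of its coordinates. *)
Lemma rapid_Ft tau u : schw u -> rapid (Ft tau u).
Proof.
move=> hu k; elim: k tau u hu => [|k ih] tau u hu.
  by have [C h] := Ft_bound hu; exists C => x; rewrite expr0 mul1r.
have /choice[C hC] : forall i, exists C, forall x,
    enorm x ^+ k * `|Ft (tau - pi / 2) (DD i u) x| <= C.
  by move=> i; apply: ih; exact: schw_DD.
exists ((2 * pi)^-1 * \sum_(i < d) C i) => x.
have pi2 : 0 < 2 * pi :> R by rewrite mulr_gt0 ?pi_gt0.
rewrite -ler_pdivrMl ?invr_gt0// invrK.
apply: (@le_trans _ _ (\sum_(i < d) enorm x ^+ k * `|2 * pi * x 0 i * Ft tau u x|)).
  have -> : \sum_(i < d) enorm x ^+ k * `|2 * pi * x 0 i * Ft tau u x| =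
      2 * pi * (enorm x ^+ k * `|Ft tau u x|) * \sum_(i < d) `|x 0 i|.
    rewrite mulr_sumr; apply: eq_bigr => i _.
    by rewrite !normrM (gtr0_norm (pi_gt0 R)) (ger0_norm (_ : 0 <= 2))//; ring.
  rewrite exprS (_ : _ * (_ * _ * _) = 2 * pi * (enorm x ^+ k * `|Ft tau u x|) * enorm x); last by ring.
  by rewrite ler_wpM2l ?enorm_le_sum// mulr_ge0 ?(ltW pi2)// mulr_ge0// exprn_ge0// enorm_ge0.
apply: ler_sum => i _; rewrite Ft_parts// normrN; exact: hC.
Qed.

Lemma Ft_schw tau u : schw u -> schw (Ft tau u).
Proof.
move=> hu; pose K v := exists (c : R) (t : R) w, schw w /\ v = fun xi => c * Ft t w xi.
apply: (@closed_schw _ _ K); last first.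
- by exists 1, tau, u; split => //; apply/funext => x; rewrite mul1r.
- move=> v [c [t [w [hw ->]]]]; apply: rapid_mul; first exact: polybnd_cst.
  exact: rapid_Ft.
- move=> v i [c [t [w [hw ->]]]].
  exists (c * (2 * pi)), (t + pi / 2), (fun x => x 0 i * w x).
  split; first exact: schw_coord.
  apply/funext => x; have [dF DF] := Ft_differentiable t x hw.
  by rewrite DD_mul// DD_cst mul0r add0r DF mulrA.
- move=> v [c [t [w [hw ->]]]] x; have [dF DF] := Ft_differentiable t x hw.
  exact: differentiableM.
Qed.

End real_fourier.

(** * Gaussians *)
Section gaussian_integral.
Context {R : realType}.
Local Notation lam := (@lebesgue_measure R).
Local Notation mu n := (@lebesgue_rV R n).

(** The value [(pi / l)^{n/2}] of the Gaussian integral of rate [l] on R^n. *)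
Definition gaussI (n : nat) (l : R) : R := Num.sqrt (pi / l) ^+ n.

Lemma measurable_gauss n (l : R) :
  measurable_fun setT (fun x : 'rV[R]_n => expR (- l * dotv x x)).
Proof.
apply: measurableT_comp; first exact: measurable_expR.
apply: measurable_funM => //; exact: measurable_dotv.
Qed.

Lemma integral_gauss1 (l : R) : 0 < l ->
  (\int[lam]_x (expR (- l * x ^+ 2))%:E = (Num.sqrt (pi / l))%:E)%E.
Proof.
move=> l0; have sl : 0 < Num.sqrt l by rewrite sqrtr_gt0.
transitivity (\int[lam]_x (gauss_fun (Num.sqrt l * x + 0))%:E)%E.
  by apply: eq_integral => x _; rewrite /gauss_fun addr0 exprMn sqr_sqrtr ?ltW// mulNr.
rewrite (@integral_affine R (Num.sqrt l) 0 (fun y => (gauss_fun y)%:E))//.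
- by rewrite integralT_gauss -EFinM sqrtrM ?pi_ge0// sqrtrV ?ltW// mulrC.
- by apply/measurable_EFinP; exact: measurable_gauss_fun.
by move=> x; rewrite lee_fin expR_ge0.
Qed.

Lemma dotv_rV_cons n (x : R) (v : 'rV[R]_n) :
  dotv (rV_cons (x, v)) (rV_cons (x, v)) = x ^+ 2 + dotv v v.
Proof.
rewrite {1}/dotv big_ord_recl rV_cons0 expr2; congr (_ + _).
by apply: eq_bigr => i _; rewrite rV_cons_lift.
Qed.

Lemma integral_gauss n (l : R) : 0 < l ->
  (\int[mu n]_x (expR (- l * dotv x x))%:E = (gaussI n l)%:E)%E.
Proof.
move=> l0; have mg k : measurable_fun setT (fun x : 'rV[R]_k => (expR (- l * dotv x x))%:E).
  by apply/measurable_EFinP; exact: measurable_gauss.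
elim: n => [|n ih].
  by rewrite integral_rV0// /dotv big_ord0 mulr0 expR0 /gaussI expr0.
rewrite integral_rV_cons//.
transitivity (\int[lam]_x ((gaussI n l)%:E * (expR (- l * x ^+ 2))%:E))%E.
  apply: eq_integral => x _; rewrite -ih muleC -ge0_integralZl//=.
  - by apply: eq_integral => v _; rewrite dotv_rV_cons mulrDr expRD EFinM.
  - exact: mg.
rewrite ge0_integralZl//=.
- by rewrite integral_gauss1// -EFinM /gaussI exprSr.
- apply/measurable_EFinP; apply: measurableT_comp; first exact: measurable_expR.
  by apply: measurable_funM => //; exact: measurable_funX.
- by rewrite lee_fin exprn_ge0// sqrtr_ge0.
Qed.

Lemma gaussI_gt0 n (l : R) : 0 < l -> 0 < gaussI n l.
Proof. by move=> l0; rewrite exprn_gt0// sqrtr_gt0 divr_gt0// pi_gt0. Qed.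

Lemma gaussI_dual n (l : R) : 0 < l -> gaussI n l * gaussI n (pi ^+ 2 / l) = 1.
Proof.
move=> l0; have p0 := pi_gt0 R.
rewrite /gaussI -exprMn -sqrtrM ?divr_ge0 ?ltW//.
rewrite (_ : _ * _ = 1) ?sqrtr1 ?expr1n//.
have l1 := lt0r_neq0 l0; have p1 := lt0r_neq0 p0; by rewrite invf_div [pi * (l / _)]mulrA mulf_div expr2 mulrA [l * _]mulrC mulfV// !mulf_neq0.
Qed.

Lemma gaussI_scale n (c l : R) : 0 < c -> 0 < l ->
  gaussI n (c * l) = Num.sqrt c ^- n * gaussI n l.
Proof.
move=> c0 l0; rewrite /gaussI -exprVn -exprMn -sqrtrV ?ltW// -sqrtrM ?invr_ge0 ?ltW//.
by congr (Num.sqrt _ ^+ n); rewrite invfM; ring.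
Qed.

End gaussian_integral.

Section gaussian_fourier.
Context {R : realType} {d : nat}.
Local Notation mu := (@lebesgue_rV R d).
Implicit Types (x xi : 'rV[R]_d) (u v : 'rV[R]_d -> R) (tau : R).

Lemma is_derive_ray u x (s : R) : (forall y, differentiable u y) ->
  is_derive s 1 (fun s => u (s *: x)) (\sum_(i < d) x 0 i * DD i u (s *: x)).
Proof.
move=> du.
have ds : is_diff s (fun s : R => s *: x) (fun s : R => s *: x).
  have := is_diff_scalel (s : R^o) x; exact.
have dc : is_diff (s *: x) u ('d u (s *: x)) by apply: differentiableP.
have dcomp := is_diff_comp ds dc.
have dd : derivable (u \o (fun s : R => s *: x)) s (1 : R).
  by apply: diff_derivable; case: dcomp.
apply: (@DeriveDef _ _ _ _ _ _ _ dd).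
rewrite deriveE; last by case: dcomp.
have [_ ->] := dcomp => /=; rewrite scale1r.
rewrite [X in 'd u _ X]row_sum_delta linear_sum; apply: eq_bigr => i _.
by rewrite linearZ/= -(deriveE (delta_mx 0 i) (du _)).
Qed.

Lemma zero_gradient_cst u : (forall x, differentiable u x) ->
  (forall i x, DD i u x = 0) -> forall x, u x = u 0.
Proof.
move=> du D0 x; rewrite -[x in LHS]scale1r -[0 in RHS](scale0r x).
apply: (@is_derive_0_is_cst R (fun s => u (s *: x))) => s.
have := is_derive_ray x s du; rewrite big1// => i _.
by rewrite D0 mulr0.
Qed.

Lemma phaseDpi tau xi x : phase (tau + pi) xi x = - phase tau xi x.
Proof. by rewrite /phase addrA cosDpi. Qed.

(** The transform divided by the expected Gaussian has zero gradient: [x_i g] is a multiple of the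
    derivative of [g], and integration by parts turns this derivative into a factor [xi_i]. The
    constant is found at [xi = 0]. *)
Lemma Ft_gauss tau (l : R) xi : 0 < l ->
  Ft tau (fun x => expR (- l * dotv x x)) xi =
  gaussI d l * cos tau * expR (- (pi ^+ 2 / l) * dotv xi xi).
Proof.
move=> l0; have hg := @gauss_schw R d l l0; set g := fun x => _ in hg *.
have gd x : differentiable (fun x => expR (pi ^+ 2 / l * dotv x x)) x.
  apply: (differentiable_comp1 (k := expR) (u := fun x => pi ^+ 2 / l * dotv x x)).
    by apply: differentiableM => //; exact: differentiable_sqnorm.
have DF i x : DD i (Ft tau g) x = - (2 * pi ^+ 2 / l) * x 0 i * Ft tau g x.
  rewrite (Ft_differentiable tau x hg).2.
  have -> : (fun y : 'rV[R]_d => y 0 i * g y) = fun y => - (2 * l)^-1 * DD i g y.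
    apply/funext => y; rewrite /g DD_gauss; field; exact: lt0r_neq0.
  have P := Ft_parts i (tau + pi) x hg.
  have -> : Ft (tau + pi / 2) (fun y => - (2 * l)^-1 * DD i g y) x =
      - (2 * l)^-1 * Ft (tau + pi - pi / 2) (DD i g) x.
    rewrite /Ft -RintegralZl//; last exact: schw_integrable (schw_phase _ _ (schw_DD _ hg)).
    apply: eq_Rintegral => y _; rewrite mulrA; congr (_ * phase _ _ _); lra.
  have PN : Ft (tau + pi) g x = - Ft tau g x.
    rewrite /Ft -mulN1r -RintegralZl//; last exact: schw_integrable (schw_phase _ _ hg).
    by apply: eq_Rintegral => y _; rewrite phaseDpi mulN1r mulrN.
  rewrite -[Ft _ (DD i g) x]opprK -P PN; field; exact: lt0r_neq0.
pose h x := expR (pi ^+ 2 / l * dotv x x) * Ft tau g x.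
have hx : h xi = h 0.
  apply: zero_gradient_cst => [x|i x].
    by apply: differentiableM => //; exact: (Ft_differentiable _ _ hg).1.
  rewrite /h DD_mul//; last exact: (Ft_differentiable _ _ hg).1.
  rewrite DF; have := @DD_gauss R d i (- (pi ^+ 2 / l)) x; rewrite opprK => ->.
  by field; exact: lt0r_neq0.
have h0 : h 0 = gaussI d l * cos tau.
  rewrite /h dotv0l mulr0 expR0 mul1r /Ft.
  under eq_Rintegral => x _.
    rewrite /phase dotvC dotv0l mulr0 add0r mulrC; over.
  rewrite RintegralZl//; last exact: schw_integrable hg.
  by rewrite mulrC /Rintegral integral_gauss.
rewrite -h0 -hx /h mulrAC -expRD.
by rewrite mulNr subrr expR0 mul1r.
Qed.

End gaussian_fourier.

(** * The complex Fourier transform and the heat kernel *)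
Section real_valued_cint.
Context {R : realType} d (T : measurableType d) (mu : {measure set T -> \bar R}).

Lemma cint_ge0_real (r : T -> R) (c : R) :
  (\int[mu]_x (r x)%:E = c%:E)%E -> cint mu (fun x => (r x)%:C%C) = c%:C%C.
Proof.
move=> h; apply: complex_eq => /=; first by rewrite /Rintegral h.
by rewrite /Rintegral integral0.
Qed.

Lemma cL1_ge0_real (r : T -> R) (c : R) : measurable_fun setT r ->
  (forall x, 0 <= r x) -> (\int[mu]_x (r x)%:E = c%:E)%E -> cL1 mu (fun x => (r x)%:C%C).
Proof.
move=> mr r0 rc; split; first exact: cmeas_real.
under eq_integral => x _ do rewrite normc_real ger0_norm//.
by rewrite rc ltry.
Qed.

End real_valued_cint.

Section complex_schwartz.
Context {R : realType} {d : nat}.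
Local Notation mu := (@lebesgue_rV R d).
Implicit Types (x xi : 'rV[R]_d) (f g : 'rV[R]_d -> R[i]).

Lemma schwartzP f :
  schwartz f <-> schw (fun x => Re (f x)) /\ schw (fun x => Im (f x)).
Proof.
split=> [[[sR sI] hs]|[[sR rR] [sI rI]]].
  have hb k a : exists C : R, forall x, enorm x ^+ k * normc (cpartials a f x) <= C.
    have := hs (k, a); rewrite /schwartz_seminorm; set S := ereal_sup _ => S1.
    have hS x : ((enorm x ^+ k * normc (cpartials a f x))%:E <= S)%E.
      by apply: ereal_sup_ubound; exists x.
    case: S S1 hS => [r| |]//=; first by move=> _ h; exists r => x; have := h x; rewrite lee_fin.
    by move=> _ h; have := h 0; rewrite leeNy_eq.
  split; split => // a k; have [C hC] := hb k a; exists C => x; apply: le_trans (hC x).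
    rewrite ler_wpM2l ?exprn_ge0 ?enorm_ge0//; exact: Re_le_normc (cpartials a f x).
  rewrite ler_wpM2l ?exprn_ge0 ?enorm_ge0//; exact: Im_le_normc (cpartials a f x).
split; first by [].
case=> k a; have [C hC] := rR a k; have [C' hC'] := rI a k.
apply: (@le_lt_trans _ _ (C + C')%:E); last by rewrite ltry.
apply: ge_ereal_sup => _ [x _ <-]; rewrite lee_fin.
apply: le_trans (lerD (hC x) (hC' x)); rewrite -mulrDr ler_wpM2l ?exprn_ge0 ?enorm_ge0//.
exact: normc_le_ReIm.
Qed.

Lemma schwartz_cmeas f : schwartz f -> cmeas f.
Proof. by move=> /schwartzP[fR fI]; split; exact: schw_measurable. Qed.

Lemma schwartz_cL1 f : schwartz f -> cL1 mu f.
Proof. by move=> /schwartzP[fR fI]; apply: cL1P; exact: schw_integrable. Qed.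

Lemma cL1_cexpi (r : 'rV[R]_d -> R) f : measurable_fun setT r -> cL1 mu f ->
  cL1 mu (fun x => f x * cexpi (r x)).
Proof.
move=> mr [mf If]; split; first by apply: cmeasM => //; exact: cmeas_cexpi.
under eq_integral => x _ do rewrite ComplexField.Normc.normcM normc_cexpi mulr1.
exact: If.
Qed.

Lemma measurable_phase (w : 'rV[R]_d) :
  measurable_fun setT (fun x : 'rV[R]_d => 2 * pi * dotv x w).
Proof. by apply: measurable_funM => //; exact: measurable_dotv. Qed.

Lemma measurable_phaseN (w : 'rV[R]_d) :
  measurable_fun setT (fun x : 'rV[R]_d => - (2 * pi * dotv x w)).
Proof. by apply: measurableT_comp => //; exact: measurable_phase. Qed.

Lemma cL1_fourier_kernel f xi : cL1 mu f ->
  cL1 mu (fun x => f x * cexpi (- (2 * pi * dotv x xi))).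
Proof. by apply: cL1_cexpi; exact: measurable_phaseN. Qed.

Lemma fourier_Ft f xi : schwartz f -> fourier f xi =
  ((Ft 0 (fun x => Re (f x)) xi + Ft (- (pi / 2)) (fun x => Im (f x)) xi) +i*
   (Ft 0 (fun x => Im (f x)) xi - Ft (- (pi / 2)) (fun x => Re (f x)) xi))%C.
Proof.
move=> /schwartzP[fR fI].
have cE x : cexpi (- (2 * pi * dotv x xi)) =
    (phase 0 xi x +i* - phase (- (pi / 2)) xi x)%C.
  rewrite /cexpi cosN sinN /phase addr0; congr (_ +i* - _)%C.
  by rewrite -[RHS]cosN opprB addrC cosDpihalf sinN opprK.
apply: complex_eq => /=.
  rewrite /Ft -RintegralD//; [|exact: schw_integrable (schw_phase _ _ _)..].
  by apply: eq_Rintegral => x _; rewrite ReM cE/= mulrN opprK.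
rewrite /Ft -RintegralB//; [|exact: schw_integrable (schw_phase _ _ _)..].
by apply: eq_Rintegral => x _; rewrite ImM cE/= mulrN addrC.
Qed.

Lemma fourier_schwartz f : schwartz f -> schwartz (fourier f).
Proof.
move=> sf; have [fR fI] := (schwartzP f).1 sf.
apply/schwartzP; split.
  under eq_fun do rewrite fourier_Ft//=.
  by apply: schwD; exact: Ft_schw.
under eq_fun do rewrite fourier_Ft//= -mulN1r.
by apply: schwD; [exact: Ft_schw|apply: schwZ; exact: Ft_schw].
Qed.

Lemma cmeas_fourier f : cmeas f -> cmeas (fourier f).
Proof.
move=> mf; apply: (@cmeas_cint R _ _ _ _ mu
  (fun p => f p.2 * cexpi (- (2 * pi * dotv p.2 p.1)))).
apply: cmeasM; first by apply: cmeas_comp => //; exact: measurable_snd.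
apply: cmeas_cexpi; apply: measurableT_comp => //; apply: measurable_funM => //.
by apply: measurable_dotv; [exact: measurable_snd|exact: measurable_fst].
Qed.

Lemma fourier_multiplication f g : cL1 mu f -> cL1 mu g ->
  cint mu (fun xi => g xi * fourier f xi) = cint mu (fun y => f y * fourier g y).
Proof.
move=> [mf If] [mg Ig].
transitivity (cint mu (fun xi => cint mu (fun y => g xi * f y * cexpi (- (2 * pi * dotv y xi))))).
  apply: eq_cint => xi; rewrite -[fourier f xi]/(cint mu _) -cintZ.
    by apply: eq_cint => y; rewrite mulrA.
  exact: cL1_fourier_kernel.
rewrite (@cint_swap R _ _ _ _ mu mu
  (fun p => g p.1 * f p.2 * cexpi (- (2 * pi * dotv p.2 p.1)))).
- apply: eq_cint => y; rewrite -[fourier g y]/(cint mu _) -cintZ.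
    by apply: eq_cint => xi /=; rewrite dotvC [g xi * _]mulrC mulrA.
  exact: cL1_fourier_kernel.
- apply: cmeasM.
    by apply: cmeasM; apply: cmeas_comp.
  apply: cmeas_cexpi; apply: measurableT_comp => //; apply: measurable_funM => //.
  by apply: measurable_dotv; [exact: measurable_snd|exact: measurable_fst].
under eq_integral => x _.
  under eq_integral => y _.
    rewrite /= !ComplexField.Normc.normcM normc_cexpi mulr1 EFinM; over.
  rewrite ge0_integralZl//=; first over.
  - by apply/measurable_EFinP; exact: measurable_normc.
  - by move=> y _; rewrite lee_fin normc_ge0.
  - by rewrite lee_fin normc_ge0.
rewrite ge0_integralZr//.
- by rewrite lte_mul_pinfty// ?ge0_fin_numE// ?integral_ge0// => x _; rewrite lee_fin normc_ge0.
- by apply/measurable_EFinP; exact: measurable_normc.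
- by move=> y _; rewrite lee_fin normc_ge0.
- by apply: integral_ge0 => x _; rewrite lee_fin normc_ge0.
Qed.

End complex_schwartz.

Section heat_kernel.
Context {R : realType} {d : nat}.
Local Notation mu := (@lebesgue_rV R d).
Implicit Types (x xi v a : 'rV[R]_d) (t : R) (f g : 'rV[R]_d -> R[i]).

(** The Fourier multiplier of the heat semigroup at time [t]. The same function, read in space, is
    the Gaussian window. *)
Definition qgauss t x : R := expR (- (4 * pi ^+ 2 * t) * dotv x x).

(* The heat kernel at time [t], written as the Fourier transform of [qgauss t]. *)
Definition heat t x : R :=
  gaussI d (4 * pi ^+ 2 * t) * expR (- (pi ^+ 2 / (4 * pi ^+ 2 * t)) * dotv x x).

Lemma qgauss_rate_gt0 t : 0 < t -> 0 < 4 * pi ^+ 2 * t.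
Proof. by move=> t0; rewrite mulr_gt0// mulr_gt0// exprn_gt0// pi_gt0. Qed.

Lemma qgauss_ge0 t x : 0 <= qgauss t x. Proof. exact: expR_ge0. Qed.

Lemma qgauss_le1 t x : 0 <= t -> qgauss t x <= 1.
Proof.
move=> t0; rewrite -expR0 ler_expR mulNr oppr_le0 mulr_ge0 ?dotvv_ge0//.
by rewrite mulr_ge0// mulr_ge0// sqr_ge0.
Qed.

Lemma measurable_qgauss t : measurable_fun setT (qgauss t).
Proof. exact: measurable_gauss. Qed.

Lemma measurable_heat t : measurable_fun setT (heat t).
Proof. by apply: measurable_funM => //; exact: measurable_gauss. Qed.

Lemma heat_ge0 t x : 0 < t -> 0 <= heat t x.
Proof. by move=> t0; rewrite mulr_ge0 ?expR_ge0// ltW// gaussI_gt0// qgauss_rate_gt0. Qed.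

Lemma heatN t x : heat t (- x) = heat t x.
Proof. by rewrite /heat dotvNl dotvNr opprK. Qed.

Lemma qgaussN t x : qgauss t (- x) = qgauss t x.
Proof. by rewrite /qgauss dotvNl dotvNr opprK. Qed.

Lemma heat_rate_gt0 t : 0 < t -> 0 < pi ^+ 2 / (4 * pi ^+ 2 * t).
Proof. by move=> t0; rewrite divr_gt0 ?qgauss_rate_gt0// exprn_gt0// pi_gt0. Qed.

Lemma heat_le t x : 0 < t -> heat t x <= gaussI d (4 * pi ^+ 2 * t).
Proof.
move=> t0; rewrite ler_piMr ?(ltW (gaussI_gt0 _ _)) ?qgauss_rate_gt0//.
have h := ltW (heat_rate_gt0 t0).
by rewrite expR_le1 mulNr oppr_le0 mulr_ge0 ?dotvv_ge0.
Qed.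

Lemma integral_qgauss t : 0 < t ->
  (\int[mu]_x (qgauss t x)%:E = (gaussI d (4 * pi ^+ 2 * t))%:E)%E.
Proof. by move=> t0; rewrite integral_gauss// qgauss_rate_gt0. Qed.

Lemma integral_heat t : 0 < t -> (\int[mu]_x (heat t x)%:E = 1)%E.
Proof.
move=> t0; have l0 := qgauss_rate_gt0 t0.
under eq_integral do rewrite EFinM.
rewrite ge0_integralZl//=.
- by rewrite integral_gauss ?heat_rate_gt0// -EFinM gaussI_dual.
- by apply/measurable_EFinP; exact: measurable_gauss.
- by rewrite lee_fin ltW// gaussI_gt0.
Qed.

Lemma cL1_qgauss t : 0 < t -> cL1 mu (fun x => (qgauss t x)%:C%C).
Proof.
move=> t0; apply: cL1_ge0_real (integral_qgauss t0); first exact: measurable_qgauss.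
by move=> x; exact: qgauss_ge0.
Qed.

Lemma cL1_heat t : 0 < t -> cL1 mu (fun x => (heat t x)%:C%C).
Proof.
move=> t0; apply: cL1_ge0_real (integral_heat t0); first exact: measurable_heat.
by move=> x; exact: heat_ge0.
Qed.

Lemma schwartz_real_gauss (l : R) : 0 < l ->
  schwartz (fun x : 'rV[R]_d => (expR (- l * dotv x x))%:C%C).
Proof.
move=> l0; apply/schwartzP; split => /=; first exact: gauss_schw.
have := schwZ 0 (@gauss_schw R d l l0); congr schw.
by apply/funext => x; rewrite mul0r.
Qed.

Lemma Ft0 tau xi : Ft tau (fun=> 0) xi = 0 :> R.
Proof.
rewrite /Ft /Rintegral; under eq_integral do rewrite mul0r.
by rewrite integral0.
Qed.

Lemma fourier_gauss (l : R) xi : 0 < l ->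
  fourier (fun x => (expR (- l * dotv x x))%:C%C) xi =
  (gaussI d l * expR (- (pi ^+ 2 / l) * dotv xi xi))%:C%C.
Proof.
move=> l0; rewrite fourier_Ft; last exact: schwartz_real_gauss.
rewrite /= !Ft0 !Ft_gauss// cosN cos_pihalf cos0 mulr1 mulr0 mul0r subrr addr0.
by [].
Qed.

Lemma fourier_qgauss t xi : 0 < t ->
  fourier (fun x => (qgauss t x)%:C%C) xi = (heat t xi)%:C%C.
Proof. by move=> t0; rewrite fourier_gauss// qgauss_rate_gt0. Qed.

Lemma fourier_heat t xi : 0 < t ->
  fourier (fun x => (heat t x)%:C%C) xi = (qgauss t xi)%:C%C.
Proof.
move=> t0; have l0 := qgauss_rate_gt0 t0; have h0 := heat_rate_gt0 t0.
transitivity ((gaussI d (4 * pi ^+ 2 * t))%:C%C *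
    fourier (fun x => (expR (- (pi ^+ 2 / (4 * pi ^+ 2 * t)) * dotv x x))%:C%C) xi).
  rewrite -[fourier _ xi]/(cint mu _) -cintZ.
    by apply: eq_cint => x; rewrite mulrA -rmorphM.
  by apply: cL1_fourier_kernel; apply: schwartz_cL1; exact: schwartz_real_gauss.
rewrite fourier_gauss// -rmorphM mulrA gaussI_dual// mul1r; congr (expR _)%:C%C.
congr (- _ * _); rewrite invf_div mulrCA mulfV ?mulr1//.
by rewrite expf_neq0// lt0r_neq0// pi_gt0.
Qed.

Lemma fourier_modulate f a v :
  fourier (fun x => f x * cexpi (2 * pi * dotv a x)) v = fourier f (v - a).
Proof.
apply: eq_cint => x; rewrite -mulrA -cexpiD; congr (_ * cexpi _).
by rewrite dotvDr dotvNr [dotv a x]dotvC; ring.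
Qed.

Lemma heat_scale (c : R) x : 0 < c -> heat (c ^+ 2) (c *: x) = c ^- d * heat 1 x.
Proof.
move=> c0; have l0 : 0 < 4 * pi ^+ 2 :> R by have := qgauss_rate_gt0 (@ltr01 R); rewrite mulr1.
have cc0 : 0 < c ^+ 2 by rewrite exprn_gt0.
rewrite /heat mulr1 [4 * _ * c ^+ 2]mulrC (gaussI_scale d cc0 l0).
rewrite sqrtr_sqr gtr0_norm// -mulrA; congr (_ * (_ * expR _)).
have alg (p e : R) : p != 0 -> - (p ^+ 2 / (c ^+ 2 * (4 * p ^+ 2))) * (c * (c * e)) =
    - (p ^+ 2 / (4 * p ^+ 2)) * e.
  by move=> p0; field; rewrite p0 lt0r_neq0.
by rewrite dotvZl dotvZr alg// lt0r_neq0// pi_gt0.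
Qed.

Lemma fourier_heat_wave t a x y : 0 < t ->
  fourier (fun xi => (heat t (xi - a))%:C%C * cexpi (2 * pi * dotv x xi)) y =
  (qgauss t (x - y))%:C%C * cexpi (2 * pi * dotv a (x - y)).
Proof.
move=> t0; pose F xi := (heat t (xi - a))%:C%C * cexpi (2 * pi * dotv x xi) *
  cexpi (- (2 * pi * dotv xi y)).
rewrite -[fourier _ y]/(cint mu F) -(cint_rV_shift a); last first.
  apply: cmeasM; last by apply: cmeas_cexpi; exact: measurable_phaseN.
  apply: cmeasM; last first.
    by apply: cmeas_cexpi; under eq_fun do rewrite dotvC; exact: measurable_phase.
  apply: cmeas_real; apply: measurableT_comp; first exact: measurable_heat.
  exact: measurable_rVB.
transitivity (cint mu (fun xi => cexpi (2 * pi * dotv a (x - y)) *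
    ((heat t xi)%:C%C * cexpi (- (2 * pi * dotv xi (y - x)))))).
  apply: eq_cint => xi; rewrite /F addrK -!mulrA [RHS]mulrCA -!cexpiD; congr (_ * cexpi _).
  rewrite !dotvDr !dotvDl !dotvNr [dotv x xi]dotvC [dotv x a]dotvC; ring.
rewrite cintZ; last by apply: cL1_fourier_kernel; exact: cL1_heat.
rewrite -[cint mu _]/(fourier _ _) fourier_heat// mulrC.
by rewrite -[y - x]opprB qgaussN.
Qed.

Lemma fourier_qgauss_wave t x y : 0 < t ->
  fourier (fun v => (qgauss t v)%:C%C * cexpi (2 * pi * dotv x v)) y = (heat t (y - x))%:C%C.
Proof. by move=> t0; rewrite fourier_modulate fourier_qgauss. Qed.

(* Localising the frequencies of [f] near [a] by a heat kernel amounts to a Gaussian window in space. *)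
Lemma heat_window t f a x : 0 < t -> cL1 mu f ->
  cint mu (fun xi => (heat t (xi - a))%:C%C * cexpi (2 * pi * dotv x xi) * fourier f xi) =
  cint mu (fun y => f y * ((qgauss t (x - y))%:C%C * cexpi (2 * pi * dotv a (x - y)))).
Proof.
move=> t0 If; rewrite fourier_multiplication//; last first.
  under eq_fun do rewrite dotvC.
  apply: cL1_cexpi; first exact: measurable_phase.
  apply: (cL1_ge0_real (c := 1)).
  - by apply: measurableT_comp; [exact: measurable_heat|exact: measurable_rVB].
  - by move=> y; exact: heat_ge0.
  rewrite (integral_rV_shift (- a) (f := fun y => (heat t y)%:E)).
  - exact: integral_heat.
  - by apply/measurable_EFinP; exact: measurable_heat.
  - by move=> y; rewrite lee_fin heat_ge0.
by apply: eq_cint => y; rewrite fourier_heat_wave.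
Qed.

Lemma gauss_regularized_inversion t f x : 0 < t -> cL1 mu f ->
  cint mu (fun v => (qgauss t v)%:C%C * cexpi (2 * pi * dotv x v) * fourier f v) =
  cint mu (fun y => f y * (heat t (y - x))%:C%C).
Proof.
move=> t0 If; rewrite fourier_multiplication//; last first.
  under eq_fun do rewrite dotvC.
  by apply: cL1_cexpi; [exact: measurable_phase|exact: cL1_qgauss].
by apply: eq_cint => y; rewrite fourier_qgauss_wave.
Qed.

(** At time [c^2] with [c = 1/(N+1)], the substitution [y = c z + x] turns the kernel into the fixed
    kernel [heat 1], and dominated convergence applies with majorant [2 M heat 1]. *)
Lemma heat_approximation (u : 'rV[R]_d -> R) (M : R) x :
  measurable_fun setT u -> (forall y, `|u y| <= M) -> {for x, continuous u} ->
  (fun N => (\int[mu]_y (u y * heat (N.+1%:R ^-1 ^+ 2) (y - x)))%R) @ \oo --> u x.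
Proof.
move=> mu_ uM cu.
pose c N : R := N.+1%:R^-1.
have c0 N : 0 < c N by rewrite invr_gt0.
have cc0 N : 0 < c N ^+ 2 by rewrite exprn_gt0.
have mh N : measurable_fun setT (fun y : 'rV[R]_d => heat (c N ^+ 2) (y - x)).
  by apply: measurableT_comp; [exact: measurable_heat|exact: measurable_rVB].
have ih N : (\int[mu]_y (heat (c N ^+ 2) (y - x))%:E = 1)%E.
  rewrite (integral_rV_shift (- x) (f := fun y => (heat (c N ^+ 2) y)%:E)).
  - exact: integral_heat.
  - by apply/measurable_EFinP; exact: measurable_heat.
  - by move=> y; rewrite lee_fin heat_ge0.
have Ih N : mu.-integrable setT (EFin \o (fun y : 'rV[R]_d => heat (c N ^+ 2) (y - x))).
  apply/integrableP; split; first exact/measurable_EFinP.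
  by under eq_integral => y _ do rewrite /= ger0_norm ?heat_ge0//; rewrite ih ltry.
have M0 : 0 <= M by apply: le_trans (uM 0).
have Iuh N : mu.-integrable setT (EFin \o (fun y : 'rV[R]_d => u y * heat (c N ^+ 2) (y - x))).
  apply: (@le_integrable _ _ _ mu _ _ _ (EFin \o (fun y : 'rV[R]_d => M * heat (c N ^+ 2) (y - x)))) => //.
  - by apply/measurable_EFinP; exact: measurable_funM.
  - move=> y _; rewrite /= lee_fin !normrM (ger0_norm M0) ler_wpM2r//.
  - exact: (integrableZl measurableT M (Ih N)).
pose D N (z : 'rV[R]_d) := `|u (c N *: z + x) - u x| * heat 1 z.
have mD N : measurable_fun setT (D N).
  apply: measurable_funM; last exact: measurable_heat.
  apply: measurableT_comp => //; apply: measurable_funB => //.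
  by apply: measurableT_comp => //; apply: measurable_rVD => //; exact: measurable_rVZ.
have bound N : (`|(\int[mu]_y (u y * heat (c N ^+ 2) (y - x)))%R - u x|%:E <=
    \int[mu]_z (D N z)%:E)%E.
  have -> : u x = (\int[mu]_y (u x * heat (c N ^+ 2) (y - x)))%R.
    by rewrite RintegralZl// /Rintegral ih mulr1.
  have Iux : mu.-integrable setT (EFin \o (fun y : 'rV[R]_d => u x * heat (c N ^+ 2) (y - x))).
    exact: (integrableZl measurableT (u x) (Ih N)).
  rewrite -RintegralB//; have IB := integrableB measurableT (Iuh N) Iux.
  rewrite -[leLHS]/(`|_|%:E)%E.
  apply: le_trans (_ : ((\int[mu]_y `|u y * heat (c N ^+ 2) (y - x) -
     u x * heat (c N ^+ 2) (y - x)|)%R%:E <= _)%E).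
    by rewrite lee_fin; apply: le_normr_Rintegral.
  rewrite /Rintegral fineK; last first.
    by have := integrable_fin_num measurableT (integrable_norm IB).
  pose G (y : 'rV[R]_d) := (`|u y - u x| * heat (c N ^+ 2) (y - x))%:E.
  have mG : measurable_fun setT G.
    apply/measurable_EFinP; apply: measurable_funM => //.
    by apply: measurableT_comp => //; exact: measurable_funB.
  have G0 y : (0 <= G y)%E by rewrite lee_fin mulr_ge0// heat_ge0.
  apply: (@le_trans _ _ (\int[mu]_y G y)%E).
    rewrite le_eqVlt; apply/orP; left; apply/eqP; apply: eq_integral => y _.
    by rewrite /= -mulrBl normrM [`|heat _ _|]ger0_norm ?heat_ge0.
  have := integral_rV_affine x (c0 N) mG G0.
  move/(congr1 (fun e => ((c N ^+ d)%:E * e)%E)); rewrite muleA -EFinM mulfV; last first.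
    by rewrite expf_neq0// lt0r_neq0.
  rewrite mul1e => <-; rewrite -ge0_integralZl//; last 2 first.
  - exact: measurable_affine_comp.
  - by rewrite lee_fin exprn_ge0// ltW.
  apply: ge0_le_integral_nomeas => [z _|z _]; first by rewrite mule_ge0// lee_fin exprn_ge0 ?ltW.
  rewrite /G/= -EFinM addrK heat_scale// lee_fin mulrCA [_ * (_ * heat _ _)]mulrA.
  by rewrite mulfV ?mul1r// expf_neq0// lt0r_neq0.
have lim : (fun N => \int[mu]_z (D N z)%:E)%E @ \oo --> 0%E.
  have := @dominated_convergence _ _ _ mu setT measurableT (fun N z => (D N z)%:E) (cst 0%E)
    (fun z => (2 * M * heat 1 z)%:E).
  case.
  - by move=> N; exact/measurable_EFinP.
  - exact: measurable_cst.
  - apply: aeW => z _ /=; apply/fine_cvgP; split; first by apply: nearW.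
    rewrite /= -[X in _ --> X](mul0r (heat 1 z)); apply: cvgMl.
    rewrite -(normr0 R) -[X in `|X|](subrr (u x)); apply: cvg_norm; apply: cvgB; last exact: cvg_cst.
    have : (fun N => c N *: z + x) @ \oo --> x.
      have h0 : c @ \oo --> (0 : R) by exact: cvg_harmonic.
      have := cvgD (cvgZr_tmp (a := z) h0) (cvg_cst x).
      by rewrite scale0r add0r; exact.
    by move/(continuous_cvg _ cu).
  - have ih1 : mu.-integrable setT (EFin \o (@heat 1)).
      apply/integrableP; split; first by apply/measurable_EFinP; exact: measurable_heat.
      by under eq_integral => y _ do rewrite /= ger0_norm ?heat_ge0//; rewrite integral_heat// ltry.
    exact: (integrableZl measurableT (2 * M) ih1).
  - apply: aeW => N z _; rewrite /= lee_fin ger0_norm; last by rewrite mulr_ge0// heat_ge0.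
    rewrite ler_wpM2r ?heat_ge0//; apply: le_trans (ler_normB _ _) _.
    by rewrite mulr_natl mulr2n lerD.
  by move=> _ _; rewrite /= integral0; apply.
apply/cvgrPdist_le => e e0; have /fine_cvgP[fin /cvgrPdist_le/(_ e e0) h] := lim.
near=> N.
rewrite distrC -lee_fin; apply: (le_trans (bound N)).
have finN : (\int[mu]_z (D N z)%:E)%E \is a fin_num by near: N; exact: fin.
rewrite -(fineK finN) lee_fin; apply: le_trans (ler_norm _) _.
by rewrite -normrN -sub0r; near: N; exact: h.
Unshelve. all: by end_near. Qed.

End heat_kernel.

(** * Fourier inversion and Bessel's inequality *)
Section fatou_convergence.
Context {R : realType} d (T : measurableType d) (mu : {measure set T -> \bar R}).

Lemma fatou_cvg (f : nat -> T -> \bar R) (g : T -> \bar R) (c : \bar R) :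
  (forall n, measurable_fun setT (f n)) -> (forall n x, (0 <= f n x)%E) ->
  measurable_fun setT g -> (forall x, (0 <= g x)%E) ->
  {ae mu, forall x, f^~ x @ \oo --> g x} ->
  (\forall n \near \oo, (\int[mu]_x f n x <= c)%E) -> (\int[mu]_x g x <= c)%E.
Proof.
move=> mf f0 mg g0 fg fc.
have le1 : (\int[mu]_x g x <= \int[mu]_x limn_einf (f^~ x))%E.
  apply: ae_ge0_le_integral => //.
  - move=> x _; rewrite limn_einf_lim; apply: lime_ge; first exact: is_cvg_einfs.
    by apply: nearW => n; apply: le_ereal_inf_tmp => _ [m _ <-].
  - apply: measurableT_comp => //; apply: measurable_fun_limn_esup => n.
    exact: measurableT_comp.
  apply: filterS fg => x fx _.
  by have [-> _] := cvg_limn_einf_sup fx.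
apply: le_trans le1 _; apply: le_trans (fatou _ _ _ _) _ => //.
rewrite limn_einf_lim; apply: lime_le; first exact: is_cvg_einfs.
apply: filterS fc => n; apply: le_trans.
by apply: ereal_inf_lbound; exists n => /=.
Qed.

End fatou_convergence.

Section complex_limits.
Context {R : realType}.
Implicit Types (z : nat -> R[i]) (w : R[i]).

Definition ccvg z w := (fun N => Re (z N)) @ \oo --> Re w /\
  (fun N => Im (z N)) @ \oo --> Im w.

Lemma ccvg_unique z w1 w2 : ccvg z w1 -> ccvg z w2 -> w1 = w2.
Proof.
by move=> [r1 i1] [r2 i2]; apply: complex_eq; [apply: cvg_unique r1 r2|apply: cvg_unique i1 i2].
Qed.

Lemma ccvg_cst w : ccvg (fun=> w) w. Proof. by split; exact: cvg_cst. Qed.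

Lemma ccvgM z1 z2 w1 w2 : ccvg z1 w1 -> ccvg z2 w2 ->
  ccvg (fun N => z1 N * z2 N) (w1 * w2).
Proof.
move=> [r1 i1] [r2 i2]; split.
  by under eq_fun do rewrite ReM; rewrite ReM; apply: cvgB; exact: cvgM.
by under eq_fun do rewrite ImM; rewrite ImM; apply: cvgD; exact: cvgM.
Qed.

Lemma ccvg_real (r : nat -> R) (a : R) : r @ \oo --> a ->
  ccvg (fun N => (r N)%:C%C) a%:C%C.
Proof. by move=> ra; split => //=; exact: cvg_cst. Qed.

Lemma Re_mul_real w (r : R) : Re (w * r%:C%C) = Re w * r.
Proof. by rewrite ReM/= mulr0 subr0. Qed.

Lemma Im_mul_real w (r : R) : Im (w * r%:C%C) = Im w * r.
Proof. by rewrite ImM/= mulr0 add0r. Qed.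

Lemma ccvg_normcB z w : ccvg z w -> (fun N => normc (z N - w)) @ \oo --> 0.
Proof.
move=> [zr zi]; apply: (@squeeze_cvgr _ _ _ _ (cst 0)
  (fun N => `|Re (z N) - Re w| + `|Im (z N) - Im w|)).
- apply: nearW => N; rewrite normc_ge0/=.
  by apply: le_trans (normc_le_ReIm _) _; rewrite !raddfB.
- exact: cvg_cst.
rewrite -[0 in X in _ --> X]addr0 -{1}(normr0 R) -{1}(subrr (Re w)).
rewrite -(normr0 R) -(subrr (Im w)).
by apply: cvgD; apply: cvg_norm; apply: cvgB => //; exact: cvg_cst.
Qed.

End complex_limits.

Section inversion.
Context {R : realType} {d : nat}.
Local Notation mu := (@lebesgue_rV R d).
Implicit Types (x xi v a : 'rV[R]_d) (t : R) (f g : 'rV[R]_d -> R[i]).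

Lemma schw_bounded (u : 'rV[R]_d -> R) : schw u -> exists M, forall x, `|u x| <= M.
Proof.
by move=> [_ /(_ [::] 0%N)[M h]]; exists M => x; have := h x; rewrite expr0 mul1r.
Qed.

Lemma schw_continuous (u : 'rV[R]_d -> R) : schw u -> continuous u.
Proof.
by move=> [su _] x; apply: differentiable_continuous; exact: smooth_differentiable.
Qed.

Lemma cvg_qgauss v : (fun N => qgauss (N.+1%:R ^-1 ^+ 2) v) @ \oo --> (1 : R).
Proof.
rewrite -[X in _ --> X](@expR0 R); apply: continuous_cvg; first exact: continuous_expR.
have h0 : (fun N => N.+1%:R^-1 : R) @ \oo --> (0 : R) by exact: cvg_harmonic.
have : (fun N => - (4 * pi ^+ 2 * (N.+1%:R^-1 * N.+1%:R^-1)) * dotv v v) @ \oo -->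
    - (4 * pi ^+ 2 * (0 * 0)) * dotv v v.
  by apply: cvgMl; apply: cvgN; apply: cvgMr; exact: cvgM.
by rewrite !mulr0 oppr0 mul0r.
Qed.

(** The Gaussian-damped inversion integrals have two limits: dominated convergence gives the
    left-hand side, and the heat kernel as an approximate identity gives [f x]. *)
Lemma fourier_inversion f x : schwartz f ->
  cint mu (fun v => fourier f v * cexpi (2 * pi * dotv x v)) = f x.
Proof.
move=> sf; have [sR sI] := (schwartzP f).1 sf; have If := schwartz_cL1 sf.
have sF := fourier_schwartz sf; have [mF IF] := schwartz_cL1 sF.
have mx : measurable_fun setT (fun v : 'rV[R]_d => 2 * pi * dotv x v).
  by under eq_fun do rewrite dotvC; exact: measurable_phase.
pose t N : R := N.+1%:R ^-1 ^+ 2.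
have t0 N : 0 < t N by rewrite exprn_gt0// invr_gt0.
pose FN N v := (qgauss (t N) v)%:C%C * cexpi (2 * pi * dotv x v) * fourier f v.
have cF v : ccvg (FN^~ v) (fourier f v * cexpi (2 * pi * dotv x v)).
  have := ccvgM (ccvgM (ccvg_real (cvg_qgauss v)) (ccvg_cst (cexpi (2 * pi * dotv x v))))
      (ccvg_cst (fourier f v)).
  by rewrite (_ : 1%:C%C = 1)// mul1r [X in ccvg _ X -> _]mulrC.
apply: (@ccvg_unique _ (fun N => cint mu (FN N))).
  apply: (@cint_dct _ _ _ mu FN _ (fun v => normc (fourier f v))).
  - move=> N; apply: cmeasM => //; apply: cmeasM; last exact: cmeas_cexpi.
    by apply: cmeas_real; exact: measurable_qgauss.
  - by apply: cmeasM => //; exact: cmeas_cexpi.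
  - exact: measurable_normc.
  - by move=> v; exact: (cF v).1.
  - by move=> v; exact: (cF v).2.
  - move=> N v; rewrite !ComplexField.Normc.normcM normc_cexpi mulr1 normc_real.
    by rewrite ger0_norm ?qgauss_ge0// ler_piMl ?normc_ge0// qgauss_le1// ltW.
  - exact: IF.
have E N : cint mu (FN N) = cint mu (fun y => f y * (heat (t N) (y - x))%:C%C).
  exact: gauss_regularized_inversion.
have [MR hR] := schw_bounded sR; have [MI hI] := schw_bounded sI.
have aR : (fun N => \int[mu]_y (Re (f y) * heat (t N) (y - x)))%R @ \oo --> Re (f x).
  apply: (@heat_approximation _ _ (fun y => Re (f y)) MR) => //.
    exact: schw_measurable.
  exact: schw_continuous.
have aI : (fun N => \int[mu]_y (Im (f y) * heat (t N) (y - x)))%R @ \oo --> Im (f x).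
  apply: (@heat_approximation _ _ (fun y => Im (f y)) MI) => //.
    exact: schw_measurable.
  exact: schw_continuous.
split.
  have -> : (fun N => Re (cint mu (FN N))) =
      (fun N => \int[mu]_y (Re (f y) * heat (t N) (y - x)))%R; last exact: aR.
  apply/funext => N; rewrite E; apply: eq_Rintegral => y _; exact: Re_mul_real.
have -> : (fun N => Im (cint mu (FN N))) =
    (fun N => \int[mu]_y (Im (f y) * heat (t N) (y - x)))%R; last exact: aI.
apply/funext => N; rewrite E; apply: eq_Rintegral => y _; exact: Im_mul_real.
Qed.

Lemma cint_conj f : cL1 mu f -> cint mu (fun x => ((f x)^*)%C) = ((cint mu f)^*)%C.
Proof.
move=> If; apply: complex_eq => /=.
  by apply: eq_Rintegral => x _; case: (f x).
rewrite -mulN1r -RintegralZl//; last exact: cL1_Im If.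
by apply: eq_Rintegral => x _; rewrite mulN1r; case: (f x).
Qed.

Lemma normc_fourier_le f xi : cL1 mu f ->
  ((normc (fourier f xi))%:E <= \int[mu]_x (normc (f x))%:E)%E.
Proof.
move=> If; apply: le_trans (le_normc_cint (cL1_fourier_kernel xi If)) _.
by under eq_integral do rewrite ComplexField.Normc.normcM normc_cexpi mulr1.
Qed.

Lemma fourier_bounded f : cL1 mu f -> exists2 M, 0 <= M & forall xi, normc (fourier f xi) <= M.
Proof.
move=> If; exists (fine (\int[mu]_x (normc (f x))%:E)%E) => [|xi].
  by rewrite fine_ge0// integral_ge0// => x _; rewrite lee_fin normc_ge0.
rewrite -lee_fin fineK; first exact: normc_fourier_le.
rewrite ge0_fin_numE ?If.2//.
by rewrite integral_ge0// => x _; rewrite lee_fin normc_ge0.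
Qed.

Lemma cL1_bounded_mul f g (M : R) : cmeas g -> (forall x, normc (g x) <= M) ->
  cL1 mu f -> cL1 mu (fun x => g x * f x).
Proof.
move=> mg gM [mf If]; apply: (@le_cL1 _ _ _ mu _ (fun x => M * normc (f x))).
- exact: cmeasM.
- by apply: measurable_funM => //; exact: measurable_normc.
- by move=> x; rewrite ComplexField.Normc.normcM ler_wpM2r ?normc_ge0.
under eq_integral do rewrite EFinM.
have M0 : 0 <= M by apply: le_trans (gM 0); exact: normc_ge0.
rewrite ge0_integralZl//.
- by rewrite lte_mul_pinfty// lee_fin.
- by apply/measurable_EFinP; exact: measurable_normc.
- by move=> x _; rewrite lee_fin normc_ge0.
Qed.

Lemma integral_heat_shift t (y : 'rV[R]_d) : 0 < t ->
  (\int[mu]_z (heat t (z - y))%:E = 1)%E.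
Proof.
move=> t0; rewrite (integral_rV_shift (- y) (f := fun z => (heat t z)%:E)).
- exact: integral_heat.
- by apply/measurable_EFinP; exact: measurable_heat.
- by move=> z; rewrite lee_fin heat_ge0.
Qed.

Lemma even_kernel_sum (K U V : 'rV[R]_d -> \bar R) :
  measurable_fun setT K -> measurable_fun setT U -> measurable_fun setT V ->
  (forall x, (0 <= K x)%E) -> (forall x, (0 <= U x)%E) -> (forall x, (0 <= V x)%E) ->
  (forall x, K (- x) = K x) ->
  (\int[mu]_y \int[mu]_z ((U y + V z) * K (z - y)%R) =
   (\int[mu]_x K x) * (\int[mu]_x U x + \int[mu]_x V x))%E.
Proof.
move=> mK mU mV K0 U0 V0 KN; set c := (\int[mu]_x K x)%E.
have c0 : (0 <= c)%E by exact: integral_ge0.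
have Kshift y : (\int[mu]_z K (z - y)%R = c)%E by rewrite (integral_rV_shift (- y) (f := K)).
have mKs : measurable_fun setT (fun p : 'rV[R]_d * 'rV[R]_d => K (p.2 - p.1)).
  apply: (measurableT_comp mK).
  by apply: measurable_rVB; [exact: measurable_snd|exact: measurable_fst].
pose F1 (p : 'rV[R]_d * 'rV[R]_d) := (U p.1 * K (p.2 - p.1)%R)%E.
pose F2 (p : 'rV[R]_d * 'rV[R]_d) := (V p.2 * K (p.2 - p.1)%R)%E.
have mF1 : measurable_fun setT F1.
  by apply: emeasurable_funM => //; apply: (measurableT_comp mU); exact: measurable_fst.
have mF2 : measurable_fun setT F2.
  by apply: emeasurable_funM => //; apply: (measurableT_comp mV); exact: measurable_snd.
have F10 p : (0 <= F1 p)%E by exact: mule_ge0.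
have F20 p : (0 <= F2 p)%E by exact: mule_ge0.
have E1 : (\int[mu]_y \int[mu]_z F1 (y, z) = c * \int[mu]_y U y)%E.
  transitivity (\int[mu]_y (c * U y))%E; last by rewrite ge0_integralZl.
  apply: eq_integral => y _; rewrite /F1/= ge0_integralZl ?Kshift 1?muleC//.
  by apply: (measurableT_comp mK); exact: measurable_rVB.
have E2 : (\int[mu]_y \int[mu]_z F2 (y, z) = c * \int[mu]_y V y)%E.
  transitivity (\int[mu]_z \int[mu]_y F2 (y, z))%E.
    exact: (fubini_tonelli (m1 := mu) (m2 := mu)).
  transitivity (\int[mu]_y (c * V y))%E; last by rewrite ge0_integralZl.
  apply: eq_integral => z _; rewrite /F2/= ge0_integralZl//; last first.
    by apply: (measurableT_comp mK); exact: measurable_rVB.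
  by under eq_integral do rewrite -opprB KN; rewrite Kshift muleC.
transitivity (\int[mu]_y \int[mu]_z (F1 (y, z) + F2 (y, z)))%E.
  by apply: eq_integral => y _; apply: eq_integral => z _; rewrite ge0_muleDl.
under eq_integral => y _.
  rewrite ge0_integralD//; [over|exact: (measurableT_comp mF1 (measurable_pair1 y))|exact: (measurableT_comp mF2 (measurable_pair1 y))].
rewrite ge0_integralD//=.
- have U1 : (0 <= \int[mu]_x U x)%E by apply: integral_ge0.
  have V1 : (0 <= \int[mu]_x V x)%E by apply: integral_ge0.
  by rewrite E1 E2 (ge0_muleDr _ U1 V1).
- by move=> y _; apply: integral_ge0.
- exact: (measurable_fun_fubini_tonelli_F (m2 := mu)).
- by move=> y _; apply: integral_ge0.
- exact: (measurable_fun_fubini_tonelli_F (m2 := mu)).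
Qed.

(** Schur's test: [2uv <= u^2 + v^2], and both marginals of an even convolution kernel equal its
    total mass. *)
Lemma even_kernel_form (K u v : 'rV[R]_d -> R) :
  measurable_fun setT K -> measurable_fun setT u -> measurable_fun setT v ->
  (forall x, 0 <= K x) -> (forall x, 0 <= u x) -> (forall x, 0 <= v x) ->
  (forall x, K (- x) = K x) ->
  (\int[mu]_y \int[mu]_z (u y * v z * K (z - y))%:E <=
   (\int[mu]_x (K x)%:E) * (\int[mu]_x (2^-1 * u x ^+ 2)%:E + \int[mu]_x (2^-1 * v x ^+ 2)%:E))%E.
Proof.
move=> mK mu_ mv K0 u0 v0 KN.
have sq0 (w : R) : 0 <= 2^-1 * w ^+ 2 by rewrite mulr_ge0// ?invr_ge0// sqr_ge0.
have msq (w : 'rV[R]_d -> R) : measurable_fun setT w -> measurable_fun setT (fun x => (2^-1 * w x ^+ 2)%:E).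
  by move=> mw; apply/measurable_EFinP; apply: measurable_funM => //; exact: measurable_funX.
rewrite -(@even_kernel_sum (EFin \o K) (fun x => (2^-1 * u x ^+ 2)%:E) (fun x => (2^-1 * v x ^+ 2)%:E));
  first last.
- by move=> x; rewrite /= KN.
- by move=> x; rewrite lee_fin.
- by move=> x; rewrite lee_fin.
- by move=> x; rewrite lee_fin.
- exact: msq.
- exact: msq.
- exact/measurable_EFinP.
apply: ge0_le_integral_nomeas => [y _|y _].
  by apply: integral_ge0 => z _; rewrite lee_fin mulr_ge0// mulr_ge0.
apply: ge0_le_integral_nomeas => [z _|z _]; first by rewrite lee_fin mulr_ge0// mulr_ge0.
rewrite -EFinD -EFinM lee_fin ler_wpM2r//.
by have := sqr_ge0 (u y - v z); rewrite sqrrB; lra.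
Qed.

(** By Fatou it suffices to bound the integral damped by [qgauss], uniformly in the damping. The
    multiplication formula rewrites it as a quadratic form of [f] with a heat kernel, and Schur's
    test concludes since this kernel has mass one. *)
Theorem bessel_inequality f : cL1 mu f ->
  (\int[mu]_xi (normc (fourier f xi) ^+ 2)%:E <= \int[mu]_x (normc (f x) ^+ 2)%:E)%E.
Proof.
move=> If; have [mf Ifn] := If; have mF := cmeas_fourier mf.
have [M M0 hM] := fourier_bounded If.
have mnF := measurable_normc mF.
pose t N : R := N.+1%:R ^-1 ^+ 2.
have t0 N : 0 < t N by rewrite exprn_gt0// invr_gt0.
apply: (@fatou_cvg _ _ _ mu (fun N v => (qgauss (t N) v * normc (fourier f v) ^+ 2)%:E)).
- move=> N; apply/measurable_EFinP; apply: measurable_funM; first exact: measurable_qgauss.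
  exact: measurable_funX.
- by move=> N v; rewrite lee_fin mulr_ge0 ?qgauss_ge0// sqr_ge0.
- by apply/measurable_EFinP; exact: measurable_funX.
- by move=> v; rewrite lee_fin sqr_ge0.
- apply: aeW => v; apply/fine_cvgP; split; first exact: nearW.
  rewrite -[X in _ --> X]mul1r; apply: cvgMl; exact: cvg_qgauss.
apply: nearW => N; move: (t N) (t0 N) => r r0 {t t0}.
set I := (X in (X <= _)%E).
have I0 : (0 <= I)%E by apply: integral_ge0 => v _; rewrite lee_fin mulr_ge0 ?qgauss_ge0// sqr_ge0.
(* Paired with the transform of [f] this gives the damped square integral; its own transform is the
   conjugate of [f] averaged by the heat kernel. *)
pose k v := (qgauss r v)%:C%C * ((fourier f v)^*)%C.
have Iq := @cL1_qgauss R d r r0.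
have IqF : cL1 mu (fun v => fourier f v * (qgauss r v)%:C%C) by apply: cL1_bounded_mul hM Iq.
have Ik : cL1 mu k.
  have := @cL1_bounded_mul _ (fun v => ((fourier f v)^*)%C) M (cmeas_conj mF) _ Iq.
  by under eq_fun do rewrite mulrC; apply=> v; rewrite normc_conj.
have Ifin : I \is a fin_num.
  rewrite ge0_fin_numE//; apply: le_lt_trans (_ : (\int[mu]_x (M * normc (k x))%:E < +oo)%E).
    apply: ge0_le_integral_nomeas => v _; first by rewrite lee_fin mulr_ge0 ?qgauss_ge0// sqr_ge0.
    rewrite lee_fin /k ComplexField.Normc.normcM normc_conj normc_real ger0_norm ?qgauss_ge0//.
    by rewrite [leRHS]mulrCA ler_wpM2l ?qgauss_ge0// expr2 ler_wpM2r ?normc_ge0.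
  under eq_integral do rewrite EFinM.
  rewrite ge0_integralZl//.
  - by rewrite lte_mul_pinfty// ?lee_fin//; exact: Ik.2.
  - by apply/measurable_EFinP; apply: measurable_normc; exact: Ik.1.
  - by move=> v _; rewrite lee_fin normc_ge0.
have E1 : cint mu (fun v => k v * fourier f v) = (fine I)%:C%C.
  rewrite -(cint_ge0_real (mu := mu) (r := fun v => qgauss r v * normc (fourier f v) ^+ 2)) ?fineK//.
  by apply: eq_cint => v; rewrite /k -mulrA [(_^*)%C * _]mulrC mul_conjc -rmorphM.
have E2 y : fourier k y = ((cint mu (fun z => f z * (heat r (z - y))%:C%C))^*)%C.
  rewrite -gauss_regularized_inversion// -cint_conj; last first.
    have := cL1_cexpi (measurable_phase y) IqF; congr (cL1 mu _).
    by apply/funext => v; rewrite dotvC [RHS]mulrC mulrA.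
  have cM (z w : R[i]) : ((z * w)^*)%C = (z^*)%C * (w^*)%C by exact: rmorphM.
  apply: eq_cint => v; rewrite /k !cM conj_cexpi dotvC [in RHS]mulrAC.
  by congr (_ * _ * _); apply: complex_eq => //=; rewrite oppr0.
have n2 y : ((normc (fourier k y))%:E <= \int[mu]_z (normc (f z) * heat r (z - y))%:E)%E.
  rewrite E2 normc_conj; apply: le_trans (le_normc_cint _) _.
    under eq_fun do rewrite mulrC.
    apply: (cL1_bounded_mul (M := gaussI d (4 * pi ^+ 2 * r))) => //.
    - apply: cmeas_real; apply: measurableT_comp; first exact: measurable_heat.
      exact: measurable_rVB.
    - by move=> z; rewrite normc_real ger0_norm ?heat_ge0// heat_le.
  apply: ge0_le_integral_nomeas => z _; first by rewrite lee_fin normc_ge0.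
  by rewrite ComplexField.Normc.normcM normc_real ger0_norm ?heat_ge0.
rewrite -(fineK Ifin); apply: (@le_trans _ _ (normc (cint mu (fun v => k v * fourier f v)))%:E).
  by rewrite E1 normc_real lee_fin ler_norm.
rewrite fourier_multiplication//; apply: le_trans (le_normc_cint _) _.
  under eq_fun do rewrite mulrC.
  have [Mk _ hk] := fourier_bounded Ik.
  by apply: cL1_bounded_mul hk If; exact: cmeas_fourier Ik.1.
have mnf := measurable_normc mf.
apply: (@le_trans _ _ (\int[mu]_y \int[mu]_z (normc (f y) * normc (f z) * heat r (z - y))%:E)%E); last first.
  apply: le_trans (even_kernel_form (measurable_heat r) mnf mnf _ _ _ _) _ => //.
  - by move=> x; exact: heat_ge0.
  - by move=> x; exact: normc_ge0.
  - by move=> x; exact: normc_ge0.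
  - by move=> x; exact: heatN.
  have sq0 x : 0 <= 2^-1 * normc (f x) ^+ 2 by rewrite mulr_ge0// ?invr_ge0// sqr_ge0.
  rewrite integral_heat// mul1e -ge0_integralD//=; last 4 first.
  - by move=> x _; rewrite lee_fin.
  - by apply/measurable_EFinP; apply: measurable_funM => //; exact: measurable_funX.
  - by move=> x _; rewrite lee_fin.
  - by apply/measurable_EFinP; apply: measurable_funM => //; exact: measurable_funX.
  apply: ge0_le_integral_nomeas => x _; first by rewrite -EFinD lee_fin addr_ge0.
  by rewrite -EFinD lee_fin; lra.
apply: ge0_le_integral_nomeas => y _; first by rewrite lee_fin normc_ge0.
rewrite ComplexField.Normc.normcM EFinM.
apply: le_trans (lee_wpmul2l _ (n2 y)) _; first by rewrite lee_fin normc_ge0.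
rewrite -ge0_integralZl//.
- by rewrite le_eqVlt; apply/orP; left; apply/eqP; apply: eq_integral => z _; rewrite -EFinM mulrA.
- apply/measurable_EFinP; apply: measurable_funM; first exact: measurable_normc.
  by apply: measurableT_comp; [exact: measurable_heat|exact: measurable_rVB].
- by move=> z _; rewrite lee_fin mulr_ge0 ?normc_ge0 ?heat_ge0.
- by rewrite lee_fin normc_ge0.
Qed.

End inversion.

(** * Gamma densities *)
Section gamma_density.
Context {R : realType}.
Local Notation lam := (@lebesgue_measure R).
Implicit Types (b r t : R).

(** Extended by 0 to [t <= 0], so that all time integrals run over the real line with Lebesgue
    measure. *)
Definition gamma_kernel b t : R := if 0 < t then expR (- t) * t `^ (b - 1) else 0.

Lemma gamma_kernel_ge0 b t : 0 <= gamma_kernel b t.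
Proof. by rewrite /gamma_kernel; case: ifP => // _; rewrite mulr_ge0 ?expR_ge0 ?powR_ge0. Qed.

Lemma measurable_gamma_kernel b : measurable_fun setT (gamma_kernel b).
Proof.
apply: measurable_fun_ifT => //; first exact: measurable_fun_ltr.
apply: measurable_funM; last exact: measurable_powR_fun.
by apply: measurableT_comp => //; exact: measurable_expR.
Qed.

Lemma integral_gamma_kernel_itv b :
  (\int[lam]_t (gamma_kernel b t)%:E =
   \int[lam]_(t in `]0%R, +oo[) (expR (- t) * t `^ (b - 1))%:E)%E.
Proof.
rewrite [RHS]integral_mkcond; apply: eq_integral => t _; rewrite patchE /gamma_kernel.
by rewrite mem_setE in_itv/= andbT; case: ifP.
Qed.

Lemma integral_gamma_kernel_lty b : 0 < b -> (\int[lam]_t (gamma_kernel b t)%:E < +oo)%E.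
Proof.
move=> b0; rewrite integral_gamma_kernel_itv.
(* For [t >= 1], [t^(b+1) <= t^(m+1) <= (m+1)! exp t], which leaves the integrable majorant
   [(m+1)! t^-2]. *)
have [m hm] : exists m : nat, b <= m%:R by exists (Num.truncn b).+1; rewrite ltW// truncnS_gt.
pose F : R := (m.+1)`!%:R.
have F0 : 0 < F by rewrite ltr0n fact_gt0.
apply: le_lt_trans (@le_integral_split _ 1 _ (fun t => (t `^ (b - 1))%:E)
  (fun t => (F * t `^ (- (1 + 1)))%:E) _ _ _ _ _ _ _ _) _ => //.
- by move=> t t0; rewrite lee_fin mulr_ge0 ?expR_ge0 ?powR_ge0.
- by apply/measurable_EFinP; exact: measurable_powR_fun.
- by apply/measurable_EFinP; apply: measurable_funM => //; exact: measurable_powR_fun.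
- by move=> t; rewrite lee_fin powR_ge0.
- by move=> t; rewrite lee_fin mulr_ge0 ?powR_ge0// ltW.
- move=> t /andP[t0 _]; rewrite lee_fin ler_piMl ?powR_ge0//.
  by rewrite expR_le1 oppr_le0 ltW.
- move=> t t1; have t0 : 0 < t by apply: lt_le_trans t1.
  rewrite lee_fin expRN -ler_pdivlMl ?invr_gt0 ?expR_gt0// invrK.
  have -> : t `^ (b - 1) = t `^ (b + 1) * t `^ (- (1 + 1)).
    by rewrite powRD_gt0//; congr (_ `^ _); ring.
  rewrite mulrA ler_wpM2r ?powR_ge0//.
  apply: le_trans (_ : t `^ (m.+1)%:R <= _); first by apply: ler_powR => //; rewrite -natr1 lerD2r.
  rewrite powR_mulrn ?(ltW t0)// -ler_pdivrMr//.
  by apply: le_trans (expR_ge1Dxn m (ltW t0)); rewrite lerDr.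
apply: lte_add_pinfty.
  by apply: le_lt_trans (integral_powR_0 _ _) _ => //; rewrite ltry.
under eq_integral do rewrite EFinM.
rewrite ge0_integralZl//=.
- by rewrite integral_powR_infty// -EFinM ltry.
- apply/measurable_EFinP; apply: measurable_funTS; exact: measurable_powR_fun.
- by move=> t _; rewrite lee_fin powR_ge0.
- by rewrite lee_fin ltW.
Qed.

Lemma integral_gamma_kernel_gt0 b : 0 < b -> (0 < \int[lam]_t (gamma_kernel b t)%:E)%E.
Proof.
(* A lower bound for the kernel on [[1, 2]], where [exp(-t) >= exp(-2)] and
   [t^(b-1) >= 1/t >= 1/2]. *)
move=> b0; pose c : R := expR (- 2) / 2.
have c0 : 0 < c by rewrite divr_gt0 ?expR_gt0.
apply: (@lt_le_trans _ _ (\int[lam]_(t in `[1%R, 2%R]) (cst c%:E) t)%E).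
  rewrite integral_cst//= lebesgue_measure_itv/= lte_fin ltr1n.
  by rewrite -EFinB -EFinM lte_fin mulr_gt0// subr_gt0 ltr1n.
apply: le_trans; last first.
  apply: (ge0_integral_le_setT lam `[1%R, 2%R] (f := fun t => (gamma_kernel b t)%:E)) => t.
  by rewrite lee_fin gamma_kernel_ge0.
apply: ge0_le_integral_nomeas => t; first by rewrite lee_fin ltW.
rewrite /= in_itv/= => /andP[t1 t2]; have t0 : 0 < t by apply: lt_le_trans t1.
rewrite lee_fin /gamma_kernel t0; apply: ler_pM; rewrite ?expR_ge0 ?invr_ge0//.
  by rewrite ler_expR lerN2.
apply: (@le_trans _ _ t^-1); first by rewrite lef_pV2 ?posrE.
rewrite -(powR_inv1 (ltW t0)) ; apply: ler_powR => //.
by rewrite lerBrDl subrr ltW.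
Qed.

Definition gamma_const b : R := fine (\int[lam]_t (gamma_kernel b t)%:E)%E.

Lemma gamma_constE b : 0 < b -> (\int[lam]_t (gamma_kernel b t)%:E = (gamma_const b)%:E)%E.
Proof.
move=> b0; rewrite /gamma_const fineK// ge0_fin_numE ?integral_gamma_kernel_lty//.
exact/ltW/integral_gamma_kernel_gt0.
Qed.

Lemma gamma_const_gt0 b : 0 < b -> 0 < gamma_const b.
Proof. by move=> b0; rewrite -lte_fin -gamma_constE// integral_gamma_kernel_gt0. Qed.

Definition gamma_density b t : R := (gamma_const b)^-1 * gamma_kernel b t.

Lemma gamma_density_ge0 b t : 0 < b -> 0 <= gamma_density b t.
Proof. by move=> b0; rewrite mulr_ge0 ?gamma_kernel_ge0// invr_ge0 ltW// gamma_const_gt0. Qed.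

Lemma gamma_density_le0 b t : t <= 0 -> gamma_density b t = 0.
Proof. by move=> t0; rewrite /gamma_density /gamma_kernel ltNge t0 mulr0. Qed.

Lemma measurable_gamma_density b : measurable_fun setT (gamma_density b).
Proof. by apply: measurable_funM => //; exact: measurable_gamma_kernel. Qed.

(** The Laplace transform of the gamma kernel, by the substitution of [(1 + r) t] for [t]. *)
Lemma integral_gamma_kernel_exp b r : 0 < b -> 0 <= r ->
  (\int[lam]_t (gamma_kernel b t * expR (- (r * t)))%:E =
   ((1 + r) `^ (- b) * gamma_const b)%:E)%E.
Proof.
move=> b0 r0; have r1 : 0 < 1 + r by rewrite ltr_wpDr.
have := @integral_affine R (1 + r) 0 (fun t => (gamma_kernel b t)%:E) r1.
rewrite gamma_constE// -EFinM => h.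
transitivity (((1 + r) `^ (1 - b))%:E * \int[lam]_x (gamma_kernel b ((1 + r) * x + 0))%:E)%E.
  rewrite -ge0_integralZl//.
  - apply: eq_integral => t _; rewrite -EFinM addr0 /gamma_kernel pmulr_rgt0//.
    case: ifP => t0; last by rewrite mul0r mulr0.
    have e1 : expR (- ((1 + r) * t)) = expR (- t) * expR (- (r * t)).
      by rewrite -expRD; congr expR; ring.
    have e2 : (1 + r) `^ (1 - b) * (1 + r) `^ (b - 1) = 1.
      by rewrite powRD_gt0// addrC subrKA subrr powRr0.
    rewrite powRM ?(ltW r1) ?(ltW t0)// e1; congr EFin.
    transitivity ((1 + r) `^ (1 - b) * (1 + r) `^ (b - 1) *
        (expR (- t) * t `^ (b - 1) * expR (- (r * t)))); first by rewrite e2 mul1r.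
    by ring.
  - apply/measurable_EFinP; apply: measurableT_comp; first exact: measurable_gamma_kernel.
    by apply: measurable_funD => //; apply: measurable_funM.
  - by move=> t _; rewrite lee_fin gamma_kernel_ge0.
  - by rewrite lee_fin powR_ge0.
rewrite h.
- rewrite -EFinM mulrA -(powR_inv1 (ltW r1)) powRD_gt0//; congr (_ `^ _ * _)%:E; ring.
- by apply/measurable_EFinP; exact: measurable_gamma_kernel.
- by move=> t; rewrite lee_fin gamma_kernel_ge0.
Qed.

Lemma integral_gamma_density_exp b r : 0 < b -> 0 <= r ->
  (\int[lam]_t (gamma_density b t * expR (- (r * t)))%:E = ((1 + r) `^ (- b))%:E)%E.
Proof.
move=> b0 r0; have g0 := gamma_const_gt0 b0.
under eq_integral do rewrite -mulrA EFinM.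
rewrite ge0_integralZl//.
- rewrite integral_gamma_kernel_exp// -EFinM mulrCA mulVf ?mulr1//; exact: lt0r_neq0.
- apply/measurable_EFinP; apply: measurable_funM; first exact: measurable_gamma_kernel.
  apply: measurableT_comp; first exact: measurable_expR.
  by apply: measurableT_comp => //; apply: measurable_funM.
- by move=> t _; rewrite lee_fin mulr_ge0 ?gamma_kernel_ge0 ?expR_ge0.
- by rewrite lee_fin invr_ge0 ltW.
Qed.

Lemma integral_gamma_density b : 0 < b -> (\int[lam]_t (gamma_density b t)%:E = 1)%E.
Proof.
move=> b0; have := integral_gamma_density_exp b0 (lexx 0); rewrite addr0 powR1 => <-.
by apply: eq_integral => t _; rewrite mul0r oppr0 expR0 mulr1.
Qed.

(** The extra power lowers the shape parameter to [b - k]. With [b = s/2] and [k = n/4] this is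
    where [s > n/2] is spent. *)
Lemma integral_gamma_density_powR b k : 0 < b -> k < b ->
  (\int[lam]_t (gamma_density b t * t `^ (- k))%:E < +oo)%E.
Proof.
move=> b0 kb; have bk : 0 < b - k by rewrite subr_gt0.
have g0 := gamma_const_gt0 b0.
have -> : (\int[lam]_t (gamma_density b t * t `^ (- k))%:E =
    \int[lam]_t ((gamma_const b)^-1%:E * (gamma_kernel (b - k) t)%:E))%E.
  apply: eq_integral => t _; rewrite -EFinM /gamma_density -mulrA; congr (_ * _)%:E.
  rewrite /gamma_kernel; case: ifP => t0; last by rewrite mul0r.
  by rewrite -mulrA powRD_gt0//; congr (_ * _ `^ _); ring.
rewrite ge0_integralZl//.
- by rewrite gamma_constE// -EFinM ltry.
- by apply/measurable_EFinP; exact: measurable_gamma_kernel.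
- by move=> t _; rewrite lee_fin gamma_kernel_ge0.
- by rewrite lee_fin invr_ge0 ltW.
Qed.

End gamma_density.

Section weak_L4_bounded.
Context {R : realType} dP (P : measurableType dP).
Variable pi : {sigma_finite_measure set P -> \bar R}.
Local Notation lam := (@lebesgue_measure R).

(** Layer cake in [w]: its level sets have measure at most [1/t] and are empty above [M].
    Integrating [4/3 k t^(-3/4)] up to [M] brings another factor 4. *)
Lemma integral_weakL4_bounded (H w : P -> R) (k M : R) :
  measurable_fun setT H -> (forall p, 0 <= H p) -> 0 < k -> weakL4 pi H k ->
  measurable_fun setT w -> (forall p, 0 <= w p <= M) -> 0 < M ->
  (\int[pi]_p (w p)%:E <= 1)%E ->
  (\int[pi]_p (H p * w p)%:E <= (16 / 3 * k * M `^ (1 / 4))%:E)%E.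
Proof.
move=> mH H0 k0 hH mw hw M0 w1.
have w0 p : 0 <= w p by have /andP[] := hw p.
have wM p : w p <= M by have /andP[] := hw p.
under eq_integral do rewrite EFinM.
rewrite (layer_cake pi (F := EFin \o H))//; last exact/measurable_EFinP.
have lev t : 0 < t -> (pi [set p | (t < w p)%R] <= (t^-1)%:E)%E.
  move=> t0; rewrite -(@lee_pmul2l _ t%:E)// ?lte_fin// -EFinM mulfV ?lt0r_neq0//.
  apply: le_trans w1; rewrite -integral_cst//; last exact: measurable_level.
  apply: le_trans (_ : (\int[pi]_(p in [set p | (t < w p)%R]) (w p)%:E <= _)%E).
    by apply: ge0_le_integral_nomeas => p /= tp; rewrite lee_fin ltW.
  by apply: ge0_integral_le_setT => p; rewrite lee_fin.
apply: le_trans (@le_integral_split _ M _ (fun t => ((4 / 3 * k) * t `^ (1 / 4 - 1))%:E)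
  (cst 0%E) M0 _ _ _ _ _ _ _) _.
- by move=> t t0; apply: integral_ge0 => p _; rewrite lee_fin.
- by apply/measurable_EFinP; apply: measurable_funM => //; exact: measurable_powR_fun.
- exact: measurable_cst.
- by move=> t; rewrite lee_fin mulr_ge0 ?powR_ge0// mulr_ge0// ltW.
- by [].
- move=> t /andP[t0 _]; apply: le_trans (integral_set_weakL4 mH H0 k0 hH _ _ (lev t t0)) _.
  + exact: measurable_level.
  + by rewrite invr_ge0 ltW.
  rewrite lee_fin ler_wpM2l//; first by rewrite mulr_ge0// ltW.
  rewrite -(powR_inv1 (ltW t0)) -powRrM le_eqVlt; apply/orP; left; apply/eqP.
  by congr (_ `^ _); lra.
- move=> t Mt; rewrite (_ : [set p | _] = set0) ?integral_set0//.
  by apply/seteqP; split => // p /= /lt_le_trans/(_ (wM p)); rewrite ltNge Mt.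
rewrite integral0 adde0; under eq_integral do rewrite EFinM.
rewrite ge0_integralZl//=.
- apply: le_trans (lee_wpmul2l _ (integral_powR_0 M0 _)) _; rewrite ?lee_fin ?mulr_ge0 ?(ltW k0)//.
  by rewrite le_eqVlt; apply/orP; left; apply/eqP; field.
- by apply/measurable_EFinP; apply: measurable_funTS; exact: measurable_powR_fun.
- by move=> t _; rewrite lee_fin powR_ge0.
- by rewrite lee_fin mulr_ge0// ltW.
Qed.

End weak_L4_bounded.

(** * Heat averages of weak L^4 functions *)

Section heat_weak_L4.
Context {R : realType} {n : nat}.
Local Notation mu := (@lebesgue_rV R (n + n)).

Definition heatC : R := 16 / 3 * (gaussI (n + n) (4 * pi ^+ 2)) `^ (1 / 4).

(** On R^{2n} the heat kernel has mass one and height of order [t^-n]; its fourth root gives the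
    power of [t]. *)
Lemma integral_heat_weakL4 (H : 'rV[R]_(n + n) -> R) (k t : R) z :
  measurable_fun setT H -> (forall p, 0 <= H p) -> 0 < k -> weakL4 mu H k -> 0 < t ->
  (\int[mu]_p (H p * heat t (z - p))%:E <= (heatC * k * t `^ (- (n%:R / 4)))%:E)%E.
Proof.
move=> mH H0 k0 hH t0.
have l0 : 0 < 4 * pi ^+ 2 :> R by have := qgauss_rate_gt0 (@ltr01 R); rewrite mulr1.
apply: le_trans (integral_weakL4_bounded (M := gaussI (n + n) (4 * pi ^+ 2 * t)) mH H0 k0 hH _ _ _ _) _.
- by apply: measurableT_comp; [exact: measurable_heat|exact: measurable_rVB].
- by move=> p; rewrite heat_ge0 ?heat_le.
- by rewrite gaussI_gt0// mulr_gt0.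
- under eq_integral do rewrite -opprB heatN.
  by rewrite integral_heat_shift.
rewrite lee_fin [4 * _ * t]mulrC gaussI_scale//.
rewrite powRM ?invr_ge0 ?exprn_ge0 ?sqrtr_ge0//.
rewrite le_eqVlt; apply/orP; left; apply/eqP.
have -> : (Num.sqrt t ^- (n + n)) `^ (1 / 4) = t `^ (- (n%:R / 4)).
  rewrite addnn -muln2 mulnC exprM sqr_sqrtr ?(ltW t0)//.
  rewrite -powR_mulrn ?(ltW t0)// -powRN -powRrM; congr (_ `^ _); lra.
rewrite /heatC; ring.
Qed.

Lemma heatC_ge0 : 0 <= heatC.
Proof. by rewrite mulr_ge0// powR_ge0. Qed.

End heat_weak_L4.

(** * Bump functions *)
Section bump.
Context {R : realType}.
Implicit Types (p : {poly R}) (x y : R).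

(** All derivatives of [exp(-1/x)], extended by 0, have this form, the polynomial being transformed
    by [bump_step]. Its iterates supply the family required by [OM_family]. *)
Definition bump_poly p x : R := if 0 < x then p.[x^-1] * expR (- x^-1) else 0.

Definition bump_step p : {poly R} := 'X^2 * (p - p^`()).

Lemma powX_expR_le n y : 0 <= y -> y ^+ n * expR (- y) <= n`!%:R.
Proof.
move=> y0; rewrite expRN -ler_pdivlMr ?invr_gt0 ?expR_gt0// invrK.
have f0 k : 0 < k`!%:R :> R by rewrite ltr0n fact_gt0.
rewrite mulrC -ler_pdivrMr//; case: n => [|n].
  by rewrite expr0 fact0 divr1 -[leLHS](@expR0 R) ler_expR.
by apply: le_trans (expR_ge1Dxn n y0); rewrite lerDr.
Qed.

Lemma poly_expR_bounded p : exists2 C, 0 <= C &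
  forall y, 0 <= y -> `|p.[y] * expR (- y)| <= C.
Proof.
exists (\sum_(i < size p) `|p`_i| * i`!%:R) => [|y y0].
  by apply: sumr_ge0 => i _; rewrite mulr_ge0.
rewrite horner_coef mulr_suml; apply: le_trans (ler_norm_sum _ _ _) _.
apply: ler_sum => i _; rewrite -mulrA normrM ler_wpM2l//.
by rewrite ger0_norm ?powX_expR_le// mulr_ge0 ?expR_ge0// exprn_ge0.
Qed.

Lemma bump_poly_bounded p : exists2 C, 0 <= C & forall x, `|bump_poly p x| <= C.
Proof.
have [C C0 hC] := poly_expR_bounded p; exists C => // x.
by rewrite /bump_poly; case: ifPn => [x0|_]; rewrite ?normr0// hC// invr_ge0 ltW.
Qed.

Lemma is_derive_flat (f : R -> R) (C a : R) :
  (forall h, `|f (a + h) - f a| <= C * h ^+ 2) -> is_derive a 1 f 0.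
Proof.
move=> hf; have C0 : 0 <= C.
  by have := le_trans (normr_ge0 _) (hf 1); rewrite expr1n mulr1.
have L : (fun h => h^-1 *: ((f \o shift a) (h *: (1 : R)) - f a)) @ 0^' --> (0 : R).
  apply/cvgr0Pnorm_le => e e0; near=> h.
  rewrite normrZ /= [h *: 1]mulr1 normfV [h + a]addrC.
  have h0 : h != 0 by near: h; exact: nbhs_dnbhs_neq.
  rewrite ler_pdivrMl ?normr_gt0//; apply: le_trans (hf h) _.
  rewrite -real_normK ?num_real// expr2 mulrCA ler_wpM2l//.
  apply: (@le_trans _ _ ((C + 1) * `|h|)); first by rewrite ler_wpM2r// lerDl.
  rewrite mulrC -ler_pdivlMr; last by rewrite ltr_pwDr.
  near: h; apply: nbhs_dnbhs; apply/nbhs_ballP; exists (e / (C + 1)) => /=.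
    by rewrite divr_gt0// ltr_pwDr//.
  by move=> h; rewrite /ball/= sub0r normrN => /ltW.
by apply: DeriveDef; [apply/cvg_ex; exists 0|apply/cvg_lim].
Unshelve. all: by end_near. Qed.

Lemma is_derive_bump_poly p x : is_derive x 1 (bump_poly p) (bump_poly (bump_step p) x).
Proof.
have [x0|x0|->] := ltgtP x 0.
- rewrite [X in is_derive _ _ _ X]/bump_poly ltNge (ltW x0)/=.
  apply: (@near_eq_is_derive _ _ _ (cst 0)).
  near=> y; rewrite /bump_poly ltNge /= ifF//; apply/negbTE; rewrite negbK ltW//.
  by near: y; exact: lt_nbhsl.
- rewrite [X in is_derive _ _ _ X]/bump_poly x0.
  apply: (@near_eq_is_derive _ _ _ (fun y => p.[y^-1] * expR (- y^-1))).
    near=> y; rewrite /bump_poly ifT//; near: y; exact: lt_nbhsr.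
  have xn0 := lt0r_neq0 x0.
  have dV : is_derive x (1 : R) (fun y => y^-1) (- (x ^- 2)).
    have := @is_deriveV R id x 1 1 xn0 (is_derive_id _ _).
    by rewrite [_ *: 1]mulr1.
  have dp : is_derive x (1 : R) (fun y => p.[y^-1]) (- (x ^- 2) * p^`().[x^-1]).
    have := @is_derive1_comp _ (horner p) (fun y => y^-1) x _ _ (is_derive_poly _ _) dV.
    by rewrite mulrC.
  have dVN : is_derive x (1 : R) (fun y => - y^-1) (x ^- 2).
    by have := is_deriveN dV; rewrite opprK.
  have de : is_derive x (1 : R) (fun y => expR (- y^-1)) (x ^- 2 * expR (- x^-1)).
    have := @is_derive1_comp _ expR (fun y => - y^-1) x _ _ (is_derive_expR _) dVN.
    by rewrite mulrC.
  have := is_deriveM dp de; move/is_derive_eq; apply.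
  rewrite /bump_step hornerM hornerXn hornerD hornerN -exprVn /GRing.scale/=; ring.
- rewrite [X in is_derive _ _ _ X]/bump_poly ltxx.
  (* Read at [1/h], the bound for [X^2 p] says that the function is of order [h^2] at 0, hence flat
     there. *)
  have [C C0 hC] := poly_expR_bounded ('X^2 * p).
  apply: (@is_derive_flat _ C) => h; rewrite add0r /bump_poly ltxx subr0.
  case: ifPn => [h0|_]; last by rewrite normr0 mulr_ge0// sqr_ge0.
  have := hC h^-1; rewrite invr_ge0 => /(_ (ltW h0)).
  rewrite hornerM hornerXn -mulrA normrM ger0_norm ?exprn_ge0 ?invr_ge0 ?(ltW h0)//.
  by rewrite exprVn ler_pdivrMl ?exprn_gt0// [h ^+ 2 * _]mulrC.
Unshelve. all: by end_near. Qed.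

Definition bump : R -> R := bump_poly 1.

Lemma bump_family : bounded_family (fun k => bump_poly (iter k bump_step 1)).
Proof.
split=> [k y|k]; first exact: is_derive_bump_poly.
by have [C _ hC] := bump_poly_bounded (iter k bump_step 1); exists C.
Qed.

Lemma bumpE x : bump x = if 0 < x then expR (- x^-1) else 0.
Proof. by rewrite /bump /bump_poly hornerC mul1r. Qed.

Lemma bump_ge0 x : 0 <= bump x.
Proof. by rewrite bumpE; case: ifP => // _; exact: expR_ge0. Qed.

Lemma bump_le1 x : bump x <= 1.
Proof. by rewrite bumpE; case: ifP => // x0; rewrite expR_le1 oppr_le0 invr_ge0 ltW. Qed.

Lemma bump_le0 x : x <= 0 -> bump x = 0.
Proof. by move=> x0; rewrite bumpE ltNge x0. Qed.

Lemma bump_dilate_cvg x : (fun N => bump (N.+1%:R * x)) @ \oo --> ((0 < x)%R%:R : R).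
Proof.
case: (ltP 0 x) => x0; last first.
  under eq_fun do rewrite bump_le0 ?mulr_ge0_le0//.
  exact: cvg_cst.
under eq_fun do rewrite bumpE pmulr_rgt0// x0.
have -> : (true%:R : R) = expR 0 by rewrite expR0.
apply: continuous_cvg; first exact: continuous_expR.
have h0 : (fun N => N.+1%:R^-1 : R) @ \oo --> (0 : R) by exact: cvg_harmonic.
under eq_fun do rewrite invfM.
by rewrite -oppr0 -(mul0r (x^-1)); apply: cvgN; exact: cvgMl.
Qed.

End bump.

Section box_bump.
Context {R : realType} {d : nat}.
Implicit Types (a b x : 'rV[R]_d) (k : R).

(** Smooth, supported in the closed box, and convergent to the indicator of the open box as [k]
    grows, because [exp(-1/(k y))] tends to 1 for [y > 0]. *)
Definition box_bump k a b x : R :=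
  \prod_(i < d) (bump (k * (x 0 i - a 0 i)) * bump (k * (b 0 i - x 0 i))).

Lemma OM_bump_coord k i (e : R) : OM (fun x : 'rV[R]_d => bump (k * x 0 i + e)).
Proof.
have := OM_family 0 (k *: delta_mx 0 i : 'rV[R]_d) e (@bump_family R); congr OM.
by apply/funext => x /=; rewrite dotvC dotvZl dotv_delta.
Qed.

Lemma OM_box_bump k a b : OM (box_bump k a b).
Proof.
rewrite /box_bump; elim: (index_enum _) => [|i s ih].
  by under eq_fun do rewrite big_nil; exact: OM_cst.
under eq_fun do rewrite big_cons; apply: OM_mul => //; apply: OM_mul.
  by under eq_fun do rewrite mulrBr; exact: OM_bump_coord.
under eq_fun => x do rewrite mulrBr addrC -mulNr; exact: OM_bump_coord.
Qed.

Lemma box_bump_neq0 k a b x : 0 < k -> box_bump k a b x != 0 ->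
  forall i, a 0 i < x 0 i < b 0 i.
Proof.
move=> k0 /prodf_neq0 h i; have := h i isT; rewrite mulf_eq0 negb_or => /andP[h1 h2].
apply/andP; split; rewrite ltNge; apply/negP => hle.
  by move: h1; rewrite bump_le0 ?eqxx// pmulr_rle0// subr_le0.
by move: h2; rewrite bump_le0 ?eqxx// pmulr_rle0// subr_le0.
Qed.

Lemma box_bump_support k a b x : 0 < k ->
  \sum_(i < d) (`|a 0 i| + `|b 0 i|) ^+ 2 < dotv x x -> box_bump k a b x = 0.
Proof.
move=> k0 hx; apply/eqP; apply: contraTT hx => /(box_bump_neq0 k0) h.
rewrite -leNgt; apply: ler_sum => i _; have /andP[h1 h2] := h i.
rewrite -expr2 -real_normK ?num_real// lerXn2r ?nnegrE ?addr_ge0//.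
have := ler_norm (- a 0 i); have := ler_norm (b 0 i); rewrite normrN.
by have [x0|x0] := leP 0 (x 0 i); [rewrite ger0_norm//|rewrite ltr0_norm//]; have := normr_ge0 (a 0 i); have := normr_ge0 (b 0 i); lra.
Qed.

Lemma schw_box_bump k a b : 0 < k -> schw (box_bump k a b).
Proof.
move=> k0; apply: (OM_compact_schw (M := \sum_(i < d) (`|a 0 i| + `|b 0 i|) ^+ 2)).
- by apply: sumr_ge0 => i _; exact: sqr_ge0.
- exact: OM_box_bump.
- by move=> x; exact: box_bump_support.
Qed.

Lemma box_bump_ge0 k a b x : 0 <= box_bump k a b x.
Proof. by apply: prodr_ge0 => i _; rewrite mulr_ge0 ?bump_ge0. Qed.

Lemma box_bump_le1 k a b x : box_bump k a b x <= 1.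
Proof.
rewrite /box_bump; apply: (@le_trans _ _ (\prod_(i < d) 1)); last by rewrite big1.
apply: ler_prod => i _; rewrite mulr_ge0 ?bump_ge0//=.
by rewrite mulr_ile1 ?bump_ge0 ?bump_le1.
Qed.

Definition box a b : set 'rV[R]_d := [set x | forall i, a 0 i < x 0 i < b 0 i].

Lemma box_bump_cvg a b x :
  (fun N => box_bump N.+1%:R a b x) @ \oo --> (\1_(box a b) x : R).
Proof.
have -> : \1_(box a b) x = \prod_(i < d) ((0 < x 0 i - a 0 i)%R%:R * (0 < b 0 i - x 0 i)%R%:R) :> R.
  rewrite indicE; case: (pselect (box a b x)) => [bx|nbx].
    rewrite mem_set// big1// => i _; have /andP[h1 h2] := bx i.
    by rewrite !subr_gt0 h1 h2 mulr1.
  rewrite memNset//; apply/esym/eqP/prodf_eq0.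
  have /existsNP[i hi] := nbx; exists i => //.
  by move/negP: hi; rewrite negb_and !subr_gt0 => /orP[]/negbTE ->; rewrite ?mul0r ?mulr0.
rewrite /box_bump; elim: (index_enum _) => [|i s ih].
  under eq_fun do rewrite big_nil; rewrite big_nil; exact: cvg_cst.
under eq_fun do rewrite big_cons; rewrite big_cons; apply: cvgM => //.
by apply: cvgM; exact: bump_dilate_cvg.
Qed.

End box_bump.

Section dilation.
Context {R : realType} {d : nat}.
Implicit Types (x : 'rV[R]_d) (u b psi : 'rV[R]_d -> R) (c : R).

Lemma enormZ c x : 0 < c -> enorm (c *: x) = c * enorm x.
Proof.
move=> c0; rewrite /enorm dotvZl dotvZr mulrA -expr2 sqrtrM ?sqr_ge0//.
by rewrite sqrtr_sqr gtr0_norm.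
Qed.

Lemma dilate_diff u c x : differentiable u (c *: x) ->
  differentiable (fun y => u (c *: y)) x /\
  forall i, DD i (fun y => u (c *: y)) x = c * DD i u (c *: x).
Proof.
move=> du.
have ds : is_diff x (fun y : 'rV[R]_d => c *: y) (fun y : 'rV[R]_d => c *: y).
  have := is_diff_scaler c x; exact.
have dc : is_diff (c *: x) u ('d u (c *: x)) by apply: differentiableP.
have dcomp := is_diff_comp ds dc.
have dd : differentiable (fun y => u (c *: y)) x by case: dcomp.
split=> // i; rewrite /DD deriveE//; have [_ ->] := dcomp => /=.
by rewrite linearZ/= deriveE.
Qed.

Lemma schw_dilate u c : 0 < c -> schw u -> schw (fun y => u (c *: y)).
Proof.
move=> c0 hu; pose K (v : 'rV[R]_d -> R) := exists (a : R) w, schw w /\ v = fun y => a * w (c *: y).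
apply: (@closed_schw _ _ K); last first.
- by exists 1, u; split => //; apply/funext => y; rewrite mul1r.
- move=> _ [a [w [hw ->]]] k; have [C hC] := hw.2 [::] k.
  exists (`|a| * (c ^- k * C)) => x; rewrite normrM mulrCA ler_wpM2l//.
  rewrite -ler_pdivrMl ?invr_gt0 ?exprn_gt0// invrK mulrA -exprMn.
  by rewrite -enormZ//; exact: hC.
- move=> _ i [a [w [hw ->]]]; exists (a * c), (DD i w); split; first exact: schw_DD.
  apply/funext => x; have [dw Dw] := dilate_diff (smooth_differentiable (c *: x) hw.1).
  by rewrite DD_mul// DD_cst mul0r add0r Dw mulrA.
- move=> _ [a [w [hw ->]]] x; have [dw _] := dilate_diff (smooth_differentiable (c *: x) hw.1).
  exact: differentiableM.
Qed.

Lemma schw_lipschitz0 u : schw u -> exists2 L, 0 <= L &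
  forall x, `|u x - u 0| <= L * enorm x.
Proof.
move=> hu; have /choice[M hM] : forall i, exists M, forall x, `|DD i u x| <= M.
  by move=> i; apply: schw_bounded; exact: schw_DD.
have M0 i : 0 <= M i by apply: le_trans (hM i 0).
exists (\sum_i M i) => [|x]; first exact: sumr_ge0.
have df s := @is_derive_ray _ _ u x s (fun y => smooth_differentiable y hu.1).
have ct : {within `[0, 1], continuous (fun s : R => u (s *: x))}.
  apply: continuous_subspaceT => s.
  by apply: differentiable_continuous; apply/derivable1_diffP; have [] := df s.
have [c _] := MVT_segment ler01 (fun s _ => df s) ct.
rewrite scale1r scale0r subr0 mulr1 => ->.
apply: le_trans (ler_norm_sum _ _ _) _; rewrite mulr_suml; apply: ler_sum => i _.
by rewrite normrM mulrC ler_pM// coord_le_enorm.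
Qed.

End dilation.

(** * Dilated cutoffs converge in every Schwartz seminorm *)

Section cutoff.
Context {R : realType} {d : nat}.
Variable chi : 'rV[R]_d -> R.
Hypotheses (schw_chi : schw chi) (chi0 : chi 0 = 1).
Implicit Types (x : 'rV[R]_d) (psi b : 'rV[R]_d -> R).
Local Notation c N := (N.+1%:R^-1 : R).

(* Families of size O(1/N) in every Schwartz seminorm, closed under differentiation. *)
Inductive small_family : (nat -> 'rV[R]_d -> R) -> Prop :=
| small_family_cutoff psi : schw psi ->
    small_family (fun N x => (1 - chi (c N *: x)) * psi x)
| small_family_dilate b psi : schw b -> schw psi ->
    small_family (fun N x => c N * (b (c N *: x) * psi x))
| small_family_scale F : small_family F -> small_family (fun N x => c N * F N x)
| small_family_add F G : small_family F -> small_family G ->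
    small_family (fun N x => F N x + G N x).

Let c0 N : 0 < c N. Proof. by rewrite invr_gt0. Qed.

Let dchi N x : differentiable (fun y => 1 - chi (c N *: y)) x.
Proof.
apply: differentiableB => //.
exact: (dilate_diff (smooth_differentiable _ schw_chi.1)).1.
Qed.

Lemma small_family_diff F : small_family F -> forall N x, differentiable (F N) x.
Proof.
elim=> {F} [psi hp N x|b psi hb hp N x|F _ dF N x|F G _ dF _ dG N x].
- by apply: differentiableM; [exact: dchi|exact: smooth_differentiable hp.1].
- apply: differentiableM => //; apply: differentiableM; last exact: smooth_differentiable hp.1.
  exact: (dilate_diff (smooth_differentiable _ hb.1)).1.
- exact: differentiableM.
- exact: differentiableD.
Qed.

Lemma small_family_DD F i : small_family F -> small_family (fun N => DD i (F N)).
Proof.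
elim=> {F} [psi hp|b psi hb hp|F hF ih|F G hF ihF hG ihG].
- have -> : (fun N => DD i (fun x => (1 - chi (c N *: x)) * psi x)) =
      fun N x => c N * ((fun y => -1 * DD i chi y) (c N *: x) * psi x) +
        (1 - chi (c N *: x)) * DD i psi x.
    apply/funext => N; apply/funext => x.
    have [dw Dw] := dilate_diff (smooth_differentiable (c N *: x) schw_chi.1).
    rewrite DD_mul//; last exact: smooth_differentiable hp.1.
    rewrite (@DD_add _ _ i (fun=> 1) (fun x => - chi (c N *: x)))//; last first.
      exact: differentiableN.
    have -> : DD i (fun y => - chi (c N *: y)) x = - (c N * DD i chi (c N *: x)).
      by rewrite /DD deriveN -?Dw//; exact: diff_derivable.
    by rewrite DD_cst; ring.
  apply: small_family_add.
    exact: (small_family_dilate (schwZ (-1) (schw_DD i schw_chi)) hp).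
  by apply: small_family_cutoff; exact: schw_DD.
- have -> : (fun N => DD i (fun x => c N * (b (c N *: x) * psi x))) =
      fun N x => c N * (c N * (DD i b (c N *: x) * psi x)) + c N * (b (c N *: x) * DD i psi x).
    apply/funext => N; apply/funext => x.
    have [dw Dw] := dilate_diff (smooth_differentiable (c N *: x) hb.1).
    have dp := smooth_differentiable x hp.1.
    rewrite DD_mul//; last exact: differentiableM.
    by rewrite DD_cst DD_mul// Dw; ring.
  apply: small_family_add.
    by apply: small_family_scale; apply: small_family_dilate => //; exact: schw_DD.
  by apply: small_family_dilate => //; exact: schw_DD.
- have -> : (fun N => DD i (fun x => c N * F N x)) = fun N x => c N * DD i (F N) x.
    apply/funext => N; apply/funext => x.
    by rewrite DD_mul ?DD_cst ?mul0r ?add0r//; exact: small_family_diff.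
  exact: small_family_scale.
- have -> : (fun N => DD i (fun x => F N x + G N x)) = fun N x => DD i (F N) x + DD i (G N) x.
    apply/funext => N; apply/funext => x.
    by rewrite DD_add//; exact: small_family_diff.
  exact: small_family_add.
Qed.

Lemma small_family_bound F k : small_family F ->
  exists C, forall N x, enorm x ^+ k * `|F N x| <= C * c N.
Proof.
elim=> {F} [psi hp|b psi hb hp|F _ [C hC]|F G _ [C hC] _ [C' hC']].
(* As [chi] is 1 at the origin, [1 - chi (c x)] is at most [L c |x|]; the additional power of [|x|]
   is absorbed by the seminorm of order [k+1] of [psi]. *)
- have [L L0 hL] := schw_lipschitz0 schw_chi; have [C hC] := hp.2 [::] k.+1.
  exists (L * C) => N x; rewrite normrM mulrCA.
  apply: (@le_trans _ _ (L * (c N * enorm x) * (enorm x ^+ k * `|psi x|))).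
    apply: ler_wpM2r; first by rewrite mulr_ge0// exprn_ge0// enorm_ge0.
    have := hL (c N *: x); rewrite chi0 -normrN opprB.
    by rewrite enormZ.
  have -> : L * (c N * enorm x) * (enorm x ^+ k * `|psi x|) =
      L * (enorm x ^+ k.+1 * `|psi x|) * c N by rewrite exprS; ring.
  by apply: ler_wpM2r; [exact: ltW|exact: ler_wpM2l].
- have [M hM] := schw_bounded hb; have [C hC] := hp.2 [::] k.
  exists (M * C) => N x; rewrite !normrM gtr0_norm//.
  have -> : enorm x ^+ k * (c N * (`|b (c N *: x)| * `|psi x|)) =
      `|b (c N *: x)| * (enorm x ^+ k * `|psi x|) * c N by ring.
  apply: ler_wpM2r; first exact: ltW.
  by apply: ler_pM => //; rewrite mulr_ge0// exprn_ge0// enorm_ge0.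
- exists C => N x; apply: le_trans (hC N x); rewrite ler_wpM2l ?exprn_ge0 ?enorm_ge0//.
  by rewrite normrM gtr0_norm// ler_piMl// invf_le1// ler1n.
- exists (C + C') => N x; rewrite mulrDl; apply: le_trans (lerD (hC N x) (hC' N x)).
  by rewrite -mulrDr ler_wpM2l ?exprn_ge0 ?enorm_ge0// ler_normD.
Qed.

Lemma small_family_seminorm a F k : small_family F ->
  exists C, forall N x, enorm x ^+ k * `|partials a (F N) x| <= C * c N.
Proof.
elim/last_ind: a F => [|a i ih] F hF; first exact: small_family_bound.
have [C hC] := ih _ (small_family_DD i hF).
by exists C => N x; rewrite partials_rcons.
Qed.

Lemma cutoff_seminorm a k psi : schw psi -> exists C, forall N x,
  enorm x ^+ k * `|partials a (fun x => (1 - chi (c N *: x)) * psi x) x| <= C * c N.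
Proof. by move=> hp; apply: small_family_seminorm; exact: small_family_cutoff. Qed.

End cutoff.

(** * Functions as tempered distributions *)
Lemma ccvg_normc_le {R : realType} (z : nat -> R[i]) (w : R[i]) (e : nat -> R) :
  (forall N, normc (z N - w) <= e N) -> e @ \oo --> 0 -> ccvg z w.
Proof.
move=> ze e0.
have main (f : R[i] -> R) : (forall a b, f (a - b) = f a - f b) -> (forall a, `|f a| <= normc a) ->
    (fun N => f (z N)) @ \oo --> f w.
  move=> fB fn; apply/cvgrPdist_le => r r0.
  have /cvgrPdist_le/(_ r r0) := e0; apply: filterS => N; rewrite sub0r normrN => h.
  rewrite distrC -fB; apply: le_trans (fn _) _; apply: le_trans (ze N) _.
  by apply: le_trans h; exact: ler_norm.
split; apply: main; [exact: raddfB|exact: Re_le_normc|exact: raddfB|exact: Im_le_normc].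
Qed.

Lemma Re_real_mul {R : realType} (r : R) (w : R[i]) : Re (r%:C%C * w) = r * Re w.
Proof. by rewrite mulrC Re_mul_real mulrC. Qed.

Lemma Im_real_mul {R : realType} (r : R) (w : R[i]) : Im (r%:C%C * w) = r * Im w.
Proof. by rewrite mulrC Im_mul_real mulrC. Qed.

Lemma ReN {R : realType} (w : R[i]) : Re (- w) = - Re w.
Proof. by case: w. Qed.

Lemma ImN {R : realType} (w : R[i]) : Im (- w) = - Im w.
Proof. by case: w. Qed.

Section weak_L4_functions.
Context {R : realType} {d : nat}.
Local Notation mu := (@lebesgue_rV R d).
Implicit Types (x : 'rV[R]_d) (f psi h : 'rV[R]_d -> R[i]).

Lemma weakL4_bounded_integrable (H w : 'rV[R]_d -> R) (k M : R) :
  measurable_fun setT H -> (forall p, 0 <= H p) -> 0 < k -> weakL4 mu H k ->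
  measurable_fun setT w -> (forall p, 0 <= w p <= M) -> (\int[mu]_p (w p)%:E < +oo)%E ->
  (\int[mu]_p (H p * w p)%:E < +oo)%E.
Proof.
move=> mH H0 k0 hH mw hw Iw.
have w0 p : 0 <= w p by have /andP[] := hw p.
have Iw0 : (0 <= \int[mu]_p (w p)%:E)%E by apply: integral_ge0 => p _; rewrite lee_fin.
have fw : (\int[mu]_p (w p)%:E)%E \is a fin_num by rewrite ge0_fin_numE.
(* The summand 1 keeps the normalising factor positive when [w] has mass zero. *)
pose A := fine (\int[mu]_p (w p)%:E)%E + 1.
have A0 : 0 < A by rewrite ltr_wpDl// fine_ge0.
have M0 : 0 <= M by have /andP[h1 h2] := hw 0; apply: le_trans h2.
have E : (\int[mu]_p (H p * w p)%:E = A%:E * \int[mu]_p (H p * (A^-1 * w p))%:E)%E.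
  rewrite -ge0_integralZl//.
  - apply: eq_integral => p _; rewrite -EFinM; congr EFin; field; exact: lt0r_neq0.
  - by apply/measurable_EFinP; apply: measurable_funM => //; exact: measurable_funM.
  - by move=> p _; rewrite lee_fin mulr_ge0// mulr_ge0// invr_ge0 ltW.
  - by rewrite lee_fin ltW.
rewrite E lte_mul_pinfty// ?lee_fin ?ltW//.
apply: le_lt_trans (integral_weakL4_bounded (M := A^-1 * (M + 1)) mH H0 k0 hH _ _ _ _) _.
- exact: measurable_funM.
- move=> p; rewrite mulr_ge0 ?invr_ge0 ?(ltW A0)//=.
  rewrite ler_wpM2l ?invr_ge0 ?(ltW A0)//; have /andP[_ h2] := hw p.
  by apply: le_trans h2 _; rewrite lerDl.
- by rewrite mulr_gt0 ?invr_gt0// ltr_wpDl.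
- under eq_integral do rewrite EFinM.
  rewrite ge0_integralZl//; last 3 first.
  + exact/measurable_EFinP.
  + by move=> p _; rewrite lee_fin.
  + by rewrite lee_fin invr_ge0 ltW.
  rewrite -(fineK fw) -EFinM lee_fin ler_pdivrMl// mulr1 /A lerDl//.
by rewrite ltry.
Qed.

Lemma schwartz_bounded psi : schwartz psi -> exists M, forall x, normc (psi x) <= M.
Proof.
move=> /schwartzP[/schw_bounded[M hM] /schw_bounded[M' hM']]; exists (M + M') => x.
by apply: le_trans (normc_le_ReIm _) _; exact: lerD.
Qed.

Lemma cL1_weakL4_schwartz h psi (k : R) : cmeas h -> 0 < k ->
  weakL4 mu (fun x => normc (h x)) k -> schwartz psi -> cL1 mu (fun x => h x * psi x).
Proof.
move=> mh k0 hk sp; have [mp Ip] := schwartz_cL1 sp; have [M hM] := schwartz_bounded sp.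
split; first exact: cmeasM.
under eq_integral do rewrite ComplexField.Normc.normcM.
apply: (weakL4_bounded_integrable (M := M) _ _ k0 hk) => //; try exact: measurable_normc.
- by move=> x; exact: normc_ge0.
- by move=> x; rewrite normc_ge0 hM.
Qed.

Lemma schwartz_mul (u : 'rV[R]_d -> R) f : tame u -> schwartz f ->
  schwartz (fun x => (u x)%:C%C * f x).
Proof.
move=> tu /schwartzP[fR fI]; apply/schwartzP; split.
  by have := schw_mul tu fR; congr schw; apply/funext => x; rewrite Re_real_mul.
by have := schw_mul tu fI; congr schw; apply/funext => x; rewrite Im_real_mul.
Qed.

End weak_L4_functions.

Section tempered_function.
Context {R : realType} {d : nat}.
Local Notation mu := (@lebesgue_rV R d).
Implicit Types (x : 'rV[R]_d) (f psi h : 'rV[R]_d -> R[i]).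
Local Notation c N := (N.+1%:R^-1 : R).

Let one : 'rV[R]_d := const_mx 1.

(** Compactly supported and normalised to be 1 at the origin only: the Lipschitz estimate makes this
    enough for the truncations to converge. *)
Definition unit_cutoff x : R := (box_bump 1 (- one) one 0)^-1 * box_bump 1 (- one) one x.

Let bump0 : 0 < box_bump 1 (- one) one 0.
Proof.
apply: prodr_gt0 => i _; rewrite !mxE !bumpE !mul1r opprK add0r subr0 ltr01.
by rewrite mulr_gt0// expR_gt0.
Qed.

Let cst_ge0 : 0 <= (box_bump 1 (- one) one 0)^-1. Proof. by rewrite invr_ge0 ltW. Qed.

Lemma unit_cutoff0 : unit_cutoff 0 = 1.
Proof. by rewrite /unit_cutoff mulVf// lt0r_neq0. Qed.

Lemma unit_cutoff_bound x : 0 <= unit_cutoff x <= (box_bump 1 (- one) one 0)^-1.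
Proof. by rewrite mulr_ge0 ?box_bump_ge0//= ler_piMr// box_bump_le1. Qed.

Lemma schw_unit_cutoff : schw unit_cutoff.
Proof. by apply: schwZ; exact: schw_box_bump. Qed.

Lemma unit_cutoff_support x (i : 'I_d) : 1 <= `|x 0 i| -> unit_cutoff x = 0.
Proof.
move=> xi; apply/eqP; apply: contraTT xi; rewrite mulf_eq0 negb_or => /andP[_].
move=> /(box_bump_neq0 ltr01)/(_ i); rewrite !mxE => h.
by rewrite -ltNge ltr_norml.
Qed.

Lemma schw_tame (u : 'rV[R]_d -> R) : schw u -> tame u.
Proof.
move=> [su ru]; split=> // a; have [C hC] := ru a 0%N; exists 0%N, C => x.
by have := hC x; rewrite expr0 mul1r mulr1.
Qed.

Definition truncation N psi x : R[i] := (unit_cutoff (c N *: x))%:C%C * psi x.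

(** Written as [-1 * truncation + psi] to match the shape [a * f + g] of the linearity clause of
    [tempered_distribution]. *)
Definition remainder N psi x : R[i] := - 1 * truncation N psi x + psi x.

Let c0 N : 0 < c N. Proof. by rewrite invr_gt0. Qed.

Lemma schwartz_truncation N psi : schwartz psi -> schwartz (truncation N psi).
Proof.
by apply: schwartz_mul; apply: schw_tame; apply: schw_dilate => //; exact: schw_unit_cutoff.
Qed.

Lemma test_function_truncation N psi : (0 < d)%N -> schwartz psi ->
  test_function (truncation N psi).
Proof.
move=> d0 sp; split; first by have [] := schwartz_truncation N sp.
exists (N.+1%:R * d%:R) => x hx.
have [i hi] : exists i, N.+1%:R <= `|x 0 i|.
  apply: contrapT => /forallNP hn; move: hx; apply/negP; rewrite -leNgt.
  apply: le_trans (enorm_le_sum x) _.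
  apply: (@le_trans _ _ (\sum_(i < d) N.+1%:R)); last first.
    by rewrite (sumr_const (predT : pred 'I_d)) cardT size_enum_ord -[X in X <= _]mulr_natr.
  by apply: ler_sum => i _; apply/ltW; rewrite ltNge; apply/negP; exact: hn.
rewrite /truncation (@unit_cutoff_support _ i) ?mul0r//.
by rewrite mxE normrM gtr0_norm// ler_pdivlMl// mulr1.
Qed.

Lemma truncation_seminorm psi (p : nat * seq 'I_d) : schwartz psi ->
  exists2 C, 0 <= C & forall N,
  (schwartz_seminorm p (remainder N psi) <= (C * c N)%:E)%E.
Proof.
case: p => k a sp; have /schwartzP[pR pI] := sp.
have [C hC] := cutoff_seminorm schw_unit_cutoff unit_cutoff0 a k pR.
have [C' hC'] := cutoff_seminorm schw_unit_cutoff unit_cutoff0 a k pI.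
have nn (u : 'rV[R]_d -> R) x : 0 <= enorm x ^+ k * `|u x|.
  by rewrite mulr_ge0// exprn_ge0// enorm_ge0.
exists (C + C') => [|N].
  have := lerD (le_trans (nn _ _) (hC 0%N 0)) (le_trans (nn _ _) (hC' 0%N 0)).
  by rewrite invr1 !mulr1 addr0.
apply: ge_ereal_sup => _ [x _ <-]; rewrite lee_fin mulrDl.
apply: le_trans (lerD (hC N x) (hC' N x)).
rewrite -mulrDr ler_wpM2l ?exprn_ge0 ?enorm_ge0//.
apply: le_trans (normc_le_ReIm _) _; rewrite /cpartials /=.
rewrite le_eqVlt; apply/orP; left; apply/eqP; congr (`|partials a _ x| + `|partials a _ x|).
  by apply/funext => y; rewrite /remainder /truncation ReD mulN1r ReN Re_real_mul; ring.
by apply/funext => y; rewrite /remainder /truncation ImD mulN1r ImN Im_real_mul; ring.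
Qed.

Lemma schwartz_seminorm_ge0 (p : nat * seq 'I_d) f : (0 <= schwartz_seminorm p f)%E.
Proof.
apply: (@le_trans _ _ (enorm 0 ^+ p.1 * normc (cpartials p.2 f 0))%:E).
  by rewrite lee_fin mulr_ge0 ?normc_ge0// exprn_ge0// enorm_ge0.
by apply: ereal_sup_ubound; exists 0.
Qed.

Lemma schwartz_remainder N psi : schwartz psi ->
  schwartz (remainder N psi).
Proof.
move=> sp; have /schwartzP[pR pI] := sp; have /schwartzP[tR tI] := schwartz_truncation N sp.
apply/schwartzP; split.
  by have := schwD (schwZ (-1) tR) pR; congr schw; apply/funext => x; rewrite ReD mulN1r ReN mulN1r.
by have := schwD (schwZ (-1) tI) pI; congr schw; apply/funext => x; rewrite ImD mulN1r ImN mulN1r.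
Qed.

(** By definition [v] and [h] are identified on test functions only. For truncations of [psi] the
    distribution side converges by continuity in the seminorms, and the integral side by dominated
    convergence, [h psi] being integrable. *)
Theorem dist_is_fun_schwartz (v : ('rV[R]_d -> R[i]) -> R[i]) h (k : R) psi :
  (0 < d)%N -> dist_is_fun v h -> 0 < k -> weakL4 mu (fun x => normc (h x)) k ->
  schwartz psi -> v psi = cint mu (fun x => h x * psi x).
Proof.
move=> d0 [[vlin [b [ps vb]]] [mh _] vh] k0 hk sp.
have mh' : cmeas h by [].
apply: (@ccvg_unique _ (fun N => v (truncation N psi))).
  have [C hC] : exists C, forall N,
    (\sum_(p <- ps) schwartz_seminorm p (remainder N psi) <= (C * c N)%:E)%E.
    elim: ps {vb} => [|p ps [C hC]].
      by exists 0 => N; rewrite big_nil mul0r.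
    have [C' C'0 hC'] := truncation_seminorm p sp.
    by exists (C' + C) => N; rewrite big_cons mulrDl EFinD leeD.
  apply: (@ccvg_normc_le _ _ _ (fun N => `|b| * C * c N)) => [N|].
    rewrite normcB.
    have := vb _ (schwartz_remainder N sp).
    rewrite /remainder vlin//; last exact: schwartz_truncation.
    rewrite mulN1r addrC => /le_trans h1; rewrite -lee_fin; apply: h1.
    set S := (\sum_(p <- ps) _)%E.
    have S0 : (0 <= S)%E by apply: sume_ge0 => p _; exact: schwartz_seminorm_ge0.
    apply: (@le_trans _ _ (`|b|%:E * S)%E); first by rewrite lee_wpmul2r// lee_fin ler_norm.
    by rewrite -mulrA EFinM lee_wpmul2l// ?lee_fin// hC.
  rewrite -(mulr0 (`|b| * C)); apply: cvgMr.
  exact: cvg_harmonic.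
have E N : v (truncation N psi) = cint mu (fun x => h x * truncation N psi x).
  by rewrite vh//; exact: test_function_truncation.
have [mhp Ihp] := cL1_weakL4_schwartz mh' k0 hk sp.
pose K := (box_bump 1 (- one) one 0)^-1.
have lim x : ccvg (fun N => h x * truncation N psi x) (h x * psi x).
  apply: ccvgM; first exact: ccvg_cst.
  rewrite -[X in ccvg _ X]mul1r; apply: ccvgM; last exact: ccvg_cst.
  have h0 : (fun N => unit_cutoff (c N *: x)) @ \oo --> unit_cutoff 0.
    apply: continuous_cvg; first exact: schw_continuous schw_unit_cutoff 0.
    by rewrite -(scale0r x); apply: cvgZr_tmp; exact: cvg_harmonic.
  by have := ccvg_real h0; rewrite unit_cutoff0.
have -> : (fun N => v (truncation N psi)) = (fun N => cint mu (fun x => h x * truncation N psi x)).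
  by apply/funext => N; exact: E.
apply: (@cint_dct _ _ _ mu (fun N x => h x * truncation N psi x) (fun x => h x * psi x)
  (fun x => K * normc (h x * psi x))).
- by move=> N; apply: cmeasM => //; exact: schwartz_cmeas (schwartz_truncation N sp).
- exact: mhp.
- by apply: measurable_funM => //; exact: measurable_normc.
- by move=> x; exact: (lim x).1.
- by move=> x; exact: (lim x).2.
- move=> N x; rewrite /truncation mulrCA ComplexField.Normc.normcM ler_wpM2r ?normc_ge0//.
  by rewrite normc_real; have /andP[h1 h2] := unit_cutoff_bound (c N *: x); rewrite ger0_norm.
under eq_integral do rewrite EFinM.
rewrite ge0_integralZl//.
- by rewrite lte_mul_pinfty// lee_fin.
- by apply/measurable_EFinP; exact: measurable_normc.
- by move=> x _; rewrite lee_fin normc_ge0.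
Qed.

End tempered_function.

(** * The fundamental lemma of the calculus of variations *)
Section boxes.
Context {R : realType} {d : nat}.
Local Notation mu := (@lebesgue_rV R d).
Implicit Types (a b x : 'rV[R]_d).

Definition boxes : set (set 'rV[R]_d) := [set A | exists a b, A = box a b].

Lemma box_closed_ball (M : R) : compact [set x : 'rV[R]_d | forall i, x 0 i \in `[- M, M]].
Proof.
have := @rV_compact R d (fun=> `[- M, M]%classic) (fun=> @segment_compact _ _ _).
by congr compact; apply/seteqP; split => x /= h i; have := h i; rewrite ?inE.
Qed.

Lemma measurable_box a b : measurable (box a b).
Proof.
rewrite (_ : box a b = \bigcap_(i in [set: 'I_d]) (fun x : 'rV[R]_d => x 0 i) @^-1` `]a 0 i, b 0 i[%classic).
  apply: fin_bigcap_measurable => // i _; rewrite -[X in measurable X]setTI.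
  exact: measurable_rV_coord.
by apply/seteqP; split => x /= h i; have := h i; rewrite /= in_itv//= => h'; apply: h'.
Qed.

Lemma setI_closed_boxes : setI_closed boxes.
Proof.
move=> _ _ [a [b ->]] [a' [b' ->]].
exists (\row_i Num.max (a 0 i) (a' 0 i)), (\row_i Num.min (b 0 i) (b' 0 i)).
apply/seteqP; split => x /=.
  by move=> [h h'] i; rewrite !mxE gt_max lt_min; have /andP[-> ->] := h i; have /andP[-> ->] := h' i.
move=> h; split => i; have := h i; rewrite !mxE gt_max lt_min => /andP[/andP[h1 h2] /andP[h3 h4]].
  by rewrite h1.
by rewrite h2.
Qed.

(** A coordinate half-space is a countable union of boxes, whose sides in the other directions grow
    to infinity. *)
Lemma measurable_boxes : @measurable _ 'rV[R]_d = <<s boxes >>.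
Proof.
apply/seteqP; split; last first.
  apply: smallest_sub; first exact: sigma_algebra_measurable.
  by move=> _ [a [b ->]]; exact: measurable_box.
apply: smallest_sub; first exact: smallest_sigma_algebra.
move=> A; rewrite -bigcup_seq/= => -[i _ [B mB <-]].
suff mc : measurable_fun [set: g_sigma_algebraType boxes] (fun x : 'rV[R]_d => x 0 i : measurableTypeR R).
  by apply: mc.
apply: (@measurability _ _ _ _ _ _ (@RGenOInfty.G R)); first exact: RGenOInfty.measurableE.
move=> _ [_ [r ->] <-]; rewrite setTI.
rewrite (_ : _ @^-1` _ = \bigcup_N box (\row_j if j == i then r else - N%:R) (\row_j N%:R)).
  by apply: bigcupT_measurable => N; apply: sub_sigma_algebra; eexists; eexists; reflexivity.
apply/seteqP; split => x /=.
  rewrite in_itv/= andbT => rx.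
  exists (Num.truncn (\sum_j `|x 0 j|)).+1 => //= j; rewrite !mxE.
  have : `|x 0 j| < (Num.truncn (\sum_j `|x 0 j|)).+1%:R.
    by apply: le_lt_trans (truncnS_gt _); rewrite (bigD1 j)//= lerDl sumr_ge0.
  by rewrite ltr_norml => /andP[h1 h2]; rewrite h2 andbT; case: eqP => [->|].
by move=> [N _ /(_ i)]; rewrite !mxE eqxx in_itv/= andbT => /andP[].
Qed.

End boxes.

Section fundamental_lemma.
Context {R : realType} {d : nat}.
Local Notation mu := (@lebesgue_rV R d).
Implicit Types (a b x : 'rV[R]_d) (g : 'rV[R]_d -> R).

Let B N : set 'rV[R]_d := box (const_mx (- N%:R)) (const_mx N%:R).

Lemma box_integrable g a b : (forall K, compact K -> mu.-integrable K (EFin \o g)) ->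
  mu.-integrable (box a b) (EFin \o g).
Proof.
move=> gK; pose M := \sum_i (`|a 0 i| + `|b 0 i|).
have := gK _ (@box_closed_ball R d M); apply: integrableS; last first.
- move=> x hx i; rewrite in_itv/=; have /andP[h1 h2] := hx i.
  have hM : `|a 0 i| + `|b 0 i| <= M.
    by rewrite /M (bigD1 i)//= lerDl sumr_ge0// => j _; rewrite addr_ge0.
  have := ler_norm (b 0 i); have := ler_norm (- a 0 i); rewrite normrN.
  have := normr_ge0 (a 0 i); have := normr_ge0 (b 0 i).
  by move=> *; apply/andP; split; lra.
- exact: measurable_box.
- rewrite (_ : [set x | _] = \bigcap_(i in [set: 'I_d]) (fun x : 'rV[R]_d => x 0 i) @^-1` `[- M, M]%classic).
    apply: fin_bigcap_measurable => // i _; rewrite -[X in measurable X]setTI.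
    exact: measurable_rV_coord.
  by apply/seteqP; split => x /= h i; have := h i; rewrite /= ?inE//= => h'; apply: h'.
Qed.

(** Box bumps converge boundedly to box indicators, so the integral of [g] over every box vanishes,
    and boxes generate the Borel sets. *)
Lemma fundamental_lemma_real g : measurable_fun setT g ->
  (forall a b, mu.-integrable (box a b) (EFin \o g)) ->
  (forall N a b, \int[mu]_x (g x * box_bump N.+1%:R a b x) = 0)%R ->
  {ae mu, forall x, g x = 0}.
Proof.
move=> mg gK gb.
have gbox a b : (\int[mu]_(x in box a b) (g x)%:E = 0)%E.
  have Ib := gK a b.
  have mb := @measurable_box R d a b.
  pose F N x := (g x * box_bump N.+1%:R a b x)%:E.
  have mF N : measurable_fun setT (F N).
    apply/measurable_EFinP; apply: measurable_funM => //.
    by apply: schw_measurable; exact: schw_box_bump.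
  have F0 N x : ~ box a b x -> F N x = 0%E.
    move=> nb; rewrite /F; have [->|/box_bump_neq0] := eqVneq (box_bump N.+1%:R a b x) 0.
      by rewrite mulr0.
    by move=> /(_ (ltr0Sn _ _)).
  have FE N : (\int[mu]_x F N x = \int[mu]_(x in box a b) F N x)%E.
    rewrite [RHS]integral_mkcond; apply: eq_integral => x _; rewrite patchE.
    by case: ifPn => // /negP; rewrite inE => /F0.
  have IF N : mu.-integrable (box a b) (F N).
    apply: le_integrable Ib => //; first exact: measurable_funTS.
    by move=> x _; rewrite lee_fin normrM ler_piMr// ger0_norm ?box_bump_ge0 ?box_bump_le1.
  have FN0 N : (\int[mu]_x F N x = 0)%E.
    have := gb N a b; rewrite /Rintegral -/(F N) => h.
    have : (\int[mu]_x F N x)%E \is a fin_num.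
      by rewrite FE; exact: integrable_fin_num (IF N).
    by move/fineK => <-; rewrite h.
  have := @dominated_convergence _ _ _ mu (box a b) mb F (EFin \o g) (fun x => `|g x|%:E).
  case.
  - by move=> N; exact: measurable_funTS.
  - by apply: measurable_funTS; exact/measurable_EFinP.
  - apply: aeW => x bx; apply/fine_cvgP; split; first exact: nearW.
    have := @box_bump_cvg R d a b x; rewrite indicE mem_set//= => h.
    by rewrite -[X in _ --> X]mulr1; apply: cvgMr.
  - exact: (integrable_norm Ib).
  - apply: aeW => N x _; rewrite lee_fin normrM ler_piMr// ger0_norm ?box_bump_ge0 ?box_bump_le1//.
  move=> _ _ /= h; have : (fun N => \int[mu]_(x in box a b) F N x)%E @ \oo --> 0%E.
    by under eq_fun do rewrite -FE FN0; exact: cvg_cst.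
  by move=> h'; apply: cvg_unique h h'.
(* Inside the cube [B N] the function is integrable, so the sets over which its integral vanishes
   form a Dynkin class; it contains the boxes, which are closed under intersection. *)
have aeN N : ae_eq mu (B N) (EFin \o g) (cst 0%E).
  have mB : measurable (B N) by exact: measurable_box.
  have IB : mu.-integrable (B N) (EFin \o g) by exact: gK.
  have IS S : measurable S -> mu.-integrable (S `&` B N) (EFin \o g).
    by move=> mS; apply: integrableS IB => //; exact: measurableI.
  apply: integral_ae_eq => //.
  move=> E EB mE; rewrite integral0 -(setIidl EB).
  apply: (@dynkin_induction _ _ boxes (fun S => \int[mu]_(x in S `&` B N) (EFin \o g) x = 0)%E).
  - exact: measurable_boxes.
  - exact: setI_closed_boxes.
  - by rewrite setTI; exact: gbox.
  - move=> A bA; have [a [b ->]] : boxes (A `&` B N).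
      by apply: setI_closed_boxes => //; eexists; eexists; reflexivity.
    exact: gbox.
  - move=> S mS PS.
    have : (\int[mu]_(x in S `&` B N `|` ~` S `&` B N) (EFin \o g) x = 0)%E.
      by rewrite -setIUl setUv setTI; exact: gbox.
    rewrite integral_setU//; last 4 first.
    + exact: measurableI.
    + by apply: measurableI => //; exact: measurableC.
    + rewrite -setIUl setUv setTI; apply: measurable_funTS; exact/measurable_EFinP.
    + by apply/disj_setPS => x [[h _] [h' _]].
    by rewrite PS add0e.
  - move=> F mF tF PF; rewrite setI_bigcupl integral_bigcup//.
    + by apply: eseries0 => n _ _; exact: PF.
    + exact: trivIset_setIr.
    + by move=> n; exact: measurableI.
    + by rewrite -setI_bigcupl; apply: IS; exact: bigcup_measurable.
  - by rewrite -measurable_boxes.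
have : {ae mu, forall x, forall N, B N x -> (g x)%:E = 0%E}.
  by apply/ae_foralln => N; exact: aeN.
apply: filterS => x hx.
have hB : B (Num.truncn (\sum_j `|x 0 j|)).+1 x.
  move=> j; rewrite !mxE -ltr_norml.
  by apply: le_lt_trans (truncnS_gt _); rewrite (bigD1 j)//= lerDl sumr_ge0.
by have [] := hx _ hB.
Qed.

End fundamental_lemma.

(** * Bessel potentials *)
Section product_measure.
Context d1 d2 (T1 : measurableType d1) (T2 : measurableType d2) (R : realType).
Variables (m1 : {sigma_finite_measure set T1 -> \bar R}) (m2 : {sigma_finite_measure set T2 -> \bar R}).

Lemma product_sigma_finite : sigma_finite setT (m1 \x m2)%E.
Proof.
have /sigma_finiteP[F [FT Fnd Foo]] := sigma_finiteT m1.
have /sigma_finiteP[G [GT Gnd Goo]] := sigma_finiteT m2.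
exists (fun i => F i `*` G i) => [|i].
  apply/esym; rewrite -subTset => -[x y] _.
  have [i _ Fx] : (\bigcup_i F i) x by rewrite -FT.
  have [j _ Gy] : (\bigcup_i G i) y by rewrite -GT.
  exists (maxn i j) => //; split => /=.
    by move: Fx; exact/subsetPset/Fnd/leq_maxl.
  by move: Gy; exact/subsetPset/Gnd/leq_maxr.
have [mF ltF] := Foo i; have [mG ltG] := Goo i; split; first exact: measurableX.
by rewrite product_measure1E// lte_mul_pinfty// ge0_fin_numE.
Qed.

(** The product measure bundled with its sigma-finiteness, so that it can itself be a factor in
    Tonelli's and Fubini's theorems. *)
Definition product_sf : {sigma_finite_measure set (T1 * T2)%type -> \bar R} :=
  HB.pack (product_measure1 m1 m2) (Measure_isSigmaFinite.Build _ _ _ (product_measure1 m1 m2) product_sigma_finite).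
End product_measure.

Lemma le_normc_cint_cmeas {R : realType} d (T : measurableType d)
    (mu : {measure set T -> \bar R}) (f : T -> R[i]) : cmeas f ->
  ((normc (cint mu f))%:E <= \int[mu]_x (normc (f x))%:E)%E.
Proof.
move=> mf; have [If|] := ltP (\int[mu]_x (normc (f x))%:E)%E (+oo%E).
  exact: le_normc_cint.
by rewrite leye_eq => /eqP ->; exact: leey.
Qed.

Section subordinated_kernel.
Context {R : realType} {d : nat}.
Local Notation mu := (@lebesgue_rV R d).
Local Notation lam := (@lebesgue_measure R).

(** Joint measurability in time and space: for [t > 0] the kernel is expressed through powers of
    [t], and for [t <= 0] the density makes both expressions vanish. *)
Lemma measurable_gamma_heat (b : R) :
  measurable_fun setT (fun p : R * 'rV[R]_d => gamma_density b p.1 * heat p.1 p.2).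
Proof.
pose r (t : R) := t `^ (-1).
have mr : measurable_fun setT (fun p : R * 'rV[R]_d => r p.1).
  by apply: measurableT_comp; [exact: measurable_powR_fun|exact: measurable_fst].
rewrite (_ : (fun p => _) = fun p : R * 'rV[R]_d => gamma_density b p.1 *
    ((((4 * pi)^-1 * r p.1) `^ 2^-1) ^+ d * expR (- (4^-1 * r p.1) * dotv p.2 p.2))).
  apply: measurable_funM.
    by apply: measurableT_comp; [exact: measurable_gamma_density|exact: measurable_fst].
  apply: measurable_funM.
    apply: measurable_funX.
    apply: (measurableT_comp (f := fun y : R => y `^ 2^-1) (measurable_powR_fun _)).
    exact: measurable_funM.
  apply: measurableT_comp; first exact: measurable_expR.
  apply: measurable_funM.
    by apply: measurableT_comp => //; exact: measurable_funM.
  by apply: measurable_dotv; exact: measurable_snd.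
apply/funext => -[t y] /=; have [t0|t0] := leP t 0.
  by rewrite gamma_density_le0 ?mul0r.
have p0 := lt0r_neq0 (pi_gt0 R); have tn0 := lt0r_neq0 t0.
have alg (p : R) : p != 0 -> p / (4 * p ^+ 2 * t) = (4 * p)^-1 / t.
  by move=> q0; field; rewrite q0 tn0.
have alg2 (p : R) : p != 0 -> p ^+ 2 / (4 * p ^+ 2 * t) = 4^-1 / t.
  by move=> q0; field; rewrite q0 tn0.
rewrite /heat /gaussI /r powR_inv1 ?(ltW t0)// alg// alg2// powR12_sqrt//.
by rewrite mulr_ge0// invr_ge0 ?(ltW t0)// mulr_ge0// ltW// pi_gt0.
Qed.

Lemma measurable_gamma_qgauss (b : R) :
  measurable_fun setT (fun p : R * 'rV[R]_d => gamma_density b p.1 * qgauss p.1 p.2).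
Proof.
apply: measurable_funM.
  by apply: measurableT_comp; [exact: measurable_gamma_density|exact: measurable_fst].
apply: measurableT_comp; first exact: measurable_expR.
apply: measurable_funM; last by apply: measurable_dotv; exact: measurable_snd.
by apply: measurableT_comp => //; apply: measurable_funM => //; exact: measurable_fst.
Qed.

(** Subordination on the Fourier side: the symbol of [(I - Delta)^{-b}] is the gamma average of the
    heat multipliers. *)
Lemma integral_gamma_qgauss (b : R) (v : 'rV[R]_d) : 0 < b ->
  (\int[lam]_t (gamma_density b t * qgauss t v)%:E = (bweight v `^ (- b))%:E)%E.
Proof.
move=> b0; rewrite /bweight -integral_gamma_density_exp//; last first.
  by rewrite mulr_ge0 ?dotvv_ge0// mulr_ge0// sqr_ge0.
by apply: eq_integral => t _; rewrite /qgauss; congr (_ * expR _)%:E; ring.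
Qed.

End subordinated_kernel.

Section bessel_potential.
Context {R : realType} {n : nat}.
Local Notation mu := (@lebesgue_rV R (n + n)).
Local Notation lam := (@lebesgue_measure R).
Local Notation Pi := (product_sf lam mu).
Variables (b k : R) (h : 'rV[R]_(n + n) -> R[i]).
Hypotheses (b0 : 0 < b) (nb : n%:R / 4 < b) (k0 : 0 < k).
Hypotheses (mh : cmeas h) (hk : weakL4 mu (fun x => normc (h x)) k).

Definition potential_kernel (x : 'rV[R]_(n + n)) (p : R * 'rV[R]_(n + n)) : R[i] :=
  (gamma_density b p.1 * heat p.1 (x - p.2))%:C%C * h p.2.

(* The Bessel potential $(I-\Delta)^{-b} h$, written by subordination to the heat semigroup. *)
Definition bessel_potential x : R[i] := cint Pi (potential_kernel x).

Definition potential_bound : R :=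
  heatC (R := R) (n := n) * k * fine (\int[lam]_t (gamma_density b t * t `^ (- (n%:R / 4)))%:E)%E.

Lemma measurable_potential_weight : measurable_fun setT
  (fun q : 'rV[R]_(n + n) * (R * 'rV[R]_(n + n)) =>
    gamma_density b q.2.1 * heat q.2.1 (q.1 - q.2.2)).
Proof.
apply: (measurableT_comp (f := fun p : R * 'rV[R]_(n + n) => gamma_density b p.1 * heat p.1 p.2)
  (g := fun q : 'rV[R]_(n + n) * (R * 'rV[R]_(n + n)) => (q.2.1, q.1 - q.2.2))).
  exact: measurable_gamma_heat.
apply/measurable_fun_pairP; split => /=.
  exact: (measurableT_comp (f := fst) (g := snd) measurable_fst measurable_snd).
apply: measurable_rVB; first exact: measurable_fst.
exact: (measurableT_comp (f := snd) (g := snd) measurable_snd measurable_snd).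
Qed.

Lemma measurable_potential_weight1 x : measurable_fun setT
  (fun p : R * 'rV[R]_(n + n) => gamma_density b p.1 * heat p.1 (x - p.2)).
Proof. exact: (measurableT_comp measurable_potential_weight (measurable_pair1 x)). Qed.

Lemma potential_weight_ge0 t (y : 'rV[R]_(n + n)) : 0 <= gamma_density b t * heat t y.
Proof.
have [t0|t0] := leP t 0; first by rewrite gamma_density_le0 ?mul0r.
by rewrite mulr_ge0 ?gamma_density_ge0// heat_ge0.
Qed.

Lemma cmeas_potential_kernel : cmeas (fun q : 'rV[R]_(n + n) * (R * 'rV[R]_(n + n)) =>
  potential_kernel q.1 q.2).
Proof.
apply: cmeasM; first by apply: cmeas_real; exact: measurable_potential_weight.
by apply: cmeas_comp => //; apply: measurableT_comp; exact: measurable_snd.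
Qed.

Lemma normc_potential_kernel x p : normc (potential_kernel x p) =
  gamma_density b p.1 * heat p.1 (x - p.2) * normc (h p.2).
Proof.
rewrite /potential_kernel ComplexField.Normc.normcM normc_real ger0_norm//.
exact: potential_weight_ge0.
Qed.

Lemma integral_gamma_powR_fin :
  (\int[lam]_t (gamma_density b t * t `^ (- (n%:R / 4)))%:E)%E \is a fin_num.
Proof.
rewrite ge0_fin_numE ?integral_gamma_density_powR//.
by apply: integral_ge0 => t _; rewrite lee_fin mulr_ge0 ?gamma_density_ge0 ?powR_ge0.
Qed.

Lemma integral_potential_kernel x :
  (\int[Pi]_p (normc (potential_kernel x p))%:E <= potential_bound%:E)%E.
Proof.
have mK : measurable_fun setT (fun p => normc (potential_kernel x p)).
  apply: measurable_normc.
  exact: (cmeas_comp (g := fun p => (x, p)) cmeas_potential_kernel (measurable_pair1 x)).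
rewrite (fubini_tonelli1 (m1 := lam) (m2 := mu) (fun p => (normc (potential_kernel x p))%:E))//; last 2 first.
- exact/measurable_EFinP.
- by move=> p; rewrite lee_fin normc_ge0.
rewrite /fubini_F /=.
apply: (@le_trans _ _ (\int[lam]_t ((heatC (R := R) (n := n) * k)%:E *
    (gamma_density b t * t `^ (- (n%:R / 4)))%:E))%E); last first.
  rewrite ge0_integralZl//.
  - by rewrite -(fineK integral_gamma_powR_fin) -EFinM.
  - apply/measurable_EFinP; apply: measurable_funM; first exact: measurable_gamma_density.
    exact: measurable_powR_fun.
  - by move=> t _; rewrite lee_fin mulr_ge0 ?gamma_density_ge0 ?powR_ge0.
  - by rewrite lee_fin mulr_ge0 ?heatC_ge0// ltW.
apply: ge0_le_integral_nomeas => t _.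
  by apply: integral_ge0 => p _; rewrite lee_fin normc_ge0.
have [t0|t0] := leP t 0.
  rewrite integral0_eq ?gamma_density_le0 ?mul0r ?mule0// => y _.
  by rewrite normc_potential_kernel/= gamma_density_le0// !mul0r.
have -> : (\int[mu]_y (normc (potential_kernel x (t, y)))%:E =
    \int[mu]_y ((gamma_density b t)%:E * (normc (h y) * heat t (x - y))%:E))%E.
  by apply: eq_integral => y _; rewrite normc_potential_kernel/= -EFinM -mulrA [heat _ _ * _]mulrC.
rewrite ge0_integralZl//; last 3 first.
- apply/measurable_EFinP; apply: measurable_funM; first exact: measurable_normc.
  by apply: measurableT_comp; [exact: measurable_heat|exact: measurable_rVB].
- by move=> y _; rewrite lee_fin mulr_ge0 ?normc_ge0 ?heat_ge0.
- by rewrite lee_fin gamma_density_ge0.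
apply: le_trans (lee_wpmul2l _ (integral_heat_weakL4 x (measurable_normc mh) (fun=> normc_ge0 _) k0 hk t0)) _.
  by rewrite lee_fin gamma_density_ge0.
by rewrite -!EFinM lee_fin mulrCA.
Qed.

Lemma cL1_potential_kernel x : cL1 Pi (potential_kernel x).
Proof.
split; first exact: (cmeas_comp (g := fun p => (x, p)) cmeas_potential_kernel (measurable_pair1 x)).
by apply: le_lt_trans (integral_potential_kernel x) _; rewrite ltry.
Qed.

Lemma cmeas_bessel_potential : cmeas bessel_potential.
Proof.
have := @cmeas_cint R _ _ _ _ Pi
  (fun q : 'rV[R]_(n + n) * (R * 'rV[R]_(n + n)) => potential_kernel q.1 q.2) cmeas_potential_kernel.
exact.
Qed.

Lemma bessel_potential_bounded x : normc (bessel_potential x) <= potential_bound.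
Proof.
rewrite -lee_fin; apply: le_trans (le_normc_cint (cL1_potential_kernel x)) _.
exact: integral_potential_kernel.
Qed.

(** Self-adjointness of the potential, by Fubini. The right-hand side is kept as an iterated
    integral to match [fourier_bessel_inv_fourier]. *)
Lemma bessel_potential_pairing (th : 'rV[R]_(n + n) -> R[i]) (M : R) : cL1 mu th ->
  (forall y, normc (th y) <= M) ->
  cint mu (fun x => bessel_potential x * th x) =
  cint mu (fun z => h z * cint lam (fun t => cint mu (fun y =>
    (gamma_density b t * heat t (y - z))%:C%C * th y))).
Proof.
move=> Ith' thM; have [mth Ith] := Ith'.
pose G (q : 'rV[R]_(n + n) * (R * 'rV[R]_(n + n))) := th q.1 * potential_kernel q.1 q.2.
have mG : cmeas G.
  apply: cmeasM cmeas_potential_kernel.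
  by apply: cmeas_comp => //; exact: measurable_fst.
have IG : (\int[mu]_x \int[Pi]_p (normc (G (x, p)))%:E < +oo)%E.
  apply: (@le_lt_trans _ _ (\int[mu]_x ((normc (th x))%:E * potential_bound%:E))%E).
    apply: ge0_le_integral_nomeas => x _.
      by apply: integral_ge0 => p _; rewrite lee_fin normc_ge0.
    under eq_integral do rewrite /G ComplexField.Normc.normcM EFinM.
    rewrite /= ge0_integralZl//=.
    - by rewrite lee_wpmul2l// ?lee_fin ?normc_ge0//; exact: integral_potential_kernel.
    - apply/measurable_EFinP; apply: measurable_normc; exact: (cL1_potential_kernel x).1.
    - by move=> p _; rewrite lee_fin normc_ge0.
    - by rewrite lee_fin normc_ge0.
  have pb0 : 0 <= potential_bound by apply: le_trans (bessel_potential_bounded 0); exact: normc_ge0.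
  rewrite ge0_integralZr//.
  - have th0 : (0 <= \int[mu]_x (normc (th x))%:E)%E by apply: integral_ge0 => x _; rewrite lee_fin normc_ge0.
    by rewrite lte_mul_pinfty ?ltry// ge0_fin_numE.
  - by apply/measurable_EFinP; exact: measurable_normc.
  - by move=> x _; rewrite lee_fin normc_ge0.
transitivity (cint mu (fun x => cint Pi (fun p => G (x, p)))).
  apply: eq_cint => x; rewrite mulrC -cintZ//; exact: cL1_potential_kernel.
rewrite (@cint_swap R _ _ _ _ mu Pi G mG IG).
rewrite -(@cint_fubini_sym R _ _ _ _ lam mu (fun p => cint mu (fun y => G (y, p)))); last first.
  pose G' (q : (R * 'rV[R]_(n + n)) * 'rV[R]_(n + n)) := G (q.2, q.1).
  have mG' : cmeas G' by apply: (cmeas_comp (g := fun q => (q.2, q.1)) mG); exact: measurable_swap.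
  split; first exact: (@cmeas_cint R _ _ _ _ mu G' mG').
  have mnG' : measurable_fun setT (fun q => (normc (G q))%:E) by apply/measurable_EFinP; exact: measurable_normc.
  apply: le_lt_trans IG.
  rewrite (fubini_tonelli (m1 := mu) (m2 := Pi) (fun q => (normc (G q))%:E))//; last first.
    by move=> q; rewrite lee_fin normc_ge0.
  apply: ge0_le_integral_nomeas => p _; first by rewrite lee_fin normc_ge0.
  apply: le_normc_cint_cmeas.
  exact: (cmeas_comp (g := fun y => (y, p)) mG (measurable_pair2 p)).
apply: eq_cint => z.
have wM t y : normc (gamma_density b t * heat t (y - z))%:C%C <=
    gamma_density b t * gaussI (n + n) (4 * pi ^+ 2 * t).
  rewrite normc_real ger0_norm ?potential_weight_ge0//.
  have [t0|t0] := leP t 0; first by rewrite gamma_density_le0 ?mul0r.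
  by rewrite ler_wpM2l ?gamma_density_ge0 ?heat_le.
have mw : measurable_fun setT (fun q : R * 'rV[R]_(n + n) => gamma_density b q.1 * heat q.1 (q.2 - z)).
  have := measurable_potential_weight1 z; congr (measurable_fun _ _).
  by apply/funext => -[t y] /=; rewrite -opprB heatN.
have mW : cmeas (fun q : R * 'rV[R]_(n + n) => (gamma_density b q.1 * heat q.1 (q.2 - z))%:C%C * th q.2).
  apply: cmeasM; first exact: cmeas_real.
  by apply: cmeas_comp => //; exact: measurable_snd.
have Iy t : cL1 mu (fun y => (gamma_density b t * heat t (y - z))%:C%C * th y).
  apply: (cL1_bounded_mul _ (wM t)) => //.
  by apply: cmeas_real; exact: (measurableT_comp mw (measurable_pair1 t)).
rewrite -cintZ; last first.
  apply: (@le_cL1 _ _ _ lam _ (fun t => M * gamma_density b t)).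
  - exact: (@cmeas_cint R _ _ _ _ mu _ mW).
  - by apply: measurable_funM => //; exact: measurable_gamma_density.
  - have M0 : 0 <= M by apply: le_trans (thM 0); exact: normc_ge0.
    move=> t; rewrite -lee_fin; apply: le_trans (le_normc_cint (Iy t)) _.
    have [t0|t0] := leP t 0.
      rewrite gamma_density_le0// mulr0 integral0_eq// => y _.
      by rewrite mul0r mul0r ComplexField.Normc.normc0.
    apply: (@le_trans _ _ (\int[mu]_y ((M * gamma_density b t)%:E * (heat t (y - z))%:E))%E).
      apply: ge0_le_integral_nomeas => y _; first by rewrite lee_fin normc_ge0.
      rewrite -EFinM lee_fin ComplexField.Normc.normcM normc_real ger0_norm ?potential_weight_ge0//.
      by rewrite -[leRHS]mulrA mulrC ler_wpM2r ?potential_weight_ge0.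
    rewrite ge0_integralZl//.
    + by rewrite integral_heat_shift// mule1.
    + apply/measurable_EFinP; apply: measurableT_comp; first exact: measurable_heat.
      exact: measurable_rVB.
    + by move=> y _; rewrite lee_fin heat_ge0.
    + by rewrite lee_fin mulr_ge0 ?gamma_density_ge0.
  - under eq_integral do rewrite EFinM.
    rewrite ge0_integralZl//.
    + by rewrite integral_gamma_density// mule1 ltry.
    + by apply/measurable_EFinP; exact: measurable_gamma_density.
    + by move=> t _; rewrite lee_fin gamma_density_ge0.
    + by rewrite lee_fin; apply: le_trans (thM 0); exact: normc_ge0.
apply: eq_cint => t; rewrite -cintZ//; apply: eq_cint => y.
by rewrite /G /potential_kernel/= mulrC -mulrA mulrCA.
Qed.

End bessel_potential.

Section subordination.
Context {R : realType} {d : nat}.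
Local Notation mu := (@lebesgue_rV R d).
Local Notation lam := (@lebesgue_measure R).
Variables (b : R) (r : 'rV[R]_d -> R).
Hypotheses (b0 : 0 < b) (sr : schw r).
Local Notation th := (fun x => (r x)%:C%C : R[i]).

Lemma schwartz_real : schwartz th.
Proof.
apply/schwartzP; split => //=.
by have := schwZ 0 sr; congr schw; apply/funext => x; rewrite mul0r.
Qed.

(* As [r] is real, conjugating its Fourier transform gives its inverse Fourier transform. *)
Definition inv_fourier v : R[i] := ((fourier th v)^*)%C.

Lemma schwartz_inv_fourier : schwartz inv_fourier.
Proof.
have /schwartzP[sR sI] := fourier_schwartz schwartz_real.
apply/schwartzP; split.
  by move: sR; congr schw; apply/funext => x; rewrite /inv_fourier; case: (fourier _ _).
have := schwZ (-1) sI; congr schw; apply/funext => x; rewrite /inv_fourier.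
by case: (fourier _ _) => u v /=; rewrite mulN1r.
Qed.

Lemma conjcM (z w : R[i]) : ((z * w)^*)%C = (z^*)%C * (w^*)%C.
Proof. exact: rmorphM. Qed.

Lemma conjc_realc (a : R) : ((a%:C)^*)%C = a%:C%C.
Proof. by apply: complex_eq => //=; rewrite oppr0. Qed.

Lemma fourier_inv_fourier x : fourier inv_fourier x = th x.
Proof.
have cF := schwartz_cL1 (fourier_schwartz schwartz_real).
transitivity ((cint mu (fun v => fourier th v * cexpi (2 * pi * dotv x v)))^*)%C.
  rewrite -cint_conj; last first.
    by under eq_fun do rewrite dotvC; apply: cL1_cexpi => //; exact: measurable_phase.
  by apply: eq_cint => v; rewrite conjcM conj_cexpi [dotv x v]dotvC.
by rewrite fourier_inversion ?conjc_realc//; exact: schwartz_real.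
Qed.

(** The function on which [is_bessel_dist] is tested: the Bessel weight turns it into [inv_fourier],
    whose Fourier transform is [r] itself. *)
Definition bessel_inv_fourier v : R[i] := (bweight v `^ (- b))%:C%C * inv_fourier v.

Lemma schwartz_bessel_inv_fourier : schwartz bessel_inv_fourier.
Proof.
apply: schwartz_mul schwartz_inv_fourier; apply: OM_tame.
exact: OM_bweight.
Qed.

Lemma bessel_weight_inv_fourier (s : R) v : b = s / 2 ->
  (bessel_weight s v)%:C%C * bessel_inv_fourier v = inv_fourier v.
Proof.
move=> bE; rewrite /bessel_inv_fourier mulrA -rmorphM /bessel_weight sqr_enorm -bE.
by rewrite -/(bweight v) powRD_gt0 ?bweight_gt0// subrr powRr0 mul1r.
Qed.

Lemma integral_gauss_inv_fourier t z : 0 < t ->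
  cint mu (fun v => (qgauss t v)%:C%C * (inv_fourier v * cexpi (- (2 * pi * dotv v z)))) =
  cint mu (fun y => (heat t (y - z))%:C%C * th y).
Proof.
move=> t0; have cT := schwartz_cL1 schwartz_real; have cF := schwartz_cL1 (fourier_schwartz schwartz_real).
transitivity ((cint mu (fun v => (qgauss t v)%:C%C * cexpi (2 * pi * dotv z v) * fourier th v))^*)%C.
  rewrite -cint_conj; last first.
    apply: (cL1_bounded_mul (M := 1)) => //.
    - apply: cmeasM; first by apply: cmeas_real; exact: measurable_qgauss.
      by apply: cmeas_cexpi; under eq_fun do rewrite dotvC; exact: measurable_phase.
    - move=> v; rewrite ComplexField.Normc.normcM normc_cexpi mulr1 normc_real.
      by rewrite ger0_norm ?qgauss_ge0 ?qgauss_le1// ltW.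
  apply: eq_cint => v; rewrite !conjcM conj_cexpi conjc_realc [dotv z v]dotvC.
  by rewrite -[RHS]mulrA [X in _ = _ * X]mulrC.
rewrite gauss_regularized_inversion// -cint_conj.
  by apply: eq_cint => y; rewrite conjcM !conjc_realc mulrC.
under eq_fun do rewrite mulrC.
apply: (cL1_bounded_mul (M := gaussI d (4 * pi ^+ 2 * t))) => //.
- apply: cmeas_real; apply: measurableT_comp; first exact: measurable_heat.
  exact: measurable_rVB.
- by move=> y; rewrite normc_real ger0_norm ?heat_ge0// heat_le.
Qed.

(** The weight is replaced by its gamma average and the integrals are exchanged; at each positive
    time, Gaussian-regularised inversion returns a heat average of [r]. *)
Lemma fourier_bessel_inv_fourier z : fourier bessel_inv_fourier z =
  cint lam (fun t => cint mu (fun y => (gamma_density b t * heat t (y - z))%:C%C * th y)).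
Proof.
pose w v := inv_fourier v * cexpi (- (2 * pi * dotv v z)).
have cw : cL1 mu w by apply: cL1_fourier_kernel; apply: schwartz_cL1; exact: schwartz_inv_fourier.
have mgq (v : 'rV[R]_d) : measurable_fun setT (fun t => gamma_density b t * qgauss t v).
  exact: (measurableT_comp (@measurable_gamma_qgauss R d b) (measurable_pair2 v)).
have gq0 t (v : 'rV[R]_d) : 0 <= gamma_density b t * qgauss t v.
  by rewrite mulr_ge0 ?gamma_density_ge0 ?qgauss_ge0.
transitivity (cint mu (fun v => cint lam (fun t => (gamma_density b t * qgauss t v)%:C%C * w v))).
  apply: eq_cint => v; rewrite /bessel_inv_fourier -mulrA -/(w v).
  under [RHS]eq_cint do rewrite mulrC.
  rewrite cintZ; last first.
    apply: (cL1_ge0_real (c := bweight v `^ (- b))); [exact: mgq|by move=> t; exact: gq0|].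
    exact: integral_gamma_qgauss.
  by rewrite (cint_ge0_real (integral_gamma_qgauss v b0)) mulrC.
pose G (q : 'rV[R]_d * R) := (gamma_density b q.2 * qgauss q.2 q.1)%:C%C * w q.1.
have mG : cmeas G.
  apply: cmeasM; last by apply: cmeas_comp cw.1 _; exact: measurable_fst.
  apply: cmeas_real.
  apply: (measurableT_comp (f := fun p : R * 'rV[R]_d => gamma_density b p.1 * qgauss p.1 p.2)
    (g := fun q : 'rV[R]_d * R => (q.2, q.1))); first exact: measurable_gamma_qgauss.
  exact: measurable_swap.
rewrite (@cint_swap R _ _ _ _ mu lam G mG); last first.
  apply: (@le_lt_trans _ _ (\int[mu]_x (normc (w x))%:E)%E); last exact: cw.2.
  apply: ge0_le_integral_nomeas => v _.
    by apply: integral_ge0 => t _; rewrite lee_fin normc_ge0.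
  apply: (@le_trans _ _ (\int[lam]_t ((normc (w v))%:E * (gamma_density b t)%:E))%E).
    apply: ge0_le_integral_nomeas => t _; first by rewrite lee_fin normc_ge0.
    rewrite -EFinM lee_fin ComplexField.Normc.normcM normc_real ger0_norm// mulrC.
    rewrite ler_wpM2l ?normc_ge0//; have [t0|t0] := leP t 0; first by rewrite gamma_density_le0 ?mul0r.
    by rewrite ler_piMr ?gamma_density_ge0// qgauss_le1// ltW.
  rewrite ge0_integralZl//.
  - by rewrite integral_gamma_density// mule1.
  - by apply/measurable_EFinP; exact: measurable_gamma_density.
  - by move=> t _; rewrite lee_fin gamma_density_ge0.
  - by rewrite lee_fin normc_ge0.
apply: eq_cint => t; have [t0|t0] := leP t 0.
  transitivity (cint mu (fun=> 0 : R[i])); first by apply: eq_cint => v; rewrite /G/= gamma_density_le0// !mul0r.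
  by apply: eq_cint => v; rewrite gamma_density_le0// !mul0r.
have cT := schwartz_cL1 schwartz_real.
transitivity ((gamma_density b t)%:C%C * cint mu (fun y => (heat t (y - z))%:C%C * th y)); last first.
  rewrite -cintZ; first by apply: eq_cint => y; rewrite mulrA -rmorphM.
  apply: (cL1_bounded_mul (M := gaussI d (4 * pi ^+ 2 * t))) => //.
  - apply: cmeas_real; apply: measurableT_comp; first exact: measurable_heat.
    exact: measurable_rVB.
  - by move=> y; rewrite normc_real ger0_norm ?heat_ge0// heat_le.
rewrite -integral_gauss_inv_fourier// -cintZ.
  by apply: eq_cint => v; rewrite /G/= rmorphM mulrA.
apply: (cL1_bounded_mul (M := 1)) => //.
- by apply: cmeas_real; exact: measurable_qgauss.
- by move=> v; rewrite normc_real ger0_norm ?qgauss_ge0 ?qgauss_le1// ltW.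
Qed.

End subordination.

Section identification.
Context {R : realType} {n : nat}.
Local Notation mu := (@lebesgue_rV R (n + n)).

Lemma bounded_box_integrable (g : 'rV[R]_(n + n) -> R) (M : R) a b :
  measurable_fun setT g -> (forall x, `|g x| <= M) -> mu.-integrable (box a b) (EFin \o g).
Proof.
move=> mg gM; have mb := @measurable_box R (n + n) a b.
pose S := \sum_(i < n + n) (`|a 0 i| + `|b 0 i|) ^+ 2.
have M0 : 0 <= M by apply: le_trans (gM 0).
(* On the box [|x|^2 <= S], so this multiple of [qgauss 1] is at least [M] there and serves as an
   integrable majorant. *)
pose K := M * expR (4 * pi ^+ 2 * S).
apply: (@le_integrable _ _ _ mu _ _ _ (EFin \o (fun x => K * qgauss 1 x))) => //.
- by apply: measurable_funTS; exact/measurable_EFinP.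
- move=> x hx; rewrite lee_fin; apply: le_trans (gM x) _.
  rewrite normrM (ger0_norm (qgauss_ge0 _ _)) ger0_norm; last by rewrite mulr_ge0// expR_ge0.
  rewrite -mulrA ler_peMr// /qgauss -expRD -[leLHS](@expR0 R) ler_expR.
  rewrite mulr1 mulNr subr_ge0 ler_wpM2l//; first by rewrite mulr_ge0// sqr_ge0.
  have nz : box_bump 1 a b x != 0.
    rewrite lt0r_neq0//; apply: prodr_gt0 => i _; have /andP[h1 h2] := hx i.
    by rewrite !mul1r !bumpE !subr_gt0 h1 h2 mulr_gt0 ?expR_gt0.
  by rewrite leNgt; apply/negP => /(box_bump_support ltr01) h; move: nz; rewrite h eqxx.
apply: (@integrableS _ _ _ mu setT) => //.
apply/integrableP; split.
  by apply/measurable_EFinP; apply: measurable_funM => //; exact: measurable_qgauss.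
under eq_integral => x _ do rewrite /= normrM (ger0_norm (qgauss_ge0 _ _)) EFinM.
rewrite ge0_integralZl//.
- by rewrite integral_qgauss// -EFinM ltry.
- by apply/measurable_EFinP; exact: measurable_qgauss.
- by move=> x _; rewrite lee_fin qgauss_ge0.
Qed.

Lemma box_bump_integrable (g : 'rV[R]_(n + n) -> R) N a c : measurable_fun setT g ->
  mu.-integrable (box a c) (EFin \o g) ->
  mu.-integrable setT (EFin \o (fun x => g x * box_bump N.+1%:R a c x)).
Proof.
move=> mg Ig; have mb := @measurable_box R (n + n) a c.
have mgb : measurable_fun setT (fun x => g x * box_bump N.+1%:R a c x).
  by apply: measurable_funM => //; apply: schw_measurable; exact: schw_box_bump.
have -> : EFin \o (fun x => g x * box_bump N.+1%:R a c x) =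
    (EFin \o (fun x => g x * box_bump N.+1%:R a c x)) \_ (box a c).
  apply/funext => x; rewrite patchE; case: ifPn => // /negP; rewrite inE => nb /=.
  have [->|/box_bump_neq0 h] := eqVneq (box_bump N.+1%:R a c x) 0; first by rewrite mulr0.
  by case: nb; exact: h.
apply/(integrable_mkcond _ mb); apply: le_integrable Ig => //.
  by apply: measurable_funTS; exact/measurable_EFinP.
by move=> x _; rewrite lee_fin normrM ler_piMr// ger0_norm ?box_bump_ge0 ?box_bump_le1.
Qed.

(** Both functions have the same pairing with every box bump: the potential is moved onto the bump,
    which produces the Fourier transform of [bessel_inv_fourier], and the defining relation of
    [is_bessel_dist] converts the pairing with [h] into one with [m]. The fundamental lemma then
    identifies them. *)
Theorem is_bessel_potential (s k : R) (m h : 'rV[R]_(n + n) -> R[i]) :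
  (0 < n)%N -> n%:R / 2 < s -> is_bessel s m h -> 0 < k ->
  weakL4 mu (fun x => normc (h x)) k ->
  {ae mu, forall x, m x = bessel_potential (s / 2) h x}.
Proof.
move=> n0 ns [u [v [um vh uv]]] k0 hk.
have nn0 : (0 < n + n)%N by rewrite addn_gt0 n0.
have s0 : 0 < s by apply: le_lt_trans ns; rewrite divr_ge0.
pose b := s / 2.
have b0 : 0 < b by rewrite divr_gt0.
have nb : n%:R / 4 < b by rewrite /b; lra.
have mh : cmeas h by case: vh => _ [].
have [mm mK] : cmeas m /\ forall K, compact K -> cintegrable K m by case: um => _ [].
pose m' := bessel_potential b h.
have mm' : cmeas m' by exact: cmeas_bessel_potential.
have m'B := bessel_potential_bounded b0 nb k0 mh hk.
have key N a c : cint mu (fun x => m x * (box_bump N.+1%:R a c x)%:C%C) =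
    cint mu (fun x => m' x * (box_bump N.+1%:R a c x)%:C%C).
  have sr : schw (box_bump N.+1%:R a c) by exact: schw_box_bump.
  rewrite (bessel_potential_pairing b0 nb k0 mh hk (M := 1)); last 2 first.
  - exact: schwartz_cL1 (schwartz_real sr).
  - by move=> y; rewrite normc_real ger0_norm ?box_bump_ge0 ?box_bump_le1.
  under [RHS]eq_cint do rewrite -fourier_bessel_inv_fourier//.
  rewrite -(dist_is_fun_schwartz nn0 vh k0 hk); last first.
    by apply: fourier_schwartz; exact: schwartz_bessel_inv_fourier.
  rewrite -[RHS]/(fourier_dist v (bessel_inv_fourier b (box_bump N.+1%:R a c))) uv; last first.
    exact: schwartz_bessel_inv_fourier.
  rewrite /mul_dist /fourier_dist.
  have -> : (fun x => (bessel_weight s x)%:C%C * bessel_inv_fourier b (box_bump N.+1%:R a c) x) =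
      inv_fourier (box_bump N.+1%:R a c).
    by apply/funext => x; exact: bessel_weight_inv_fourier.
  rewrite (_ : fourier _ = fun x => (box_bump N.+1%:R a c x)%:C%C); last first.
    by apply/funext => x; exact: fourier_inv_fourier.
  have [_ _ ->] := um => //.
  split; first by have [] := schwartz_real sr.
  (* A radius is wanted, whereas [box_bump_support] speaks of [|x|^2]: [|x| > S + 1] implies
     [|x|^2 > S]. *)
  exists (\sum_(i < n + n) (`|a 0 i| + `|c 0 i|) ^+ 2 + 1) => x hx.
  rewrite box_bump_support// -sqr_enorm.
  set S := \sum_(i < _) _ in hx *.
  have S0 : 0 <= S by apply: sumr_ge0 => i _; exact: sqr_ge0.
  by rewrite expr2; nra.
have main (p : R[i] -> R) : measurable_fun setT (fun x => p (m x)) ->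
    measurable_fun setT (fun x => p (m' x)) ->
    (forall K, compact K -> mu.-integrable K (EFin \o (fun x => p (m x)))) ->
    (forall z, `|p z| <= normc z) -> (forall z (r : R), p (z * r%:C%C) = p z * r) ->
    (forall f, p (cint mu f) = \int[mu]_x p (f x))%R -> {ae mu, forall x, p (m x) - p (m' x) = 0}.
  move=> mp mp' Kp pn pZ pI.
  have Ib a c : mu.-integrable (box a c) (EFin \o (fun x => p (m x))) by exact: box_integrable.
  have Ib' a c : mu.-integrable (box a c) (EFin \o (fun x => p (m' x))).
    by apply: (bounded_box_integrable (M := potential_bound (n := n) b k)) => // x; exact: le_trans (pn _) (m'B x).
  apply: fundamental_lemma_real => [|a c|N a c].
  - exact: measurable_funB.
  - have := integrableB (measurable_box a c) (Ib a c) (Ib' a c); exact.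
  under eq_Rintegral do rewrite mulrBl.
  rewrite RintegralB//; [|exact: box_bump_integrable..].
  by under eq_Rintegral do rewrite -pZ; under [X in _ - X]eq_Rintegral do rewrite -pZ; rewrite -!pI key subrr.
have aeR : {ae mu, forall x, Re (m x) - Re (m' x) = 0}.
  apply: (main (fun z => Re z)) => //; [exact: mm.1|exact: mm'.1|by move=> K /mK[]| |].
  - exact: Re_le_normc.
  - exact: Re_mul_real.
have aeI : {ae mu, forall x, Im (m x) - Im (m' x) = 0}.
  apply: (main (fun z => Im z)) => //; [exact: mm.2|exact: mm'.2|by move=> K /mK[]| |].
  - exact: Im_le_normc.
  - exact: Im_mul_real.
apply: filterS2 aeR aeI => x /subr0_eq hR /subr0_eq hI.
exact: complex_eq.
Qed.

End identification.

(** * The trilinear form on R^n x R^n *)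
Section pair_variables.
Context {R : realType} {n : nat}.
Local Notation mu := (@lebesgue_rV R n).
Local Notation mu2 := (@lebesgue_rV R (n + n)).
Implicit Types (A B : set 'rV[R]_n).
Local Open Scope ereal_scope.

Lemma integral_indic_rV m (A : set 'rV[R]_m) : measurable A ->
  \int[@lebesgue_rV R m]_x (\1_A x)%:E = @lebesgue_rV R m A.
Proof. by move=> mA; rewrite integral_indic// setIT. Qed.

Lemma measurable_sum_coord : measurable_fun setT
  (fun p : 'rV[R]_(n + n) => lsubmx p + rsubmx p)%R.
Proof. by apply: measurable_rVD; [exact: measurable_lsubmx|exact: measurable_rsubmx]. Qed.

Lemma measurable_indic_comp d (T : measurableType d) (X : T -> 'rV[R]_n) A :
  measurable A -> measurable_fun setT X -> measurable_fun setT (fun p => \1_A (X p) : R)%R.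
Proof.
by move=> mA; apply: (measurableT_comp (f := (\1_A : 'rV[R]_n -> R))); exact: measurable_indic.
Qed.

Lemma measure_row_mx (S : set 'rV[R]_(n + n)) : measurable S ->
  mu2 S = \int[mu]_a \int[mu]_b (\1_S (row_mx a b))%:E.
Proof.
move=> mS; rewrite -integral_indic_rV// integral_row_mx//.
by apply/measurable_EFinP; exact: measurable_indic.
Qed.

Lemma indic_preimage T U (f : T -> U) (A : set U) x : \1_(f @^-1` A) x = \1_A (f x) :> R.
Proof. by rewrite !indicE; congr ((nat_of_bool _)%:R); apply/idP/idP; rewrite !inE. Qed.

Let integral_indic_shift A (a : 'rV[R]_n) : measurable A ->
  \int[mu]_b (\1_A (b + a)%R)%:E = mu A.
Proof.
move=> mA; rewrite (integral_rV_shift a (f := fun x => (\1_A x)%:E)).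
- exact: integral_indic_rV.
- by apply/measurable_EFinP; exact: measurable_indic.
- by move=> x; rewrite lee_fin indicE.
Qed.

Let preimage_measurable (X : 'rV[R]_(n + n) -> 'rV[R]_n) A : measurable_fun setT X ->
  measurable A -> measurable (X @^-1` A).
Proof. by move=> mX mA; rewrite -[X in measurable X]setTI; exact: mX. Qed.

Let integral_indic_mul A (c : \bar R) : measurable A -> 0 <= c ->
  \int[mu]_a (c * (\1_A a)%:E) = c * mu A.
Proof.
move=> mA c0; rewrite ge0_integralZl//.
- by rewrite integral_indic_rV.
- by apply/measurable_EFinP; exact: measurable_indic.
Qed.

Let measure_pair (X Y : 'rV[R]_(n + n) -> 'rV[R]_n) A B :
  measurable_fun setT X -> measurable_fun setT Y -> measurable A -> measurable B ->
  mu2 (X @^-1` A `&` Y @^-1` B) =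
  \int[mu]_a \int[mu]_b (\1_A (X (row_mx a b)) * \1_B (Y (row_mx a b)))%:E.
Proof.
move=> mX mY mA mB; rewrite measure_row_mx; last first.
  by apply: measurableI; exact: preimage_measurable.
apply: eq_integral => a _; apply: eq_integral => b _.
by rewrite indicI /= !indic_preimage.
Qed.

(** The map sending [(a, b)] to [(a + b, a)] preserves volume: for fixed [a] the inner integral is a
    translate of the indicator of [A]. *)
Lemma measure_sum_left A B : measurable A -> measurable B ->
  mu2 ((fun p => lsubmx p + rsubmx p)%R @^-1` A `&` (fun p => lsubmx p) @^-1` B) <= mu A * mu B.
Proof.
move=> mA mB; rewrite measure_pair//; [|exact: measurable_sum_coord|exact: measurable_lsubmx].
rewrite -integral_indic_mul// le_eqVlt; apply/orP; left; apply/eqP.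
apply: eq_integral => a _; rewrite -(integral_indic_shift a mA).
under eq_integral => b _ do rewrite row_mxKl row_mxKr EFinM.
rewrite ge0_integralZr//.
- by under eq_integral do rewrite addrC.
- by apply/measurable_EFinP; apply: measurable_indic_comp => //; exact: measurable_rVD.
Qed.

Lemma measure_sum_right A B : measurable A -> measurable B ->
  mu2 ((fun p => lsubmx p + rsubmx p)%R @^-1` A `&` (fun p => rsubmx p) @^-1` B) <= mu A * mu B.
Proof.
move=> mA mB; rewrite measure_pair//; [|exact: measurable_sum_coord|exact: measurable_rsubmx].
rewrite -integral_indic_mul// le_eqVlt; apply/orP; left; apply/eqP.
rewrite (fubini_tonelli (m1 := mu) (m2 := mu) (fun q => (\1_A (lsubmx (row_mx q.1 q.2) + rsubmx (row_mx q.1 q.2)) *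
  \1_B (rsubmx (row_mx q.1 q.2)))%:E))//; last first.
  under eq_fun do rewrite row_mxKl row_mxKr.
  apply/measurable_EFinP; apply: measurable_funM.
    apply: measurable_indic_comp => //.
    by apply: measurable_rVD; [exact: measurable_fst|exact: measurable_snd].
  by apply: measurable_indic_comp => //; exact: measurable_snd.
apply: eq_integral => b _; rewrite -(integral_indic_shift b mA).
under eq_integral => a _ do rewrite row_mxKl row_mxKr EFinM.
rewrite /= ge0_integralZr//.
by apply/measurable_EFinP; apply: measurable_indic_comp => //; exact: measurable_rVD.
Qed.

Lemma measure_left_right A B : measurable A -> measurable B ->
  mu2 ((fun p => lsubmx p) @^-1` A `&` (fun p => rsubmx p) @^-1` B) <= mu A * mu B.
Proof.
move=> mA mB; rewrite measure_pair//; [|exact: measurable_lsubmx|exact: measurable_rsubmx].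
rewrite muleC -integral_indic_mul// le_eqVlt; apply/orP; left; apply/eqP.
apply: eq_integral => a _; rewrite muleC -integral_indic_mul//.
by apply: eq_integral => b _; rewrite row_mxKl row_mxKr EFinM.
Qed.

End pair_variables.

Section trilinear_form.
Context {R : realType} {n : nat}.
Local Notation mu := (@lebesgue_rV R n).
Local Notation mu2 := (@lebesgue_rV R (n + n)).

(** The product of the norms of [B] and [C] is given in the form [r X + Y / r], which involves the
    squared norms linearly and can be integrated over the two centres. If a squared norm is
    infinite, so is the right-hand side. *)
Lemma trilinear_form_weakL4 (H : 'rV[R]_(n + n) -> R) (A B C : 'rV[R]_n -> R) (k a r : R) :
  measurable_fun setT H -> (forall p, 0 <= H p) -> 0 < k -> weakL4 mu2 H k ->
  measurable_fun setT A -> measurable_fun setT B -> measurable_fun setT C ->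
  (forall v, 0 <= A v) -> (forall v, 0 <= B v) -> (forall v, 0 <= C v) ->
  0 < a -> 0 < r -> (\int[mu]_v (A v ^+ 2)%:E <= (a ^+ 2)%:E)%E ->
  (\int[mu2]_p (H p * A (lsubmx p + rsubmx p) * B (lsubmx p) * C (rsubmx p))%:E <=
   (32 * k * a)%:E * (r%:E * \int[mu]_v (B v ^+ 2)%:E + (r^-1)%:E * \int[mu]_v (C v ^+ 2)%:E))%E.
Proof.
move=> mH H0 k0 hk mA mB mC A0 B0 C0 a0 r0 hA.
set b := (\int[mu]_v (B v ^+ 2)%:E)%E; set c := (\int[mu]_v (C v ^+ 2)%:E)%E.
have b0 : (0 <= b)%E by apply: integral_ge0 => v _; rewrite lee_fin sqr_ge0.
have c0 : (0 <= c)%E by apply: integral_ge0 => v _; rewrite lee_fin sqr_ge0.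
have rV0 : 0 < r^-1 by rewrite invr_gt0.
have ka0 : 0 < 32 * k * a by rewrite mulr_gt0// mulr_gt0.
have [bfin|/negP] := boolP (b \is a fin_num); last first.
  rewrite ge0_fin_numE// => /negP; rewrite -leNgt leye_eq => /eqP bE.
  by rewrite bE gt0_muley ?lte_fin// addye ?gt0_muley ?lte_fin ?leey// -ltNye (lt_le_trans _ (mule_ge0 _ c0))// lee_fin ltW.
have [cfin|/negP] := boolP (c \is a fin_num); last first.
  rewrite ge0_fin_numE// => /negP; rewrite -leNgt leye_eq => /eqP cE.
  by rewrite cE gt0_muley ?lte_fin// addey ?gt0_muley ?lte_fin ?leey// -ltNye (lt_le_trans _ (mule_ge0 _ b0))// lee_fin ltW.
have bE := fineK bfin; have cE := fineK cfin.
have -> : ((32 * k * a)%:E * (r%:E * b + (r^-1)%:E * c) =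
    (32 * k * a * (r * fine b + r^-1 * fine c))%:E)%E by rewrite -bE -cE.
apply/lee_addgt0Pr => e e0; rewrite -EFinD.
(* The slack [e / (32 k a)] makes [S] positive, as [trilinear_weakL4] wants positive norms; [S / r]
   and [S r] bound the two squared norms and have product [S^2]. *)
pose S := r * fine b + r^-1 * fine c + e / (32 * k * a).
have fb0 : 0 <= fine b by rewrite fine_ge0.
have fc0 : 0 <= fine c by rewrite fine_ge0.
have S0 : 0 < S by rewrite ltr_wpDl ?divr_gt0// addr_ge0// mulr_ge0// ltW.
have hS : fine b <= S / r /\ fine c <= S * r.
  have q0 : 0 <= e / (32 * k * a) by rewrite ltW// divr_gt0.
  split.
    by rewrite ler_pdivlMr// /S mulrC -addrA lerDl addr_ge0// mulr_ge0// ltW.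
  by rewrite -ler_pdivrMr// /S mulrC addrAC lerDr addr_ge0// mulr_ge0// ltW.
have := @trilinear_weakL4 _ _ _ _ _ mu2 mu (fun p => lsubmx p + rsubmx p) (fun p => lsubmx p)
  (fun p => rsubmx p) H A B C k a (Num.sqrt (S / r)) (Num.sqrt (S * r)).
move=> /(_ measure_sum_left measure_sum_right measure_left_right measurable_sum_coord).
move=> /(_ (@measurable_lsubmx _ _ _ _ _ id (@measurable_id _ _ _)) (@measurable_rsubmx _ _ _ _ _ id (@measurable_id _ _ _))).
move=> /(_ mH H0 k0 hk mA mB mC A0 B0 C0 a0).
have s1 := divr_gt0 S0 r0; have s2 := mulr_gt0 S0 r0.
rewrite !sqrtr_gt0 !sqr_sqrtr ?(ltW s1) ?(ltW s2)// => /(_ s1 s2 hA).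
rewrite -/b -/c -bE -cE !lee_fin => /(_ hS.1 hS.2) /le_trans; apply.
rewrite lee_fin -mulrA -sqrtrM ?(ltW s1)//.
rewrite (_ : S / r * (S * r) = S ^+ 2); last by field; exact: lt0r_neq0.
rewrite sqrtr_sqr gtr0_norm// /S mulrDr le_eqVlt; apply/orP; left; apply/eqP; congr (_ + _).
by field; rewrite !lt0r_neq0.
Qed.

End trilinear_form.

(** * Gaussian windows *)
Section gaussian_windows.
Context {R : realType} {d : nat}.
Local Notation mu := (@lebesgue_rV R d).
Implicit Types (x y z a : 'rV[R]_d) (t : R) (f g : 'rV[R]_d -> R[i]).

(** The parallelogram identity [|x-z|^2 + |y-z|^2 = |x-y|^2 / 2 + 2 |z - (x+y)/2|^2]. *)
Lemma qgauss_mul t x y z : qgauss t (x - z) * qgauss t (y - z) =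
  qgauss (t / 2) (x - y) * qgauss (2 * t) (z - 2^-1 *: (x + y)).
Proof.
rewrite /qgauss -!expRD; congr expR.
rewrite !(dotvDl, dotvDr, dotvNl, dotvNr, dotvZl, dotvZr).
rewrite [dotv z x]dotvC [dotv z y]dotvC [dotv y x]dotvC; lra.
Qed.

Lemma integral_qgauss_shift t a : 0 < t ->
  (\int[mu]_z (qgauss t (z - a))%:E = (gaussI d (4 * pi ^+ 2 * t))%:E)%E.
Proof.
move=> t0; rewrite (integral_rV_shift (- a) (f := fun z => (qgauss t z)%:E)).
- exact: integral_qgauss.
- by apply/measurable_EFinP; exact: measurable_qgauss.
- by move=> z; rewrite lee_fin qgauss_ge0.
Qed.

Lemma measurable_qgauss_sub t a : measurable_fun setT (fun z => qgauss t (z - a)).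
Proof. by apply: measurableT_comp; [exact: measurable_qgauss|exact: measurable_rVB]. Qed.

Lemma integral_qgauss_mul t x y : 0 < t ->
  (\int[mu]_z (qgauss t (x - z) * qgauss t (y - z))%:E =
   (qgauss (t / 2) (x - y) * gaussI d (4 * pi ^+ 2 * (2 * t)))%:E)%E.
Proof.
move=> t0; under eq_integral do rewrite qgauss_mul EFinM.
rewrite ge0_integralZl//.
- by rewrite integral_qgauss_shift ?mulr_gt0.
- by apply/measurable_EFinP; exact: measurable_qgauss_sub.
- by move=> z _; rewrite lee_fin qgauss_ge0.
- by rewrite lee_fin qgauss_ge0.
Qed.

Lemma qgauss_anti (e t : R) x : e <= t -> qgauss t x <= qgauss e x.
Proof.
move=> et; rewrite /qgauss ler_expR !mulNr lerN2 ler_wpM2r ?dotvv_ge0//.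
by rewrite ler_wpM2l// mulr_ge0// sqr_ge0.
Qed.

Definition in_L2 f := cmeas f /\ (\int[mu]_x (normc (f x) ^+ 2)%:E < +oo)%E.

(** The modulus of [f] convolved with a Gaussian. It dominates the windows and short-time transforms
    uniformly in frequency, and thus governs all questions of absolute convergence. *)
Definition smear t f x : \bar R := (\int[mu]_y (normc (f y) * qgauss t (x - y))%:E)%E.

Lemma smear_ge0 t f x : (0 <= smear t f x)%E.
Proof. by apply: integral_ge0 => y _; rewrite lee_fin mulr_ge0 ?normc_ge0 ?qgauss_ge0. Qed.

Lemma measurable_qgauss_sub2 t : measurable_fun setT
  (fun p : 'rV[R]_d * 'rV[R]_d => qgauss t (p.1 - p.2)).
Proof.
apply: measurableT_comp; first exact: measurable_qgauss.
by apply: measurable_rVB; [exact: measurable_fst|exact: measurable_snd].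
Qed.

Lemma measurable_smear_integrand t f : cmeas f -> measurable_fun setT
  (fun p : 'rV[R]_d * 'rV[R]_d => (normc (f p.2) * qgauss t (p.1 - p.2))%:E).
Proof.
move=> mf; apply/measurable_EFinP; apply: measurable_funM; last exact: measurable_qgauss_sub2.
by apply: (measurableT_comp (measurable_normc mf)); exact: measurable_snd.
Qed.

Lemma measurable_smear t f : cmeas f -> measurable_fun setT (smear t f).
Proof.
move=> mf; pose F (p : 'rV[R]_d * 'rV[R]_d) := (normc (f p.2) * qgauss t (p.1 - p.2))%:E.
have F0 p : (0 <= F p)%E by rewrite lee_fin mulr_ge0 ?normc_ge0 ?qgauss_ge0.
exact: (measurable_fun_fubini_tonelli_F (m2 := mu) F (measurable_smear_integrand t mf) F0).
Qed.

Lemma smear_anti (e t : R) f x : e <= t -> (smear t f x <= smear e f x)%E.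
Proof.
move=> et; apply: ge0_le_integral_nomeas => y _.
  by rewrite lee_fin mulr_ge0 ?normc_ge0 ?qgauss_ge0.
by rewrite lee_fin ler_wpM2l ?normc_ge0// qgauss_anti.
Qed.

Lemma smear_lty t f x : 0 < t -> in_L2 f -> (smear t f x < +oo)%E.
Proof.
move=> t0 [mf If].
apply: (@le_lt_trans _ _ (\int[mu]_y ((normc (f y) ^+ 2)%:E + (qgauss t (x - y))%:E))%E).
  apply: ge0_le_integral_nomeas => y _; first by rewrite lee_fin mulr_ge0 ?normc_ge0 ?qgauss_ge0.
  rewrite -EFinD lee_fin.
  have q0 := qgauss_ge0 t (x - y); have q1 := qgauss_le1 (x - y) (ltW t0).
  have n0 := normc_ge0 (f y); have := sqr_ge0 (normc (f y) - qgauss t (x - y)).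
  rewrite sqrrB; have : qgauss t (x - y) ^+ 2 <= qgauss t (x - y) by rewrite expr2 ler_piMl.
  by have := mulr_ge0 n0 q0; lra.
have mq : measurable_fun setT (fun y => (qgauss t (x - y))%:E).
  apply/measurable_EFinP; apply: measurableT_comp; first exact: measurable_qgauss.
  exact: measurable_rVB.
rewrite ge0_integralD//.
- rewrite lte_add_pinfty//.
  under eq_integral do rewrite -opprB qgaussN.
  by rewrite integral_qgauss_shift// ltry.
- by move=> y _; rewrite lee_fin sqr_ge0.
- by apply/measurable_EFinP; apply: measurable_funX; exact: measurable_normc.
- by move=> y _; rewrite lee_fin qgauss_ge0.
Qed.

Lemma smear_fin t f x : 0 < t -> in_L2 f -> smear t f x \is a fin_num.
Proof. by move=> t0 fL; rewrite ge0_fin_numE ?smear_ge0// smear_lty. Qed.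

(** Integrating out [x] first leaves a Gaussian in the difference of the two remaining variables, to
    which Schur's test applies. *)
Lemma integral_smear_mul t f g : 0 < t -> in_L2 f -> in_L2 g ->
  (\int[mu]_x (smear t f x * smear t g x) < +oo)%E.
Proof.
move=> t0 [mf If] [mg Ig].
pose W (x : 'rV[R]_d) (p : 'rV[R]_d * 'rV[R]_d) : \bar R :=
  ((normc (f p.1) * qgauss t (x - p.1))%:E * (normc (g p.2) * qgauss t (x - p.2))%:E)%E.
pose mm : {sigma_finite_measure set ('rV[R]_d * 'rV[R]_d)%type -> \bar R} := product_sf mu mu.
have mW : measurable_fun setT (fun q : 'rV[R]_d * ('rV[R]_d * 'rV[R]_d) => W q.1 q.2).
  apply: emeasurable_funM.
    apply: (measurableT_comp (f := fun p : 'rV[R]_d * 'rV[R]_d => (normc (f p.2) * qgauss t (p.1 - p.2))%:E)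
      (g := fun q : 'rV[R]_d * ('rV[R]_d * 'rV[R]_d) => (q.1, q.2.1)) (measurable_smear_integrand t mf)).
    apply/measurable_fun_pairP; split; first exact: measurable_fst.
    exact: (measurableT_comp (f := fst) (g := snd) measurable_fst measurable_snd).
  apply: (measurableT_comp (f := fun p : 'rV[R]_d * 'rV[R]_d => (normc (g p.2) * qgauss t (p.1 - p.2))%:E)
    (g := fun q : 'rV[R]_d * ('rV[R]_d * 'rV[R]_d) => (q.1, q.2.2)) (measurable_smear_integrand t mg)).
  apply/measurable_fun_pairP; split; first exact: measurable_fst.
  exact: (measurableT_comp (f := snd) (g := snd) measurable_snd measurable_snd).
have W0 x p : (0 <= W x p)%E.
  by rewrite mule_ge0// lee_fin mulr_ge0 ?normc_ge0 ?qgauss_ge0.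
have mq x : measurable_fun setT (fun y => qgauss t (x - y)).
  apply: measurableT_comp; first exact: measurable_qgauss.
  exact: measurable_rVB.
have mfq x : measurable_fun setT (fun y => (normc (f y) * qgauss t (x - y))%:E).
  by apply/measurable_EFinP; apply: measurable_funM => //; exact: measurable_normc.
have mgq x : measurable_fun setT (fun y => (normc (g y) * qgauss t (x - y))%:E).
  by apply/measurable_EFinP; apply: measurable_funM => //; exact: measurable_normc.
have E x : (smear t f x * smear t g x = \int[mm]_p W x p)%E.
  have mWx : measurable_fun setT (W x) by exact: (measurableT_comp mW (measurable_pair1 x)).
  rewrite (fubini_tonelli1 (m1 := mu) (m2 := mu) (W x))// /fubini_F /W /=.
  rewrite muleC -ge0_integralZl//; last 2 first.
  - by move=> y _; rewrite lee_fin mulr_ge0 ?normc_ge0 ?qgauss_ge0.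
  - exact: smear_ge0.
  apply: eq_integral => y _; rewrite muleC ge0_integralZl//.
  - by move=> z _; rewrite lee_fin mulr_ge0 ?normc_ge0 ?qgauss_ge0.
  - by rewrite lee_fin mulr_ge0 ?normc_ge0 ?qgauss_ge0.
under eq_integral do rewrite E.
rewrite (fubini_tonelli (m1 := mu) (m2 := mm) (fun q => W q.1 q.2))//.
pose c := gaussI d (4 * pi ^+ 2 * (2 * t)).
have c0 : 0 < c by rewrite gaussI_gt0// qgauss_rate_gt0// mulr_gt0.
have E2 p : (\int[mu]_x W x p = c%:E * (normc (f p.1) * normc (g p.2) * qgauss (t / 2) (p.2 - p.1))%:E)%E.
  transitivity (\int[mu]_x ((normc (f p.1) * normc (g p.2))%:E * (qgauss t (p.1 - x) * qgauss t (p.2 - x))%:E))%E.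
    apply: eq_integral => x _; rewrite /W -!EFinM; congr EFin.
    by rewrite -[p.1 - x]opprB -[p.2 - x]opprB !qgaussN; ring.
  rewrite ge0_integralZl//.
  - rewrite integral_qgauss_mul// -!EFinM; congr EFin.
    by rewrite -[p.1 - p.2]opprB qgaussN -/c; ring.
  - apply/measurable_EFinP; apply: measurable_funM; exact: mq.
  - by move=> x _; rewrite lee_fin mulr_ge0 ?qgauss_ge0.
  - by rewrite lee_fin mulr_ge0 ?normc_ge0.
rewrite /=; under eq_integral do rewrite E2.
pose V (p : 'rV[R]_d * 'rV[R]_d) := (normc (f p.1) * normc (g p.2) * qgauss (t / 2) (p.2 - p.1))%:E.
have V0 p : (0 <= V p)%E by rewrite lee_fin mulr_ge0 ?qgauss_ge0// mulr_ge0 ?normc_ge0.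
have mV : measurable_fun setT V.
  apply/measurable_EFinP; apply: measurable_funM.
    apply: measurable_funM.
      by apply: (measurableT_comp (measurable_normc mf)); exact: measurable_fst.
    by apply: (measurableT_comp (measurable_normc mg)); exact: measurable_snd.
  apply: measurableT_comp; first exact: measurable_qgauss.
  by apply: measurable_rVB; [exact: measurable_snd|exact: measurable_fst].
rewrite ge0_integralZl//; [|by move=> p _; exact: V0|by rewrite lee_fin ltW].
apply: lte_mul_pinfty => //; first by rewrite lee_fin ltW.
rewrite (fubini_tonelli1 (m1 := mu) (m2 := mu) V)// /fubini_F /V /=.
have t20 : 0 < t / 2 by rewrite divr_gt0.
apply: le_lt_trans (even_kernel_form (measurable_qgauss (t / 2)) (measurable_normc mf) (measurable_normc mg) _ _ _ _) _.
- by move=> x; exact: qgauss_ge0.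
- by move=> x; exact: normc_ge0.
- by move=> x; exact: normc_ge0.
- by move=> x; exact: qgaussN.
have half (h : 'rV[R]_d -> R[i]) : in_L2 h -> (\int[mu]_x (2^-1 * normc (h x) ^+ 2)%:E < +oo)%E.
  move=> [mh Ih]; apply: le_lt_trans Ih; apply: ge0_le_integral_nomeas => x _.
    by rewrite lee_fin mulr_ge0// ?invr_ge0// sqr_ge0.
  by rewrite lee_fin; have := sqr_ge0 (normc (h x)); lra.
rewrite integral_qgauss// lte_mul_pinfty ?lee_fin ?(ltW (gaussI_gt0 _ _)) ?qgauss_rate_gt0//.
by rewrite lte_add_pinfty// half.
Qed.

End gaussian_windows.

(** * Windows and short-time Fourier transforms *)

Section windows.
Context {R : realType} {d : nat}.
Local Notation mu := (@lebesgue_rV R d).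
Implicit Types (x y z a : 'rV[R]_d) (t : R) (f g : 'rV[R]_d -> R[i]).

(** For integrable [f] this is, by [heat_window], the inverse transform of [fourier f] localised
    near [a]; the present form also makes sense for [f] in L^2. *)
Definition window f t a x : R[i] :=
  cint mu (fun y => f y * ((qgauss t (x - y))%:C%C * cexpi (2 * pi * dotv a (x - y)))).

(* Note the doubled time: the product of two windows of time [2 t] integrates to one of time [t]. *)
Definition stft f t z a : R[i] := fourier (fun y => f y * (qgauss (2 * t) (y - z))%:C%C) a.

Lemma measurable_qgauss_comp dS (S : measurableType dS) (t : S -> R) (v : S -> 'rV[R]_d) :
  measurable_fun setT t -> measurable_fun setT v ->
  measurable_fun setT (fun s => qgauss (t s) (v s)).
Proof.
move=> mt mv; apply: measurableT_comp; first exact: measurable_expR.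
apply: measurable_funM; last exact: measurable_dotv.
apply: measurableT_comp => //; exact: measurable_funM.
Qed.

Lemma cmeas_window dS (S : measurableType dS) (t : S -> R) (a x : S -> 'rV[R]_d) f :
  measurable_fun setT t -> measurable_fun setT a -> measurable_fun setT x ->
  cmeas f -> cmeas (fun s => window f (t s) (a s) (x s)).
Proof.
move=> mt ma mx mf.
pose G (p : S * 'rV[R]_d) : R[i] := f p.2 * ((qgauss (t p.1) (x p.1 - p.2))%:C%C *
  cexpi (2 * pi * dotv (a p.1) (x p.1 - p.2))).
have m1 : measurable_fun setT (fun p : S * 'rV[R]_d => x p.1 - p.2).
  by apply: measurable_rVB; [exact: (measurableT_comp (g := fst) mx measurable_fst)|exact: measurable_snd].
have mG : cmeas G.
  apply: cmeasM; first exact: (cmeas_comp mf measurable_snd).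
  apply: cmeasM.
    apply/cmeas_real; apply: measurable_qgauss_comp => //.
    exact: (measurableT_comp (g := fst) mt measurable_fst).
  apply: cmeas_cexpi; apply: measurable_funM => //; apply: measurable_dotv => //.
  exact: (measurableT_comp (g := fst) ma measurable_fst).
exact: (@cmeas_cint R _ _ _ _ mu G mG).
Qed.

Lemma cmeas_stft dS (S : measurableType dS) (t : S -> R) (z a : S -> 'rV[R]_d) f :
  measurable_fun setT t -> measurable_fun setT z -> measurable_fun setT a ->
  cmeas f -> cmeas (fun s => stft f (t s) (z s) (a s)).
Proof.
move=> mt mz ma mf.
pose G (p : S * 'rV[R]_d) : R[i] := f p.2 * (qgauss (2 * t p.1) (p.2 - z p.1))%:C%C *
  cexpi (- (2 * pi * dotv p.2 (a p.1))).
have mG : cmeas G.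
  apply: cmeasM.
    apply: cmeasM; first exact: (cmeas_comp mf measurable_snd).
    apply/cmeas_real; apply: measurable_qgauss_comp.
      apply: measurable_funM => //; exact: (measurableT_comp (g := fst) mt measurable_fst).
    by apply: measurable_rVB; [exact: measurable_snd|exact: (measurableT_comp (g := fst) mz measurable_fst)].
  apply: cmeas_cexpi; apply: measurableT_comp => //; apply: measurable_funM => //.
  apply: measurable_dotv; first exact: measurable_snd.
  exact: (measurableT_comp (g := fst) ma measurable_fst).
exact: (@cmeas_cint R _ _ _ _ mu G mG).
Qed.

Lemma normc_window_le f t a x : cmeas f ->
  ((normc (window f t a x))%:E <= smear t f x)%E.
Proof.
move=> mf; apply: le_trans (le_normc_cint_cmeas _ _) _.
  apply: cmeasM => //; apply: cmeasM.
    apply/cmeas_real; apply: measurable_qgauss_comp => //; exact: measurable_rVB.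
  apply: cmeas_cexpi; apply: measurable_funM => //; apply: measurable_dotv => //.
  exact: measurable_rVB.
apply: ge0_le_integral_nomeas => y _; first by rewrite lee_fin normc_ge0.
by rewrite lee_fin !ComplexField.Normc.normcM normc_real normc_cexpi mulr1 ger0_norm ?qgauss_ge0.
Qed.

Lemma qgauss_sym t x y : qgauss t (x - y) = qgauss t (y - x).
Proof. by rewrite -opprB qgaussN. Qed.

Lemma cL1_window_slice f t z : 0 < t -> in_L2 f ->
  cL1 mu (fun y => f y * (qgauss t (y - z))%:C%C).
Proof.
move=> t0 fL; have [mf If] := fL; split.
  apply: cmeasM => //; apply/cmeas_real; apply: measurable_qgauss_comp => //; exact: measurable_rVB.
apply: le_lt_trans (smear_lty z t0 fL); apply: ge0_le_integral_nomeas => y _.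
  by rewrite lee_fin normc_ge0.
by rewrite lee_fin ComplexField.Normc.normcM normc_real ger0_norm ?qgauss_ge0// qgauss_sym.
Qed.

Lemma normc_stft_le f t z a : 0 < t -> in_L2 f ->
  ((normc (stft f t z a))%:E <= smear (2 * t) f z)%E.
Proof.
move=> t0 fL; have t20 : 0 < 2 * t by rewrite mulr_gt0.
apply: le_trans (normc_fourier_le _ (cL1_window_slice z t20 fL)) _.
apply: ge0_le_integral_nomeas => y _; first by rewrite lee_fin normc_ge0.
by rewrite lee_fin ComplexField.Normc.normcM normc_real ger0_norm ?qgauss_ge0// qgauss_sym.
Qed.

(** The integral of [qgauss (4 t)], the constant left when two windows of time [2 t] are integrated
    over a common centre. *)
Local Notation cg t := (gaussI d (4 * pi ^+ 2 * (2 * (2 * t)))).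

Lemma qgauss_conv t x y : 0 < t ->
  (\int[mu]_z (qgauss (2 * t) (x - z) * qgauss (2 * t) (y - z))%:E =
   (qgauss t (x - y) * cg t)%:E)%E.
Proof.
move=> t0; rewrite integral_qgauss_mul ?mulr_gt0//.
by rewrite (_ : 2 * t / 2 = t)//; field.
Qed.

Lemma smear_conv f t x : 0 < t -> cmeas f ->
  (\int[mu]_z ((qgauss (2 * t) (x - z))%:E * smear (2 * t) f z) = (cg t)%:E * smear t f x)%E.
Proof.
move=> t0 mf.
pose F (p : 'rV[R]_d * 'rV[R]_d) : \bar R :=
  ((qgauss (2 * t) (x - p.1))%:E * (normc (f p.2) * qgauss (2 * t) (p.1 - p.2))%:E)%E.
have F0 p : (0 <= F p)%E.
  by rewrite mule_ge0// lee_fin ?qgauss_ge0// mulr_ge0 ?normc_ge0 ?qgauss_ge0.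
have mF : measurable_fun setT F.
  apply: emeasurable_funM; last exact: measurable_smear_integrand.
  apply/measurable_EFinP; apply: measurable_qgauss_comp => //.
  by apply: measurable_rVB => //; exact: measurable_fst.
have mn : measurable_fun setT (fun y => (normc (f y))%:E).
  by apply/measurable_EFinP; exact: measurable_normc.
transitivity (\int[mu]_z \int[mu]_y F (z, y))%E.
  apply: eq_integral => z _; rewrite /smear -ge0_integralZl//.
  - apply/measurable_EFinP; apply: measurable_funM; first exact: measurable_normc.
    by apply: measurable_qgauss_comp => //; exact: measurable_rVB.
  - by move=> y _; rewrite lee_fin mulr_ge0 ?normc_ge0 ?qgauss_ge0.
  - by rewrite lee_fin qgauss_ge0.
rewrite (fubini_tonelli (m1 := mu) (m2 := mu) F)//= /smear -ge0_integralZl//; last 3 first.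
- apply/measurable_EFinP; apply: measurable_funM; first exact: measurable_normc.
  by apply: measurable_qgauss_comp => //; exact: measurable_rVB.
- by move=> y _; rewrite lee_fin mulr_ge0 ?normc_ge0 ?qgauss_ge0.
- by rewrite lee_fin ltW// gaussI_gt0// qgauss_rate_gt0// !mulr_gt0.
apply: eq_integral => y _.
transitivity (\int[mu]_z ((normc (f y))%:E * (qgauss (2 * t) (x - z) * qgauss (2 * t) (y - z))%:E))%E.
  by apply: eq_integral => z _; rewrite /F /= -!EFinM (qgauss_sym _ z y); congr EFin; ring.
rewrite ge0_integralZl//.
- by rewrite qgauss_conv// -!EFinM; congr EFin; ring.
- apply/measurable_EFinP; apply: measurable_funM; apply: measurable_qgauss_comp => //; exact: measurable_rVB.
- by move=> z _; rewrite lee_fin mulr_ge0 ?qgauss_ge0.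
- by rewrite lee_fin normc_ge0.
Qed.

(** The reproducing formula [qgauss_conv] writes the window of [x - y] as a superposition over
    centres [z]. After Fubini, [x] occurs only in a Gaussian and an exponential. *)
Lemma window_stft f t a x : 0 < t -> in_L2 f ->
  window f t a x = (cg t)^-1%:C%C * (cexpi (2 * pi * dotv a x) *
    cint mu (fun z => (qgauss (2 * t) (x - z))%:C%C * stft f t z a)).
Proof.
move=> t0 fL; have [mf If] := fL; have t20 : 0 < 2 * t by rewrite mulr_gt0.
have c0 : 0 < cg t by rewrite gaussI_gt0// qgauss_rate_gt0// !mulr_gt0.
pose G (p : 'rV[R]_d * 'rV[R]_d) : R[i] := (qgauss (2 * t) (x - p.1))%:C%C *
  (f p.2 * (qgauss (2 * t) (p.2 - p.1))%:C%C * cexpi (- (2 * pi * dotv p.2 a))).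
have mG : cmeas G.
  apply: cmeasM.
    apply/cmeas_real; apply: measurable_qgauss_comp => //.
    by apply: measurable_rVB => //; exact: measurable_fst.
  apply: cmeasM.
    apply: cmeasM; first exact: (cmeas_comp mf measurable_snd).
    apply/cmeas_real; apply: measurable_qgauss_comp => //.
    by apply: measurable_rVB; [exact: measurable_snd|exact: measurable_fst].
  apply: cmeas_cexpi; apply: measurableT_comp => //; apply: measurable_funM => //.
  by apply: measurable_dotv => //; exact: measurable_snd.
have IG : (\int[mu]_z \int[mu]_y (normc (G (z, y)))%:E < +oo)%E.
  rewrite [ltLHS](_ : _ = (cg t)%:E * smear t f x)%E.
    by rewrite lte_mul_pinfty ?lee_fin ?(ltW c0)// smear_lty.
  rewrite -smear_conv//; apply: eq_integral => z _; rewrite /smear -ge0_integralZl//.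
  - apply: eq_integral => y _; rewrite /G /= !ComplexField.Normc.normcM !normc_real normc_cexpi mulr1.
    by rewrite !ger0_norm ?qgauss_ge0// -EFinM (qgauss_sym _ z y).
  - apply/measurable_EFinP; apply: measurable_funM; first exact: measurable_normc.
    by apply: measurable_qgauss_comp => //; exact: measurable_rVB.
  - by move=> y _; rewrite lee_fin mulr_ge0 ?normc_ge0 ?qgauss_ge0.
  - by rewrite lee_fin qgauss_ge0.
have -> : cint mu (fun z => (qgauss (2 * t) (x - z))%:C%C * stft f t z a) =
    cint mu (fun z => cint mu (fun y => G (z, y))).
  apply: eq_cint => z; rewrite /G /= cintZ//.
  by apply: cL1_fourier_kernel; exact: cL1_window_slice.
rewrite (@cint_swap R _ _ _ _ mu mu G mG IG).
pose V y : R[i] := f y * (qgauss t (y - x))%:C%C * cexpi (- (2 * pi * dotv y a)).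
have LV : cL1 mu V by apply: cL1_fourier_kernel; exact: cL1_window_slice.
have -> : cint mu (fun y => cint mu (fun z => G (z, y))) =
    cint mu (fun y => (cg t)%:C%C * V y).
  apply: eq_cint => y; rewrite /G /=.
  have E := qgauss_conv x y t0.
  have L : cL1 mu (fun z => (qgauss (2 * t) (x - z) * qgauss (2 * t) (y - z))%:C%C).
    apply: (cL1_ge0_real (c := qgauss t (x - y) * cg t)) => //.
    - apply: measurable_funM; apply: measurable_qgauss_comp => //; exact: measurable_rVB.
    - by move=> z; rewrite mulr_ge0 ?qgauss_ge0.
  transitivity (cint mu (fun z => (f y * cexpi (- (2 * pi * dotv y a))) *
      (qgauss (2 * t) (x - z) * qgauss (2 * t) (y - z))%:C%C)).
    by apply: eq_cint => z; rewrite rmorphM /=; ring.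
  rewrite cintZ// (cint_ge0_real E) /V rmorphM /= (qgauss_sym _ x y); ring.
rewrite cintZ// [RHS]mulrCA [X in _ * X]mulrA -rmorphM mulVf ?gt_eqF// rmorph1 mul1r.
rewrite -cintZ//; apply: eq_cint => y; rewrite /V (qgauss_sym _ y x).
have -> : 2 * pi * dotv a (x - y) = 2 * pi * dotv a x + - (2 * pi * dotv y a).
  by rewrite dotvDr dotvNr (dotvC a y); ring.
rewrite cexpiD; ring.
Qed.

(** Bessel's inequality for each centre [z]; the squared window, which is [qgauss (4 t)], is then
    integrated over [z]. *)
Lemma integral_stft f t : 0 < t -> in_L2 f ->
  (\int[mu]_z \int[mu]_a (normc (stft f t z a) ^+ 2)%:E <=
   (cg t)%:E * \int[mu]_x (normc (f x) ^+ 2)%:E)%E.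
Proof.
move=> t0 fL; have [mf If] := fL; have t20 : 0 < 2 * t by rewrite mulr_gt0.
have c0 : 0 < cg t by rewrite gaussI_gt0// qgauss_rate_gt0// !mulr_gt0.
pose F (p : 'rV[R]_d * 'rV[R]_d) : \bar R :=
  ((normc (f p.2) ^+ 2)%:E * (qgauss (2 * (2 * t)) (p.1 - p.2))%:E)%E.
have F0 p : (0 <= F p)%E by rewrite mule_ge0// lee_fin ?sqr_ge0 ?qgauss_ge0.
have m2 : measurable_fun setT (fun y => (normc (f y) ^+ 2)%:E).
  by apply/measurable_EFinP; apply: measurable_funX; exact: measurable_normc.
have mF : measurable_fun setT F.
  apply: emeasurable_funM; first exact: (measurableT_comp (g := snd) m2 measurable_snd).
  apply/measurable_EFinP; apply: measurable_qgauss_comp => //.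
  by apply: measurable_rVB; [exact: measurable_fst|exact: measurable_snd].
apply: (@le_trans _ _ (\int[mu]_z \int[mu]_y F (z, y))%E).
  apply: ge0_le_integral_nomeas => z _; first by apply: integral_ge0 => a _; rewrite lee_fin sqr_ge0.
  apply: le_trans (bessel_inequality (cL1_window_slice z t20 fL)) _.
  apply: ge0_le_integral_nomeas => y _; first by rewrite lee_fin sqr_ge0.
  rewrite /F /= -EFinM lee_fin ComplexField.Normc.normcM normc_real ger0_norm ?qgauss_ge0// exprMn.
  rewrite ler_wpM2l ?sqr_ge0// qgauss_sym /qgauss expr2 -expRD ler_expR; lra.
rewrite (fubini_tonelli (m1 := mu) (m2 := mu) F)//= -ge0_integralZl//; last 2 first.
- by move=> x _; rewrite lee_fin sqr_ge0.
- by rewrite lee_fin ltW.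
apply: ge0_le_integral_nomeas => y _; first by apply: integral_ge0 => z _.
rewrite /F /= ge0_integralZl//.
- by rewrite integral_qgauss_shift ?mulr_gt0// muleC.
- by apply/measurable_EFinP; apply: measurable_qgauss_comp => //; exact: measurable_rVB.
- by move=> z _; rewrite lee_fin qgauss_ge0.
- by rewrite lee_fin sqr_ge0.
Qed.

End windows.

Section product_integrals.
Context {R : realType} d1 d2 (T1 : measurableType d1) (T2 : measurableType d2).
Variables (m1 : {sigma_finite_measure set T1 -> \bar R}).
Variables (m2 : {sigma_finite_measure set T2 -> \bar R}).

Lemma integral_prod (u : T1 -> \bar R) (v : T2 -> \bar R) :
  measurable_fun setT u -> measurable_fun setT v ->
  (forall x, (0 <= u x)%E) -> (forall y, (0 <= v y)%E) ->
  (\int[(m1 \x m2)%E]_p (u p.1 * v p.2) = \int[m1]_x u x * \int[m2]_y v y)%E.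
Proof.
move=> mu mv u0 v0; pose F (p : T1 * T2) : \bar R := (u p.1 * v p.2)%E.
rewrite (fubini_tonelli1 (m1 := m1) (m2 := m2) F) /fubini_F /F /=; last 2 first.
- apply: emeasurable_funM; first exact: (measurableT_comp (g := fst) mu measurable_fst).
  exact: (measurableT_comp (g := snd) mv measurable_snd).
- by move=> p; exact: mule_ge0.
have iv0 : (0 <= \int[m2]_y v y)%E by exact: integral_ge0.
under eq_integral => x _ do rewrite ge0_integralZl// muleC.
by rewrite ge0_integralZl// muleC.
Qed.

Lemma cL1_prod (F : T1 -> R[i]) (G : T2 -> R[i]) : cL1 m1 F -> cL1 m2 G ->
  cL1 (m1 \x m2)%E (fun p => F p.1 * G p.2) /\
  cint (m1 \x m2)%E (fun p => F p.1 * G p.2) = cint m1 F * cint m2 G.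
Proof.
move=> LF LG; have [mF IF] := LF; have [mG IG] := LG.
have mH : cmeas (fun p : T1 * T2 => F p.1 * G p.2).
  by apply: cmeasM; [exact: (cmeas_comp mF measurable_fst)|exact: (cmeas_comp mG measurable_snd)].
have LH : cL1 (m1 \x m2)%E (fun p : T1 * T2 => F p.1 * G p.2).
  split=> //; under eq_integral do rewrite ComplexField.Normc.normcM EFinM.
  rewrite (integral_prod (u := fun x => (normc (F x))%:E) (v := fun y => (normc (G y))%:E)).
  - rewrite lte_mul_pinfty// ?ge0_fin_numE//; apply: integral_ge0 => x _; rewrite lee_fin; exact: normc_ge0.
  - by apply/measurable_EFinP; exact: measurable_normc.
  - by apply/measurable_EFinP; exact: measurable_normc.
  - by move=> x; rewrite lee_fin normc_ge0.
  - by move=> y; rewrite lee_fin normc_ge0.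
split=> //; rewrite -(cint_fubini LH) /=.
transitivity (cint m1 (fun x => cint m2 G * F x)).
  by apply: eq_cint => x; rewrite cintZ// mulrC.
by rewrite cintZ// mulrC.
Qed.

End product_integrals.

(** * Pairing a product of windows with a bounded function *)

Section ambiguity.
Context {R : realType} {d : nat}.
Local Notation mu := (@lebesgue_rV R d).
Local Notation mm := (product_sf mu mu).
Implicit Types (x y z a : 'rV[R]_d) (t : R) (f g phi : 'rV[R]_d -> R[i]).
Local Notation cg t := (gaussI d (4 * pi ^+ 2 * (2 * (2 * t)))).

(** A cross-ambiguity function of [phi] for two Gaussian windows. The sign of [w] is set so that the
    two modulations produce the value at [a + b]. *)
Definition ambiguity phi t (q : 'rV[R]_d * 'rV[R]_d) w : R[i] :=
  fourier (fun x => phi x * (qgauss (2 * t) (x - q.1) * qgauss (2 * t) (x - q.2))%:C%C) (- w).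

Lemma qgauss_double t x : qgauss (2 * t) x = qgauss t x ^+ 2.
Proof. by rewrite /qgauss -expRM_natl; congr expR; ring. Qed.

Lemma cL1_ambiguity_slice phi t z z' : 0 < t -> cmeas phi -> (forall x, normc (phi x) <= 1) ->
  cL1 mu (fun x => phi x * (qgauss (2 * t) (x - z) * qgauss (2 * t) (x - z'))%:C%C).
Proof.
move=> t0 mphi phi1; have t20 : 0 < 2 * t by rewrite mulr_gt0.
apply: (@cL1_bounded_mul _ _ _ phi 1) => //.
apply: (cL1_ge0_real (c := qgauss t (z - z') * cg t)).
- by apply: measurable_funM; apply: measurable_qgauss_comp => //; exact: measurable_rVB.
- by move=> x; rewrite mulr_ge0 ?qgauss_ge0.
rewrite -(qgauss_conv z z' t0); apply: eq_integral => x _.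
by rewrite (qgauss_sym _ z x) (qgauss_sym _ z' x).
Qed.

(** Bessel's inequality and [|phi| <= 1]. The Gaussian decay in [z - z'], due to the product of two
    windows, is what later permits summation over pairs of centres. *)
Lemma integral_ambiguity phi t z z' : 0 < t -> cmeas phi -> (forall x, normc (phi x) <= 1) ->
  (\int[mu]_w (normc (ambiguity phi t (z, z') w) ^+ 2)%:E <=
   ((qgauss t (z - z') * Num.sqrt (cg (2 * t))) ^+ 2)%:E)%E.
Proof.
move=> t0 mphi phi1; have t20 : 0 < 2 * t by rewrite mulr_gt0.
have LS := cL1_ambiguity_slice z z' t0 mphi phi1.
rewrite (integral_rV_opp (f := fun w => (normc (fourier (fun x => phi x * (qgauss (2 * t) (x - z) * qgauss (2 * t) (x - z'))%:C%C) w) ^+ 2)%:E)); last 2 first.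
- by apply/measurable_EFinP; apply: measurable_funX; apply: measurable_normc; apply: cmeas_fourier; exact: LS.1.
- by move=> w; rewrite lee_fin sqr_ge0.
apply: le_trans (bessel_inequality LS) _.
apply: (@le_trans _ _ (\int[mu]_x (qgauss (2 * (2 * t)) (z - x) * qgauss (2 * (2 * t)) (z' - x))%:E)%E).
  apply: ge0_le_integral_nomeas => x _; first by rewrite lee_fin sqr_ge0.
  have q0 := qgauss_ge0 (2 * t).
  rewrite lee_fin ComplexField.Normc.normcM normc_real ger0_norm ?mulr_ge0// !exprMn.
  have -> : qgauss (2 * (2 * t)) (z - x) = qgauss (2 * t) (x - z) ^+ 2.
    by rewrite qgauss_sym qgauss_double.
  have -> : qgauss (2 * (2 * t)) (z' - x) = qgauss (2 * t) (x - z') ^+ 2.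
    by rewrite qgauss_sym qgauss_double.
  rewrite ler_piMl//; first by rewrite mulr_ge0 ?sqr_ge0.
  by rewrite exprn_ile1 ?normc_ge0.
rewrite qgauss_conv ?mulr_gt0// lee_fin exprMn sqr_sqrtr; last first.
  by rewrite ltW// gaussI_gt0// qgauss_rate_gt0// !mulr_gt0.
rewrite ler_wpM2r//; first by rewrite ltW// gaussI_gt0// qgauss_rate_gt0// !mulr_gt0.
by rewrite -qgauss_double.

Qed.

Lemma cmeas_ambiguity dS (S : measurableType dS) (t : S -> R) (z z' w : S -> 'rV[R]_d) phi :
  measurable_fun setT t -> measurable_fun setT z -> measurable_fun setT z' ->
  measurable_fun setT w -> cmeas phi -> cmeas (fun s => ambiguity phi (t s) (z s, z' s) (w s)).
Proof.
move=> mt mz mz' mw mphi.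
pose G (p : S * 'rV[R]_d) : R[i] := phi p.2 *
  (qgauss (2 * t p.1) (p.2 - z p.1) * qgauss (2 * t p.1) (p.2 - z' p.1))%:C%C *
  cexpi (- (2 * pi * dotv p.2 (- w p.1))).
have m2t : measurable_fun setT (fun p : S * 'rV[R]_d => 2 * t p.1).
  by apply: measurable_funM => //; exact: (measurableT_comp (g := fst) mt measurable_fst).
have mG : cmeas G.
  apply: cmeasM.
    apply: cmeasM; first exact: (cmeas_comp mphi measurable_snd).
    apply/cmeas_real; apply: measurable_funM; apply: measurable_qgauss_comp => //.
      by apply: measurable_rVB; [exact: measurable_snd|exact: (measurableT_comp (g := fst) mz measurable_fst)].
    by apply: measurable_rVB; [exact: measurable_snd|exact: (measurableT_comp (g := fst) mz' measurable_fst)].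
  apply: cmeas_cexpi; apply: measurableT_comp => //; apply: measurable_funM => //.
  apply: measurable_dotv; first exact: measurable_snd.
  by apply: measurable_rVN; exact: (measurableT_comp (g := fst) mw measurable_fst).
exact: (@cmeas_cint R _ _ _ _ mu G mG).
Qed.

Lemma cL1_stft_weighted f t a x : 0 < t -> in_L2 f ->
  cL1 mu (fun z => (qgauss (2 * t) (x - z))%:C%C * stft f t z a) /\
  (\int[mu]_z (normc ((qgauss (2 * t) (x - z))%:C%C * stft f t z a))%:E <= (cg t)%:E * smear t f x)%E.
Proof.
move=> t0 fL; have [mf If] := fL.
have c0 : 0 < cg t by rewrite gaussI_gt0// qgauss_rate_gt0// !mulr_gt0.
have I : (\int[mu]_z (normc ((qgauss (2 * t) (x - z))%:C%C * stft f t z a))%:E <= (cg t)%:E * smear t f x)%E.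
  rewrite -smear_conv//; apply: ge0_le_integral_nomeas => z _; first by rewrite lee_fin normc_ge0.
  rewrite ComplexField.Normc.normcM normc_real ger0_norm ?qgauss_ge0// EFinM.
  by rewrite lee_wpmul2l ?lee_fin ?qgauss_ge0// normc_stft_le.
split=> //; split; last by apply: le_lt_trans I _; rewrite lte_mul_pinfty ?lee_fin ?(ltW c0)// smear_lty.
apply: cmeasM; last exact: (@cmeas_stft _ _ _ _ (fun=> t) id (fun=> a)).
by apply/cmeas_real; apply: measurable_qgauss_comp => //; exact: measurable_rVB.
Qed.

(** Both windows are expanded over their centres. Integrating [phi], the two Gaussians and the
    exponential in [x] leaves the ambiguity function at [a + b]. *)
Lemma cint_window_mul phi f g t a b : 0 < t -> cmeas phi -> (forall x, normc (phi x) <= 1) ->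
  in_L2 f -> in_L2 g ->
  ((normc (cint mu (fun x => phi x * (window f t a x * window g t b x))))%:E <=
   ((cg t)^-1 ^+ 2)%:E * \int[mm]_q (normc (stft f t q.1 a) * normc (stft g t q.2 b) *
     normc (ambiguity phi t q (a + b)))%:E)%E.
Proof.
move=> t0 mphi phi1 fL gL; have [mf If] := fL; have [mg Ig] := gL.
have c0 : 0 < cg t by rewrite gaussI_gt0// qgauss_rate_gt0// !mulr_gt0.
have t20 : 0 < 2 * t by rewrite mulr_gt0.
pose X (p : 'rV[R]_d * ('rV[R]_d * 'rV[R]_d)) : R[i] := phi p.1 * cexpi (2 * pi * dotv (a + b) p.1) *
  (((qgauss (2 * t) (p.1 - p.2.1))%:C%C * stft f t p.2.1 a) *
   ((qgauss (2 * t) (p.1 - p.2.2))%:C%C * stft g t p.2.2 b)).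
have m21 : measurable_fun setT (fun p : 'rV[R]_d * ('rV[R]_d * 'rV[R]_d) => p.2.1).
  exact: (measurableT_comp (f := fst) (g := snd) measurable_fst measurable_snd).
have m22 : measurable_fun setT (fun p : 'rV[R]_d * ('rV[R]_d * 'rV[R]_d) => p.2.2).
  exact: (measurableT_comp (f := snd) (g := snd) measurable_snd measurable_snd).
have mX : cmeas X.
  apply: cmeasM.
    apply: cmeasM; first exact: (cmeas_comp mphi measurable_fst).
    apply: cmeas_cexpi; apply: measurable_funM => //; exact: measurable_dotv.
  apply: cmeasM; apply: cmeasM.
  - apply/cmeas_real; apply: measurable_qgauss_comp => //.
    by apply: measurable_rVB => //; exact: measurable_fst.
  - exact: (@cmeas_stft _ _ _ _ (fun=> t) (fun p => p.2.1) (fun=> a)).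
  - apply/cmeas_real; apply: measurable_qgauss_comp => //.
    by apply: measurable_rVB => //; exact: measurable_fst.
  - exact: (@cmeas_stft _ _ _ _ (fun=> t) (fun p => p.2.2) (fun=> b)).
pose F (x z : 'rV[R]_d) : R[i] := (qgauss (2 * t) (x - z))%:C%C * stft f t z a.
pose G (x z : 'rV[R]_d) : R[i] := (qgauss (2 * t) (x - z))%:C%C * stft g t z b.
have LF x : cL1 mu (F x) := (cL1_stft_weighted a x t0 fL).1.
have LG x : cL1 mu (G x) := (cL1_stft_weighted b x t0 gL).1.
have mn (u : 'rV[R]_d -> R[i]) : cL1 mu u -> measurable_fun setT (fun z => (normc (u z))%:E).
  by move=> [mu' _]; apply/measurable_EFinP; exact: measurable_normc.
(* Absolute convergence for Fubini: the integral over centres is at most [cg t] squared times the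
   product of the two smears, integrable by [integral_smear_mul]. *)
have IX : (\int[mu]_x \int[mm]_q (normc (X (x, q)))%:E < +oo)%E.
  apply: (@le_lt_trans _ _ (\int[mu]_x (((cg t) ^+ 2)%:E * (smear t f x * smear t g x)))%E).
    apply: ge0_le_integral_nomeas => x _; first by apply: integral_ge0 => q _; rewrite lee_fin normc_ge0.
    apply: (@le_trans _ _ (\int[mm]_q ((normc (F x q.1))%:E * (normc (G x q.2))%:E))%E).
      apply: ge0_le_integral_nomeas => q _; first by rewrite lee_fin normc_ge0.
      rewrite -EFinM lee_fin /X /= [in leLHS]ComplexField.Normc.normcM.
      rewrite [normc (_ * (_ * _))]ComplexField.Normc.normcM -/(F x q.1) -/(G x q.2).
      rewrite ler_piMl ?mulr_ge0 ?normc_ge0// ComplexField.Normc.normcM normc_cexpi mulr1; exact: phi1.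
    rewrite (integral_prod _ _ (u := fun z => (normc (F x z))%:E) (v := fun z => (normc (G x z))%:E)).
    - rewrite expr2 EFinM muleACA; apply: lee_pmul.
      + by apply: integral_ge0 => z _; rewrite lee_fin normc_ge0.
      + by apply: integral_ge0 => z _; rewrite lee_fin normc_ge0.
      + exact: (cL1_stft_weighted a x t0 fL).2.
      + exact: (cL1_stft_weighted b x t0 gL).2.
    - exact: (mn _ (LF x)).
    - exact: (mn _ (LG x)).
    - by move=> z; rewrite lee_fin normc_ge0.
    - by move=> z; rewrite lee_fin normc_ge0.
  rewrite ge0_integralZl//.
  - by rewrite lte_mul_pinfty ?lee_fin ?sqr_ge0// integral_smear_mul.
  - by apply: emeasurable_funM; exact: measurable_smear.
  - by move=> x _; rewrite mule_ge0 ?smear_ge0.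
  - by rewrite lee_fin sqr_ge0.
have E1 x : phi x * (window f t a x * window g t b x) =
    ((cg t)^-1 ^+ 2)%:C%C * cint mm (fun q => X (x, q)).
  rewrite !window_stft//; have [LFG FG] := cL1_prod (LF x) (LG x).
  rewrite [cint mm _](_ : _ = phi x * cexpi (2 * pi * dotv (a + b) x) *
      (cint mu (F x) * cint mu (G x))); last by rewrite -FG -cintZ.
  have -> : 2 * pi * dotv (a + b) x = 2 * pi * dotv a x + 2 * pi * dotv b x.
    by rewrite dotvDl; ring.
  have -> : ((cg t)^-1 ^+ 2)%:C%C = ((cg t)^-1)%:C%C ^+ 2 :> R[i] by exact: rmorphXn.
  rewrite cexpiD -/(F x) -/(G x); move: ((cg t)^-1)%:C%C (cint mu (F x)) (cint mu (G x)) => u v w.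
  by move: (cexpi _) (cexpi _) => e1 e2; ring.
have E2 : cint mu (fun x => phi x * (window f t a x * window g t b x)) =
    ((cg t)^-1 ^+ 2)%:C%C * cint mm (fun q => cint mu (fun x => X (x, q))).
  rewrite -(@cint_swap R _ _ _ _ mu mm X mX IX) -cintZ; first by apply: eq_cint => x; exact: E1.
  split; first exact: (@cmeas_cint R _ _ _ _ mm X mX).
  apply: le_lt_trans IX; apply: ge0_le_integral_nomeas => x _; first by rewrite lee_fin normc_ge0.
  by apply: le_normc_cint_cmeas; exact: (cmeas_comp mX (measurable_pair1 x)).
rewrite E2 ComplexField.Normc.normcM normc_real ger0_norm ?sqr_ge0// EFinM.
rewrite lee_wpmul2l ?lee_fin ?sqr_ge0//.
pose X' (q : ('rV[R]_d * 'rV[R]_d) * 'rV[R]_d) := X (q.2, q.1).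
have mX' : cmeas X' by apply: (cmeas_comp mX); exact: measurable_swap.
apply: le_trans (le_normc_cint_cmeas _ (@cmeas_cint R _ _ _ _ mu X' mX')) _.
apply: ge0_le_integral_nomeas => q _; first by rewrite lee_fin normc_ge0.
rewrite lee_fin -!ComplexField.Normc.normcM le_eqVlt; apply/orP; left; apply/eqP; congr (normc _).
rewrite /ambiguity /fourier -[cintegral _]/(cint mu _) -cintZ; last first.
  by apply: cL1_fourier_kernel; exact: cL1_ambiguity_slice.
apply: eq_cint => x; rewrite /X' /X /= rmorphM /= (dotvC x) dotvNl mulrN opprK; ring.
Qed.

End ambiguity.

(** * The truncated operator *)
Lemma gaussI_powR {R : realType} n (c t : R) : 0 < c -> 0 < t ->
  gaussI n (c * t) = gaussI n c * t `^ (- (n%:R / 2)).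
Proof.
move=> c0 t0; rewrite mulrC gaussI_scale// mulrC; congr (_ * _).
rewrite -powR12_sqrt ?(ltW t0)// -powR_mulrn ?powR_ge0// -powRN -powRrM; congr (_ `^ _); lra.
Qed.

Lemma dotv_submx {R : realType} n m (p : 'rV[R]_(n + m)) (q : 'rV[R]_(n + m)) :
  dotv p q = dotv (lsubmx p) (lsubmx q) + dotv (rsubmx p) (rsubmx q).
Proof.
by rewrite /dotv big_split_ord /=; congr (_ + _); apply: eq_bigr => i _; rewrite !mxE.
Qed.

Section cutoff.
Context {R : realType} {n : nat}.
Implicit Types (q : R * 'rV[R]_n) (th : R * 'rV[R]_n -> R).

(* Keeps [t >= 1/(N+1)] and damps high frequencies, which makes all integrals of the truncated
   operator absolutely convergent. *)
Definition cutoff N q : R :=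
  \1_(`[N.+1%:R^-1, +oo[%classic) q.1 * qgauss (N.+1%:R^-1 ^+ 2) q.2.

Lemma inv_nat_gt0 N : 0 < N.+1%:R^-1 :> R. Proof. by rewrite invr_gt0. Qed.

Lemma cutoff_ge0 N q : 0 <= cutoff N q.
Proof. by rewrite mulr_ge0 ?qgauss_ge0// indicE. Qed.

Lemma cutoff_le1 N q : cutoff N q <= 1.
Proof. by rewrite mulr_ile1 ?qgauss_ge0 ?qgauss_le1 ?sqr_ge0// indicE ?ler0n// lern1 leq_b1. Qed.

Lemma measurable_cutoff N : measurable_fun setT (cutoff N).
Proof.
apply: measurable_funM; last exact: measurable_qgauss_comp.
by apply: (measurableT_comp (g := fst) _ measurable_fst); exact: measurable_indic.
Qed.

Lemma cutoff_small N t (a : 'rV[R]_n) : t < N.+1%:R^-1 -> cutoff N (t, a) = 0.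
Proof.
move=> tN; rewrite /cutoff indicE memNset ?mul0r//= in_itv/= andbT => h.
by move: tN; rewrite ltNge h.
Qed.

Lemma cutoff_homo N M q : (N <= M)%N -> cutoff N q <= cutoff M q.
Proof.
move=> NM; have i : M.+1%:R^-1 <= N.+1%:R^-1 :> R by rewrite lef_pV2 ?posrE// ler_nat.
rewrite /cutoff; apply: ler_pM => //; first exact: qgauss_ge0.
  rewrite !indicE ler_nat; case: (boolP (q.1 \in _)) => // /set_mem /=.
  rewrite in_itv/= andbT => h; rewrite mem_set//= in_itv/= andbT; exact: le_trans h.
by apply: qgauss_anti; rewrite ler_pXn2r ?nnegrE ?invr_ge0.
Qed.

Lemma cvg_cutoff q : 0 < q.1 -> (fun N => cutoff N q) @ \oo --> (1 : R).
Proof.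
move=> q0; rewrite -[X in _ --> X]mulr1; apply: cvgM; last exact: cvg_qgauss.
apply: cvg_near_cst.
have h0 : (fun N => N.+1%:R^-1 : R) @ \oo --> (0 : R) by exact: cvg_harmonic.
near=> N; rewrite indicE mem_set//= in_itv/= andbT; apply: ltW.
near: N; exact: (cvgr_lt _ h0).
Unshelve. all: end_near. Qed.

(** The estimates are stated for arbitrary weights below the cutoff, since the Cauchy property
    applies them to differences of cutoffs. *)
Definition admissible N th := measurable_fun setT th /\ forall q, 0 <= th q <= cutoff N q.

Lemma admissible_ge0 N th q : admissible N th -> 0 <= th q.
Proof. by case=> _ /(_ q)/andP[]. Qed.

Lemma admissible_le1 N th q : admissible N th -> th q <= 1.
Proof. by case=> _ /(_ q)/andP[_ h]; exact: (le_trans h (cutoff_le1 N q)). Qed.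

Lemma admissible_eq0 N th t (a : 'rV[R]_n) : admissible N th -> t < N.+1%:R^-1 -> th (t, a) = 0.
Proof.
case=> _ /(_ (t, a))/andP[h1 h2] tN; apply/eqP; rewrite eq_le h1 andbT.
by rewrite (le_trans h2)// cutoff_small.
Qed.

End cutoff.

Section truncated_form.
Context {R : realType} {n : nat}.
Local Notation mu := (@lebesgue_rV R n).
Local Notation mu2 := (@lebesgue_rV R (n + n)).
Local Notation lam := (@lebesgue_measure R).
Local Notation Pi := (product_sf lam mu2).
Implicit Types (f g phi : 'rV[R]_n -> R[i]) (th : R * 'rV[R]_n -> R).
Variables (b k : R) (h : 'rV[R]_(n + n) -> R[i]).
Hypotheses (b0 : 0 < b) (mh : cmeas h) (k0 : 0 < k) (hk : weakL4 mu2 (fun p => normc (h p)) k).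

Definition weight th1 th2 (p : R * 'rV[R]_(n + n)) : R :=
  gamma_density b p.1 * (th1 (p.1, lsubmx p.2) * th2 (p.1, rsubmx p.2)).

Definition form_kernel th1 th2 f g (x : 'rV[R]_n) (p : R * 'rV[R]_(n + n)) : R[i] :=
  (weight th1 th2 p)%:C%C * h p.2 *
  (window f p.1 (lsubmx p.2) x * window g p.1 (rsubmx p.2) x).

Definition form th1 th2 f g x : R[i] := cint Pi (form_kernel th1 th2 f g x).

Lemma measurable_slice_left dS (S : measurableType dS) (t : S -> R) (p : S -> 'rV[R]_(n + n)) th :
  measurable_fun setT t -> measurable_fun setT p -> measurable_fun setT th ->
  measurable_fun setT (fun s => th (t s, lsubmx (p s))).
Proof.
move=> mt mp mth; apply: (measurableT_comp mth); apply/measurable_fun_pairP; split => //.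
exact: measurable_lsubmx.
Qed.

Lemma measurable_slice_right dS (S : measurableType dS) (t : S -> R) (p : S -> 'rV[R]_(n + n)) th :
  measurable_fun setT t -> measurable_fun setT p -> measurable_fun setT th ->
  measurable_fun setT (fun s => th (t s, rsubmx (p s))).
Proof.
move=> mt mp mth; apply: (measurableT_comp mth); apply/measurable_fun_pairP; split => //.
exact: measurable_rsubmx.
Qed.

Lemma measurable_weight th1 th2 : measurable_fun setT th1 -> measurable_fun setT th2 ->
  measurable_fun setT (weight th1 th2).
Proof.
move=> m1 m2; apply: measurable_funM.
  exact: (measurableT_comp (g := fst) (measurable_gamma_density b) measurable_fst).
apply: measurable_funM.
  exact: (measurable_slice_left measurable_fst measurable_snd).
exact: (measurable_slice_right measurable_fst measurable_snd).
Qed.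

Lemma weight_ge0 N th1 th2 p : admissible N th1 -> admissible N th2 -> 0 <= weight th1 th2 p.
Proof.
move=> A1 A2; apply: mulr_ge0; first exact: gamma_density_ge0.
by apply: mulr_ge0; [exact: admissible_ge0 A1|exact: admissible_ge0 A2].
Qed.

Lemma admissible_cutoff N : admissible N (@cutoff R n N).
Proof. by split=> [|q]; [exact: measurable_cutoff|rewrite cutoff_ge0 lexx]. Qed.

(** The Gaussian dampings in the two frequencies multiply to one on R^{2n}, which is bounded and
    integrable, hence integrable against a weak L^4 function. *)
Lemma integral_weight_cutoff N :
  (\int[Pi]_p (weight (cutoff N) (cutoff N) p * normc (h p.2))%:E < +oo)%E.
Proof.
pose e : R := N.+1%:R^-1 ^+ 2.
have e0 : 0 < e by rewrite exprn_gt0// inv_nat_gt0.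
pose u (t : R) := (gamma_density b t)%:E.
pose v (p : 'rV[R]_(n + n)) := (normc (h p) * qgauss e p)%:E.
have mu_ : measurable_fun setT u by apply/measurable_EFinP; exact: measurable_gamma_density.
have mv : measurable_fun setT v.
  by apply/measurable_EFinP; apply: measurable_funM; [exact: measurable_normc|exact: measurable_qgauss].
apply: (@le_lt_trans _ _ (\int[Pi]_p (u p.1 * v p.2))%E).
  apply: ge0_le_integral_nomeas => p _.
    by rewrite lee_fin mulr_ge0 ?normc_ge0// (weight_ge0 _ (admissible_cutoff N) (admissible_cutoff N)).
  rewrite /u /v -EFinM lee_fin /weight -mulrA ler_wpM2l ?gamma_density_ge0//.
  rewrite mulrC ler_wpM2l ?normc_ge0//.
  have -> : qgauss e p.2 = qgauss e (lsubmx p.2) * qgauss e (rsubmx p.2).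
    by rewrite /qgauss dotv_submx -expRD -mulrDr.
  by apply: ler_pM; rewrite ?cutoff_ge0// /cutoff -/e ler_piMl ?qgauss_ge0// indicE lern1 leq_b1.
rewrite (integral_prod lam mu2 (u := u) (v := v))//.
- rewrite /u integral_gamma_density// mul1e.
  apply: (weakL4_bounded_integrable (k := k) (M := 1)) => //.
  + exact: measurable_normc.
  + by move=> p; exact: normc_ge0.
  + exact: measurable_qgauss.
  + by move=> p; rewrite qgauss_ge0 qgauss_le1// ltW.
  + by rewrite integral_qgauss// ltry.
- by move=> t; rewrite lee_fin gamma_density_ge0.
- by move=> p; rewrite lee_fin mulr_ge0 ?normc_ge0 ?qgauss_ge0.
Qed.

Lemma cmeas_form_kernel th1 th2 f g : measurable_fun setT th1 -> measurable_fun setT th2 ->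
  cmeas f -> cmeas g ->
  cmeas (fun q : 'rV[R]_n * (R * 'rV[R]_(n + n)) => form_kernel th1 th2 f g q.1 q.2).
Proof.
move=> m1 m2 mf mg.
have m21 : measurable_fun setT (fun q : 'rV[R]_n * (R * 'rV[R]_(n + n)) => q.2.1).
  exact: (measurableT_comp (f := fst) (g := snd) measurable_fst measurable_snd).
have m22 : measurable_fun setT (fun q : 'rV[R]_n * (R * 'rV[R]_(n + n)) => q.2.2).
  exact: (measurableT_comp (f := snd) (g := snd) measurable_snd measurable_snd).
apply: cmeasM.
  apply: cmeasM; last exact: (cmeas_comp (g := fun q : 'rV[R]_n * (R * 'rV[R]_(n + n)) => q.2.2) mh m22).
  apply/cmeas_real; exact: (measurableT_comp (g := snd) (measurable_weight m1 m2) measurable_snd).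
apply: cmeasM; apply: cmeas_window => //.
- exact: measurable_lsubmx.
- exact: measurable_rsubmx.
Qed.

(** The truncation keeps only [t >= 1/(N+1)], where the windows are at most the smears at time
    [1/(N+1)]. This separates the variable [x] from the time and frequency variables. *)
Lemma form_kernel_le N th1 th2 f g x p : admissible N th1 -> admissible N th2 ->
  cmeas f -> cmeas g ->
  ((normc (form_kernel th1 th2 f g x p))%:E <=
   (weight (cutoff N) (cutoff N) p * normc (h p.2))%:E *
   (smear N.+1%:R^-1 f x * smear N.+1%:R^-1 g x))%E.
Proof.
move=> A1 A2 mf mg.
have W0 := weight_ge0 p A1 A2.
have WN0 := weight_ge0 p (admissible_cutoff N) (admissible_cutoff N).
have WW : weight th1 th2 p <= weight (cutoff N) (cutoff N) p.
  rewrite /weight ler_wpM2l ?gamma_density_ge0//.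
  have /andP[a1 a2] := A1.2 (p.1, lsubmx p.2); have /andP[c1 c2] := A2.2 (p.1, rsubmx p.2).
  exact: ler_pM.
rewrite /form_kernel !ComplexField.Normc.normcM normc_real ger0_norm//.
have [pN|pN] := ltP p.1 N.+1%:R^-1.
  rewrite {1}/weight (admissible_eq0 _ A1)// mul0r mulr0 !mul0r.
  by apply: mule_ge0; [rewrite lee_fin mulr_ge0 ?normc_ge0|rewrite mule_ge0 ?smear_ge0].
rewrite EFinM; apply: lee_pmul.
- by rewrite lee_fin mulr_ge0 ?normc_ge0.
- by rewrite lee_fin mulr_ge0 ?normc_ge0.
- by rewrite lee_fin ler_wpM2r ?normc_ge0.
rewrite EFinM; apply: lee_pmul; rewrite ?lee_fin ?normc_ge0//.
- by apply: le_trans (normc_window_le _ _ _ mf) _; exact: smear_anti.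
- by apply: le_trans (normc_window_le _ _ _ mg) _; exact: smear_anti.
Qed.

Lemma integral_form_kernel N th1 th2 f g x : admissible N th1 -> admissible N th2 ->
  cmeas f -> cmeas g ->
  (\int[Pi]_p (normc (form_kernel th1 th2 f g x p))%:E <=
   (\int[Pi]_p (weight (cutoff N) (cutoff N) p * normc (h p.2))%:E) *
   (smear N.+1%:R^-1 f x * smear N.+1%:R^-1 g x))%E.
Proof.
move=> A1 A2 mf mg.
have W0 p : (0 <= (weight (cutoff N) (cutoff N) p * normc (h p.2))%:E)%E.
  by rewrite lee_fin mulr_ge0 ?normc_ge0// (weight_ge0 _ (admissible_cutoff N) (admissible_cutoff N)).
rewrite muleC -ge0_integralZl//.
- apply: ge0_le_integral_nomeas => p _; first by rewrite lee_fin normc_ge0.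
  by rewrite muleC; exact: form_kernel_le.
- apply/measurable_EFinP; apply: measurable_funM.
    by apply: measurable_weight; exact: measurable_cutoff.
  exact: (measurableT_comp (g := snd) (measurable_normc mh) measurable_snd).
- by rewrite mule_ge0 ?smear_ge0.
Qed.

Lemma cL1_form_kernel N th1 th2 f g x : admissible N th1 -> admissible N th2 ->
  in_L2 f -> in_L2 g -> cL1 Pi (form_kernel th1 th2 f g x).
Proof.
move=> A1 A2 fL gL; split.
  exact: (cmeas_comp (cmeas_form_kernel A1.1 A2.1 fL.1 gL.1) (measurable_pair1 x)).
apply: le_lt_trans (integral_form_kernel x A1 A2 fL.1 gL.1) _.
have N0 := inv_nat_gt0 (R := R) N.
rewrite -ge0_fin_numE; last first.
  rewrite mule_ge0 ?mule_ge0 ?smear_ge0//; apply: integral_ge0 => p _.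
  by rewrite lee_fin mulr_ge0 ?normc_ge0// (weight_ge0 _ (admissible_cutoff N) (admissible_cutoff N)).
rewrite !fin_numM ?smear_fin// ge0_fin_numE ?integral_weight_cutoff//; apply: integral_ge0 => p _.
by rewrite lee_fin mulr_ge0 ?normc_ge0// (weight_ge0 _ (admissible_cutoff N) (admissible_cutoff N)).
Qed.

Lemma integral_integral_form_kernel N th1 th2 f g : admissible N th1 -> admissible N th2 ->
  in_L2 f -> in_L2 g ->
  (\int[mu]_x \int[Pi]_p (normc (form_kernel th1 th2 f g x p))%:E < +oo)%E.
Proof.
move=> A1 A2 fL gL; have N0 := inv_nat_gt0 (R := R) N.
have W0 : (0 <= \int[Pi]_p (weight (cutoff N) (cutoff N) p * normc (h p.2))%:E)%E.
  apply: integral_ge0 => p _.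
  by rewrite lee_fin mulr_ge0 ?normc_ge0// (weight_ge0 _ (admissible_cutoff N) (admissible_cutoff N)).
pose I := (\int[Pi]_p (weight (cutoff N) (cutoff N) p * normc (h p.2))%:E)%E.
apply: (@le_lt_trans _ _ (\int[mu]_x (I * (smear N.+1%:R^-1 f x * smear N.+1%:R^-1 g x)))%E).
  apply: ge0_le_integral_nomeas => x _; first by apply: integral_ge0 => p _; rewrite lee_fin normc_ge0.
  exact: integral_form_kernel fL.1 gL.1.
rewrite ge0_integralZl//.
- rewrite lte_mul_pinfty ?ge0_fin_numE ?integral_weight_cutoff// integral_smear_mul//.
- by apply: emeasurable_funM; apply: measurable_smear; [exact: fL.1|exact: gL.1].
- by move=> x _; rewrite mule_ge0 ?smear_ge0.
Qed.

Lemma cmeas_form th1 th2 f g : measurable_fun setT th1 -> measurable_fun setT th2 ->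
  cmeas f -> cmeas g -> cmeas (form th1 th2 f g).
Proof.
move=> m1 m2 mf mg.
exact: (@cmeas_cint R _ _ _ _ Pi _ (cmeas_form_kernel m1 m2 mf mg)).
Qed.

Lemma cL1_form N th1 th2 f g : admissible N th1 -> admissible N th2 ->
  in_L2 f -> in_L2 g -> cL1 mu (form th1 th2 f g).
Proof.
move=> A1 A2 fL gL; split; first exact: cmeas_form A1.1 A2.1 fL.1 gL.1.
apply: le_lt_trans (integral_integral_form_kernel A1 A2 fL gL).
apply: ge0_le_integral_nomeas => x _; first by rewrite lee_fin normc_ge0.
by apply: le_normc_cint_cmeas; exact: (cL1_form_kernel x A1 A2 fL gL).1.
Qed.

End truncated_form.

(** * Energies and the estimate at a fixed time *)

Section energy.
Context {R : realType} {n : nat}.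
Local Notation mu := (@lebesgue_rV R n).
Local Notation mm := (product_sf mu mu).
Local Notation mu2 := (@lebesgue_rV R (n + n)).
Local Notation lam := (@lebesgue_measure R).
Local Notation Pi := (product_sf lam mu2).
Local Notation cg t := (gaussI n (4 * pi ^+ 2 * (2 * (2 * t)))).
Implicit Types (f g phi : 'rV[R]_n -> R[i]) (th : R * 'rV[R]_n -> R).

Definition form_rate : R :=
  (gaussI n (4 * pi ^+ 2 * 2 * 2))^-1 ^+ 2 *
  (Num.sqrt (gaussI n (4 * pi ^+ 2 * 2 * 2 * 2)) * gaussI n (4 * pi ^+ 2)).

(** Each Gaussian integral scales as [t^(-n/2)], so the exponents add up to
    [n - n/4 - n/2 = n/4]. *)
Lemma form_rateE t : 0 < t ->
  (cg t)^-1 ^+ 2 * (Num.sqrt (cg (2 * t)) * gaussI n (4 * pi ^+ 2 * t)) =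
  form_rate * t `^ (n%:R / 4).
Proof.
move=> t0; have p0 : 0 < pi :> R by exact: pi_gt0.
have P0 : 0 < 4 * pi ^+ 2 :> R by rewrite mulr_gt0// exprn_gt0.
have -> : 4 * pi ^+ 2 * (2 * (2 * t)) = (4 * pi ^+ 2 * 2 * 2) * t by ring.
have -> : 4 * pi ^+ 2 * (2 * (2 * (2 * t))) = (4 * pi ^+ 2 * 2 * 2 * 2) * t by ring.
rewrite /form_rate; set c4 := 4 * pi ^+ 2 * 2 * 2; set c8 := c4 * 2; set c1 := 4 * pi ^+ 2.
have c40 : 0 < c4 by rewrite !mulr_gt0.
have c80 : 0 < c8 by rewrite !mulr_gt0.
rewrite (gaussI_powR n c40 t0) (gaussI_powR n c80 t0) (gaussI_powR n P0 t0) sqrtrM ?(ltW (gaussI_gt0 _ _))//.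
rewrite -(powR12_sqrt (powR_ge0 _ _)) -powRrM invfM exprMn.
rewrite -(powR_mulrn 2 (_ : 0 <= (t `^ (- (n%:R / 2)))^-1)) ?invr_ge0 ?powR_ge0// -powRN opprK -powRrM.
rewrite [LHS](_ : _ = ((gaussI n c4)^-1 ^+ 2 * (Num.sqrt (gaussI n c8) * gaussI n c1)) *
  (t `^ (n%:R / 2 * 2%:R) * (t `^ (- (n%:R / 2) * 2^-1) * t `^ (- (n%:R / 2))))); last by ring.
by rewrite !powRD_gt0//; congr (_ * _ `^ _); lra.
Qed.

Lemma form_rate_ge0 : 0 <= form_rate.
Proof. by rewrite mulr_ge0 ?sqr_ge0// mulr_ge0 ?sqrtr_ge0// exprn_ge0// sqrtr_ge0. Qed.

Variables (b k : R) (h : 'rV[R]_(n + n) -> R[i]).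
Hypotheses (b0 : 0 < b) (mh : cmeas h) (k0 : 0 < k) (hk : weakL4 mu2 (fun p => normc (h p)) k).

Definition rho t : R := gamma_density b t * (form_rate * t `^ (n%:R / 4)).

Lemma rho_ge0 t : 0 <= rho t.
Proof. by rewrite mulr_ge0 ?gamma_density_ge0// mulr_ge0 ?powR_ge0 ?form_rate_ge0. Qed.

Lemma measurable_rho : measurable_fun setT rho.
Proof.
apply: measurable_funM; first exact: measurable_gamma_density.
by apply: measurable_funM => //; exact: measurable_powR_fun.
Qed.

Definition energy_density th f (q : R * ('rV[R]_n * 'rV[R]_n)) : R :=
  th (q.1, q.2.2) * normc (stft f q.1 q.2.1 q.2.2) ^+ 2.

(** The L^2 mass of the pieces of [f] over times, centres and frequencies, weighted by [th]. The
    total mass is finite by [energy_le], so the part removed by the cutoff becomes small. *)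
Definition energy th f : \bar R :=
  (\int[product_sf lam mm]_q (rho q.1 * energy_density th f q)%:E)%E.

Definition slice_energy th f t : \bar R :=
  (\int[mu]_z \int[mu]_a (energy_density th f (t, (z, a)))%:E)%E.

Lemma measurable_energy_density th f : measurable_fun setT th -> cmeas f ->
  measurable_fun setT (energy_density th f).
Proof.
move=> mth mf.
have m21 : measurable_fun setT (fun q : R * ('rV[R]_n * 'rV[R]_n) => q.2.1).
  exact: (measurableT_comp (f := fst) (g := snd) measurable_fst measurable_snd).
have m22 : measurable_fun setT (fun q : R * ('rV[R]_n * 'rV[R]_n) => q.2.2).
  exact: (measurableT_comp (f := snd) (g := snd) measurable_snd measurable_snd).
apply: measurable_funM; last first.
  apply: measurable_funX; apply: measurable_normc.
  exact: cmeas_stft measurable_fst m21 m22 mf.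
apply: (measurableT_comp mth); apply/measurable_fun_pairP; split => //; exact: measurable_fst.
Qed.

Lemma energy_density_ge0 th f q : (forall q, 0 <= th q) -> 0 <= energy_density th f q.
Proof. by move=> th0; rewrite mulr_ge0 ?sqr_ge0. Qed.

Lemma slice_energyE th f t : measurable_fun setT th -> (forall q, 0 <= th q) -> cmeas f ->
  slice_energy th f t = (\int[mm]_q (energy_density th f (t, q))%:E)%E.
Proof.
move=> mth th0 mf; rewrite /slice_energy.
rewrite (fubini_tonelli1 (m1 := mu) (m2 := mu) (fun q => (energy_density th f (t, q))%:E))//.
- apply/measurable_EFinP.
  exact: (measurableT_comp (measurable_energy_density mth mf) (measurable_pair1 t)).
- by move=> q; rewrite lee_fin energy_density_ge0.
Qed.

Lemma measurable_slice_energy th f : measurable_fun setT th -> (forall q, 0 <= th q) ->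
  cmeas f -> measurable_fun setT (slice_energy th f).
Proof.
move=> mth th0 mf.
rewrite (_ : slice_energy th f = fun t => (\int[mm]_q (energy_density th f (t, q))%:E)%E); last first.
  by apply/funext => t; exact: slice_energyE.
apply: (measurable_fun_fubini_tonelli_F (m2 := mm) (fun q => (energy_density th f q)%:E)).
  by apply/measurable_EFinP; exact: measurable_energy_density.
by move=> q; rewrite lee_fin energy_density_ge0.
Qed.

Lemma slice_energy_ge0 th f t : (forall q, 0 <= th q) -> (0 <= slice_energy th f t)%E.
Proof.
move=> th0; apply: integral_ge0 => z _; apply: integral_ge0 => a _.
by rewrite lee_fin energy_density_ge0.
Qed.

Lemma energyE th f : measurable_fun setT th -> (forall q, 0 <= th q) -> cmeas f ->
  energy th f = (\int[lam]_t ((rho t)%:E * slice_energy th f t))%E.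
Proof.
move=> mth th0 mf; have mE := measurable_energy_density mth mf.
pose F (q : R * ('rV[R]_n * 'rV[R]_n)) := (rho q.1 * energy_density th f q)%:E.
rewrite /energy (fubini_tonelli1 (m1 := lam) (m2 := mm) F) /fubini_F /F /=; last 2 first.
- apply/measurable_EFinP; apply: measurable_funM => //.
  exact: (measurableT_comp (g := fst) measurable_rho measurable_fst).
- by move=> q; rewrite lee_fin mulr_ge0 ?rho_ge0 ?energy_density_ge0.
apply: eq_integral => t _; rewrite slice_energyE//.
under eq_integral do rewrite EFinM.
rewrite ge0_integralZl//.
- by apply/measurable_EFinP; exact: (measurableT_comp mE (measurable_pair1 t)).
- by move=> q _; rewrite lee_fin energy_density_ge0.
- by rewrite lee_fin rho_ge0.
Qed.

(* Expanding both windows over their centres [z], [z'] leaves, for fixed centres, a trilinear form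
   in the ambiguity function and the two short-time transforms. *)
Lemma slice_form_bound N phi f g th1 th2 (r t : R) : cmeas phi -> (forall x, normc (phi x) <= 1) ->
  admissible N th1 -> admissible N th2 -> in_L2 f -> in_L2 g -> 0 < r -> 0 < t ->
  (\int[mu2]_p (normc (h p) * (th1 (t, lsubmx p) * th2 (t, rsubmx p)) *
     normc (cint mu (fun x => phi x * (window f t (lsubmx p) x * window g t (rsubmx p) x))))%:E <=
   (32 * k * (form_rate * t `^ (n%:R / 4)))%:E *
   (r%:E * slice_energy th1 f t + (r^-1)%:E * slice_energy th2 g t))%E.
Proof.
move=> mphi phi1 A1 A2 fL gL r0 t0; have [mf If] := fL; have [mg Ig] := gL.
have c0 : 0 < cg t by rewrite gaussI_gt0// qgauss_rate_gt0// !mulr_gt0.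
have c20 : 0 < cg (2 * t) by rewrite gaussI_gt0// qgauss_rate_gt0// !mulr_gt0.
have a1 q : 0 <= th1 q by exact: admissible_ge0 A1.
have a2 q : 0 <= th2 q by exact: admissible_ge0 A2.
have m1 := A1.1; have m2 := A2.1.
pose B (z a : 'rV[R]_n) : R := th1 (t, a) * normc (stft f t z a).
pose C (z a : 'rV[R]_n) : R := th2 (t, a) * normc (stft g t z a).
have B0 z a : 0 <= B z a by rewrite mulr_ge0 ?normc_ge0.
have C0 z a : 0 <= C z a by rewrite mulr_ge0 ?normc_ge0.
have mBS dS (S : measurableType dS) (z a : S -> 'rV[R]_n) : measurable_fun setT z ->
    measurable_fun setT a -> measurable_fun setT (fun s => B (z s) (a s)).
  move=> mz ma; apply: measurable_funM.
    exact: (measurableT_comp (g := a) (measurableT_comp m1 (measurable_pair1 t)) ma).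
  by apply: measurable_normc; exact: (@cmeas_stft _ _ _ _ (fun=> t)).
have mCS dS (S : measurableType dS) (z a : S -> 'rV[R]_n) : measurable_fun setT z ->
    measurable_fun setT a -> measurable_fun setT (fun s => C (z s) (a s)).
  move=> mz ma; apply: measurable_funM.
    exact: (measurableT_comp (g := a) (measurableT_comp m2 (measurable_pair1 t)) ma).
  by apply: measurable_normc; exact: (@cmeas_stft _ _ _ _ (fun=> t)).
pose Y (q : 'rV[R]_(n + n) * ('rV[R]_n * 'rV[R]_n)) : R :=
  normc (h q.1) * normc (ambiguity phi t q.2 (lsubmx q.1 + rsubmx q.1)) *
  B q.2.1 (lsubmx q.1) * C q.2.2 (rsubmx q.1).
have Y0 q : 0 <= Y q by rewrite mulr_ge0// mulr_ge0// mulr_ge0 ?normc_ge0.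
have m21 : measurable_fun setT (fun q : 'rV[R]_(n + n) * ('rV[R]_n * 'rV[R]_n) => q.2.1).
  exact: (measurableT_comp (f := fst) (g := snd) measurable_fst measurable_snd).
have m22 : measurable_fun setT (fun q : 'rV[R]_(n + n) * ('rV[R]_n * 'rV[R]_n) => q.2.2).
  exact: (measurableT_comp (f := snd) (g := snd) measurable_snd measurable_snd).
have ml : measurable_fun setT (fun q : 'rV[R]_(n + n) * ('rV[R]_n * 'rV[R]_n) => lsubmx q.1).
  by apply: measurable_lsubmx; exact: measurable_fst.
have mr : measurable_fun setT (fun q : 'rV[R]_(n + n) * ('rV[R]_n * 'rV[R]_n) => rsubmx q.1).
  by apply: measurable_rsubmx; exact: measurable_fst.
have mY : measurable_fun setT (fun q => (Y q)%:E).
  apply/measurable_EFinP; apply: measurable_funM; last exact: mCS.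
  apply: measurable_funM; last exact: mBS.
  apply: measurable_funM.
    exact: (measurableT_comp (g := fst) (measurable_normc mh) measurable_fst).
  apply: measurable_normc.
  have := @cmeas_ambiguity R n _ _ (fun=> t) _ _ _ phi (measurable_cst _) m21 m22
    (measurable_rVD ml mr) mphi.
  by congr cmeas; apply/funext => -[p [z z']].
pose U (z : 'rV[R]_n) : \bar R := (\int[mu]_a (B z a ^+ 2)%:E)%E.
pose V (z : 'rV[R]_n) : \bar R := (\int[mu]_a (C z a ^+ 2)%:E)%E.
have mU : measurable_fun setT U.
  apply: (measurable_fun_fubini_tonelli_F (m2 := mu) (fun q : 'rV[R]_n * 'rV[R]_n => (B q.1 q.2 ^+ 2)%:E)).
    by apply/measurable_EFinP; apply: measurable_funX; apply: mBS; [exact: measurable_fst|exact: measurable_snd].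
  by move=> q; rewrite lee_fin sqr_ge0.
have mV : measurable_fun setT V.
  apply: (measurable_fun_fubini_tonelli_F (m2 := mu) (fun q : 'rV[R]_n * 'rV[R]_n => (C q.1 q.2 ^+ 2)%:E)).
    by apply/measurable_EFinP; apply: measurable_funX; apply: mCS; [exact: measurable_fst|exact: measurable_snd].
  by move=> q; rewrite lee_fin sqr_ge0.
have U0 z : (0 <= U z)%E by apply: integral_ge0 => a _; rewrite lee_fin sqr_ge0.
have V0 z : (0 <= V z)%E by apply: integral_ge0 => a _; rewrite lee_fin sqr_ge0.
have IU : (\int[mu]_z U z <= slice_energy th1 f t)%E.
  apply: ge0_le_integral_nomeas => z _; first exact: U0.
  apply: ge0_le_integral_nomeas => a _; rewrite lee_fin ?sqr_ge0//.
  (* The square of the weight is at most the weight, because the weight is at most 1. *)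
  rewrite /B exprMn /energy_density/= ler_wpM2r ?sqr_ge0// expr2 ler_piMl//.
  exact: admissible_le1 A1.
have IV : (\int[mu]_z V z <= slice_energy th2 g t)%E.
  apply: ge0_le_integral_nomeas => z _; first exact: V0.
  apply: ge0_le_integral_nomeas => a _; rewrite lee_fin ?sqr_ge0//.
  rewrite /C exprMn /energy_density/= ler_wpM2r ?sqr_ge0// expr2 ler_piMl//.
  exact: admissible_le1 A2.
have iU0 : (0 <= \int[mu]_z U z)%E by apply: integral_ge0 => z _; exact: U0.
have iV0 : (0 <= \int[mu]_z V z)%E by apply: integral_ge0 => z _; exact: V0.
(* The L^2 bound on the ambiguity function; its Gaussian in [z - z'] is the only coupling left
   between the two centres. *)
pose a (q : 'rV[R]_n * 'rV[R]_n) : R := qgauss t (q.1 - q.2) * Num.sqrt (cg (2 * t)).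
have a0 q : 0 < a q by rewrite mulr_gt0 ?expR_gt0// sqrtr_gt0.
have tri (q : 'rV[R]_n * 'rV[R]_n) : (\int[mu2]_p (Y (p, q))%:E <=
    (32 * k * a q)%:E * (r%:E * U q.1 + (r^-1)%:E * V q.2))%E.
  apply: (trilinear_form_weakL4 (H := fun p => normc (h p))
    (A := fun w => normc (ambiguity phi t q w)) (B := B q.1) (C := C q.2)) => //.
  - exact: measurable_normc.
  - by move=> p; exact: normc_ge0.
  - apply: measurable_normc; case: (q) => z z'.
    exact: (@cmeas_ambiguity R n _ _ (fun=> t) (fun=> z) (fun=> z')).
  - exact: (mBS _ _ (fun=> q.1)).
  - exact: (mCS _ _ (fun=> q.2)).
  - by move=> v; exact: normc_ge0.
  - by case: (q) => z z'; exact: integral_ambiguity.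
clearbody U V.
have step1 : (\int[mu2]_p (normc (h p) * (th1 (t, lsubmx p) * th2 (t, rsubmx p)) *
     normc (cint mu (fun x => phi x * (window f t (lsubmx p) x * window g t (rsubmx p) x))))%:E <=
   ((cg t)^-1 ^+ 2)%:E * \int[mm]_q \int[mu2]_p (Y (p, q))%:E)%E.
  rewrite -(fubini_tonelli (m1 := mu2) (m2 := mm) (fun q => (Y q)%:E))//.
  rewrite -ge0_integralZl//; last 3 first.
  - apply: (measurable_fun_fubini_tonelli_F (m2 := mm) (fun q => (Y q)%:E)) => //.
  - by move=> p _; apply: integral_ge0 => q _; rewrite lee_fin.
  - by rewrite lee_fin sqr_ge0.
  apply: ge0_le_integral_nomeas => p _.
    by rewrite lee_fin mulr_ge0 ?normc_ge0// mulr_ge0 ?normc_ge0// mulr_ge0.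
  pose w := normc (h p) * (th1 (t, lsubmx p) * th2 (t, rsubmx p)).
  have w0 : 0 <= w by rewrite mulr_ge0 ?normc_ge0// mulr_ge0.
  rewrite EFinM; apply: le_trans (lee_wpmul2l _ (cint_window_mul (lsubmx p) (rsubmx p) t0 mphi phi1 fL gL)) _.
    by rewrite lee_fin.
  pose G (q : 'rV[R]_n * 'rV[R]_n) := (normc (stft f t q.1 (lsubmx p)) *
    normc (stft g t q.2 (rsubmx p)) * normc (ambiguity phi t q (lsubmx p + rsubmx p)))%:E.
  have mG : measurable_fun setT G.
    apply/measurable_EFinP; apply: measurable_funM.
      apply: measurable_funM; apply: measurable_normc.
        by apply: (@cmeas_stft _ _ _ _ (fun=> t) fst (fun=> lsubmx p)) => //; exact: measurable_fst.
      by apply: (@cmeas_stft _ _ _ _ (fun=> t) snd (fun=> rsubmx p)) => //; exact: measurable_snd.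
    apply: measurable_normc.
    have := @cmeas_ambiguity R n _ _ (fun=> t) fst snd (fun=> lsubmx p + rsubmx p) phi (measurable_cst _)
      measurable_fst measurable_snd (measurable_cst _) mphi.
    by congr cmeas; apply/funext => -[z z'].
  have G0 q : (0 <= G q)%E by rewrite lee_fin mulr_ge0 ?normc_ge0// mulr_ge0 ?normc_ge0.
  have -> : (\int[mm]_q (Y (p, q))%:E = w%:E * \int[mm]_q G q)%E.
    rewrite -(ge0_integralZl mm measurableT mG (fun q _ => G0 q) (w0 : (0 <= w%:E)%E)).
    by apply: eq_integral => q _; rewrite -EFinM /Y /B /C /w /=; congr EFin; ring.
  by rewrite -/(G _) muleCA.
apply: le_trans step1 _.
(* The mass of that Gaussian, gained when the trilinear bounds are integrated over both centres by
   [even_kernel_sum]. *)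
pose K := gaussI n (4 * pi ^+ 2 * t).
have K0 : 0 < K by rewrite gaussI_gt0// qgauss_rate_gt0.
have step2 : (\int[mm]_q \int[mu2]_p (Y (p, q))%:E <=
    (32 * k * Num.sqrt (cg (2 * t)))%:E * (K%:E *
     (r%:E * slice_energy th1 f t + (r^-1)%:E * slice_energy th2 g t)))%E.
  have c320 : 0 <= 32 * k * Num.sqrt (cg (2 * t)) by rewrite mulr_ge0 ?sqrtr_ge0// mulr_ge0// ltW.
  pose Z (q : 'rV[R]_n * 'rV[R]_n) : \bar R := ((r%:E * U q.1 + (r^-1)%:E * V q.2) * (qgauss t (q.2 - q.1))%:E)%E.
  have rU0 z : (0 <= r%:E * U z)%E by apply: mule_ge0; [rewrite lee_fin ltW|exact: U0].
  have rV0 z : (0 <= (r^-1)%:E * V z)%E by apply: mule_ge0; [rewrite lee_fin invr_ge0 ltW|exact: V0].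
  have mrU : measurable_fun setT (fun z => r%:E * U z)%E by apply: emeasurable_funM.
  have mrV : measurable_fun setT (fun z => (r^-1)%:E * V z)%E by apply: emeasurable_funM.
  have Z0 q : (0 <= Z q)%E by rewrite mule_ge0 ?lee_fin ?qgauss_ge0// adde_ge0.
  have mZ : measurable_fun setT Z.
    apply: emeasurable_funM.
      apply: emeasurable_funD.
        exact: (measurableT_comp (g := fst) mrU measurable_fst).
      exact: (measurableT_comp (g := snd) mrV measurable_snd).
    apply/measurable_EFinP; apply: measurable_qgauss_comp => //.
    by apply: measurable_rVB; [exact: measurable_snd|exact: measurable_fst].
  apply: (@le_trans _ _ (\int[mm]_q ((32 * k * Num.sqrt (cg (2 * t)))%:E * Z q))%E).
    apply: ge0_le_integral_nomeas => q _; first by apply: integral_ge0 => p _; rewrite lee_fin.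
    apply: le_trans (tri q) _; rewrite /Z /a (qgauss_sym _ q.2) [X in (_ <= X)%E]muleCA -EFinM muleC.
    by rewrite le_eqVlt; apply/orP; left; apply/eqP; congr (_ * _%:E)%E; ring.
  rewrite ge0_integralZl// lee_wpmul2l ?lee_fin//.
  rewrite (fubini_tonelli1 (m1 := mu) (m2 := mu) Z)// /fubini_F /Z /=.
  rewrite (even_kernel_sum (K := fun x => (qgauss t x)%:E) (U := fun z => (r%:E * U z)%E) (V := fun z => ((r^-1)%:E * V z)%E))//.
  - rewrite integral_qgauss// lee_wpmul2l ?lee_fin ?(ltW K0)//.
    rewrite !ge0_integralZl ?lee_fin ?invr_ge0 ?(ltW r0)//.
    apply: leeD.
      by apply: lee_wpmul2l; [rewrite lee_fin ltW|exact: IU].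
    by apply: lee_wpmul2l; [rewrite lee_fin invr_ge0 ltW|exact: IV].
  - by apply/measurable_EFinP; exact: measurable_qgauss.
  - by move=> x; rewrite lee_fin qgauss_ge0.
  - by move=> x; rewrite qgaussN.
apply: le_trans (lee_wpmul2l _ step2) _; first by rewrite lee_fin sqr_ge0.
rewrite !muleA -!EFinM -form_rateE// -/K.
by rewrite le_eqVlt; apply/orP; left; apply/eqP; congr (_%:E * _)%E; ring.
Qed.

End energy.

Lemma ge0_integral_combination {R : realType} d (T : measurableType d) (mu : {measure set T -> \bar R})
    (u v : T -> \bar R) (c r1 r2 : R) : measurable_fun setT u -> measurable_fun setT v ->
  (forall x, (0 <= u x)%E) -> (forall x, (0 <= v x)%E) -> 0 <= c -> 0 <= r1 -> 0 <= r2 ->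
  (\int[mu]_x (c%:E * (r1%:E * u x + r2%:E * v x)) =
   c%:E * (r1%:E * \int[mu]_x u x + r2%:E * \int[mu]_x v x))%E.
Proof.
move=> mu' mv u0 v0 c0 r10 r20.
have U0 x : (0 <= r1%:E * u x)%E by rewrite mule_ge0.
have V0 x : (0 <= r2%:E * v x)%E by rewrite mule_ge0.
have mU : measurable_fun setT (fun x => r1%:E * u x)%E by exact: emeasurable_funM.
have mV : measurable_fun setT (fun x => r2%:E * v x)%E by exact: emeasurable_funM.
rewrite ge0_integralZl//; last 2 first.
- exact: emeasurable_funD.
- by move=> x _; exact: adde_ge0.
by rewrite ge0_integralD// !ge0_integralZl.
Qed.

(** * Estimates of the truncated form and of the tails *)

Section form_estimate.
Context {R : realType} {n : nat}.
Local Notation mu := (@lebesgue_rV R n).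
Local Notation mm := (product_sf mu mu).
Local Notation mu2 := (@lebesgue_rV R (n + n)).
Local Notation lam := (@lebesgue_measure R).
Local Notation Pi := (product_sf lam mu2).
Local Notation cg t := (gaussI n (4 * pi ^+ 2 * (2 * (2 * t)))).
Implicit Types (f g phi : 'rV[R]_n -> R[i]) (th : R * 'rV[R]_n -> R).
Variables (b k : R) (h : 'rV[R]_(n + n) -> R[i]).
Hypotheses (b0 : 0 < b) (mh : cmeas h) (k0 : 0 < k) (hk : weakL4 mu2 (fun p => normc (h p)) k).

Lemma cL1_bounded_window_mul phi f g t a c : 0 < t -> in_L2 f -> in_L2 g ->
  cmeas phi -> (forall x, normc (phi x) <= 1) ->
  cL1 mu (fun x => phi x * (window f t a x * window g t c x)).
Proof.
move=> t0 fL gL mphi phi1; have mW (u : 'rV[R]_n -> R[i]) v : in_L2 u -> cmeas (window u t v).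
  by move=> uL; exact: (@cmeas_window _ _ _ _ (fun=> t) (fun=> v) id _ _ _ _ uL.1).
split; first by apply: cmeasM => //; apply: cmeasM; exact: mW.
apply: le_lt_trans (integral_smear_mul t0 fL gL).
apply: ge0_le_integral_nomeas => x _; first by rewrite lee_fin normc_ge0.
apply: (@le_trans _ _ ((normc (window f t a x))%:E * (normc (window g t c x))%:E)%E).
  rewrite -EFinM -ComplexField.Normc.normcM lee_fin [leLHS]ComplexField.Normc.normcM.
  by rewrite ler_piMl ?normc_ge0.
by apply: lee_pmul; rewrite ?lee_fin ?normc_ge0//; apply: normc_window_le; [exact: fL.1|exact: gL.1].
Qed.

Lemma measurable_rho_slice th f : measurable_fun setT th -> (forall q, 0 <= th q) -> cmeas f ->
  measurable_fun setT (fun t => (rho (n := n) b t)%:E * slice_energy th f t)%E /\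
  forall t, (0 <= (rho (n := n) b t)%:E * slice_energy th f t)%E.
Proof.
move=> mth th0 mf; split=> [|t].
  apply: emeasurable_funM; last exact: measurable_slice_energy.
  by apply/measurable_EFinP; exact: measurable_rho.
by apply: mule_ge0; [rewrite lee_fin; exact: rho_ge0|exact: slice_energy_ge0].
Qed.

(* Duality: the L^1 norm is the pairing with the conjugate phase of the form. *)
Lemma form_estimate N th1 th2 f g (r : R) : admissible N th1 -> admissible N th2 ->
  in_L2 f -> in_L2 g -> 0 < r ->
  (\int[mu]_x (normc (form b h th1 th2 f g x))%:E <=
   (32 * k)%:E * (r%:E * energy b th1 f + (r^-1)%:E * energy b th2 g))%E.
Proof.
move=> A1 A2 fL gL r0; have [mf If] := fL; have [mg Ig] := gL.
have a1 q : 0 <= th1 q by exact: admissible_ge0 A1.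
have a2 q : 0 <= th2 q by exact: admissible_ge0 A2.
pose T := form b h th1 th2 f g.
have LT : cL1 mu T by exact: (@cL1_form _ _ _ _ _ b0 mh k0 hk _ _ _ _ _ A1 A2 fL gL).
have [mT IT] := LT.
(* The conjugate phase of [T]. As the inverse of 0 is 0, [phi] vanishes where [T] does, and
   [phi T = |T|] holds everywhere. *)
pose phi (x : 'rV[R]_n) : R[i] := ((T x)^*)%C * ((normc (T x))^-1)%:C%C.
have mphi : cmeas phi.
  apply: cmeasM; first exact: cmeas_conj.
  apply/cmeas_real; rewrite (_ : (fun x => _) = (fun x => normc (T x) `^ (-1))).
    exact: (measurableT_comp (f := fun y : R => y `^ (-1)) (measurable_powR_fun _) (measurable_normc mT)).
  by apply/funext => x; rewrite powR_inv1 ?normc_ge0.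
have phi1 x : normc (phi x) <= 1.
  rewrite ComplexField.Normc.normcM normc_conj normc_real ger0_norm ?invr_ge0 ?normc_ge0//.
  by have [->|n0] := eqVneq (normc (T x)) 0; [rewrite mul0r|rewrite divff].
have phiT x : phi x * T x = (normc (T x))%:C%C.
  rewrite /phi mulrAC [(_)^*%C * _]mulrC mul_conjc -rmorphM; congr (_%:C%C).
  by have [->|n0] := eqVneq (normc (T x)) 0; [rewrite expr0n mul0r|rewrite expr2 mulfK].
pose Ker (p : 'rV[R]_n * (R * 'rV[R]_(n + n))) := phi p.1 * form_kernel b h th1 th2 f g p.1 p.2.
have mKer : cmeas Ker.
  apply: cmeasM; first exact: (cmeas_comp mphi measurable_fst).
  exact: (cmeas_form_kernel _ mh A1.1 A2.1 mf mg).
have IKer : (\int[mu]_x \int[Pi]_p (normc (Ker (x, p)))%:E < +oo)%E.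
  apply: le_lt_trans (@integral_integral_form_kernel _ _ _ _ _ b0 mh k0 hk _ _ _ _ _ A1 A2 fL gL).
  apply: ge0_le_integral_nomeas => x _; first by apply: integral_ge0 => p _; rewrite lee_fin normc_ge0.
  apply: ge0_le_integral_nomeas => p _; first by rewrite lee_fin normc_ge0.
  by rewrite lee_fin ComplexField.Normc.normcM ler_piMl ?normc_ge0.
have -> : (\int[mu]_x (normc (T x))%:E = (normc (cint mu (fun x => phi x * T x)))%:E)%E.
  have I0 : (0 <= \int[mu]_x (normc (T x))%:E)%E by apply: integral_ge0 => x _; rewrite lee_fin normc_ge0.
  have EI : (\int[mu]_x (normc (T x))%:E = (fine (\int[mu]_x (normc (T x))%:E))%:E)%E.
    by rewrite fineK// ge0_fin_numE.
  have -> : cint mu (fun x => phi x * T x) = cint mu (fun x => (normc (T x))%:C%C).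
    by apply: eq_cint => x; exact: phiT.
  by rewrite (cint_ge0_real EI) normc_real ger0_norm ?fine_ge0// -EI.
have -> : cint mu (fun x => phi x * T x) = cint Pi (fun p => cint mu (fun x => Ker (x, p))).
  rewrite -(@cint_swap R _ _ _ _ mu Pi Ker mKer IKer).
  apply: eq_cint => x; rewrite /T /form -cintZ//.
  exact: (@cL1_form_kernel _ _ _ _ _ b0 mh k0 hk _ _ _ _ _ _ A1 A2 fL gL).
clearbody phi.
pose Ker' (q : (R * 'rV[R]_(n + n)) * 'rV[R]_n) := Ker (q.2, q.1).
have mKer' : cmeas Ker' by apply: (cmeas_comp mKer); exact: measurable_swap.
have LK := @le_normc_cint_cmeas R _ _ Pi _ (@cmeas_cint R _ _ _ _ mu Ker' mKer').
apply: (le_trans LK) => {LK}.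
pose F (p : R * 'rV[R]_(n + n)) : R := weight b th1 th2 p * normc (h p.2) *
  normc (cint mu (fun x => phi x * (window f p.1 (lsubmx p.2) x * window g p.1 (rsubmx p.2) x))).
have EF p : normc (cint mu (fun x => Ker' (p, x))) = F p.
  have W0 : 0 <= weight b th1 th2 p by exact: (weight_ge0 b0 _ A1 A2).
  have [p0|p0] := leP p.1 0.
    have w0 : weight b th1 th2 p = 0 by rewrite /weight gamma_density_le0 ?mul0r.
    rewrite /F w0 !mul0r.
    have -> : cint mu (fun x => Ker' (p, x)) = cint mu (fun x => 0 * (0 : R[i])).
      by apply: eq_cint => x; rewrite /Ker' /Ker /form_kernel /= w0 !mul0r mulr0.
    rewrite cintZ ?mul0r ?Normc.normc0//; split=> //.
    by rewrite Normc.normc0 integral0.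
  have L := cL1_bounded_window_mul (lsubmx p.2) (rsubmx p.2) p0 fL gL mphi phi1.
  rewrite [cint _ _](_ : _ = ((weight b th1 th2 p)%:C%C * h p.2) *
      cint mu (fun x => phi x * (window f p.1 (lsubmx p.2) x * window g p.1 (rsubmx p.2) x))).
    by rewrite !ComplexField.Normc.normcM normc_real ger0_norm.
  rewrite -cintZ//; apply: eq_cint => x; rewrite /Ker' /Ker /form_kernel /=; ring.
under eq_integral do rewrite EF.
have mF : measurable_fun setT F.
  rewrite (_ : F = fun p => normc (cint mu (fun x => Ker' (p, x)))); last by apply/funext => p.
  by apply: measurable_normc; exact: (@cmeas_cint R _ _ _ _ mu Ker' mKer').
have F0 p : 0 <= F p by rewrite -EF normc_ge0.
rewrite (fubini_tonelli1 (m1 := lam) (m2 := mu2) (fun p => (F p)%:E)); last 2 first.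
- exact/measurable_EFinP.
- by move=> p; rewrite lee_fin.
rewrite /fubini_F.
have e1 := measurable_slice_energy A1.1 a1 mf; have e2 := measurable_slice_energy A2.1 a2 mg.
have s1 t := slice_energy_ge0 f t a1; have s2 t := slice_energy_ge0 g t a2.
have [m1 p1] := measurable_rho_slice A1.1 a1 mf.
have [m2 p2] := measurable_rho_slice A2.1 a2 mg.
have k32 : 0 <= 32 * k by rewrite mulr_ge0// ltW.
have rV : 0 <= r^-1 by rewrite invr_ge0 ltW.
rewrite (energyE b0 A1.1 a1 mf) (energyE b0 A2.1 a2 mg).
rewrite -(ge0_integral_combination lam m1 m2 p1 p2 k32 (ltW r0) rV).
apply: ge0_le_integral_nomeas => t _; first by apply: integral_ge0 => p _; rewrite lee_fin.
have [t0|t0] := leP t 0.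
  rewrite integral0_eq; last by move=> p _; rewrite /F /weight /= gamma_density_le0// !mul0r.
  apply: mule_ge0; first by rewrite lee_fin.
  apply: adde_ge0.
    by apply: mule_ge0; [rewrite lee_fin ltW|exact: p1].
  by apply: mule_ge0; [rewrite lee_fin|exact: p2].
rewrite [leLHS](_ : _ = ((gamma_density b t)%:E * \int[mu2]_p
  (normc (h p) * (th1 (t, lsubmx p) * th2 (t, rsubmx p)) *
     normc (cint mu (fun x => phi x * (window f t (lsubmx p) x * window g t (rsubmx p) x))))%:E)%E); last first.
  rewrite -ge0_integralZl_EFin//.
  - by apply: eq_integral => p _; rewrite -EFinM /F /weight /=; congr EFin; ring.
  - by move=> p _; rewrite lee_fin mulr_ge0 ?normc_ge0// mulr_ge0 ?normc_ge0// mulr_ge0.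
  - apply/measurable_EFinP; apply: measurable_funM.
      apply: measurable_funM; first exact: measurable_normc.
      apply: measurable_funM; first exact: (measurable_slice_left (measurable_cst t) _ A1.1).
      exact: (measurable_slice_right (measurable_cst t) _ A2.1).
    pose V (q : 'rV[R]_(n + n) * 'rV[R]_n) : R[i] := phi q.2 *
      (window f t (lsubmx q.1) q.2 * window g t (rsubmx q.1) q.2).
    have mV : cmeas V.
      apply: cmeasM; first exact: (cmeas_comp mphi measurable_snd).
      apply: cmeasM.
        apply: (@cmeas_window _ _ _ _ (fun=> t) (fun q => lsubmx q.1) snd) => //.
        by apply: measurable_lsubmx; exact: measurable_fst.
      apply: (@cmeas_window _ _ _ _ (fun=> t) (fun q => rsubmx q.1) snd) => //.
      by apply: measurable_rsubmx; exact: measurable_fst.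
    by apply: measurable_normc; exact: (@cmeas_cint R _ _ _ _ mu V mV).
  - exact: gamma_density_ge0.
have gd0 : (0 <= (gamma_density b t)%:E)%E by rewrite lee_fin gamma_density_ge0.
apply: le_trans (lee_wpmul2l gd0 (slice_form_bound mh k0 hk mphi phi1 A1 A2 fL gL r0 t0)) _.
rewrite le_eqVlt; apply/orP; left; apply/eqP.
rewrite muleA -EFinM.
have -> : gamma_density b t * (32 * k * (form_rate (R := R) (n := n) * t `^ (n%:R / 4))) =
    32 * k * rho (n := n) b t by rewrite /rho; ring.
rewrite EFinM -muleA; congr (_ * _)%E.
rewrite ge0_muleDr; last 2 first.
- by apply: mule_ge0; [rewrite lee_fin ltW|exact: s1].
- by apply: mule_ge0; [rewrite lee_fin|exact: s2].
by congr (_ + _)%E; exact: muleCA.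
Qed.

Definition energy_const : R := form_rate (R := R) (n := n) * gaussI n (4 * pi ^+ 2 * 2 * 2) *
  fine (\int[lam]_t (gamma_density b t * t `^ (- (n%:R / 4)))%:E)%E.

Lemma energy_const_ge0 : 0 <= energy_const.
Proof.
rewrite mulr_ge0//; first by rewrite mulr_ge0 ?form_rate_ge0// exprn_ge0 ?sqrtr_ge0.
apply: fine_ge0; apply: integral_ge0 => t _.
by rewrite lee_fin mulr_ge0 ?gamma_density_ge0 ?powR_ge0.
Qed.

Hypothesis nb : n%:R / 4 < b.

(** The power [t^(n/4)] in [rho] meets [t^(-n/2)] from [integral_stft]; the resulting [t^(-n/4)] is
    integrable against the gamma density. *)
Lemma energy_le th f : measurable_fun setT th -> (forall q, 0 <= th q <= 1) -> in_L2 f ->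
  (energy b th f <= energy_const%:E * \int[mu]_x (normc (f x) ^+ 2)%:E)%E.
Proof.
move=> mth th01 fL; have [mf If] := fL.
have th0 q : 0 <= th q by have /andP[] := th01 q.
rewrite energyE//; set I := (\int[mu]_x _)%E in If *.
have I0 : (0 <= I)%E by apply: integral_ge0 => x _; rewrite lee_fin sqr_ge0.
pose c := form_rate (R := R) (n := n) * gaussI n (4 * pi ^+ 2 * 2 * 2).
have c0 : 0 <= c by rewrite mulr_ge0 ?form_rate_ge0// exprn_ge0 ?sqrtr_ge0.
have Gfin : (\int[lam]_t (gamma_density b t * t `^ (- (n%:R / 4)))%:E)%E \is a fin_num.
  rewrite ge0_fin_numE ?integral_gamma_density_powR//; apply: integral_ge0 => t _.
  by rewrite lee_fin mulr_ge0 ?gamma_density_ge0 ?powR_ge0.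
apply: (@le_trans _ _ (\int[lam]_t (I * (c%:E * (gamma_density b t * t `^ (- (n%:R / 4)))%:E)))%E); last first.
  rewrite ge0_integralZl//.
  - rewrite muleC ge0_integralZl ?lee_fin//.
    + by rewrite -(fineK Gfin) -EFinM.
    + apply/measurable_EFinP; apply: measurable_funM; first exact: measurable_gamma_density.
      exact: measurable_powR_fun.
    + by move=> t _; rewrite lee_fin mulr_ge0 ?gamma_density_ge0 ?powR_ge0.
  - apply: emeasurable_funM => //; apply/measurable_EFinP.
    by apply: measurable_funM; [exact: measurable_gamma_density|exact: measurable_powR_fun].
  - by move=> t _; rewrite -EFinM lee_fin mulr_ge0// mulr_ge0 ?gamma_density_ge0 ?powR_ge0.
apply: ge0_le_integral_nomeas => t _.
  by apply: mule_ge0; [rewrite lee_fin rho_ge0|exact: slice_energy_ge0].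
have [t0|t0] := leP t 0.
  by rewrite /rho gamma_density_le0// !mul0r mule0 mul0e mule0.
have S : (slice_energy th f t <= (cg t)%:E * I)%E.
  apply: le_trans (integral_stft t0 fL).
  apply: ge0_le_integral_nomeas => z _; first by apply: integral_ge0 => a _; rewrite lee_fin energy_density_ge0.
  apply: ge0_le_integral_nomeas => a _; rewrite lee_fin ?energy_density_ge0//.
  rewrite /energy_density/= ler_piMl ?sqr_ge0//; by have /andP[] := th01 (t, a).
apply: le_trans (lee_wpmul2l _ S) _; first by rewrite lee_fin rho_ge0.
rewrite muleA muleC lee_wpmul2l// -!EFinM lee_fin le_eqVlt; apply/orP; left; apply/eqP.
have -> : 4 * pi ^+ 2 * (2 * (2 * t)) = (4 * pi ^+ 2 * 2 * 2) * t by ring.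
have c40 : 0 < 4 * pi ^+ 2 * 2 * 2 :> R by rewrite !mulr_gt0 ?exprn_gt0 ?pi_gt0.
rewrite (gaussI_powR n c40 t0) /rho /c.
rewrite [LHS](_ : _ = form_rate (R := R) (n := n) * gaussI n (4 * pi ^+ 2 * 2 * 2) *
  (gamma_density b t * (t `^ (n%:R / 4) * t `^ (- (n%:R / 2))))); last by ring.
by rewrite powRD_gt0//; congr (_ * (_ * _ `^ _)); lra.
Qed.

Definition tail f N : \bar R := energy b (fun q => 1 - cutoff N q) f.

(** Dominated convergence, the majorant being the energy density for the constant weight 1. The
    cutoffs tend to 1 at positive times, and at the others [rho] is 0. *)
Lemma tail_cvg0 f : in_L2 f -> tail f N @[N --> \oo] --> 0%E.
Proof.
move=> fL; have [mf If] := fL.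
pose D N (q : R * ('rV[R]_n * 'rV[R]_n)) : \bar R :=
  (rho (n := n) b q.1 * energy_density (fun q => 1 - cutoff N q) f q)%:E.
pose G (q : R * ('rV[R]_n * 'rV[R]_n)) : \bar R := (rho (n := n) b q.1 * energy_density (fun=> 1) f q)%:E.
have mr : measurable_fun setT (fun q : R * ('rV[R]_n * 'rV[R]_n) => rho (n := n) b q.1).
  exact: (measurableT_comp (g := fst) (measurable_rho b) measurable_fst).
have mth N : measurable_fun setT (fun q : R * 'rV[R]_n => 1 - cutoff N q).
  by apply: measurable_funB => //; exact: measurable_cutoff.
have mD N : measurable_fun setT (D N).
  by apply/measurable_EFinP; apply: measurable_funM => //; exact: measurable_energy_density.
have G0 q : (0 <= G q)%E by rewrite lee_fin mulr_ge0 ?rho_ge0// energy_density_ge0.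
have mG : measurable_fun setT G.
  by apply/measurable_EFinP; apply: measurable_funM => //; exact: measurable_energy_density.
have IG : (product_sf lam mm).-integrable setT G.
  apply/integrableP; split=> //.
  have -> : (\int[product_sf lam mm]_q `|G q| = energy b (fun=> 1%R) f)%E.
    by apply: eq_integral => q _; rewrite gee0_abs.
  apply: le_lt_trans (energy_le _ _ fL) _ => //; first by move=> q; rewrite ler01 lexx.
  rewrite lte_mul_pinfty ?lee_fin ?energy_const_ge0//.
have := @dominated_convergence _ _ _ (product_sf lam mm) setT measurableT D (cst 0%E) G.
case=> //.
- apply: aeW => q _; have [q0|q0] := leP q.1 0.
    rewrite (_ : (fun N => D N q) = cst 0%E); first exact: cvg_cst.
    by apply/funext => N; rewrite /D /rho gamma_density_le0// !mul0r.
  rewrite /cst; apply: cvg_EFin; first exact: nearW.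
  rewrite [X in X @ _ --> _](_ : _ = fun N =>
      rho (n := n) b q.1 * ((1 - cutoff N (q.1, q.2.2)) * normc (stft f q.1 q.2.1 q.2.2) ^+ 2)); last first.
    by apply/funext => N.
  have C := @cvg_cutoff R n (q.1, q.2.2) q0.
  have : (fun N => rho (n := n) b q.1 * ((1 - cutoff N (q.1, q.2.2)) * normc (stft f q.1 q.2.1 q.2.2) ^+ 2)) @ \oo
      --> rho (n := n) b q.1 * ((1 - 1) * normc (stft f q.1 q.2.1 q.2.2) ^+ 2).
    by apply: cvgMr; apply: cvgMl; apply: cvgB => //; exact: cvg_cst.
  by rewrite subrr mul0r mulr0.
- apply: aeW => N q _; rewrite lee_fin ger0_norm; last first.
    by rewrite mulr_ge0 ?rho_ge0// energy_density_ge0// => p; rewrite subr_ge0 cutoff_le1.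
  rewrite ler_wpM2l ?rho_ge0// /energy_density ler_wpM2r ?sqr_ge0// lerBlDr lerDl cutoff_ge0//.
by move=> _ _; rewrite integral0.
Qed.

End form_estimate.

(** * Limits in L^1 *)
Lemma cvg_series_dominated {R : realType} (u v : nat -> R) :
  (forall i, `|u i| <= v i) -> (\sum_(i <oo) (v i)%:E < +oo)%E -> cvgn (series u).
Proof.
move=> uv vlty; apply: normed_cvg; have v0 i : 0 <= v i by apply: le_trans (uv i).
apply: nondecreasing_is_cvgn.
  by apply: nondecreasing_series => i _ _; exact: normr_ge0.
have vfin : (\sum_(i <oo) (v i)%:E)%E \is a fin_num.
  by rewrite ge0_fin_numE//; apply: nneseries_ge0 => i _ _; rewrite lee_fin.
exists (fine (\sum_(i <oo) (v i)%:E)%E) => _ [N _ <-].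
rewrite -lee_fin fineK//; apply: le_trans (nneseries_lim_ge (m := 0%N) (P := xpredT) N _).
  rewrite /series /= sumEFin lee_fin; apply: ler_sum => i _; exact: uv.
by move=> i _ _; rewrite lee_fin.
Qed.

Section L1_completeness.
Context {R : realType} d (T : measurableType d) (mu : {measure set T -> \bar R}).
Implicit Types F G : T -> R[i].

Definition distL1 F G : \bar R := (\int[mu]_x (normc (F x - G x))%:E)%E.

Lemma distL1_ge0 F G : (0 <= distL1 F G)%E.
Proof. by apply: integral_ge0 => x _; rewrite lee_fin normc_ge0. Qed.

Lemma distL1C F G : distL1 F G = distL1 G F.
Proof. by apply: eq_integral => x _; rewrite normcB. Qed.

Lemma cmeasB F G : cmeas F -> cmeas G -> cmeas (fun x => F x - G x).
Proof. by move=> mF mG; apply: cmeasD => //; exact: cmeasN. Qed.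

Lemma measurable_distL1 F G : cmeas F -> cmeas G ->
  measurable_fun setT (fun x => (normc (F x - G x))%:E).
Proof. by move=> mF mG; apply/measurable_EFinP; apply: measurable_normc; exact: cmeasB. Qed.

Lemma distL1_triangle F G H : cmeas F -> cmeas G -> cmeas H ->
  (distL1 F H <= distL1 F G + distL1 G H)%E.
Proof.
move=> mF mG mH; rewrite /distL1 -ge0_integralD//.
- apply: ge0_le_integral_nomeas => x _; first by rewrite lee_fin normc_ge0.
  rewrite -EFinD lee_fin (_ : F x - H x = (F x - G x) + (G x - H x)); last by rewrite addrA subrK.
  exact: le_normcD.
- by move=> x _; rewrite lee_fin normc_ge0.
- exact: measurable_distL1.
- by move=> x _; rewrite lee_fin normc_ge0.
- exact: measurable_distL1.
Qed.

Lemma distL1_eq0 F G : cmeas F -> cmeas G -> distL1 F G = 0%E -> {ae mu, forall x, F x = G x}.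
Proof.
move=> mF mG E0.
have : ae_eq mu setT (fun x => (normc (F x - G x))%:E) (cst 0%E).
  apply/ae_eq_integral_abs => //; first exact: measurable_distL1.
  rewrite -E0; apply: eq_integral => x _; rewrite gee0_abs ?lee_fin ?normc_ge0//.
apply: filterS => x /(_ I)[] /Normc.eq0_normc /eqP; rewrite subr_eq0; exact: eqP.
Qed.

Lemma ccvg_sub (z : nat -> R[i]) (w v : R[i]) : ccvg z w ->
  (fun N => (normc (v - z N))%:E) @ \oo --> (normc (v - w))%:E.
Proof.
move=> zw; apply: cvg_EFin; first exact: nearW.
apply/(@cvgrPdist_le _ _ _ (\oo)) => e e0; have := ccvg_normcB zw.
move/cvgrPdist_le => /(_ e e0); apply: filterS => N; rewrite sub0r normrN => h.
apply: le_trans h; rewrite [X in _ <= X]ger0_norm ?normc_ge0//.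
have t1 := le_normcD (v - z N) (z N - w); have t2 := le_normcD (v - w) (w - z N).
rewrite /= ler_norml; move: t1 t2; rewrite !addrA !subrK [normc (w - _)]normcB => t1 t2.
by apply/andP; split; lra.
Qed.

(** The Riesz-Fischer argument: along a subsequence the successive distances are at most [2^-(j+1)],
    so the telescoping series converges absolutely almost everywhere. *)
Lemma L1_complete (F : nat -> T -> R[i]) : (forall N, cL1 mu (F N)) ->
  (forall e : R, 0 < e -> exists N0, forall N M, (N0 <= N)%N -> (N <= M)%N ->
     (distL1 (F M) (F N) <= e%:E)%E) ->
  exists2 G, cL1 mu G & forall e : R, 0 < e -> exists N0, forall N, (N0 <= N)%N ->
     (distL1 (F N) G <= e%:E)%E.
Proof.
move=> LF cauchy; pose e_ j : R := 1 / (2 ^ j.+1)%:R.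
have e0 j : 0 < e_ j by rewrite divr_gt0// ltr0n expn_gt0.
have mF N : cmeas (F N) by exact: (LF N).1.
have /choice[K HK] j := cauchy _ (e0 j).
(* Partial sums make the indices increasing, with both [s j >= K j] and [s j >= j]. *)
pose s j := (\sum_(i < j.+1) (K i).+1)%N.
have sS j : s j.+1 = (s j + (K j.+1).+1)%N by rewrite /s big_ord_recr.
have Ks j : (K j <= s j)%N.
  by case: j => [|j]; [rewrite /s big_ord1|rewrite sS; apply: leq_trans (leq_addl _ _)].
have js j : (j <= s j)%N.
  by elim: j => // j IH; rewrite sS; apply: leq_trans (leq_add IH (ltn0Sn _)); rewrite addn1.
have ss j : (s j <= s j.+1)%N by rewrite sS leq_addr.
pose D j x := F (s j.+1) x - F (s j) x.
have mD j : measurable_fun setT (fun x => (normc (D j x))%:E) by exact: measurable_distL1.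
have D0 j x : (0 <= (normc (D j x))%:E)%E by rewrite lee_fin normc_ge0.
pose S x : \bar R := (\sum_(j <oo) (normc (D j x))%:E)%E.
have mS : measurable_fun setT S by apply: ge0_emeasurable_sum.
have S0 x : (0 <= S x)%E by apply: nneseries_ge0.
have IS : mu.-integrable setT S.
  apply/integrableP; split=> //; apply: (@le_lt_trans _ _ 1%:E); last exact: ltry.
  under eq_integral do rewrite gee0_abs//.
  rewrite integral_nneseries//.
  apply: le_trans (_ : _ <= \sum_(j <oo) (e_ j)%:E)%E _; last exact: (epsilon_trick0 xpredT).
  apply: lee_nneseries => [j _ _|j _]; first exact: integral_ge0.
  exact: HK (Ks j) (ss j).
have Sfin := integrable_ae measurableT IS.
pose E : set T := [set x | (S x < +oo)%E].
have mE : measurable E.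
  rewrite (_ : E = setT `&` S @^-1` (~` [set +oo%E])); first exact/mS/measurableC/emeasurable_set1.
  by rewrite setTI; apply/seteqP; split => x /=; rewrite /E /= ltey => /eqP.
(* Multiplying by the indicator of the set where the series converges lets the limit exist at every
   point, so that it is measurable. *)
pose a j x : R[i] := (\1_E x)%:C%C * F (s j) x.
have ma j : cmeas (a j) by apply: cmeasM => //; apply/cmeas_real; exact: measurable_indic.
have cvga x : cvgn (fun j => Re (a j x)) /\ cvgn (fun j => Im (a j x)).
  have [xE|xE] := pselect (E x); last first.
    have a0 j : a j x = 0 by rewrite /a indicE memNset// mul0r.
    by split; [rewrite (_ : (fun j => _) = cst (Re (0 : R[i])))|
      rewrite (_ : (fun j => _) = cst (Im (0 : R[i])))]; rewrite ?funeqE//; try exact: is_cvg_cst;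
      move=> j; rewrite a0.
  have tele (P : R[i] -> R) : (forall z w, P (z - w) = P z - P w) ->
      (forall z, `|P z| <= normc z) -> cvgn (fun j => P (F (s j) x)).
    move=> PB Pn; have c := @cvg_series_dominated R (fun j => P (D j x)) _ (fun j => Pn _) xE.
    have -> : (fun j => P (F (s j) x)) = (fun j => P (F (s 0%N) x) + series (fun j => P (D j x)) j).
      apply/funext => j; rewrite /series /=.
      under eq_bigr do rewrite /D PB.
      by rewrite telescope_sumr// addrC subrK.
    by apply: is_cvgD => //; exact: is_cvg_cst.
  have e1 j : a j x = F (s j) x by rewrite /a indicE mem_set// mul1r.
  split.
    rewrite (_ : (fun j => _) = (fun j => Re (F (s j) x))); last by apply/funext => j; rewrite e1.
    by apply: tele => [z w|z]; [rewrite ReD ReN|exact: Re_le_normc].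
  rewrite (_ : (fun j => _) = (fun j => Im (F (s j) x))); last by apply/funext => j; rewrite e1.
  by apply: tele => [z w|z]; [rewrite ImD ImN|exact: Im_le_normc].
pose G x : R[i] := (limn (fun j => Re (a j x)) +i* limn (fun j => Im (a j x)))%C.
have aG x : ccvg (fun j => a j x) (G x) by have [c1 c2] := cvga x; split.
have mG : cmeas G.
  split.
    by apply: (@measurable_fun_cvg _ _ _ _ (fun j x => Re (a j x))) => [j|x _]; [exact: (ma j).1|exact: (aG x).1].
  by apply: (@measurable_fun_cvg _ _ _ _ (fun j x => Im (a j x))) => [j|x _]; [exact: (ma j).2|exact: (aG x).2].
(* Fatou along the subsequence passes a Cauchy bound to the limit. *)
have lim_le N (e : R) : (forall M, (N <= M)%N -> (distL1 (F M) (F N) <= e%:E)%E) ->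
    (distL1 (F N) G <= e%:E)%E.
  move=> H; apply: (@fatou_cvg _ _ _ mu (fun j x => (normc (F N x - F (s j) x))%:E)).
  - by move=> j; exact: measurable_distL1.
  - by move=> j x; rewrite lee_fin normc_ge0.
  - exact: measurable_distL1.
  - by move=> x; rewrite lee_fin normc_ge0.
  - apply: filterS Sfin => x /(_ I) Sx.
    have xE : E x by rewrite /E /= -ge0_fin_numE.
    have := ccvg_sub (v := F N x) (aG x).
    rewrite (_ : (fun j => _) = (fun j => (normc (F N x - F (s j) x))%:E))//.
    by apply/funext => j; rewrite /a indicE mem_set// mul1r.
  - exists N => // j /= Nj; rewrite -/(distL1 _ _) distL1C; apply: H.
    exact: leq_trans Nj (js j).
have GE (e : R) : 0 < e -> exists N0, forall N, (N0 <= N)%N -> (distL1 (F N) G <= e%:E)%E.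
  move=> /cauchy[N0 HN0]; exists N0 => N N0N; apply: lim_le => M; exact: HN0.
exists G => //; have [N0 /(_ N0 (leqnn _)) h] := GE 1 ltr01.
split=> //; apply: (@le_lt_trans _ _ (\int[mu]_x ((normc (F N0 x))%:E + (normc (F N0 x - G x))%:E))%E).
  apply: ge0_le_integral_nomeas => x _; first by rewrite lee_fin normc_ge0.
  rewrite -EFinD lee_fin -[normc (F N0 x - G x)]normcB.
  by apply: le_trans (le_normcD _ _); rewrite addrC subrK.
rewrite ge0_integralD//.
- by rewrite lte_add_pinfty ?(LF N0).2//; apply: le_lt_trans h _; exact: ltry.
- by move=> x _; rewrite lee_fin normc_ge0.
- by apply/measurable_EFinP; exact: measurable_normc.
- by move=> x _; rewrite lee_fin normc_ge0.
- exact: measurable_distL1.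
Qed.

End L1_completeness.

Section L1_limits.
Context {R : realType} d (T : measurableType d) (mu : {measure set T -> \bar R}).
Implicit Types G H : T -> R[i].

Definition limL1 (F : nat -> T -> R[i]) G := forall e : R, 0 < e ->
  exists N0, forall N, (N0 <= N)%N -> (distL1 mu (F N) G <= e%:E)%E.

Lemma le_all_pos_ereal (x y : \bar R) : y \is a fin_num ->
  (forall e : R, 0 < e -> (x <= y + e%:E)%E) -> (x <= y)%E.
Proof. by move=> yf H; apply/lee_addgt0Pr => e e0; exact: H. Qed.

Lemma limL1_unique F G H : (forall N, cmeas (F N)) -> cmeas G -> cmeas H ->
  limL1 F G -> limL1 F H -> {ae mu, forall x, G x = H x}.
Proof.
move=> mF mG mH FG FH; apply: distL1_eq0 => //; apply/eqP; rewrite eq_le distL1_ge0 andbT.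
apply: le_all_pos_ereal => // e e0; rewrite add0e.
have e20 : 0 < e / 2 by rewrite divr_gt0.
have [N1 H1] := FG _ e20; have [N2 H2] := FH _ e20.
apply: le_trans (distL1_triangle mu mG (mF (maxn N1 N2)) mH) _.
rewrite (splitr e) EFinD; apply: leeD; first by rewrite distL1C; apply: H1; exact: leq_maxl.
by apply: H2; exact: leq_maxr.
Qed.

Lemma limL1D (a : R[i]) F1 F2 G1 G2 : (forall N, cmeas (F1 N)) -> (forall N, cmeas (F2 N)) ->
  cmeas G1 -> cmeas G2 -> limL1 F1 G1 -> limL1 F2 G2 ->
  limL1 (fun N x => a * F1 N x + F2 N x) (fun x => a * G1 x + G2 x).
Proof.
move=> mF1 mF2 mG1 mG2 L1 L2 e e0; pose c := normc a + 1.
have c0 : 0 < c by rewrite ltr_wpDl ?normc_ge0.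
have [N1 H1] : exists N0, forall N, (N0 <= N)%N -> (distL1 mu (F1 N) G1 <= (e / (2 * c))%:E)%E.
  by apply: L1; rewrite divr_gt0// mulr_gt0.
have [N2 H2] : exists N0, forall N, (N0 <= N)%N -> (distL1 mu (F2 N) G2 <= (e / 2)%:E)%E.
  by apply: L2; rewrite divr_gt0.
exists (maxn N1 N2) => N; rewrite geq_max => /andP[n1 n2].
apply: (@le_trans _ _ (c%:E * distL1 mu (F1 N) G1 + distL1 mu (F2 N) G2)%E).
  rewrite /distL1 -ge0_integralZl//; last 3 first.
  - exact: measurable_distL1.
  - by move=> x _; rewrite lee_fin normc_ge0.
  - by rewrite lee_fin ltW.
  rewrite -ge0_integralD//.
  - apply: ge0_le_integral_nomeas => x _; first by rewrite lee_fin normc_ge0.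
    rewrite -EFinM -EFinD lee_fin.
    have -> : a * F1 N x + F2 N x - (a * G1 x + G2 x) = a * (F1 N x - G1 x) + (F2 N x - G2 x) by ring.
    apply: le_trans (le_normcD _ _) _; rewrite lerD2r ComplexField.Normc.normcM ler_wpM2r ?normc_ge0//.
    by rewrite lerDl.
  - by move=> x _; rewrite -EFinM lee_fin mulr_ge0 ?normc_ge0// ltW.
  - by apply: emeasurable_funM => //; exact: measurable_distL1.
  - by move=> x _; rewrite lee_fin normc_ge0.
  - exact: measurable_distL1.
have -> : e%:E = (c%:E * (e / (2 * c))%:E + (e / 2)%:E)%E :> \bar R.
  by rewrite -EFinM -EFinD; congr EFin; field; rewrite gt_eqF.
apply: leeD; last exact: H2.
by apply: lee_wpmul2l; [rewrite lee_fin ltW|exact: H1].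
Qed.

Lemma limL1_norm_le F G (c : R) : (forall N, cmeas (F N)) -> cmeas G -> limL1 F G ->
  (forall N, (\int[mu]_x (normc (F N x))%:E <= c%:E)%E) ->
  (\int[mu]_x (normc (G x))%:E <= c%:E)%E.
Proof.
move=> mF mG L Fc; apply: le_all_pos_ereal => // e e0.
have [N /(_ N (leqnn _)) HN] := L _ e0.
apply: (@le_trans _ _ (\int[mu]_x (normc (F N x))%:E + distL1 mu (F N) G)%E); last exact: leeD.
rewrite /distL1 -ge0_integralD//.
- apply: ge0_le_integral_nomeas => x _; first by rewrite lee_fin normc_ge0.
  rewrite -EFinD lee_fin -[normc (F N x - G x)]normcB.
  by apply: le_trans (le_normcD _ _); rewrite addrC subrK.
- by move=> x _; rewrite lee_fin normc_ge0.
- by apply/measurable_EFinP; exact: measurable_normc.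
- by move=> x _; rewrite lee_fin normc_ge0.
- exact: measurable_distL1.
Qed.

(** By Fatou, the distance from [G] to the pointwise limit is at most any of the eventual bounds on
    the distances to [F N]. *)
Lemma limL1_ccvg F G H : (forall N, cmeas (F N)) -> cmeas G -> cmeas H -> limL1 F G ->
  (forall x, ccvg (fun N => F N x) (H x)) -> {ae mu, forall x, G x = H x}.
Proof.
move=> mF mG mH FG FH; apply: distL1_eq0 => //; apply/eqP; rewrite eq_le distL1_ge0 andbT.
apply: le_all_pos_ereal => // e e0; rewrite add0e.
have [N0 HN] := FG _ e0.
apply: (@fatou_cvg _ _ _ mu (fun N x => (normc (G x - F N x))%:E)).
- by move=> N; exact: measurable_distL1.
- by move=> N x; rewrite lee_fin normc_ge0.
- exact: measurable_distL1.
- by move=> x; rewrite lee_fin normc_ge0.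
- by apply: aeW => x; exact: ccvg_sub (FH x).
- by exists N0 => // N /= N0N; rewrite -/(distL1 _ _ _) distL1C; exact: HN.
Qed.

End L1_limits.

(** * The operator on L^2 as a limit of truncations *)

Section limit_operator.
Context {R : realType} {n : nat}.
Local Notation mu := (@lebesgue_rV R n).
Local Notation mu2 := (@lebesgue_rV R (n + n)).
Local Notation lam := (@lebesgue_measure R).
Local Notation Pi := (product_sf lam mu2).
Local Notation normL2sq f := (\int[mu]_x (normc (f x) ^+ 2)%:E)%E.
Implicit Types (f g : 'rV[R]_n -> R[i]) (th : R * 'rV[R]_n -> R).
Variables (b k : R) (h : 'rV[R]_(n + n) -> R[i]).
Hypotheses (b0 : 0 < b) (nb : n%:R / 4 < b).
Hypotheses (mh : cmeas h) (k0 : 0 < k) (hk : weakL4 mu2 (fun p => normc (h p)) k).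

Lemma energy_mono th1 th2 f : (forall q, 0 <= th1 q <= th2 q) ->
  (energy b th1 f <= energy b th2 f)%E.
Proof.
move=> th12; apply: ge0_le_integral_nomeas => q _.
  by rewrite lee_fin mulr_ge0 ?rho_ge0// energy_density_ge0// => p; case/andP: (th12 p).
rewrite lee_fin ler_wpM2l ?rho_ge0// /energy_density ler_wpM2r ?sqr_ge0//.
by case/andP: (th12 (q.1, q.2.2)).
Qed.

Definition truncated f g N : 'rV[R]_n -> R[i] := form b h (cutoff N) (cutoff N) f g.

Lemma cL1_truncated f g N : in_L2 f -> in_L2 g -> cL1 mu (truncated f g N).
Proof.
move=> fL gL.
exact: (@cL1_form _ _ _ _ _ b0 mh k0 hk _ _ _ _ _ (admissible_cutoff N) (admissible_cutoff N) fL gL).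
Qed.

Lemma admissible_le N M th : (N <= M)%N -> admissible N th -> admissible M th.
Proof.
move=> NM [mth H]; split=> // q; have /andP[-> H2] := H q.
by apply: le_trans H2 _; exact: cutoff_homo.
Qed.

Definition cutoff_diff N M : R * 'rV[R]_n -> R := fun q => cutoff M q - cutoff N q.

Lemma admissible_cutoff_diff N M : (N <= M)%N -> admissible M (cutoff_diff N M).
Proof.
move=> NM; split=> [|q]; first by apply: measurable_funB; exact: measurable_cutoff.
by rewrite subr_ge0 cutoff_homo//= lerBlDr lerDl cutoff_ge0.
Qed.

(** The bilinear identity [u v - u' v' = (u - u') v + u' (v - v')], so that each term has a tail on
    one side only. *)
Lemma truncatedB f g N M x : (N <= M)%N -> in_L2 f -> in_L2 g ->
  truncated f g M x - truncated f g N x =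
  form b h (cutoff_diff N M) (cutoff M) f g x + form b h (cutoff N) (cutoff_diff N M) f g x.
Proof.
move=> NM fL gL.
have AM := @admissible_cutoff R n M; have AD := admissible_cutoff_diff NM.
have AN := admissible_le NM (@admissible_cutoff R n N).
have L th1 th2 (A1 : admissible M th1) (A2 : admissible M th2) :
    cL1 Pi (form_kernel b h th1 th2 f g x).
  exact: (@cL1_form_kernel _ _ _ _ _ b0 mh k0 hk _ _ _ _ _ _ A1 A2 fL gL).
apply/eqP; rewrite subr_eq; apply/eqP; rewrite /truncated /form.
rewrite -cintD; [|exact: L|exact: L].
rewrite -cintD; [|by apply: cL1D; exact: L|exact: L].
apply: eq_cint => p; rewrite /form_kernel /weight /cutoff_diff.
set u := cutoff M (p.1, lsubmx p.2); set u' := cutoff N (p.1, lsubmx p.2).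
set v := cutoff M (p.1, rsubmx p.2); set v' := cutoff N (p.1, rsubmx p.2).
rewrite -!mulrDl -!rmorphD; congr ((_%:C)%C * _ * _); ring.
Qed.

Lemma tail_diff f N M : (N <= M)%N -> (energy b (cutoff_diff N M) f <= tail b f N)%E.
Proof.
move=> NM; apply: energy_mono => q; rewrite /cutoff_diff subr_ge0 cutoff_homo//=.
by rewrite lerD2r cutoff_le1.
Qed.

Local Notation Ec f := ((energy_const (n := n) b)%:E * normL2sq f)%E.

Lemma energy_cutoff_le f N : in_L2 f -> (energy b (cutoff N) f <= Ec f)%E.
Proof.
move=> fL; apply: energy_le => //; first exact: measurable_cutoff.
by move=> q; rewrite cutoff_ge0 cutoff_le1.
Qed.

(* The large parameter [r] weighs the tails, and its inverse the energies that do not get small. *)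
Lemma truncated_diff_bound f g N M (r : R) : (N <= M)%N -> in_L2 f -> in_L2 g -> 0 < r ->
  (distL1 mu (truncated f g M) (truncated f g N) <=
   (32 * k)%:E * (r%:E * tail b f N + (r^-1)%:E * Ec g) +
   (32 * k)%:E * ((r^-1)%:E * Ec f + r%:E * tail b g N))%E.
Proof.
move=> NM fL gL r0; have rV0 : 0 < r^-1 by rewrite invr_gt0.
have AM := @admissible_cutoff R n M; have AD := admissible_cutoff_diff NM.
have AN := admissible_le NM (@admissible_cutoff R n N).
have k32 : (0 <= (32 * k)%:E)%E by rewrite lee_fin mulr_ge0// ltW.
have rE : (0 <= r%:E)%E by rewrite lee_fin ltW.
have rVE : (0 <= (r^-1)%:E)%E by rewrite lee_fin ltW.
pose F1 := form b h (cutoff_diff N M) (cutoff M) f g.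
pose F2 := form b h (cutoff N) (cutoff_diff N M) f g.
have [mF1 _] : cL1 mu F1 by exact: (@cL1_form _ _ _ _ _ b0 mh k0 hk _ _ _ _ _ AD AM fL gL).
have [mF2 _] : cL1 mu F2 by exact: (@cL1_form _ _ _ _ _ b0 mh k0 hk _ _ _ _ _ AN AD fL gL).
apply: (@le_trans _ _ (\int[mu]_x (normc (F1 x))%:E + \int[mu]_x (normc (F2 x))%:E)%E).
  rewrite -ge0_integralD//.
  - apply: ge0_le_integral_nomeas => x _; first by rewrite lee_fin normc_ge0.
    by rewrite -EFinD lee_fin truncatedB//; exact: le_normcD.
  - by move=> x _; rewrite lee_fin normc_ge0.
  - by apply/measurable_EFinP; exact: measurable_normc.
  - by move=> x _; rewrite lee_fin normc_ge0.
  - by apply/measurable_EFinP; exact: measurable_normc.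
apply: leeD.
  apply: le_trans (form_estimate b0 mh k0 hk AD AM fL gL r0) _.
  apply: lee_wpmul2l => //; apply: leeD; apply: lee_wpmul2l => //; first exact: tail_diff.
  exact: energy_cutoff_le.
apply: le_trans (form_estimate b0 mh k0 hk AN AD fL gL rV0) _.
rewrite invrK.
apply: lee_wpmul2l => //; apply: leeD; apply: lee_wpmul2l => //; last exact: tail_diff.
exact: energy_cutoff_le.
Qed.

Lemma normL2sq_fin f : in_L2 f -> normL2sq f \is a fin_num.
Proof.
by move=> [_ If]; rewrite ge0_fin_numE//; apply: integral_ge0 => x _; rewrite lee_fin sqr_ge0.
Qed.

Lemma truncated_cauchy f g : in_L2 f -> in_L2 g ->
  forall e : R, 0 < e -> exists N0, forall N M, (N0 <= N)%N -> (N <= M)%N ->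
     (distL1 mu (truncated f g M) (truncated f g N) <= e%:E)%E.
Proof.
move=> fL gL e e0.
have ff := normL2sq_fin fL; have fg := normL2sq_fin gL.
pose a := energy_const (n := n) b * (fine (normL2sq f) + fine (normL2sq g)).
have f0 (u : 'rV[R]_n -> R[i]) : 0 <= fine (normL2sq u).
  by apply: fine_ge0; apply: integral_ge0 => x _; rewrite lee_fin sqr_ge0.
have a0 : 0 <= a by rewrite mulr_ge0 ?energy_const_ge0// addr_ge0.
have k32 : 0 < 32 * k by rewrite mulr_gt0.
(* The bound has four terms, each made at most [e / 4]. This [r] brings the energies divided by [r]
   below [e / (128 k)]; the summand 1 keeps it positive when [a = 0]. *)
pose r := 128 * k * a / e + 1.
have r0 : 0 < r by rewrite ltr_wpDl// divr_ge0 ?(ltW e0)// mulr_ge0// mulr_ge0// ltW.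
(* Chosen after [r], so that tails below [d] satisfy [r d = e / (128 k)]. *)
pose d := e / (128 * k * r).
have d0 : 0 < d by rewrite divr_gt0// !mulr_gt0.
have tail0 (u : 'rV[R]_n -> R[i]) : in_L2 u -> exists N0, forall N, (N0 <= N)%N -> (tail b u N <= d%:E)%E.
  move=> uL; have := tail_cvg0 b0 nb uL.
  move=> /fine_cvgP[fin /cvgrPdist_le /(_ _ d0) fc].
  have [N0 _ H0] : \forall N \near \oo, (tail b u N <= d%:E)%E.
    apply: filterS2 fin fc => N fN; rewrite sub0r normrN /= => cN.
    by rewrite -(fineK fN) lee_fin; apply: le_trans cN; exact: ler_norm.
  by exists N0 => N; exact: H0.
have [N1 H1] := tail0 _ fL; have [N2 H2] := tail0 _ gL.
exists (maxn N1 N2) => N M; rewrite geq_max => /andP[n1 n2] NM.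
apply: le_trans (truncated_diff_bound NM fL gL r0) _.
have rE : (0 <= r%:E)%E by rewrite lee_fin ltW.
have kE : (0 <= (32 * k)%:E)%E by rewrite lee_fin ltW.
have -> : e%:E = ((32 * k)%:E * (r%:E * d%:E + (e / (128 * k))%:E) +
    (32 * k)%:E * ((e / (128 * k))%:E + r%:E * d%:E))%E :> \bar R.
  rewrite -!EFinM -EFinD; congr EFin; rewrite /d; field.
  by rewrite !gt_eqF.
have side (u : 'rV[R]_n -> R[i]) : in_L2 u -> fine (normL2sq u) <= fine (normL2sq f) + fine (normL2sq g) ->
    ((r^-1)%:E * Ec u <= (e / (128 * k))%:E)%E.
  move=> uL ule; rewrite -(fineK (normL2sq_fin uL)) -!EFinM lee_fin ler_pdivrMl//.
  apply: (@le_trans _ _ a); first by rewrite ler_wpM2l ?energy_const_ge0.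
  rewrite /r mulrDl mul1r.
  have -> : 128 * k * a / e * (e / (128 * k)) = a by field; rewrite !gt_eqF.
  by rewrite lerDl divr_ge0 ?(ltW e0)// mulr_ge0// ltW.
apply: leeD; apply: lee_wpmul2l => //; apply: leeD.
- by apply: lee_wpmul2l => //; exact: H1.
- by apply: side => //; rewrite lerDr.
- by apply: side => //; rewrite lerDl.
- by apply: lee_wpmul2l => //; exact: H2.
Qed.

Definition is_limit f g G := cL1 mu G /\ limL1 mu (truncated f g) G.

(* Junk value 0 when the truncations do not converge, in particular possibly outside L^2. *)
Definition limit_operator f g : 'rV[R]_n -> R[i] := xget (fun=> 0) [set G | is_limit f g G].

Lemma limit_operatorP f g : in_L2 f -> in_L2 g -> is_limit f g (limit_operator f g).
Proof.
move=> fL gL.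
have [G LG FG] := L1_complete (fun N => cL1_truncated N fL gL) (truncated_cauchy fL gL).
exact: (@xgetPex _ (fun=> 0 : R[i]) [set G | is_limit f g G] (ex_intro _ G (conj LG FG))).
Qed.

Lemma limit_operator_bound f g (r : R) : in_L2 f -> in_L2 g -> 0 < r ->
  (\int[mu]_x (normc (limit_operator f g x))%:E <=
   (32 * k)%:E * (r%:E * Ec f + (r^-1)%:E * Ec g))%E.
Proof.
move=> fL gL r0; have [LT T] := limit_operatorP fL gL.
have ff := normL2sq_fin fL; have fg := normL2sq_fin gL.
have bound N : (\int[mu]_x (normc (truncated f g N x))%:E <=
    (32 * k)%:E * (r%:E * Ec f + (r^-1)%:E * Ec g))%E.
  have AN := @admissible_cutoff R n N.
  apply: le_trans (form_estimate b0 mh k0 hk AN AN fL gL r0) _.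
  apply: lee_wpmul2l; first by rewrite lee_fin mulr_ge0// ltW.
  apply: leeD; apply: lee_wpmul2l; rewrite ?lee_fin ?invr_ge0 ?(ltW r0)//; exact: energy_cutoff_le.
move: bound; rewrite -(fineK ff) -(fineK fg) -!EFinM => bound.
by apply: limL1_norm_le T bound => [N|]; [exact: (cL1_truncated N fL gL).1|exact: LT.1].
Qed.

Lemma in_L2_comb (a : R[i]) f1 f2 : in_L2 f1 -> in_L2 f2 -> in_L2 (fun x => a * f1 x + f2 x).
Proof.
move=> [m1 I1] [m2 I2]; split; first by apply: cmeasD => //; apply: cmeasM => //; exact: cmeas_cst.
pose c := 2 * normc a ^+ 2; have c0 : 0 <= c by rewrite mulr_ge0 ?sqr_ge0.
have q1 (u : 'rV[R]_n -> R[i]) (e : R) : 0 <= e -> forall x : 'rV[R]_n, setT x -> (0 <= e%:E * (normc (u x) ^+ 2)%:E)%E.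
  by move=> e0 x _; rewrite -EFinM lee_fin mulr_ge0 ?sqr_ge0.
have mq (u : 'rV[R]_n -> R[i]) : cmeas u -> measurable_fun setT (fun x => (normc (u x) ^+ 2)%:E).
  by move=> mu_; apply/measurable_EFinP; apply: measurable_funX; exact: measurable_normc.
have s0 (u : 'rV[R]_n -> R[i]) (x : 'rV[R]_n) : setT x -> (0 <= (normc (u x) ^+ 2)%:E)%E.
  by rewrite lee_fin sqr_ge0.
apply: (@le_lt_trans _ _ (\int[mu]_x (c%:E * (normc (f1 x) ^+ 2)%:E + 2%:E * (normc (f2 x) ^+ 2)%:E))%E).
  apply: ge0_le_integral_nomeas => x _; first by rewrite lee_fin sqr_ge0.
  rewrite -!EFinM -EFinD lee_fin /c.
  have t := le_normcD (a * f1 x) (f2 x); rewrite ComplexField.Normc.normcM in t.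
  apply: (@le_trans _ _ ((normc a * normc (f1 x) + normc (f2 x)) ^+ 2)).
    by rewrite ler_pXn2r ?nnegrE ?normc_ge0 ?addr_ge0 ?mulr_ge0 ?normc_ge0.
  have := sqr_ge0 (normc a * normc (f1 x) - normc (f2 x)).
  by rewrite sqrrB sqrrD exprMn; lra.
rewrite ge0_integralD//; [|exact: q1|by apply: emeasurable_funM => //; exact: mq|exact: q1|by apply: emeasurable_funM => //; exact: mq].
rewrite ge0_integralZl//; [|exact: mq|exact: s0].
rewrite ge0_integralZl//; [|exact: mq|exact: s0].
by rewrite lte_add_pinfty// lte_mul_pinfty// lee_fin.
Qed.

Lemma window_linear (a : R[i]) f1 f2 t v x : 0 < t -> in_L2 f1 -> in_L2 f2 ->
  window (fun x => a * f1 x + f2 x) t v x = a * window f1 t v x + window f2 t v x.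
Proof.
move=> t0 L1 L2.
have L (f : 'rV[R]_n -> R[i]) : in_L2 f -> cL1 mu (fun y => f y * ((qgauss t (x - y))%:C%C * cexpi (2 * pi * dotv v (x - y)))).
  move=> fL; have := cL1_window_slice x t0 fL.
  move=> /(cL1_cexpi (r := fun y => 2 * pi * dotv v (x - y)) _) H.
  have {}H := H _; rewrite (_ : (fun y => _) = (fun y => f y * (qgauss t (y - x))%:C%C * cexpi (2 * pi * dotv v (x - y)))).
    apply: H; apply: measurable_funM => //; apply: measurable_dotv => //; exact: measurable_rVB.
  by apply/funext => y; rewrite (qgauss_sym _ x) mulrA.
rewrite /window -cintZ; last exact: L.
rewrite -cintD; [|by apply: cL1Z; exact: L|exact: L].
by apply: eq_cint => y; ring.
Qed.

Lemma truncated_linear_l (a : R[i]) f1 f2 g N x : in_L2 f1 -> in_L2 f2 -> in_L2 g ->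
  truncated (fun x => a * f1 x + f2 x) g N x = a * truncated f1 g N x + truncated f2 g N x.
Proof.
move=> L1 L2 Lg; have AN := @admissible_cutoff R n N.
have L f (fL : in_L2 f) := @cL1_form_kernel _ _ _ _ _ b0 mh k0 hk _ _ _ _ _ x AN AN fL Lg.
rewrite /truncated /form -cintZ; last exact: L.
rewrite -cintD; [|by apply: cL1Z; exact: L|exact: L].
(* Linearity of the window rests on its absolute convergence, available for [t > 0]; at other times
   the gamma density is 0. *)
apply: eq_cint => p; rewrite /form_kernel; have [p0|p0] := leP p.1 0.
  by rewrite /weight gamma_density_le0// !mul0r mulr0 addr0.
by rewrite window_linear//; ring.
Qed.

Lemma truncated_linear_r (a : R[i]) f g1 g2 N x : in_L2 f -> in_L2 g1 -> in_L2 g2 ->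
  truncated f (fun x => a * g1 x + g2 x) N x = a * truncated f g1 N x + truncated f g2 N x.
Proof.
move=> Lf L1 L2; have AN := @admissible_cutoff R n N.
have L g (gL : in_L2 g) := @cL1_form_kernel _ _ _ _ _ b0 mh k0 hk _ _ _ _ _ x AN AN Lf gL.
rewrite /truncated /form -cintZ; last exact: L.
rewrite -cintD; [|by apply: cL1Z; exact: L|exact: L].
apply: eq_cint => p; rewrite /form_kernel; have [p0|p0] := leP p.1 0.
  by rewrite /weight gamma_density_le0// !mul0r mulr0 addr0.
by rewrite window_linear//; ring.
Qed.

Lemma limit_operator_linear_l (a : R[i]) f1 f2 g : in_L2 f1 -> in_L2 f2 -> in_L2 g ->
  {ae mu, forall x, limit_operator (fun x => a * f1 x + f2 x) g x =
    a * limit_operator f1 g x + limit_operator f2 g x}.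
Proof.
move=> L1 L2 Lg; have L12 := in_L2_comb a L1 L2.
have [l1 T1] := limit_operatorP L1 Lg; have [l2 T2] := limit_operatorP L2 Lg.
have [l12 T12] := limit_operatorP L12 Lg.
have mT f N (fL : in_L2 f) : cmeas (truncated f g N) by exact: (cL1_truncated N fL Lg).1.
have m12 : cmeas (fun x => a * limit_operator f1 g x + limit_operator f2 g x).
  by apply: cmeasD; [apply: cmeasM; [exact: cmeas_cst|exact: l1.1]|exact: l2.1].
apply: limL1_unique T12 _ => //; [by move=> N; exact: mT|exact: l12.1|].
have -> : truncated (fun x => a * f1 x + f2 x) g = (fun N x => a * truncated f1 g N x + truncated f2 g N x).
  by apply/funext => N; apply/funext => x; rewrite truncated_linear_l.
exact: limL1D (fun N => mT _ N L1) (fun N => mT _ N L2) l1.1 l2.1 T1 T2.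
Qed.

Lemma limit_operator_linear_r (a : R[i]) f g1 g2 : in_L2 f -> in_L2 g1 -> in_L2 g2 ->
  {ae mu, forall x, limit_operator f (fun x => a * g1 x + g2 x) x =
    a * limit_operator f g1 x + limit_operator f g2 x}.
Proof.
move=> Lf L1 L2; have L12 := in_L2_comb a L1 L2.
have [l1 T1] := limit_operatorP Lf L1; have [l2 T2] := limit_operatorP Lf L2.
have [l12 T12] := limit_operatorP Lf L12.
have mT g N (gL : in_L2 g) : cmeas (truncated f g N) by exact: (cL1_truncated N Lf gL).1.
have m12 : cmeas (fun x => a * limit_operator f g1 x + limit_operator f g2 x).
  by apply: cmeasD; [apply: cmeasM; [exact: cmeas_cst|exact: l1.1]|exact: l2.1].
apply: limL1_unique T12 _ => //; [by move=> N; exact: mT|exact: l12.1|].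
have -> : truncated f (fun x => a * g1 x + g2 x) = (fun N x => a * truncated f g1 N x + truncated f g2 N x).
  by apply/funext => N; apply/funext => x; rewrite truncated_linear_r.
exact: limL1D (fun N => mT _ N L1) (fun N => mT _ N L2) l1.1 l2.1 T1 T2.
Qed.

End limit_operator.

(** * Agreement on Schwartz functions *)
Lemma realcM {R : realType} (u v : R) : (u * v)%:C%C = u%:C%C * v%:C%C :> R[i].
Proof. exact: rmorphM. Qed.

Lemma eq_cint_ae {R : realType} d (T : measurableType d) (mu : {measure set T -> \bar R})
    (f g : T -> R[i]) : cmeas f -> cmeas g -> {ae mu, forall x, f x = g x} ->
  cint mu f = cint mu g.
Proof.
move=> mf mg fg; rewrite /cint /Rintegral; congr (Complex (fine _) (fine _)); apply: ae_eq_integral => //.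
- by apply/measurable_EFinP; exact: mf.1.
- by apply/measurable_EFinP; exact: mg.1.
- by apply: filterS fg => x /= ->.
- by apply/measurable_EFinP; exact: mf.2.
- by apply/measurable_EFinP; exact: mg.2.
- by apply: filterS fg => x /= ->.
Qed.

Lemma cL1_ae {R : realType} d (T : measurableType d) (mu : {measure set T -> \bar R})
    (f g : T -> R[i]) : cmeas f -> cL1 mu g -> {ae mu, forall x, f x = g x} -> cL1 mu f.
Proof.
move=> mf [mg Ig] fg; split=> //; rewrite (_ : (\int[mu]_x _)%E = (\int[mu]_x (normc (g x))%:E)%E)//; apply: ae_eq_integral => //.
- by apply/measurable_EFinP; exact: measurable_normc.
- by apply/measurable_EFinP; exact: measurable_normc.
- by apply: filterS fg => x /= ->.
Qed.

Section schwartz_agreement.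
Context {R : realType} {n : nat}.
Local Notation mu := (@lebesgue_rV R n).
Local Notation mu2 := (@lebesgue_rV R (n + n)).
Local Notation lam := (@lebesgue_measure R).
Local Notation Pi := (product_sf lam mu2).
Implicit Types (f g : 'rV[R]_n -> R[i]).
Variables (b k : R) (h : 'rV[R]_(n + n) -> R[i]).
Hypotheses (b0 : 0 < b) (nb : n%:R / 4 < b).
Hypotheses (mh : cmeas h) (k0 : 0 < k) (hk : weakL4 mu2 (fun p => normc (h p)) k).

Lemma schwartz_in_L2 f : schwartz f -> in_L2 f.
Proof.
move=> sf; have mf := schwartz_cmeas sf; split=> //.
have [M HM] := schwartz_bounded sf; have [_ If] := schwartz_cL1 sf.
have M0 : 0 <= M by apply: le_trans (HM 0); exact: normc_ge0.
apply: (@le_lt_trans _ _ (\int[mu]_x (M%:E * (normc (f x))%:E))%E).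
  apply: ge0_le_integral_nomeas => x _; first by rewrite lee_fin sqr_ge0.
  by rewrite -EFinM lee_fin expr2 ler_wpM2r ?normc_ge0.
rewrite ge0_integralZl ?lee_fin//.
- by rewrite lte_mul_pinfty ?lee_fin.
- by apply/measurable_EFinP; exact: measurable_normc.
- by move=> x _; rewrite lee_fin normc_ge0.
Qed.

Lemma heat_submx t (z : 'rV[R]_(n + n)) : heat t z = heat t (lsubmx z) * heat t (rsubmx z).
Proof. by rewrite /heat /gaussI exprD dotv_submx mulrDr expRD; ring. Qed.

(** The integrand of [bilinear_multiplier] without the factor [m], as a function on R^{2n}. *)
Definition wave f g (x : 'rV[R]_n) (z : 'rV[R]_(n + n)) : R[i] :=
  fourier f (lsubmx z) * fourier g (rsubmx z) * cexpi (2 * pi * dotv x (lsubmx z + rsubmx z)).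

Lemma cmeas_wave f g x : schwartz f -> schwartz g -> cmeas (wave f g x).
Proof.
move=> sf sg; apply: cmeasM.
  apply: cmeasM.
    by apply: (cmeas_comp (cmeas_fourier (schwartz_cmeas sf))); exact: measurable_lsubmx.
  by apply: (cmeas_comp (cmeas_fourier (schwartz_cmeas sg))); exact: measurable_rsubmx.
apply: cmeas_cexpi; apply: measurable_funM => //; apply: measurable_dotv => //.
by apply: measurable_rVD; [exact: measurable_lsubmx|exact: measurable_rsubmx].
Qed.

Lemma cL1_wave f g x : schwartz f -> schwartz g -> cL1 mu2 (wave f g x).
Proof.
move=> sf sg; split; first exact: cmeas_wave.
have Lf := schwartz_cL1 (fourier_schwartz sf); have Lg := schwartz_cL1 (fourier_schwartz sg).
have [[_ +] _] := cL1_prod (m1 := mu) (m2 := mu) Lf Lg.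
rewrite (integral_row_mx_prod (f := fun z => (normc (wave f g x z))%:E)); last first.
  by apply/measurable_EFinP; apply: measurable_normc; exact: cmeas_wave.
apply: le_lt_trans; apply: ge0_le_integral_nomeas => p _; first by rewrite lee_fin normc_ge0.
by rewrite lee_fin /wave row_mxKl row_mxKr ComplexField.Normc.normcM normc_cexpi mulr1.
Qed.

Lemma window_wave f g t a c x : 0 < t -> schwartz f -> schwartz g ->
  window f t a x * window g t c x =
  cint mu2 (fun z => (heat t (z - row_mx a c))%:C%C * wave f g x z).
Proof.
move=> t0 sf sg; rewrite /window -!heat_window//; [|exact: schwartz_cL1|exact: schwartz_cL1].
pose G (u : 'rV[R]_n -> R[i]) (v : 'rV[R]_n) (xi : 'rV[R]_n) : R[i] :=
  (heat t (xi - v))%:C%C * cexpi (2 * pi * dotv x xi) * fourier u xi.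
have LG u v : schwartz u -> cL1 mu (G u v).
  move=> su; apply: (@cL1_bounded_mul _ _ _ _ (gaussI n (4 * pi ^+ 2 * t))).
  - apply: cmeasM.
      apply/cmeas_real; apply: measurableT_comp; [exact: measurable_heat|exact: measurable_rVB].
    by apply: cmeas_cexpi; apply: measurable_funM => //; exact: measurable_dotv.
  - move=> xi; rewrite ComplexField.Normc.normcM normc_real normc_cexpi mulr1 ger0_norm ?heat_ge0//.
    exact: heat_le.
  - exact: schwartz_cL1 (fourier_schwartz su).
have [_ <-] := cL1_prod (LG f a sf) (LG g c sg).
rewrite cint_row_mx; last first.
  apply: cmeasM; last exact: cmeas_wave.
  apply/cmeas_real; apply: measurableT_comp; [exact: measurable_heat|exact: measurable_rVB].
apply: eq_cint => p; rewrite /G /wave opp_row_mx add_row_mx heat_submx !row_mxKl !row_mxKr.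
have -> : 2 * pi * dotv x (p.1 + p.2) = 2 * pi * dotv x p.1 + 2 * pi * dotv x p.2.
  by rewrite dotvDr; ring.
by rewrite cexpiD (realcM (heat t (p.1 - a)) (heat t (p.2 - c))); ring.
Qed.

(** [form_kernel] without the cutoffs. For Schwartz functions it is absolutely integrable and serves
    as majorant for the truncated kernels. *)
Definition full_kernel f g x (p : R * 'rV[R]_(n + n)) : R[i] :=
  (gamma_density b p.1)%:C%C * h p.2 *
  (window f p.1 (lsubmx p.2) x * window g p.1 (rsubmx p.2) x).

Lemma potential_kernel0 z p : p.1 <= 0 -> potential_kernel b h z p = 0.
Proof. by move=> p0; rewrite /potential_kernel gamma_density_le0// !mul0r. Qed.

Lemma cL1_heat_wave f g x t (p : 'rV[R]_(n + n)) : 0 < t -> schwartz f -> schwartz g ->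
  cL1 mu2 (fun z => (heat t (z - p))%:C%C * wave f g x z).
Proof.
move=> t0 sf sg; apply: (@cL1_bounded_mul _ _ _ _ (gaussI (n + n) (4 * pi ^+ 2 * t))).
- apply/cmeas_real; apply: measurableT_comp; [exact: measurable_heat|exact: measurable_rVB].
- by move=> z; rewrite normc_real ger0_norm ?heat_ge0//; exact: heat_le.
- exact: cL1_wave.
Qed.

Lemma full_kernelE f g x p : schwartz f -> schwartz g ->
  full_kernel f g x p = cint mu2 (fun z => wave f g x z * potential_kernel b h z p).
Proof.
move=> sf sg; have [p0|p0] := leP p.1 0.
  rewrite /full_kernel gamma_density_le0// !mul0r.
  rewrite [RHS](_ : _ = cint mu2 (fun z => 0 * (0 : R[i]))).
    rewrite cintZ ?mul0r//; split=> //.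
    by rewrite Normc.normc0 integral0.
  by apply: eq_cint => z; rewrite potential_kernel0// mulr0 mul0r.
rewrite /full_kernel window_wave// hsubmxK -cintZ; last exact: cL1_heat_wave.
by apply: eq_cint => z; rewrite /potential_kernel (realcM (gamma_density b p.1) (heat p.1 (z - p.2))); ring.
Qed.

Lemma cmeas_wave_kernel f g x : schwartz f -> schwartz g ->
  cmeas (fun q : 'rV[R]_(n + n) * (R * 'rV[R]_(n + n)) => wave f g x q.1 * potential_kernel b h q.1 q.2).
Proof.
move=> sf sg; apply: cmeasM; last exact: cmeas_potential_kernel.
exact: (cmeas_comp (cmeas_wave x sf sg) measurable_fst).
Qed.

Lemma integral_wave_kernel f g x : schwartz f -> schwartz g ->
  (\int[mu2]_z \int[Pi]_p (normc (wave f g x z * potential_kernel b h z p))%:E < +oo)%E.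
Proof.
move=> sf sg; have [mw Iw] := cL1_wave x sf sg.
have B0 : 0 <= potential_bound (n := n) b k.
  have := @bessel_potential_bounded R n b k h b0 nb k0 mh hk 0; apply: le_trans; exact: normc_ge0.
apply: (@le_lt_trans _ _ (\int[mu2]_z ((potential_bound (n := n) b k)%:E * (normc (wave f g x z))%:E))%E).
  apply: ge0_le_integral_nomeas => z _; first by apply: integral_ge0 => p _; rewrite lee_fin normc_ge0.
  under eq_integral do rewrite ComplexField.Normc.normcM EFinM.
  rewrite ge0_integralZl//.
  - rewrite muleC; apply: lee_wpmul2r; first by rewrite lee_fin normc_ge0.
    exact: (integral_potential_kernel b0 nb k0 mh hk).
  - apply/measurable_EFinP; apply: measurable_normc.
    exact: (cL1_potential_kernel b0 nb k0 mh hk z).1.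
  - by move=> p _; rewrite lee_fin normc_ge0.
  - by rewrite lee_fin normc_ge0.
rewrite ge0_integralZl ?lee_fin//.
- by rewrite lte_mul_pinfty ?lee_fin.
- by apply/measurable_EFinP; exact: measurable_normc.
- by move=> z _; rewrite lee_fin normc_ge0.
Qed.

Lemma cL1_full_kernel f g x : schwartz f -> schwartz g -> cL1 Pi (full_kernel f g x).
Proof.
move=> sf sg; pose K (q : 'rV[R]_(n + n) * (R * 'rV[R]_(n + n))) : R[i] :=
  wave f g x q.1 * potential_kernel b h q.1 q.2.
have mK : cmeas K by exact: cmeas_wave_kernel.
pose W (q : (R * 'rV[R]_(n + n)) * 'rV[R]_(n + n)) : R[i] := K (q.2, q.1).
have mW : cmeas W by apply: (cmeas_comp mK); exact: measurable_swap.
have E : full_kernel f g x = fun p => cint mu2 (fun z => W (p, z)).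
  by apply/funext => p; rewrite full_kernelE.
rewrite E; split; first exact: (@cmeas_cint R _ _ _ _ mu2 W mW).
apply: le_lt_trans (integral_wave_kernel x sf sg).
rewrite (fubini_tonelli (m1 := mu2) (m2 := Pi)
  (fun q => (normc (wave f g x q.1 * potential_kernel b h q.1 q.2))%:E)); last 2 first.
- by apply/measurable_EFinP; exact: measurable_normc.
- by move=> q; rewrite lee_fin normc_ge0.
apply: ge0_le_integral_nomeas => p _; first by rewrite lee_fin normc_ge0.
by apply: le_normc_cint_cmeas; exact: (cmeas_comp mW (measurable_pair1 p)).
Qed.

(** The cutoffs are removed by dominated convergence, and Fubini together with [full_kernelE]
    recognises the Bessel potential in the limit. *)
Lemma truncated_ccvg f g x : schwartz f -> schwartz g ->
  ccvg (fun N => truncated b h f g N x) (cint mu2 (fun z => bessel_potential b h z * wave f g x z)).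
Proof.
move=> sf sg; have mK := cmeas_wave_kernel x sf sg.
have fL := schwartz_in_L2 sf; have gL := schwartz_in_L2 sg.
have -> : cint mu2 (fun z => bessel_potential b h z * wave f g x z) = cint Pi (full_kernel f g x).
  transitivity (cint mu2 (fun z => cint Pi (fun p => wave f g x z * potential_kernel b h z p))).
    apply: eq_cint => z; rewrite cintZ; last exact: (cL1_potential_kernel b0 nb k0 mh hk).
    by rewrite mulrC.
  rewrite (@cint_swap R _ _ _ _ mu2 Pi _ mK (integral_wave_kernel x sf sg)).
  by apply: eq_cint => p; rewrite full_kernelE.
have L := cL1_full_kernel x sf sg.
have E N p : form_kernel b h (cutoff N) (cutoff N) f g x p =
    (cutoff N (p.1, lsubmx p.2) * cutoff N (p.1, rsubmx p.2))%:C%C * full_kernel f g x p.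
  by rewrite /form_kernel /weight /full_kernel (realcM (gamma_density b p.1) (cutoff N (p.1, lsubmx p.2) * cutoff N (p.1, rsubmx p.2))); ring.
have pt p : ccvg (fun N => form_kernel b h (cutoff N) (cutoff N) f g x p) (full_kernel f g x p).
  have -> : (fun N => form_kernel b h (cutoff N) (cutoff N) f g x p) =
      (fun N => (cutoff N (p.1, lsubmx p.2) * cutoff N (p.1, rsubmx p.2))%:C%C * full_kernel f g x p).
    by apply/funext => N; exact: E.
  have [p0|p0] := leP p.1 0.
    have z : full_kernel f g x p = 0 by rewrite /full_kernel gamma_density_le0// !mul0r.
    have -> : (fun N => (cutoff N (p.1, lsubmx p.2) * cutoff N (p.1, rsubmx p.2))%:C%C * full_kernel f g x p) =
        (fun=> full_kernel f g x p) by apply/funext => N; rewrite z mulr0.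
    exact: ccvg_cst.
  rewrite -[X in ccvg _ X]mul1r; apply: ccvgM; last exact: ccvg_cst.
  have -> : (1 : R[i]) = (1 * 1)%:C%C by rewrite mulr1.
  by apply: ccvg_real; apply: cvgM; exact: cvg_cutoff.
apply: (@cint_dct _ _ _ Pi _ _ (fun p => normc (full_kernel f g x p))).
- move=> N; exact: (cmeas_comp (cmeas_form_kernel b mh (measurable_cutoff N) (measurable_cutoff N) fL.1 gL.1) (measurable_pair1 x)).
- exact: L.1.
- by apply: measurable_normc; exact: L.1.
- by move=> p; exact: (pt p).1.
- by move=> p; exact: (pt p).2.
- move=> N p; rewrite E ComplexField.Normc.normcM normc_real ger0_norm; last first.
    by apply: mulr_ge0; exact: cutoff_ge0.
  by rewrite ler_piMl ?normc_ge0// mulr_ile1 ?cutoff_ge0 ?cutoff_le1.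
- exact: L.2.
Qed.

Lemma bilinear_multiplier_potential m f g x : cmeas m ->
  {ae mu2, forall z, m z = bessel_potential b h z} -> schwartz f -> schwartz g ->
  bilinear_multiplier m f g x = cint mu2 (fun z => bessel_potential b h z * wave f g x z).
Proof.
move=> mm_ mae sf sg; have [mw _] := cL1_wave x sf sg.
have mb := cmeas_bessel_potential b mh.
have Lb : cL1 mu2 (fun z => bessel_potential b h z * wave f g x z).
  apply: (@cL1_bounded_mul _ _ _ _ (potential_bound (n := n) b k)) => //; last exact: cL1_wave.
  by move=> z; exact: bessel_potential_bounded.
have mmw : cmeas (fun z => m z * wave f g x z) by exact: cmeasM.
have ae : {ae mu2, forall z, m z * wave f g x z = bessel_potential b h z * wave f g x z}.
  by apply: filterS mae => z ->.
have Lm : cL1 mu2 (fun z => m z * wave f g x z) by exact: cL1_ae mmw Lb ae.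
rewrite -(eq_cint_ae mmw Lb.1 ae) cint_row_mx//.
have LP : cL1 (mu \x mu)%E (fun p : 'rV[R]_n * 'rV[R]_n => m (row_mx p.1 p.2) * wave f g x (row_mx p.1 p.2)).
  split.
    by apply: (cmeas_comp mmw); apply: measurable_row_mx; [exact: measurable_fst|exact: measurable_snd].
  rewrite -(integral_row_mx_prod (f := fun z => (normc (m z * wave f g x z))%:E)); first exact: Lm.2.
  by apply/measurable_EFinP; exact: measurable_normc.
(* In [bilinear_multiplier] the inner integral is over [xi], the left block of the row, hence the
   Fubini theorem with the order reversed. *)
rewrite -(cint_fubini_sym LP) /bilinear_multiplier /cintegral -/(cint _ _).
apply: eq_cint => eta; rewrite -/(cint _ _); apply: eq_cint => xi.
by rewrite /wave row_mxKl row_mxKr !mulrA.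
Qed.

Lemma limit_operator_schwartz m f g : cmeas m ->
  {ae mu2, forall z, m z = bessel_potential b h z} -> schwartz f -> schwartz g ->
  {ae mu, forall x, limit_operator b h f g x = bilinear_multiplier m f g x}.
Proof.
move=> mm_ mae sf sg; have fL := schwartz_in_L2 sf; have gL := schwartz_in_L2 sg.
have [LT T] := limit_operatorP b0 nb mh k0 hk fL gL.
have BE x := bilinear_multiplier_potential x mm_ mae sf sg.
have mT N : cmeas (truncated b h f g N) by exact: (cL1_truncated b0 mh k0 hk N fL gL).1.
have C x : ccvg (fun N => truncated b h f g N x) (bilinear_multiplier m f g x).
  by rewrite BE; exact: truncated_ccvg.
apply: (limL1_ccvg mT LT.1 _ T C).
split.
  by apply: (@measurable_fun_cvg _ _ _ _ (fun N x => Re (truncated b h f g N x))) => [N|x _]; [exact: (mT N).1|exact: (C x).1].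
by apply: (@measurable_fun_cvg _ _ _ _ (fun N x => Im (truncated b h f g N x))) => [N|x _]; [exact: (mT N).2|exact: (C x).2].
Qed.

End schwartz_agreement.

(** * Norms and conclusion *)

Section norms.
Context {R : realType} {d : nat}.
Local Notation mu := (@lebesgue_rV R d).
Implicit Types f g h : 'rV[R]_d -> R[i].

Lemma cLnorm1E f : cLnorm 1 f = (\int[mu]_x (normc (f x))%:E)%E.
Proof.
by rewrite /cLnorm Lnorm1; apply: eq_integral => x _; rewrite gee0_abs ?lee_fin ?normc_ge0.
Qed.

Lemma cLnorm2E f : cLnorm 2 f = ((\int[mu]_x (normc (f x) ^+ 2)%:E) `^ 2^-1)%E.
Proof.
rewrite /cLnorm unlock; congr (_ `^ _)%E; apply: eq_integral => x _.
by rewrite gee0_abs ?lee_fin ?normc_ge0// poweR_EFin powR_mulrn ?normc_ge0.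
Qed.

Lemma in_Lp2_in_L2 f : in_Lp 2 f -> in_L2 f.
Proof.
move=> [mf]; rewrite cLnorm2E => If; split=> //.
rewrite ltey; apply/eqP => E; move: If; rewrite E poweRyr ?invr_eq0//.
Qed.

Lemma cLnorm2_sqrt f : in_L2 f ->
  cLnorm 2 f = (Num.sqrt (fine (\int[mu]_x (normc (f x) ^+ 2)%:E)%E))%:E.
Proof.
move=> fL; rewrite cLnorm2E -{1}(fineK (normL2sq_fin fL)) poweR_EFin powR12_sqrt//.
by apply: fine_ge0; apply: integral_ge0 => x _; rewrite lee_fin sqr_ge0.
Qed.

Lemma weakL4_weak_Lnorm h (k : R) : 0 < k -> (weak_Lnorm 4 h <= k%:E)%E ->
  weakL4 mu (fun x => normc (h x)) k.
Proof.
move=> k0 hk l l0; set S := [set p | _].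
have : (l%:E * mu S `^ 4^-1 <= k%:E)%E.
  by apply: le_trans hk; apply: ereal_sup_ubound; exists l.
case E : (mu S) => [r| |].
- rewrite poweR_EFin -EFinM !lee_fin => lk.
  have r0 : 0 <= r by rewrite -lee_fin -E.
  have -> : r = (r `^ 4^-1) ^+ 4.
    by rewrite -powR_mulrn ?powR_ge0// -powRrM mulVf// powRr1.
  rewrite ler_pdivlMr ?exprn_gt0// -exprMn mulrC ler_pXn2r ?nnegrE ?mulr_ge0 ?powR_ge0 ?(ltW l0)//.
  exact: ltW.
- by rewrite poweRyr ?invr_eq0// gt0_muley ?lte_fin// leye_eq.
- by move=> _; exact: leNye.
Qed.

End norms.

(** The optimal parameter is [r = c / a]; both numbers are increased by a small [q] so that the
    quotient is positive even when one of them is 0. *)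
Lemma le_geometric_mean {R : realType} (x a c : R) : 0 <= a -> 0 <= c ->
  (forall r, 0 < r -> x <= r * a ^+ 2 + r^-1 * c ^+ 2) -> x <= 2 * a * c.
Proof.
move=> a0 c0 H; apply/ler_addgt0Pr => e e0.
pose q := e / (a + c + 1).
have s0 : 0 < a + c + 1 by rewrite ltr_wpDl ?addr_ge0.
have q0 : 0 < q by rewrite divr_gt0.
have ap : 0 < a + q by rewrite ltr_wpDl.
have cp : 0 < c + q by rewrite ltr_wpDl.
apply: le_trans (H ((c + q) / (a + q)) _) _; first by rewrite divr_gt0.
rewrite invf_div.
have h1 : (c + q) / (a + q) * a ^+ 2 <= (c + q) * a.
  rewrite mulrAC ler_pdivrMr// -mulrA ler_wpM2l ?(ltW cp)// expr2 ler_wpM2l//.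
  by rewrite lerDl ltW.
have h2 : (a + q) / (c + q) * c ^+ 2 <= (a + q) * c.
  rewrite mulrAC ler_pdivrMr// -mulrA ler_wpM2l ?(ltW ap)// expr2 ler_wpM2l//.
  by rewrite lerDl ltW.
have h3 : q * (a + c) <= e.
  by rewrite /q mulrAC ler_pdivrMr// ler_wpM2l ?(ltW e0)// lerDl.
by apply: le_trans (lerD h1 h2) _; rewrite !mulrDl; move: h3; rewrite mulrDr; lra.
Qed.

Theorem theorem1p1 (R : realType) (n : nat) (s : R) :
  (0 < n)%N -> n%:R / 2 < s ->
  exists C : R, forall m Dm : 'rV[R]_(n + n) -> R[i],
    is_bessel s m Dm ->
    (weak_Lnorm 4 Dm < +oo)%E ->
    ess_bounded m /\
    exists T : ('rV[R]_n -> R[i]) -> ('rV[R]_n -> R[i]) -> 'rV[R]_n -> R[i],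
      [/\ bilinear_L2_L1 T,
          forall f g, schwartz f -> schwartz g ->
            {ae @lebesgue_rV R n, forall x,
              T f g x = bilinear_multiplier m f g x} &
          forall f g, in_Lp 2 f -> in_Lp 2 g ->
            (cLnorm 1 (T f g) <=
               C%:E * weak_Lnorm 4 Dm * cLnorm 2 f * cLnorm 2 g)%E].
Proof.
move=> n0 sn; pose b := s / 2.
have nR : 0 < n%:R :> R by rewrite ltr0n.
have b0 : 0 < b by rewrite /b; lra.
have nb : n%:R / 4 < b by rewrite /b; lra.
(* The factor 64 is 2 times 32: 32 from the trilinear estimate, 2 from the optimisation in [r]. *)
exists (64 * energy_const (n := n) b) => m Dm mDm Dlty.
have K0 : (0 <= weak_Lnorm 4 Dm)%E.
  apply: le_trans (_ : (1%:E * lebesgue_rV R (n + n) [set x | (1 < normc (Dm x))%R] `^ 4^-1 <= _)%E).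
    by rewrite mul1e poweR_ge0.
  by apply: ereal_sup_ubound; exists 1 => //=.
have Kfin : weak_Lnorm 4 Dm \is a fin_num by rewrite ge0_fin_numE.
pose K := fine (weak_Lnorm 4 Dm).
have EK : weak_Lnorm 4 Dm = K%:E by rewrite /K fineK.
have KR0 : 0 <= K by exact: fine_ge0.
have weak k : K < k -> weakL4 (lebesgue_rV R (n + n)) (fun p => normc (Dm p)) k.
  move=> Kk; apply: weakL4_weak_Lnorm; first exact: le_lt_trans Kk.
  by rewrite EK lee_fin ltW.
(* The estimates ask for a positive weak L^4 bound, while [K] may be 0; [K + 1] is used wherever
   only qualitative statements are at stake. *)
have k0 : 0 < K + 1 by rewrite ltr_wpDl.
have hk : weakL4 (lebesgue_rV R (n + n)) (fun p => normc (Dm p)) (K + 1).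
  by apply: weak; rewrite ltrDl.
have [mm mD] : cmeas m /\ cmeas Dm.
  by have [u [v [[_ [mm _] _] [_ [mD _] _] _]]] := mDm.
have mae := is_bessel_potential n0 sn mDm k0 hk.
split.
  exists (potential_bound (n := n) b (K + 1)); apply: filterS mae => x ->.
  exact: bessel_potential_bounded.
have P f g (fL : in_L2 f) (gL : in_L2 g) := limit_operatorP b0 nb mD k0 hk fL gL.
exists (limit_operator b Dm); split.
- split=> [f g /in_Lp2_in_L2 fL /in_Lp2_in_L2 gL|a f1 f2 g /in_Lp2_in_L2 L1 /in_Lp2_in_L2 L2 /in_Lp2_in_L2 L|
    a f g1 g2 /in_Lp2_in_L2 L /in_Lp2_in_L2 L1 /in_Lp2_in_L2 L2].
  + by have [[mT IT] _] := P _ _ fL gL; split=> //; rewrite cLnorm1E.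
  + exact: (limit_operator_linear_l b0 nb mD k0 hk).
  + exact: (limit_operator_linear_r b0 nb mD k0 hk).
- by move=> f g sf sg; exact: (limit_operator_schwartz b0 nb mD k0 hk).
move=> f g /in_Lp2_in_L2 fL /in_Lp2_in_L2 gL.
have [[mT IT] _] := P _ _ fL gL.
rewrite cLnorm1E EK !cLnorm2_sqrt//.
set a := Num.sqrt _; set c := Num.sqrt _.
have sq (u : 'rV[R]_n -> R[i]) : 0 <= fine (\int[lebesgue_rV R n]_x (normc (u x) ^+ 2)%:E)%E.
  by apply: fine_ge0; apply: integral_ge0 => x _; rewrite lee_fin sqr_ge0.
have a0 : 0 <= a by exact: sqrtr_ge0.
have c0 : 0 <= c by exact: sqrtr_ge0.
have Tfin : (\int[lebesgue_rV R n]_x (normc (limit_operator b Dm f g x))%:E)%E \is a fin_num.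
  by rewrite ge0_fin_numE//; apply: integral_ge0 => x _; rewrite lee_fin normc_ge0.
rewrite -(fineK Tfin) -!EFinM lee_fin; set X := fine _.
have E0 : 0 <= energy_const (n := n) b by exact: energy_const_ge0.
(* The operator depends on [b] and [Dm] but not on the bound [k], so the estimate holds for every
   [k > K] and passes to the limit [k = K]. *)
have Xk k : K < k -> X <= 64 * energy_const (n := n) b * k * a * c.
  move=> Kk; have kp : 0 < k by exact: le_lt_trans Kk.
  have q0 : 0 <= 32 * k * energy_const (n := n) b by rewrite mulr_ge0// mulr_ge0// ltW.
  have : X <= 2 * (Num.sqrt (32 * k * energy_const (n := n) b) * a) * (Num.sqrt (32 * k * energy_const (n := n) b) * c).
    apply: le_geometric_mean; rewrite ?mulr_ge0 ?sqrtr_ge0// => r r0.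
    rewrite !exprMn !sqr_sqrtr// -lee_fin fineK//.
    apply: le_trans (limit_operator_bound b0 nb mD kp (weak k Kk) fL gL r0) _.
    rewrite -(fineK (normL2sq_fin fL)) -(fineK (normL2sq_fin gL)) -!EFinM lee_fin.
    by rewrite le_eqVlt; apply/orP; left; apply/eqP; ring.
  rewrite [X in _ <= X](_ : _ = 2 * (Num.sqrt (32 * k * energy_const (n := n) b)) ^+ 2 * a * c); last by ring.
  by rewrite sqr_sqrtr// => /le_trans; apply; rewrite le_eqVlt; apply/orP; left; apply/eqP; ring.
apply/ler_addgt0Pr => e e0.
pose q := 64 * energy_const (n := n) b * a * c.
have q0 : 0 <= q by rewrite mulr_ge0// mulr_ge0// mulr_ge0.
have := Xk (K + e / (q + 1)) _; rewrite ltrDl divr_gt0 ?ltr_wpDl// => /(_ isT) /le_trans; apply.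
have -> : 64 * energy_const (n := n) b * (K + e / (q + 1)) * a * c =
  64 * energy_const (n := n) b * K * a * c + q * (e / (q + 1)) by rewrite /q; ring.
rewrite lerD2l mulrA ler_pdivrMr ?ltr_wpDl// mulrC ler_wpM2l ?(ltW e0)// lerDl//.
Qed.
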